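(* Let $N\ge 1$ be an integer, $\alpha\in(0,N)$, and let $p,q$ satisfy $\frac{N+\alpha}{N}<p,\,q<2_*^\alpha$ and $p\neq q$. Let $A\in C(\mathbb R^N,\mathbb R^+)$ satisfy $A(x)\ge A_0>0$ for all $x\in\mathbb R^N$ (for some constant $A_0$) and $A(x)\le A_\infty:=\lim_{|x|\to\infty}A(x)<+\infty$ for all $x\in\mathbb R^N$, and let $B(x)\equiv B>0$ be a positive constant. Then there exists a positive ground state solution $(u,v)\in H$ (that is, a ground state solution with $u>0$ and $v>0$) of the system $$\begin{cases}-\Delta u+A(x)u=\frac{2p}{p+q}\bigl(I_\alpha\ast|v|^q\bigr)|u|^{p-2}u,\\ -\Delta v+B(x)v=\frac{2q}{p+q}\bigl(I_\alpha\ast|u|^p\bigr)|v|^{q-2}v,\\ u(x)\to0\ \text{ and }\ v(x)\to 0\ \text{ as } |x|\to\infty\end{cases}$$ in $\mathbb R^N$, such that $\mathcal I(u,v)=c_0$.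
   Context: Functions are real valued on $\mathbb R^N$. $2_*^\alpha:=\frac{N+\alpha}{N-2}$ if $N\ge3$ and $2_*^\alpha:=\infty$ if $N=1,2$. The Riesz potential $I_\alpha:\mathbb R^N\setminus\{0\}\to\mathbb R$ is $I_\alpha(x)=\frac{A_\alpha}{|x|^{N-\alpha}}$ with $A_\alpha=\frac{\Gamma(\frac{N-\alpha}{2})}{2^\alpha\pi^{N/2}\Gamma(\frac{\alpha}{2})}$, and $\ast$ is convolution on $\mathbb R^N$. $H:=H^1(\mathbb R^N)\times H^1(\mathbb R^N)$. The action functional on $H$ is $$\mathcal I(u,v)=\frac12\int_{\mathbb R^N}\bigl(|\nabla u|^2+A(x)|u|^2+|\nabla v|^2+B(x)|v|^2\bigr)-\frac{2}{p+q}\int_{\mathbb R^N}(I_\alpha\ast|u|^p)|v|^q ,$$ which is well defined and continuously differentiable; solutions in $H$ of the differential equations of the system are understood in the weak sense, i.e. as critical points of $\mathcal I$. Put $\mathcal P(u,v):=\langle\mathcal I'(u,v),(u,v)\rangle$, $\mathcal N_0:=\{(u,v)\in H\setminus\{(0,0)\}\mid \mathcal P(u,v)=0\}$ and $c_0:=\inf_{(u,v)\in\mathcal N_0}\mathcal I(u,v)$. A nontrivial solution $(u,v)\in H$ of the system is called a ground state solution if $\mathcal I(u,v)=c_0$. *)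

(* Defs.v *)
From HB Require Import structures.
From mathcomp Require Import all_boot all_order all_algebra.
From mathcomp Require Import all_classical all_reals all_analysis.

Set Implicit Arguments.
Unset Strict Implicit.
Unset Printing Implicit Defensive.

Import Order.TTheory GRing.Theory Num.Theory.
Import numFieldNormedType.Exports.

Local Open Scope classical_set_scope.
Local Open Scope ring_scope.

(* Borel sigma-algebra of R^n, generated by the coordinates as the library does
   for n-tuples. *)
Section measurable_rV.
Context {R : realType} (n : nat).

Let coor : 'I_n -> 'rV[R]_n -> R := fun i x => x ord0 i.

Let rV_set0 : g_sigma_preimage coor set0.
Proof. exact: sigma_algebra0. Qed.

Let rV_setC A : g_sigma_preimage coor A -> g_sigma_preimage coor (~` A).
Proof. exact: sigma_algebraC. Qed.

Let rV_bigcup (F : _^nat) : (forall i, g_sigma_preimage coor (F i)) ->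
  g_sigma_preimage coor (\bigcup_i (F i)).
Proof. exact: sigma_algebra_bigcup. Qed.

HB.instance Definition _ := @isMeasurable.Build default_measure_display
  'rV[R]_n (g_sigma_preimage coor) rV_set0 rV_setC rV_bigcup.

Lemma measurable_coor (i : 'I_n) :
  measurable_fun setT (fun x : 'rV[R]_n => x ord0 i).
Proof.
move=> _ Y mY; rewrite setTI; apply: sub_sigma_algebra => /=.
rewrite -bigcup_seq/=; exists i => /=; first by rewrite mem_index_enum.
by exists Y => //; rewrite setTI.
Qed.

Lemma measurable_fun_rV d (T : measurableType d) (f : T -> 'rV[R]_n) :
  (forall i, measurable_fun setT (fun t => f t ord0 i)) ->
  measurable_fun setT f.
Proof.
move=> mf _ A mA; rewrite setTI.
suff : g_sigma_preimage (fun i => coor i \o f) `<=` measurable.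
  apply; rewrite g_sigma_preimage_comp.
  by exists A => //; rewrite setTI.
apply: smallest_sub; first exact: sigma_algebra_measurable.
rewrite -bigcup_seq; apply: bigcup_sub => i _ X [B mB <-].
exact: mf.
Qed.

End measurable_rV.

Section lebesgue_rV.
Context {R : realType}.

Definition rV_cons n (xy : R * 'rV[R]_n) : 'rV[R]_n.+1 :=
  row_mx (xy.1)%:M xy.2.

Definition rV_uncons n (x : 'rV[R]_n.+1) : R * 'rV[R]_n :=
  (x ord0 ord0, @rsubmx _ 1 1 n x).

Lemma rV_consK n : cancel (@rV_cons n) (@rV_uncons n).
Proof.
move=> [x y]; rewrite /rV_uncons /rV_cons /= row_mxKr; congr (_, _).
rewrite mxE; case: split_ordP => [j _|j /(congr1 val)//].
by rewrite mxE !ord1 eqxx.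
Qed.

Lemma measurable_rV_cons n : measurable_fun setT (@rV_cons n).
Proof.
apply: measurable_fun_rV => i.
rewrite [X in measurable_fun _ X](_ : _ = match fintype.split (i : 'I_(1 + n))
    with inl _ => fst
    | inr j => (fun y : 'rV[R]_n => y ord0 j) \o snd end); last first.
  apply/funext => xy; rewrite mxE.
  by case: fintype.split => j //; rewrite mxE !ord1 eqxx.
case: fintype.split => j; first exact: measurable_fst.
by apply: measurableT_comp => //; exact: measurable_coor.
Qed.

Lemma measurable_rV_uncons n : measurable_fun setT (@rV_uncons n).
Proof.
apply: measurable_fun_pair; first exact: measurable_coor.
apply: measurable_fun_rV => i.
rewrite [X in measurable_fun _ X](_ : _ = fun x : 'rV[R]_n.+1 => x ord0 (@rshift 1 n i)).
  exact: measurable_coor.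
by apply/funext => x; rewrite mxE.
Qed.

Section step.
Variables (n : nat) (m : {sigma_finite_measure set 'rV[R]_n -> \bar R}).

Definition lebesgue_rVS : set 'rV[R]_n.+1 -> \bar R :=
  pushforward (@lebesgue_measure R \x m)%E (@rV_cons n).

Let lebesgue_rVS0 : lebesgue_rVS set0 = 0%E.
Proof. by rewrite /lebesgue_rVS /pushforward preimage_set0 measure0. Qed.

Let lebesgue_rVS_ge0 A : (0 <= lebesgue_rVS A)%E.
Proof. by rewrite /lebesgue_rVS /pushforward measure_ge0. Qed.

Let lebesgue_rVS_sigma_additive : semi_sigma_additive lebesgue_rVS.
Proof.
have mf A : measurable A -> measurable (@rV_cons n @^-1` A).
  by move=> mA; rewrite -[X in measurable X]setTI; exact: measurable_rV_cons.
move=> F mF tF mUF; rewrite /lebesgue_rVS /pushforward preimage_bigcup.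
apply: measure_semi_sigma_additive.
- by move=> k; exact: mf.
- apply/trivIsetP => /= i j _ _ ij; rewrite -preimage_setI.
  by move/trivIsetP : tF => /(_ _ _ _ _ ij) ->//; rewrite preimage_set0.
- by rewrite -preimage_bigcup; exact: mf.
Qed.

HB.instance Definition _ := isMeasure.Build _ _ _ lebesgue_rVS
  lebesgue_rVS0 lebesgue_rVS_ge0 lebesgue_rVS_sigma_additive.

Let lebesgue_rVS_sigma_finite : sigma_finite setT lebesgue_rVS.
Proof.
have /sigma_finiteP[F [TF ndF Foo]] := sigma_finiteT (@lebesgue_measure R).
have /sigma_finiteP[G [TG ndG Goo]] := sigma_finiteT m.
exists (fun k => @rV_uncons n @^-1` (F k `*` G k)).
  rewrite -preimage_bigcup [X in _ @^-1` X](_ : _ = setT) ?preimage_setT//.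
  rewrite -setXTT TF TG predeqE => -[x y]; split.
    by move=> [k _ []/= ? ?]; split; exists k.
  move=> [/= [i _ Fx] [j _ Gy]]; exists (maxn i j) => //; split.
  - by move: x Fx; exact/subsetPset/ndF/leq_maxl.
  - by move: y Gy; exact/subsetPset/ndG/leq_maxr.
move=> k; have [mF Fk] := Foo k; have [mG Gk] := Goo k; split.
  rewrite -[X in measurable X]setTI; apply: measurable_rV_uncons => //.
  exact: measurableX.
rewrite /lebesgue_rVS /pushforward -comp_preimage.
rewrite (_ : _ \o _ = id) ?preimage_id; last exact/funext/rV_consK.
by rewrite product_measure1E// lte_mul_pinfty// ge0_fin_numE.
Qed.

HB.instance Definition _ := Measure_isSigmaFinite.Build _ _ _ lebesgue_rVS
  lebesgue_rVS_sigma_finite.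

End step.

(* Lebesgue measure on R^n, as the iterated product of lebesgue_measure. *)
Fixpoint lebesgue_rV n : {sigma_finite_measure set 'rV[R]_n -> \bar R} :=
  match n with
  | 0 => \d_(0 : 'rV[R]_0)
  | k.+1 => lebesgue_rVS (lebesgue_rV k)
  end.

End lebesgue_rV.

Section sobolev.
Context {R : realType} (N : nat).
Local Notation E := 'rV[R]_N.
Local Notation mu := (@lebesgue_rV R N).
Implicit Types (u v f phi : E -> R) (x : E).

(* The library norm `|x| on row vectors is the sup norm. *)
Definition enorm x : R := Num.sqrt (\sum_(i < N) x ord0 i ^+ 2).

(* The filter |x| -> oo. *)
Definition infty_nbhs : set_system E :=
  [set P | exists M : R, forall x, M < enorm x -> P x].

#[global] Instance infty_nbhs_filter : Filter infty_nbhs.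
Proof.
split; first by exists 0.
- move=> P Q [M PM] [M' QM']; exists (Num.max M M') => x.
  by rewrite gt_max => /andP[/PM Px /QM' Qx].
- by move=> P Q PQ [M PM]; exists M => x /PM/PQ.
Qed.

Definition partial (i : 'I_N) f : E -> R :=
  fun x => derive f x (delta_mx ord0 i).

Definition iter_partial (s : seq 'I_N) f : E -> R := foldr partial f s.

Definition smooth f := forall s : seq 'I_N,
  continuous (iter_partial s f) /\
  forall i x, derivable (iter_partial s f) x (delta_mx ord0 i).

Definition test_function phi :=
  smooth phi /\ compact (closure [set x | phi x != 0]).

Definition weak_partial (i : 'I_N) u g := forall phi, test_function phi ->
  \int[mu]_x (u x * partial i phi x) = - \int[mu]_x (g x * phi x).

Definition L2_weak_gradient u (g : E -> E) := forall i : 'I_N,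
  (fun x => g x ord0 i) \in Lfun mu 2%:E /\
  weak_partial i u (fun x => g x ord0 i).

(* H^1(R^N) is represented by functions, not classes modulo null sets. *)
Definition H1 : set (E -> R) :=
  [set u | u \in Lfun mu 2%:E /\ exists g, L2_weak_gradient u g].

(* Only determined almost everywhere, for u in H^1. *)
Definition grad u : E -> E := xget (fun=> 0) [set g | L2_weak_gradient u g].

Definition Hpair : set ((E -> R) * (E -> R)) := H1 `*` H1.

Definition Hnorm (w : (E -> R) * (E -> R)) : R :=
  Num.sqrt (\int[mu]_x (enorm (grad w.1 x) ^+ 2 + `|w.1 x| ^+ 2
                       + enorm (grad w.2 x) ^+ 2 + `|w.2 x| ^+ 2)).

Definition Hzero (w : (E -> R) * (E -> R)) :=
  {ae mu, forall x, w.1 x = 0 /\ w.2 x = 0}.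

(* L is the Frechet derivative at w of the functional F on H; the values of F
   and L outside Hpair are irrelevant. *)
Definition is_frechet (F : (E -> R) * (E -> R) -> R) w
    (L : (E -> R) * (E -> R) -> R) :=
  [/\ forall (a : R) h k, Hpair h -> Hpair k ->
        L (a *: h + k) = a * L h + L k,
      exists C : R, forall h, Hpair h -> `|L h| <= C * Hnorm h
    & forall e : R, 0 < e -> exists2 d : R, 0 < d &
        forall h, Hpair h -> Hnorm h < d ->
          `|F (w + h) - F w - L h| <= e * Hnorm h].

Definition frechet (F : (E -> R) * (E -> R) -> R) w :
    (E -> R) * (E -> R) -> R :=
  xget (fun=> 0) [set L | is_frechet F w L].

Definition critical_point (F : (E -> R) * (E -> R) -> R) w :=
  Hpair w /\ is_frechet F w (fun=> 0).

End sobolev.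

Arguments H1 {R N}.
Arguments Hpair {R N}.
Arguments infty_nbhs {R N}.

Definition Gamma {R : realType} (s : R) : R :=
  \int[@lebesgue_measure R]_(t in `]0, +oo[) (t `^ (s - 1) * expR (- t)).

Section choquard.
Context {R : realType} (N : nat).
Local Notation E := 'rV[R]_N.
Local Notation mu := (@lebesgue_rV R N).
Variable alpha : R.

Definition critical_exponent : \bar R :=
  if (N <= 2)%N then +oo%E else ((N%:R + alpha) / (N%:R - 2))%:E.

Definition riesz_constant : R :=
  Gamma ((N%:R - alpha) / 2) / (2 `^ alpha * pi `^ (N%:R / 2) * Gamma (alpha / 2)).

(* Totalised by 0 at the origin. *)
Definition riesz (x : E) : R := riesz_constant / enorm x `^ (N%:R - alpha).

Definition riesz_conv (f : E -> R) (x : E) : \bar R :=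
  (\int[mu]_y (riesz (x - y) * f y)%:E)%E.

Variables (A B : E -> R) (p q : R).

Definition action (w : (E -> R) * (E -> R)) : R :=
  2^-1 * \int[mu]_x (enorm (grad w.1 x) ^+ 2 + A x * `|w.1 x| ^+ 2
                    + enorm (grad w.2 x) ^+ 2 + B x * `|w.2 x| ^+ 2)
  - 2 / (p + q) *
    fine (\int[mu]_x (riesz_conv (fun y => `|w.1 y| `^ p)%R x
                      * (`|w.2 x| `^ q)%:E))%E.

Definition nehari_functional (w : (E -> R) * (E -> R)) : R :=
  frechet action w w.

Definition nehari_set : set ((E -> R) * (E -> R)) :=
  [set w | [/\ Hpair w, ~ Hzero w & nehari_functional w = 0]].

Definition nehari_level : \bar R :=
  ereal_inf [set (action w)%:E | w in nehari_set].

(* The differential equations are understood weakly, that is as I'(u, v) = 0,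
   whose two components are
     - Delta u + A u = 2p/(p+q) (I_alpha * |v|^q) |u|^(p-2) u,
     - Delta v + B v = 2q/(p+q) (I_alpha * |u|^p) |v|^(q-2) v. *)
Definition system_solution (u v : E -> R) :=
  [/\ critical_point action (u, v),
      u x @[x --> infty_nbhs] --> 0 & v x @[x --> infty_nbhs] --> 0].

Definition ground_state_solution (u v : E -> R) :=
  [/\ system_solution u v, ~ Hzero (u, v)
    & (action (u, v))%:E = nehari_level].

Definition positive_ground_state_solution (u v : E -> R) :=
  [/\ ground_state_solution u v, forall x, 0 < u x & forall x, 0 < v x].

End choquard.

(* Main.v *)
(* The action is I(w) = Q(w)/2 - (2/(p+q)) D(w), with Q quadratic and D homogeneous
   of degree p+q, so suitably scaled maximisers of D on {Q <= 1} are ground states.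
   A maximising sequence does not vanish, for otherwise its L^r norms, hence D, would
   tend to 0; after translations it has a nonzero weak limit w, and A(. + x_n) tends to
   a translate of A or to A_infinity >= A. Both Q and D split along the sequence
   (Brezis-Lieb), and no mass escapes since t^((p+q)/2) is strictly superadditive.
   Passing to |w|, a Picone-type inequality makes the indicator of {u > 0} translation
   invariant, so u > 0 a.e. Testing with dyadic truncations of u bootstraps u and v into
   every L^r; the nonlocal potential is then bounded, and a De Giorgi iteration against
   exp(-d|x|_1) gives u <= M exp(-d|x|_1) + k a.e. for every k > 0. Gradients enter only
   through difference quotients, and three-function Young inequalities for the near and
   far parts of the kernel replace the Hardy-Littlewood-Sobolev inequality. *)
Require Import Defs.
From mathcomp Require Import all_boot all_order all_algebra.
From mathcomp Require Import all_classical all_reals all_analysis.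
From mathcomp Require Import measurable_realfun.
From mathcomp Require Import ring lra.
Import Order.TTheory GRing.Theory Num.Theory.
Import numFieldNormedType.Exports.
Local Open Scope classical_set_scope.
Local Open Scope ring_scope.
Set Implicit Arguments.
Unset Strict Implicit.
Unset Printing Implicit Defensive.

(** [grad] is a choice, fixed only up to null sets, so the energy is handled through [dir], the
    limit of forms built from difference quotients: a pointwise inequality between products of
    increments passes to [dir], which does the work of a chain rule for truncations, barriers and
    test quotients. For the same reason Sobolev's inequality is drawn from level sets: a function
    whose support has measure m vanishes on at least half of every cube of volume 2m, so it must
    oscillate there. At the exponent 2N/(N+alpha) the kernel |x|^(alpha-N) would enter Young's
    inequality with the power N/(N-alpha), which just fails to be integrable at 0 and at infinity.
    As the bounds on p and q are strict, the exponent may be raised for the near part and lowered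
    for the far part. A maximiser is critical without Lagrange multipliers: by homogeneity I lies
    above a function of Q alone, and touches it, at its critical point, at the rescaled maximiser.
    For the indicator of {u > 0} squared increments are absolute values of increments, hence
    subadditive in the step; a bound quadratic in the step then forces them to be 0. *)

Lemma cvgn_leP (R : realType) (u : nat -> R) (l : R) :
  u n @[n --> \oo] --> l <->
  forall e : R, 0 < e -> exists N, forall n, (N <= n)%N -> `|u n - l| <= e.
Proof.
split=> [/cvgrPdist_le ul e e0|ul].
  by have [N _ Nf] := ul e e0; exists N => n /Nf; rewrite distrC.
apply/cvgrPdist_le => e e0; have [N Nf] := ul e e0.
by exists N => // n /= /Nf; rewrite distrC.
Qed.

Lemma cvgn_le_cst (R : realType) (u : nat -> R) (l c : R) :
  u n @[n --> \oo] --> l -> (forall n, u n <= c) -> l <= c.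
Proof.
move=> /cvgn_leP ul uc; apply/ler_addgt0Pr => e /ul[N /(_ N (leqnn N))].
by rewrite ler_norml => /andP[h _]; have := uc N; lra.
Qed.

Lemma cvgn_norm_le (R : realType) (u : nat -> R) (l c : R) :
  u n @[n --> \oo] --> l -> (forall n, `|u n| <= c) -> `|l| <= c.
Proof. by move=> /cvg_norm; exact: cvgn_le_cst. Qed.

Local Notation meas f := (measurable_fun setT f).

Lemma le_of_eq d (T : porderType d) (x y : T) : x = y -> (x <= y)%O.
Proof. by move->. Qed.

(** * Real-valued integrals and convergence theorems *)

Section real_integral.
Context d (T : measurableType d) (R : realType).
Variable mu : {measure set T -> \bar R}.
Implicit Types (f g h : T -> R) (c : R).

Definition L1 f := mu.-integrable setT (EFin \o f).

Lemma L1_meas f : L1 f -> meas f.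
Proof. by move=> /integrableP[/measurable_EFinP]. Qed.

Lemma L1_le f g : meas f -> (forall x, `|f x| <= g x) -> L1 g -> L1 f.
Proof.
move=> mf fg ig; apply: le_integrable ig => //; first exact/measurable_EFinP.
by move=> x _ /=; rewrite lee_fin (le_trans (fg x))// ler_norm.
Qed.

Lemma L1D f g : L1 f -> L1 g -> L1 (fun x => f x + g x).
Proof. by move=> If Ig; apply: eq_integrable (integrableD _ If Ig). Qed.

Lemma L1Z c f : L1 f -> L1 (fun x => c * f x).
Proof. by move=> If; apply: eq_integrable (integrableZl _ c If). Qed.

Lemma L1N f : L1 f -> L1 (fun x => - f x).
Proof. by move=> /(L1Z (-1)); under eq_fun do rewrite mulN1r. Qed.

Lemma L1B f g : L1 f -> L1 g -> L1 (fun x => f x - g x).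
Proof. by move=> If /L1N; exact: L1D. Qed.

Lemma L1_abs f : L1 f -> L1 (fun x => `|f x|).
Proof. exact: integrable_norm. Qed.

Lemma L1_0 : L1 (fun=> 0).
Proof. exact: integrable0. Qed.

Lemma intD f g : L1 f -> L1 g ->
  \int[mu]_x (f x + g x) = \int[mu]_x f x + \int[mu]_x g x.
Proof. by move=> ? ?; rewrite RintegralD. Qed.

Lemma intB f g : L1 f -> L1 g ->
  \int[mu]_x (f x - g x) = \int[mu]_x f x - \int[mu]_x g x.
Proof. by move=> ? ?; rewrite RintegralB. Qed.

Lemma intZ c f : L1 f -> \int[mu]_x (c * f x) = c * \int[mu]_x f x.
Proof. by move=> ?; rewrite RintegralZl. Qed.

Lemma intN f : L1 f -> \int[mu]_x (- f x) = - \int[mu]_x f x.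
Proof.
by move=> If; under eq_Rintegral do rewrite -mulN1r; rewrite intZ// mulN1r.
Qed.

Lemma L1_sum (I : Type) (r : seq I) (F : I -> T -> R) : (forall j, L1 (F j)) ->
  L1 (fun x => \sum_(j <- r) F j x).
Proof.
move=> IF; elim: r => [|j r IH].
  by rewrite (_ : (fun x => _) = fun=> 0); [exact: L1_0|apply/funext => x; rewrite big_nil].
have := L1D (IF j) IH; congr L1; apply/funext => x; by rewrite big_cons.
Qed.

Lemma int_sum (I : Type) (r : seq I) (F : I -> T -> R) : (forall j, L1 (F j)) ->
  \int[mu]_x (\sum_(j <- r) F j x) = \sum_(j <- r) \int[mu]_x F j x.
Proof.
move=> IF; elim: r => [|j r IH].
  rewrite big_nil; under eq_Rintegral do rewrite big_nil.
  by rewrite /Rintegral integral0.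
rewrite big_cons -IH -intD//; last exact: L1_sum.
by apply: eq_Rintegral => x _; rewrite big_cons.
Qed.

Lemma int_le f g : L1 f -> L1 g -> (forall x, f x <= g x) ->
  \int[mu]_x f x <= \int[mu]_x g x.
Proof. by move=> ? ? fg; exact: le_Rintegral. Qed.

Lemma int_abs f : L1 f -> `|\int[mu]_x f x| <= \int[mu]_x `|f x|.
Proof. by move=> ?; exact: le_normr_Rintegral. Qed.

Lemma int_ge0 f : (forall x, 0 <= f x) -> 0 <= \int[mu]_x f x.
Proof. by move=> f0; exact: Rintegral_ge0. Qed.

Lemma EFin_int f : L1 f -> (\int[mu]_x f x)%:E = (\int[mu]_x (f x)%:E)%E.
Proof. by move=> ?; rewrite /Rintegral fineK//; exact: integrable_fin_num. Qed.

Lemma L1_ge0P f : meas f -> (forall x, 0 <= f x) ->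
  L1 f <-> (\int[mu]_x (f x)%:E < +oo)%E.
Proof.
move=> mf f0; split.
  move=> /integrableP[_]; congr (_ < _)%E; apply: eq_integral => x _ /=.
  by rewrite ger0_norm.
move=> fy; apply/integrableP; split; first exact/measurable_EFinP.
by under eq_integral do rewrite /= ger0_norm//.
Qed.

(** Bounds are first proved for the extended integral, since the real integral of a nonnegative
    non-integrable function is 0 and says nothing; this converts them into integrability and a real
    bound. *)
Lemma L1_ge0_le f c : meas f -> (forall x, 0 <= f x) ->
  (\int[mu]_x (f x)%:E <= c%:E)%E <-> L1 f /\ \int[mu]_x f x <= c.
Proof.
move=> mf f0; split.
  move=> fc; have If : L1 f by apply/L1_ge0P => //; rewrite (le_lt_trans fc)// ltry.
  by split => //; rewrite -lee_fin EFin_int.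
by move=> [If fc]; rewrite -EFin_int// lee_fin.
Qed.

Lemma ae_eq_int f g : meas f -> meas g ->
  {ae mu, forall x, f x = g x} -> \int[mu]_x f x = \int[mu]_x g x.
Proof.
move=> mf mg fg; congr fine; apply: ae_eq_integral => //; try exact/measurable_EFinP.
by apply: filterS fg => x + _ => ->.
Qed.

Lemma ae_eq_L1 f g : meas g ->
  {ae mu, forall x, f x = g x} -> L1 f -> L1 g.
Proof.
move=> mg fg If; have mf := L1_meas If.
move: If => /integrableP[_ fy]; apply/integrableP; split; first exact/measurable_EFinP.
rewrite (@ae_eq_integral _ _ _ mu _ (fun x => `|(EFin \o f) x|)%E)//.
- by apply: measurableT_comp => //; exact/measurable_EFinP.
- by apply: measurableT_comp => //; exact/measurable_EFinP.
- by apply: filterS fg => x /= + _ => ->.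
Qed.

Lemma ae_dct (f_ : nat -> T -> R) f g :
  (forall n, meas (f_ n)) -> meas f ->
  {ae mu, forall x, f_ n x @[n --> \oo] --> f x} ->
  L1 g -> {ae mu, forall x, forall n, `|f_ n x| <= g x} ->
  L1 f /\ \int[mu]_x f_ n x @[n --> \oo] --> \int[mu]_x f x.
Proof.
move=> mf_ mf ff Ig fg.
have [] := @dominated_convergence _ _ _ mu _ measurableT (fun n => EFin \o f_ n)
  (EFin \o f) (EFin \o g) (fun n => iffRL (measurable_EFinP _ _) (mf_ n)).
- exact/measurable_EFinP.
- by apply: filterS ff => x fx _; apply: cvg_EFin fx; exact: nearW.
- exact: Ig.
- by apply: filterS fg => x h n _ /=; rewrite lee_fin.
move=> If _ cv; split => //; rewrite /Rintegral; apply: fine_cvg.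
by rewrite -/(Rintegral mu setT f) EFin_int.
Qed.

Lemma dct (f_ : nat -> T -> R) f g :
  (forall n, meas (f_ n)) -> (forall x, f_ n x @[n --> \oo] --> f x) ->
  meas f -> L1 g -> (forall n x, `|f_ n x| <= g x) ->
  L1 f /\ \int[mu]_x f_ n x @[n --> \oo] --> \int[mu]_x f x.
Proof.
by move=> mf_ ff mf Ig fg; apply: ae_dct Ig _ => //; apply: aeW => // x n; exact: fg.
Qed.

Lemma L1_fatou (f_ : nat -> T -> R) f c :
  (forall n, L1 (f_ n)) -> meas f ->
  (forall n x, 0 <= f_ n x) -> (forall n, \int[mu]_x f_ n x <= c) ->
  (forall x, 0 <= f x) ->
  {ae mu, forall x, f_ n x @[n --> \oo] --> f x} ->
  L1 f /\ \int[mu]_x f x <= c.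
Proof.
move=> If_ mf f_0 fc f0 ff; apply/L1_ge0_le => //.
have f_0E n x : [set: T] x -> (0 <= (EFin \o f_ n) x)%E by rewrite /= lee_fin.
have h := @fatou _ _ _ mu _ measurableT (fun n => EFin \o f_ n)
  (fun n => iffRL (measurable_EFinP _ _) (L1_meas (If_ n))) f_0E.
apply: (@le_trans _ _ (\int[mu]_x limn_einf (fun n => (EFin \o f_ n) x))%E).
  apply: le_of_eq; apply: ae_eq_integral => //.
  - exact/measurable_EFinP.
  - rewrite (_ : (fun _ => _) =
        (fun x => - limn_esup (fun n => - (EFin \o f_ n) x))%E); last first.
      by apply/funext => x; rewrite -(limn_einfN (fun n => (- (EFin \o f_ n) x)%E));
        congr limn_einf; apply/funext => n; rewrite /comp oppeK.
    apply: measurableT_comp => //; apply: measurable_fun_limn_esup => n.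
    by apply: measurableT_comp => //; exact/measurable_EFinP/L1_meas.
  - apply: filterS ff => x fx _; apply/esym.
    have cv : (fun n => (f_ n x)%:E) @ \oo --> (f x)%:E by apply: cvg_EFin => //; exact: nearW.
    by have [-> _] := cvg_limn_einf_sup cv.
apply: (le_trans h).
rewrite limn_einf_lim; apply: lime_le; first exact: is_cvg_einfs.
apply: nearW => n; apply: le_trans (_ : \int[mu]_x (f_ n x)%:E <= _)%E.
  by apply: ereal_inf_lbound; exists n => /=.
by rewrite -EFin_int// lee_fin.
Qed.

End real_integral.

Lemma sqr_normr (R : realDomainType) (x : R) : `|x| ^+ 2 = x ^+ 2.
Proof. by rewrite real_normK// num_real. Qed.

Lemma half_geometric_sum (R : realFieldType) (n : nat) :
  \sum_(0 <= k < n) (2^-1 : R) ^+ k = 2 - 2 * 2^-1 ^+ n.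
Proof.
elim: n => [|n IH]; first by rewrite big_geq// expr0; ring.
by rewrite big_nat_recr//= IH exprS; field.
Qed.

Lemma geometric_cauchy_cvg (R : realType) (u : nat -> R) (c : R) :
  (forall k, `|u k.+1 - u k| <= c * 2^-1 ^+ k) -> cvgn u.
Proof.
move=> uc; pose D k := u k.+1 - u k.
have cD : cvgn (series D).
  apply: normed_cvg; apply: (@nondecreasing_is_cvgn R).
    by apply/nondecreasing_seqP => n; rewrite /= /series/= big_nat_recr//= lerDl.
  exists (c * 2) => _ [n _ <-]; rewrite /series/=.
  apply: (@le_trans _ _ (\sum_(0 <= k < n) (c * 2^-1 ^+ k))).
    by apply: ler_sum => k _; exact: uc.
  rewrite -mulr_sumr half_geometric_sum ler_wpM2l//; last first.
    by rewrite lerBlDr lerDl mulr_ge0// exprn_ge0// invr_ge0.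
  by have := uc 0; rewrite expr0 mulr1; exact: le_trans.
rewrite (_ : u = fun n => u 0 + series D n); last first.
  by apply/funext => n; rewrite /series/= telescope_sumr//; ring.
exact: is_cvgD (is_cvg_cst _) cD.
Qed.

(** * Square-integrable functions *)

Section square_integrable.
Context d (T : measurableType d) (R : realType).
Variable mu : {measure set T -> \bar R}.
Implicit Types (f g : T -> R) (c : R).
Local Notation L1 := (L1 mu).

Definition L2 f := meas f /\ L1 (fun x => f x ^+ 2).

Definition n2 f := Num.sqrt (\int[mu]_x f x ^+ 2).

Lemma n2_ge0 f : 0 <= n2 f. Proof. exact: sqrtr_ge0. Qed.

Lemma sqr_n2 f : n2 f ^+ 2 = \int[mu]_x f x ^+ 2.
Proof. by rewrite sqr_sqrtr// int_ge0// => x; exact: sqr_ge0. Qed.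

Lemma L2_mul f g : L2 f -> L2 g -> L1 (fun x => f x * g x).
Proof.
move=> [mf f2] [mg g2]; apply: L1_le (L1D f2 g2) => [|x].
  exact: measurable_funM.
by rewrite normrM; have := sqr_ge0 (`|f x| - `|g x|);
  rewrite -(sqr_normr (f x)) -(sqr_normr (g x)); nra.
Qed.

Lemma L2Z c f : L2 f -> L2 (fun x => c * f x).
Proof.
move=> [mf f2]; split; first exact: measurable_funM.
by under eq_fun do rewrite exprMn; exact: L1Z.
Qed.

Lemma L2D f g : L2 f -> L2 g -> L2 (fun x => f x + g x).
Proof.
move=> Lf Lg; have [mf f2] := Lf; have [mg g2] := Lg.
split; first exact: measurable_funD.
have := L1D (L1D f2 (L1Z 2 (L2_mul Lf Lg))) g2.
by congr L1; apply/funext => x; ring.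
Qed.

Lemma L2N f : L2 f -> L2 (fun x => - f x).
Proof. by move=> /(L2Z (-1)); under eq_fun do rewrite mulN1r. Qed.

Lemma L2B f g : L2 f -> L2 g -> L2 (fun x => f x - g x).
Proof. by move=> Lf /L2N; exact: L2D. Qed.

Lemma L2_0 : L2 (fun=> 0).
Proof. by split => //; rewrite expr0n; exact: L1_0. Qed.

Lemma L2_le f g : meas f -> (forall x, `|f x| <= g x) -> L2 g -> L2 f.
Proof.
move=> mf fg [mg g2]; split => //; apply: L1_le g2 => [|x].
  exact: measurable_funX.
by rewrite normrX lerXn2r// ?nnegrE// (le_trans _ (fg x)).
Qed.

Lemma L2_abs f : L2 f -> L2 (fun x => `|f x|).
Proof.
move=> [mf f2]; split; first exact: measurableT_comp.
by under eq_fun do rewrite sqr_normr.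
Qed.

Lemma sqr_intD f g c : L2 f -> L2 g ->
  \int[mu]_x (f x + c * g x) ^+ 2 = \int[mu]_x f x ^+ 2
    + 2 * c * \int[mu]_x (f x * g x) + c ^+ 2 * \int[mu]_x g x ^+ 2.
Proof.
move=> Lf Lg; have [_ f2] := Lf; have [_ g2] := Lg.
have fg := L2_mul Lf Lg.
rewrite -(intZ (2 * c) fg) -(intZ (c ^+ 2) g2) -intD//; last exact: L1Z.
rewrite -intD//; [|exact/L1D/L1Z|exact: L1Z].
by apply: eq_Rintegral => x _; ring.
Qed.

Lemma cauchy_schwarz f g : L2 f -> L2 g ->
  `|\int[mu]_x (f x * g x)| <= n2 f * n2 g.
Proof.
move=> Lf Lg; rewrite -(@ler_sqr R) ?nnegrE ?mulr_ge0 ?n2_ge0// sqr_normr exprMn !sqr_n2.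
set b := \int[mu]_x _; set a := \int[mu]_x _; set c := \int[mu]_x _.
have q t : 0 <= a + 2 * t * b + t ^+ 2 * c.
  by rewrite -sqr_intD//; apply: int_ge0 => x; exact: sqr_ge0.
have c0 : 0 <= c by apply: int_ge0 => x; exact: sqr_ge0.
have a0 : 0 <= a by apply: int_ge0 => x; exact: sqr_ge0.
have [c00|cn0] := eqVneq c 0.
  have [->|bn0] := eqVneq b 0; first by rewrite expr0n mulr_ge0.
  (* If c = 0 the quadratic form is affine in t, and this t gives it the value a - (a + 1) = -1. *)
  have := q (- (a + 1) / (2 * b)); rewrite c00 mulr0 addr0.
  have -> : 2 * (- (a + 1) / (2 * b)) * b = - (a + 1) by field.
  lra.
have {}c0 : 0 < c by rewrite lt_neqAle eq_sym cn0.
have := q (- b / c); have -> : a + 2 * (- b / c) * b + (- b / c) ^+ 2 * c = (a * c - b ^+ 2) / c by field.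
by rewrite pmulr_lge0 ?invr_gt0// subr_ge0.
Qed.

Lemma n2D f g : L2 f -> L2 g -> n2 (fun x => f x + g x) <= n2 f + n2 g.
Proof.
move=> Lf Lg; rewrite -(@ler_sqr R) ?nnegrE ?addr_ge0 ?n2_ge0//.
rewrite sqr_n2 (_ : (fun x => (f x + g x) ^+ 2) = fun x => (f x + 1 * g x) ^+ 2); last first.
  by apply/funext => x; rewrite mul1r.
rewrite sqr_intD// -!sqr_n2; have := ler_norm (\int[mu]_x (f x * g x)).
by have := cauchy_schwarz Lf Lg; nra.
Qed.

Lemma n2Z c f : L2 f -> n2 (fun x => c * f x) = `|c| * n2 f.
Proof.
move=> [_ f2]; rewrite /n2; under eq_Rintegral do rewrite exprMn.
by rewrite intZ// sqrtrM ?sqr_ge0// sqrtr_sqr.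
Qed.

Lemma n2N f : n2 (fun x => - f x) = n2 f.
Proof. by rewrite /n2; under eq_Rintegral do rewrite sqrrN. Qed.

Lemma n2B f g : L2 f -> L2 g -> n2 (fun x => f x - g x) <= n2 f + n2 g.
Proof. by move=> Lf Lg; rewrite -[n2 g]n2N; apply: n2D => //; exact: L2N. Qed.

Lemma n2_le f g : meas f -> (forall x, `|f x| <= g x) -> L2 g -> n2 f <= n2 g.
Proof.
move=> mf fg Lg; rewrite ler_wsqrtr//; apply: int_le; [|exact: Lg.2|].
  by have [] := L2_le mf fg Lg.
by move=> x; rewrite -sqr_normr lerXn2r// ?nnegrE// (le_trans _ (fg x)).
Qed.

Lemma Lfun2P f : f \in Lfun mu 2%:E <-> L2 f.
Proof.
split.
  move=> Lf; split; first by move/sub_Lfun_mfun : Lf; rewrite inE.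
  by have := Lfun2_integrable_sqr Lf; congr integrable.
move=> [mf f2]; apply/andP; split; rewrite inE//= /finite_norm unlock /Lnorm.
apply: poweR_lty; have mf2 : meas (fun x => f x ^+ 2) by exact: measurable_funX.
have /(L1_ge0P mu mf2 (fun x => sqr_ge0 _)) := f2.
congr (_ < _)%E; apply: eq_integral => x _ /=.
by rewrite -(sqr_normr (f x)) powR_mulrn.
Qed.

(** The upper limit is measurable on the whole space and equals the limit wherever there is one. *)
Lemma ae_limit (f_ : nat -> T -> R) : (forall n, meas (f_ n)) ->
  {ae mu, forall x, cvgn (f_ ^~ x)} ->
  exists2 f : T -> R, meas f & {ae mu, forall x, f_ n x @[n --> \oo] --> f x}.
Proof.
move=> mf cf; exists (fun x => fine (limn_esup (fun n => (f_ n x)%:E))).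
  apply: measurableT_comp => //; apply: measurable_fun_limn_esup => n.
  exact/measurable_EFinP.
apply: filterS cf => x /cvg_ex[l fl].
have cv : (fun n => (f_ n x)%:E) @ \oo --> l%:E by apply: cvg_EFin => //; exact: nearW.
by have [_ ->] := cvg_limn_einf_sup cv.
Qed.

(** Riesz-Fischer. Take a subsequence whose increments D_k satisfy: the integral of D_k^2 is at most
    8^-k. Then the sum of 4^k D_k^2 is integrable, hence finite a.e., so |D_k| is a.e. at most a
    constant times 2^-k and the subsequence converges. *)
Lemma L2_complete (f_ : nat -> T -> R) : (forall n, L2 (f_ n)) ->
  (forall e : R, 0 < e -> exists M : nat, forall m n, (M <= m)%N -> (M <= n)%N ->
    \int[mu]_x (f_ m x - f_ n x) ^+ 2 <= e) ->
  exists f (psi : nat -> nat), [/\ L2 f, (forall n, psi n < psi n.+1)%N,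
    {ae mu, forall x, f_ (psi n) x @[n --> \oo] --> f x} &
    \int[mu]_x (f_ n x - f x) ^+ 2 @[n --> \oo] --> 0].
Proof.
move=> Lf cf.
have /choice[M Mf] k : exists M : nat, forall m n, (M <= m)%N -> (M <= n)%N ->
    \int[mu]_x (f_ m x - f_ n x) ^+ 2 <= 8^-1 ^+ k.
  by apply: cf; rewrite exprn_gt0.
pose psi k := (\sum_(i < k.+1) (M i).+1)%N.
have psiS n : (psi n < psi n.+1)%N by rewrite /psi [X in (_ < X)%N]big_ord_recr/= addnS ltnS leq_addr.
have psiM n : (M n <= psi n)%N by rewrite /psi big_ord_recr/= (leq_trans _ (leq_addl _ _)).
pose D k x := f_ (psi k.+1) x - f_ (psi k) x.
have LD k : L2 (D k) by exact: L2B.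
have iD k : \int[mu]_x D k x ^+ 2 <= 8^-1 ^+ k.
  by apply: Mf => //; rewrite (leq_trans (psiM k))// ltnW.
pose G x := (\sum_(0 <= k <oo) (4 ^+ k * D k x ^+ 2)%:E)%E.
have mD k : meas (fun x => 4 ^+ k * D k x ^+ 2).
  by have [_ /(L1Z (4 ^+ k))/L1_meas] := LD k.
have D0 k x : (0 <= (4 ^+ k * D k x ^+ 2)%:E)%E.
  by rewrite lee_fin mulr_ge0 ?sqr_ge0// exprn_ge0.
have iG : mu.-integrable setT G.
  apply/integrableP; split.
    by apply: ge0_emeasurable_sum => [k x _ _|k _]; [exact: D0|exact/measurable_EFinP].
  rewrite (_ : (fun x => _) = G :> (T -> \bar R)); last first.
    by apply/funext => x; rewrite gee0_abs// nneseries_ge0.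
  rewrite integral_nneseries//; last by move=> k; exact/measurable_EFinP.
  apply: (@le_lt_trans _ _ 2%:E); last exact: ltry.
  apply: lime_le; first by apply: is_cvg_nneseries => k _ _; exact: integral_ge0.
  apply: nearW => n /=.
  apply: (@le_trans _ _ (\sum_(0 <= k < n) (2^-1 ^+ k)%:E)%E); last first.
    rewrite sumEFin lee_fin half_geometric_sum lerBlDr lerDl.
    by rewrite mulr_ge0// exprn_ge0// invr_ge0.
  apply: lee_sum => k _; rewrite -EFin_int; last exact: L1Z (LD k).2.
  rewrite lee_fin intZ; last exact: (LD k).2.
  have -> : (2^-1 : R) ^+ k = 4 ^+ k * 8^-1 ^+ k by rewrite -exprMn; congr (_ ^+ _); field.
  by rewrite ler_wpM2l// exprn_ge0.
have cG : {ae mu, forall x, cvgn (fun n => f_ (psi n) x)}.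
  have := integrable_ae measurableT iG; apply: filterS => x /(_ I) Gx.
  apply: (@geometric_cauchy_cvg _ _ (Num.sqrt (fine (G x)))) => k.
  rewrite -(@ler_sqr R) ?nnegrE ?mulr_ge0 ?sqrtr_ge0 ?exprn_ge0 ?invr_ge0//.
  rewrite sqr_normr exprMn sqr_sqrtr; last by rewrite fine_ge0// nneseries_ge0.
  have -> : (2^-1 ^+ k) ^+ 2 = (4 ^+ k)^-1 :> R.
    by rewrite -exprVn -exprM mulnC exprM; congr (_ ^+ _); field.
  rewrite ler_pdivlMr ?exprn_gt0// mulrC -lee_fin fineK// /G.
  rewrite (@nneseriesD1 _ _ k)//.
  by rewrite leeDl// nneseries_ge0.
have [f mf ff] := ae_limit (fun n => (Lf (psi n)).1) cG.
have psin n : (n <= psi n)%N by elim: n => // n IH; exact: leq_ltn_trans IH (psiS n).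
(* Fatou's lemma in the second index of the Cauchy bound: the a.e. limit of the subsequence is the
   L^2 limit of the whole sequence. *)
have fat e : 0 < e -> exists N : nat, forall n, (N <= n)%N ->
    L1 (fun x => (f_ n x - f x) ^+ 2) /\ \int[mu]_x (f_ n x - f x) ^+ 2 <= e.
  move=> /cf[N Nf]; exists N => n Nn.
  apply: (@L1_fatou _ _ _ mu (fun k x => (f_ n x - f_ (psi (N + k)%N) x) ^+ 2)).
  - by move=> k; exact: (L2B (Lf n) (Lf _)).2.
  - by apply: measurable_funX; apply: measurable_funB => //; exact: (Lf n).1.
  - by move=> k x; exact: sqr_ge0.
  - by move=> k; apply: Nf => //; rewrite (leq_trans _ (psin _))// leq_addr.
  - by move=> x; exact: sqr_ge0.
  - apply: filterS ff => x fx; rewrite [X in _ --> X]expr2.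
    have cvh : f_ n x - f_ (psi (N + k)%N) x @[k --> \oo] --> f_ n x - f x.
      by apply: cvgB; [exact: cvg_cst|move: fx; rewrite -(cvg_shiftn N); under eq_fun do rewrite addnC].
    exact: (cvgM cvh cvh).
have Lff : L2 f.
  have [N /(_ N (leqnn N))[hN _]] := fat 1 ltr01.
  have LN : L2 (fun x => f_ N x - f x).
    by split => //; apply: measurable_funB => //; exact: (Lf N).1.
  by have := L2B (Lf N) LN; congr L2; apply/funext => x; ring.
exists f, psi; split => //.
apply/cvgrPdist_le => e e0; have [N Nf] := fat e e0.
exists N => // n /= Nn; rewrite sub0r normrN ger0_norm; first by have [] := Nf n Nn.
by apply: int_ge0 => x; exact: sqr_ge0.
Qed.

Lemma n2_cvg0 (f_ : nat -> T -> R) :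
  \int[mu]_x f_ n x ^+ 2 @[n --> \oo] --> 0 -> n2 (f_ n) @[n --> \oo] --> 0.
Proof.
by move=> f0; rewrite -(@sqrtr0 R); apply: continuous_cvg f0; exact: sqrt_continuous.
Qed.

Lemma L2_dct (f_ : nat -> T -> R) f g :
  (forall n, meas (f_ n)) -> meas f -> L2 g ->
  {ae mu, forall x, forall n, `|f_ n x| <= g x} ->
  {ae mu, forall x, f_ n x @[n --> \oo] --> f x} ->
  \int[mu]_x (f_ n x - f x) ^+ 2 @[n --> \oo] --> 0.
Proof.
move=> mf_ mf [mg g2] fg ff.
have [] := @ae_dct _ _ _ mu (fun n x => (f_ n x - f x) ^+ 2) (fun=> 0) (fun x => 4 * g x ^+ 2).
- by move=> n; apply: measurable_funX; exact: measurable_funB.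
- exact: measurable_cst.
- apply: filterS ff => x fx; under eq_fun do rewrite expr2.
  have h0 : (fun n => f_ n x - f x) @ \oo --> (0 : R).
    by have := cvgB fx (cvg_cst (f x)); rewrite subrr; exact.
  by have := cvgM h0 h0; rewrite mul0r; exact.
- exact: L1Z.
- apply: filterS2 fg ff => x fg ff n; have fxg := cvgn_norm_le ff fg.
  rewrite ger0_norm ?sqr_ge0//; have := fg n; move: fxg.
  by rewrite !ler_norml => /andP[? ?] /andP[? ?]; nra.
- by rewrite (_ : \int[mu]_x 0 = 0)// /Rintegral integral0.
Qed.

End square_integrable.

(** * Weak limits in L^2 *)

Section weak_compactness.
Context d (T : measurableType d) (R : realType).
Variable mu : {measure set T -> \bar R}.
Implicit Types (f g h : T -> R).

(** Stands for the convex hull of the n-th tail, as in Mazur's theorem; midpoints suffice because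
    the parallelogram identity only averages two elements. *)
Inductive midpoint_hull (f_ : nat -> T -> R) (n : nat) : (T -> R) -> Prop :=
| hull_base k : (n <= k)%N -> midpoint_hull f_ n (f_ k)
| hull_mid f g : midpoint_hull f_ n f -> midpoint_hull f_ n g ->
    midpoint_hull f_ n (fun x => 2^-1 * (f x + g x)).

Lemma midpoint_hull_le (f_ : nat -> T -> R) m n f : (m <= n)%N ->
  midpoint_hull f_ n f -> midpoint_hull f_ m f.
Proof.
move=> mn; elim=> [k nk|g h _ IHg _ IHh]; last exact: hull_mid.
exact/hull_base/(leq_trans mn).
Qed.

Lemma midpoint_hull_L2 (f_ : nat -> T -> R) n f : (forall n, L2 mu (f_ n)) ->
  midpoint_hull f_ n f -> L2 mu f.
Proof. by move=> Lf; elim=> // g h _ Lg _ Lh; exact/L2Z/L2D. Qed.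

Lemma parallelogram f g : L2 mu f -> L2 mu g ->
  \int[mu]_x (f x - g x) ^+ 2 = 2 * \int[mu]_x f x ^+ 2 + 2 * \int[mu]_x g x ^+ 2
    - 4 * \int[mu]_x (2^-1 * (f x + g x)) ^+ 2.
Proof.
move=> Lf Lg; have hfg := (L2Z 2^-1 (L2D Lf Lg)).2.
have f2 := Lf.2; have g2 := Lg.2.
rewrite -!intZ// -intD; [|exact: L1Z..].
rewrite -intB; [|by apply: L1D; exact: L1Z|exact: L1Z].
by apply: eq_Rintegral => x _; field.
Qed.

(* Near-minimisers of the norm in the midpoint hulls of the tails form a Cauchy
   sequence, by the parallelogram identity. *)
Lemma L2_weak_limit (f_ : nat -> T -> R) (C : R) (Phi : set (T -> R))
    (l : (T -> R) -> R) :
  (forall n, L2 mu (f_ n)) -> (forall n, n2 mu (f_ n) <= C) ->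
  (forall phi, Phi phi -> L2 mu phi) ->
  (forall phi, Phi phi -> \int[mu]_x (f_ n x * phi x) @[n --> \oo] --> l phi) ->
  exists g, [/\ L2 mu g, n2 mu g <= C &
    forall phi, Phi phi -> \int[mu]_x (g x * phi x) = l phi].
Proof.
move=> Lf fC LPhi fl.
have C0 : 0 <= C by apply: le_trans (fC 0); exact: n2_ge0.
have hullC n f : midpoint_hull f_ n f -> n2 mu f <= C.
  elim=> [k _|g h hg Lg hh Lh]; first exact: fC.
  have Lg' := midpoint_hull_L2 Lf hg; have Lh' := midpoint_hull_L2 Lf hh.
  rewrite n2Z; last exact: L2D.
  rewrite ger0_norm ?invr_ge0// ler_pdivrMl//.
  by rewrite (le_trans (n2D Lg' Lh'))// mulr_natl mulr2n lerD.
(* The infimum of the squared norm over the hull of the n-th tail increases with n and stays below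
   C^2; [D] is the supremum of these infima. *)
pose E n := [set \int[mu]_x f x ^+ 2 | f in midpoint_hull f_ n].
have E0 n : has_inf (E n).
  split; first by exists (\int[mu]_x f_ n x ^+ 2); exists (f_ n) => //; exact: hull_base.
  by exists 0 => _ [f _ <-]; apply: int_ge0 => x; exact: sqr_ge0.
have hullC2 n f : midpoint_hull f_ n f -> \int[mu]_x f x ^+ 2 <= C ^+ 2.
  by move=> hf; rewrite -sqr_n2 lerXn2r ?nnegrE ?n2_ge0//; exact: hullC hf.
pose D := sup [set inf (E n) | n in setT].
have hD : has_sup [set inf (E n) | n in setT].
  split; first by exists (inf (E 0)); exists 0.
  exists (C ^+ 2) => _ [n _ <-].
  apply: (@le_trans _ _ (\int[mu]_x f_ n x ^+ 2)); last exact/(@hullC2 n)/hull_base.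
  by apply: ge_inf; [exact: (E0 n).2|exists (f_ n) => //; exact: hull_base].
have ED n : inf (E n) <= D by apply: ub_le_sup; [exact: hD.2|exists n].
pose e k : R := k.+1%:R^-1.
have e0 k : 0 < e k by rewrite invr_gt0.
have /choice[Ng Ngk] k : exists Ng : nat * (T -> R), [/\ (k <= Ng.1)%N,
    midpoint_hull f_ Ng.1 Ng.2, \int[mu]_x Ng.2 x ^+ 2 <= D + e k &
    forall h, midpoint_hull f_ Ng.1 h -> D - e k <= \int[mu]_x h x ^+ 2].
  have [_ [N _ <-] DN] := sup_adherent (e0 k) hD.
  have [_ [g hg <-] gD] := inf_adherent (e0 k) (E0 (maxn k N)).
  exists (maxn k N, g) => /=; split => //; first exact: leq_maxl.
    by rewrite (le_trans (ltW gD))// lerD2r.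
  move=> h hh; rewrite (le_trans (ltW DN))//.
  apply: ge_inf; first exact: (E0 N).2.
  by exists h => //; apply: midpoint_hull_le hh; exact: leq_maxr.
pose g k := (Ng k).2.
have Lg k : L2 mu (g k) by have [_ hg _ _] := Ngk k; exact: midpoint_hull_L2 hg.
(* With e the larger of the two errors, the identity gives at most 2(D + e) + 2(D + e) - 4(D - e) =
   8e; the midpoint lies in the hull of the tail that starts earlier. *)
have cauchy_g m k : \int[mu]_x (g m x - g k x) ^+ 2 <= 8 * Num.max (e m) (e k).
  rewrite parallelogram//.
  have [_ hgm gm Dm] := Ngk m; have [_ hgk gk Dk] := Ngk k.
  have me : e m <= Num.max (e m) (e k) by rewrite le_max lexx.
  have ke : e k <= Num.max (e m) (e k) by rewrite le_max lexx orbT.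
  have [Nmk|/ltnW Nkm] := leqP (Ng m).1 (Ng k).1.
    by have := Dm _ (hull_mid hgm (midpoint_hull_le Nmk hgk)); rewrite -/(g m) -/(g k) in gm gk *; lra.
  by have := Dk _ (hull_mid (midpoint_hull_le Nkm hgm) hgk); rewrite -/(g m) -/(g k) in gm gk *; lra.
have ecv : e k @[k --> \oo] --> 0 by exact: cvg_harmonic.
have [M [psi [LM _ _ gM]]] : exists M (psi : nat -> nat), [/\ L2 mu M,
    (forall n, psi n < psi n.+1)%N, {ae mu, forall x, g (psi n) x @[n --> \oo] --> M x} &
    \int[mu]_x (g n x - M x) ^+ 2 @[n --> \oo] --> 0].
  apply: L2_complete => // eps eps0.
  have e8 : 0 < eps / 8 by rewrite divr_gt0.
  have [N Nf] := (cvgn_leP _ _).1 ecv _ e8.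
  exists N => m n Nm Nn; rewrite (le_trans (cauchy_g m n))//.
  have := Nf m Nm; have := Nf n Nn; rewrite !subr0 !gtr0_norm//.
  by move=> en em; rewrite mulrC -ler_pdivlMr// ge_max em en.
have gMn : n2 mu (fun x => g n x - M x) @[n --> \oo] --> 0.
  exact: n2_cvg0.
exists M; split => //.
  apply/ler_addgt0Pr => eps eps0.
  have [N /(_ N (leqnn N))] := (cvgn_leP _ _).1 gMn _ eps0.
  rewrite subr0 ger0_norm ?n2_ge0// => h.
  have [_ hg _ _] := Ngk N; have gC : n2 mu (g N) <= C by exact: hullC hg.
  have -> : M = fun x => g N x - (g N x - M x) by apply/funext => x; ring.
  by rewrite (le_trans (n2B (Lg N) (L2B (Lg N) LM)))// lerD.
move=> phi Pphi; have Lphi := LPhi _ Pphi.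
have cvM : \int[mu]_x (g n x * phi x) @[n --> \oo] --> \int[mu]_x (M x * phi x).
  apply/cvgn_leP => eps eps0.
  have ep : 0 < eps / (n2 mu phi + 1) by rewrite divr_gt0// ltr_wpDl// n2_ge0.
  have [N Nf] := (cvgn_leP _ _).1 gMn _ ep; exists N => n /Nf.
  rewrite subr0 ger0_norm ?n2_ge0// => h.
  rewrite -intB; [|exact: L2_mul..].
  under eq_Rintegral do rewrite -mulrBl.
  apply: (le_trans (cauchy_schwarz (L2B (Lg n) LM) Lphi)).
  rewrite (le_trans (ler_wpM2r (n2_ge0 _ _) h))//.
  rewrite mulrAC ler_pdivrMr ?ltr_wpDl ?n2_ge0// ler_wpM2l ?ltW//.
  by rewrite ltrDl.
have cvl : \int[mu]_x (g n x * phi x) @[n --> \oo] --> l phi.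
  apply/cvgn_leP => eps eps0.
  have [N Nf] := (cvgn_leP _ _).1 (fl _ Pphi) _ eps0; exists N => n Nn.
  (* Lying within eps of [l phi] is a convex condition, so it passes from the tail to its hull. *)
  have hN h : midpoint_hull f_ N h -> `|\int[mu]_x (h x * phi x) - l phi| <= eps.
    elim=> [k Nk|h1 h2 hh1 IH1 hh2 IH2]; first exact: Nf.
    have L1' := midpoint_hull_L2 Lf hh1; have L2' := midpoint_hull_L2 Lf hh2.
    under eq_Rintegral do rewrite -mulrA mulrDl.
    rewrite intZ; last by apply: L1D; exact: L2_mul.
    rewrite intD; [|exact: L2_mul..].
    move: IH1 IH2; set a := \int[mu]_x _; set b := \int[mu]_x _.
    by rewrite !ler_norml => /andP[? ?] /andP[? ?]; apply/andP; split; lra.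
  have [nN hg _ _] := Ngk n; apply: hN; apply: midpoint_hull_le hg.
  exact: leq_trans nN.
exact: cvg_unique cvM cvl.
Qed.

End weak_compactness.

(** * Lebesgue measure on R^n *)

Section lebesgue_shift1.
Context {R : realType}.

Lemma measurable_shift1 (a : R) :
  meas ((fun x => x + a) : measurableTypeR R -> measurableTypeR R).
Proof. exact: measurable_funD. Qed.

Lemma lebesgue_measure_shift (a : R) (A : set (measurableTypeR R)) : measurable A ->
  lebesgue_measure ((fun x => x + a) @^-1` A) = lebesgue_measure A.
Proof.
move=> mA; apply/esym.
apply: (@lebesgue_measure_unique _ (pushforward lebesgue_measure
  ((fun x => x + a) : measurableTypeR R -> measurableTypeR R))) => //.
  exact: measurable_shift1.
move=> m _ [[b c]] _ <-; rewrite -[RHS]/(lebesgue_measure ((fun x => x + a) @^-1` `]b, c])).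
rewrite (_ : _ @^-1` _ = `](b - a), (c - a)]%classic); last first.
  by apply/seteqP; split => x /=; rewrite !in_itv/= ltrBlDr lerBrDr.
rewrite !lebesgue_measure_itv/= !lte_fin ltrD2r; case: ifP => // _.
by rewrite -!EFinB; congr EFin; ring.
Qed.

End lebesgue_shift1.

Section lebesgue_rV_theory.
Context {R : realType}.
Implicit Types n : nat.

Lemma measurable_shift n (a : 'rV[R]_n) :
  meas (fun x : 'rV[R]_n => x + a).
Proof.
apply: measurable_fun_rV => i.
rewrite [X in measurable_fun _ X](_ : _ = fun x : 'rV[R]_n => x ord0 i + a ord0 i).
  by apply: measurable_funD => //; exact: measurable_coor.
by apply/funext => x; rewrite mxE.
Qed.

Lemma rV_cons_shift n (a : 'rV[R]_n.+1) (xy : R * 'rV[R]_n) :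
  rV_cons xy + a = rV_cons (xy.1 + a ord0 ord0, xy.2 + @rsubmx _ 1 1 n a).
Proof.
apply/rowP => i; rewrite !mxE; case: split_ordP => j ->.
  by rewrite !mxE !ord1 eqxx !mulr1n; congr (_ + a _ _); apply/val_inj.
by rewrite !mxE.
Qed.

Lemma lebesgue_rV_shift n (a : 'rV[R]_n) (A : set 'rV[R]_n) : measurable A ->
  lebesgue_rV n ((fun x => x + a) @^-1` A) = lebesgue_rV n A.
Proof.
elim: n a A => [|n IH] a A mA.
  congr (lebesgue_rV 0 _); apply/seteqP; split => x /=;
    by rewrite (_ : x + a = x)//; apply/rowP => -[].
rewrite /= /lebesgue_rVS /pushforward /product_measure1 /=.
pose B := @rV_cons R n @^-1` A.
have mB : measurable B by rewrite -[B]setTI; exact: measurable_rV_cons.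
pose F x := lebesgue_rV n (xsection B x).
have mF : meas (F : measurableTypeR R -> _) by exact: measurable_fun_xsection.
transitivity (\int[lebesgue_measure]_x F (x + a ord0 ord0)%R)%E.
  apply: eq_integral => x _ /=.
  rewrite -[RHS](IH (@rsubmx _ 1 1 n a)); last exact: measurable_xsection.
  congr (lebesgue_rV n _); apply/seteqP; split => y /=;
    by rewrite /xsection /B /= !inE/= rV_cons_shift.
have := @ge0_integral_pushforward _ _ (measurableTypeR R) (measurableTypeR R) R
  _ (measurable_shift1 (a ord0 ord0)) lebesgue_measure setT F measurableT mF (fun y _ => measure_ge0 _ _).
rewrite preimage_setT => <-.
apply: eq_measure_integral => [|? C mC _]; first exact: measurable_shift1.
exact: lebesgue_measure_shift.
Qed.

Lemma ge0_integral_shift n (a : 'rV[R]_n) (f : 'rV[R]_n -> \bar R) :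
  meas f -> (forall x, 0 <= f x)%E ->
  (\int[lebesgue_rV n]_x f (x + a)%R = \int[lebesgue_rV n]_x f x)%E.
Proof.
move=> mf f0.
have := @ge0_integral_pushforward _ _ _ _ R
  _ (measurable_shift a) (lebesgue_rV n) setT f measurableT mf (fun y _ => f0 y).
rewrite preimage_setT => <-.
apply: eq_measure_integral => [|? C mC _]; first exact: measurable_shift.
exact: (lebesgue_rV_shift a mC).
Qed.

Lemma measurable_comp_shift n d (T : measurableType d) (a : 'rV[R]_n) (f : 'rV[R]_n -> T) :
  meas f -> meas (fun x : 'rV[R]_n => f (x + a)).
Proof. by move=> mf; apply: measurableT_comp => //; exact: measurable_shift. Qed.

Lemma L1_shift n (a : 'rV[R]_n) (f : 'rV[R]_n -> R) :
  L1 (lebesgue_rV n) f -> L1 (lebesgue_rV n) (fun x => f (x + a)).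
Proof.
move=> If; have mf := L1_meas If; move: If => /integrableP[_ fy].
apply/integrableP; split; first by apply/measurable_EFinP; exact: (measurable_comp_shift a mf).
rewrite (@ge0_integral_shift _ a (fun x => `|(f x)%:E|%E))//.
by apply: measurableT_comp => //; exact/measurable_EFinP.
Qed.

Lemma int_shift n (a : 'rV[R]_n) (f : 'rV[R]_n -> R) : L1 (lebesgue_rV n) f ->
  \int[lebesgue_rV n]_x f (x + a) = \int[lebesgue_rV n]_x f x.
Proof.
move=> If; have mf := L1_meas If; apply: (congr1 fine).
have h := @integral_pushforward _ _ _ _ R
  _ (measurable_shift a) (lebesgue_rV n) setT (EFin \o f) (iffRL (measurable_EFinP _ _) mf).
rewrite preimage_setT in h; rewrite -[LHS]h//; last exact: (L1_shift a If).
apply: eq_measure_integral => [|? C mC _]; first exact: measurable_shift.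
exact: (lebesgue_rV_shift a mC).
Qed.

(** Half-open, so that the cubes of a grid tile the space. *)
Definition cube n (a : 'rV[R]_n) (l : R) : set 'rV[R]_n :=
  [set x | forall i, a ord0 i <= x ord0 i < a ord0 i + l].

Lemma measurable_box n (P : 'I_n -> set R) : (forall i, measurable (P i : set (measurableTypeR R))) ->
  measurable [set x : 'rV[R]_n | forall i, P i (x ord0 i)].
Proof.
move=> mP; rewrite (_ : [set _ | _] = \bigcap_(i in setT) ((fun x : 'rV[R]_n => x ord0 i) @^-1` P i)).
  apply: fin_bigcap_measurable => // i _.
  by rewrite -[X in measurable X]setTI; exact: (@measurable_coor R n i measurableT _ (mP i)).
by apply/seteqP; split => [x Px i _|x Px i]; exact: Px.
Qed.

Lemma measurable_cube n (a : 'rV[R]_n) l : measurable (cube a l).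
Proof.
rewrite (_ : cube a l = [set x | forall i, `[a ord0 i, (a ord0 i + l)[%classic (x ord0 i)]).
  apply: (@measurable_box _ (fun i => `[a ord0 i, (a ord0 i + l)[%classic)) => i.
  exact: measurable_itv.
by apply/seteqP; split => x /= xl i; have := xl i; rewrite in_itv.
Qed.

Lemma lebesgue_rV_cube n (a : 'rV[R]_n) (l : R) : 0 <= l ->
  lebesgue_rV n (cube a l) = (l ^+ n)%:E.
Proof.
move=> l0; elim: n a => [|n IH] a.
  by rewrite -[LHS]/(\d_(0 : 'rV[R]_0) (cube a l)) diracE mem_set ?expr0// => -[].
rewrite /= /lebesgue_rVS /pushforward.
rewrite (_ : _ @^-1` _ = `[a ord0 ord0, (a ord0 ord0 + l)[%classic `*` cube (@rsubmx _ 1 1 n a) l); last first.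
  apply/seteqP; split => [[x y] /= xy|[x y] /= [xl yl] i].
    split => [|i]; first by have := xy ord0; rewrite mxE; case: split_ordP => // j _; rewrite mxE !ord1 eqxx mulr1n in_itv.
    have := xy (@rshift 1 n i); rewrite !mxE; case: split_ordP => j ij.
      by move/(congr1 val) : ij => /= ij; have := ltn_ord j; rewrite -ij.
    by move/rshift_inj : ij => <-.
  rewrite mxE; case: split_ordP => j ij.
    by rewrite mxE !ord1 eqxx mulr1n; move: xl; rewrite in_itv/= ij (_ : lshift n j = ord0)//; apply/val_inj; rewrite /= ord1.
  by have := yl j; rewrite !mxE ij.
rewrite product_measure1E//; last exact: measurable_cube.
have h : lebesgue_measure (`[a ord0 ord0, (a ord0 ord0 + l)[%classic : set R) = l%:E.
  rewrite lebesgue_measure_itv/= lte_fin ltrDl.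
  have [l0'|l0'] := ltP 0 l; first by rewrite -EFinB; congr EFin; ring.
  by congr EFin; apply/eqP; rewrite eq_le l0 l0'.
by rewrite IH exprS EFinM; congr (_ * _)%E; exact: h.
Qed.

Lemma measurable_limit d (T : measurableType d) (f_ : nat -> T -> R) (f : T -> R) :
  (forall n, meas (f_ n)) ->
  (forall x, f_ n x @[n --> \oo] --> f x) -> meas f.
Proof.
move=> mf ff; rewrite (_ : f = fun x => fine (limn_esup (fun n => (f_ n x)%:E))).
  apply: measurableT_comp => //; apply: measurable_fun_limn_esup => n.
  exact/measurable_EFinP.
apply/funext => x; have fx := ff x.
have cv : (fun n => (f_ n x)%:E) @ \oo --> (f x)%:E by apply: cvg_EFin => //; exact: nearW.
by have [_ ->] := cvg_limn_einf_sup cv.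
Qed.

Lemma cvg_rV n (u : nat -> 'rV[R]_n) (l : 'rV[R]_n) :
  (forall i, u k ord0 i @[k --> \oo] --> l ord0 i) -> u k @[k --> \oo] --> l.
Proof.
move=> ul; apply/cvg_ballP => e e0.
have h : \forall k \near \oo, forall i : 'I_n, ball (l ord0 i) e (u k ord0 i).
  by apply: filter_forall => i; have /cvg_ballP := ul i; exact.
by apply: filterS h => k h; split => // i j; rewrite ord1.
Qed.

(** The sigma-algebra is generated by coordinates rather than by open sets. Rounding each coordinate
    down to a multiple of 1/(k+1) gives maps with countably many values, and f is the pointwise
    limit of its compositions with them. *)
Lemma measurable_continuous n (f : 'rV[R]_n -> R) : continuous f -> meas f.
Proof.
move=> cf.
pose rd k (x : 'rV[R]_n) : 'rV[R]_n := \row_i ((Num.floor (x ord0 i * k.+1%:R))%:~R / k.+1%:R).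
apply: (@measurable_limit _ _ (fun k => f \o rd k)) => [k|x]; last first.
  apply: continuous_cvg; first exact: cf.
  apply: cvg_rV => i; apply/cvgn_leP => e e0.
  have [N Nf] := (cvgn_leP _ _).1 (@cvg_harmonic R) e e0.
  exists N => k /Nf; rewrite subr0 /= mxE => h.
  set y := x ord0 i * k.+1%:R; have k0 : 0 < k.+1%:R :> R by [].
  have -> : (Num.floor y)%:~R / k.+1%:R - x ord0 i = ((Num.floor y)%:~R - y) / k.+1%:R.
    by rewrite /y; field; exact: lt0r_neq0.
  apply: le_trans h; rewrite normrM ler_piMl//.
  have := floor_itv y; rewrite intrD => /andP[h1 h2].
  by rewrite ler_norml; apply/andP; split; lra.
move=> _ Y mY; rewrite setTI.
pose S (z : 'rV[int]_n) := [set x : 'rV[R]_n | forall i, Num.floor (x ord0 i * k.+1%:R) = z ord0 i].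
rewrite (_ : _ @^-1` Y = \bigcup_(z in [set: 'rV[int]_n]) (if `[< Y (f (\row_i ((z ord0 i)%:~R / k.+1%:R))) >] then S z else set0)).
  apply: countable_bigcupT_measurable => // z; case: ifP => // _.
  apply: (@measurable_box _ (fun i => [set t : R | Num.floor (t * k.+1%:R) = z ord0 i])) => i.
  rewrite (_ : [set _ | _] = `[(z ord0 i)%:~R / k.+1%:R, (z ord0 i + 1)%:~R / k.+1%:R[%classic) ?measurable_itv//.
  apply/seteqP; split => t /=; rewrite in_itv/= ler_pdivrMr// ltr_pdivlMr//.
    by move=> <-; exact: floor_itv.
  by move=> h; apply: floor_def.
apply/seteqP; split => [x /= Yx|x [z _]].
  exists (\row_i Num.floor (x ord0 i * k.+1%:R)) => //=.
  rewrite asboolT; first by move=> i; rewrite mxE.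
  by move: Yx; congr Y; congr f; apply/rowP => i; rewrite !mxE.
case: asboolP => // Yz Sx; rewrite /=.
by move: Yz; congr Y; congr f; apply/rowP => i; rewrite !mxE Sx.
Qed.

End lebesgue_rV_theory.

(** * Test functions *)

Section ebump.
Context {R : realType}.
Implicit Types (m : nat) (c t : R).

(** The index m makes the family t^(-m) exp(-c/t), extended by 0, stable under differentiation: a
    derivative is a combination of the members m+1 and m+2. *)
Definition ebump m c t : R := if 0 < t then t^-1 ^+ m * expR (- c * t^-1) else 0.

Lemma ebump_ge0 m c t : 0 <= ebump m c t.
Proof.
by rewrite /ebump; case: ifP => // t0; rewrite mulr_ge0 ?expR_ge0// exprn_ge0// invr_ge0 ltW.
Qed.

(** Taylor's bound exp(x) >= x^(m+2)/(m+2)! at x = c/t. Vanishing to second order is what yields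
    differentiability at 0. *)
Lemma ebump_le m c t : 0 < c ->
  ebump m c t <= m.+2`!%:R * c^-1 ^+ m.+2 * t ^+ 2.
Proof.
move=> c0; have K0 : 0 <= m.+2`!%:R * c^-1 ^+ m.+2.
  by rewrite mulr_ge0// exprn_ge0// invr_ge0 ltW.
rewrite /ebump; case: ifPn => [t0|_]; last by rewrite mulr_ge0// sqr_ge0.
have ct0 : 0 < c * t^-1 by rewrite divr_gt0.
have h : (c * t^-1) ^+ m.+2 / m.+2`!%:R <= expR (c * t^-1).
  by apply: le_trans (expR_ge1Dxn m.+1 (ltW ct0)); rewrite lerDr.
rewrite mulNr expRN ler_pdivrMr ?expR_gt0//.
have f0 : 0 < m.+2`!%:R :> R by rewrite ltr0n fact_gt0.
apply: (@le_trans _ _ (m.+2`!%:R * c^-1 ^+ m.+2 * t ^+ 2 * ((c * t^-1) ^+ m.+2 / m.+2`!%:R))); last first.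
  by rewrite ler_wpM2l// mulr_ge0// sqr_ge0.
apply: le_of_eq.
rewrite exprMn !exprVn -[in t ^- m.+2](addn2 m) exprD; field.
by rewrite ?expf_neq0 ?lt0r_neq0.
Qed.

Lemma is_derive_ebump m c t : 0 < c ->
  is_derive t 1 (ebump m c) (- m%:R * ebump m.+1 c t + c * ebump m.+2 c t).
Proof.
move=> c0; have [t0|t0|->] := ltgtP t 0.
- have nt : \forall y \near t, cst 0 y = ebump m c y.
    have : \forall y \near t, y < 0 by exact: lt_nbhsl.
    by apply: filterS => y y0; rewrite /ebump (lt_gtF y0).
  rewrite /ebump (lt_gtF t0) !mulr0 addr0.
  by apply: near_eq_is_derive nt _; rewrite ?oner_neq0//; exact: is_derive_cst.
- have nt : \forall y \near t, (y^-1 ^+ m * expR (- c * y^-1)) = ebump m c y.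
    have : \forall y \near t, 0 < y by exact: lt_nbhsr.
    by apply: filterS => y y0; rewrite /ebump y0.
  apply: near_eq_is_derive nt _; rewrite ?oner_neq0//.
  have tn0 : t != 0 by rewrite gt_eqF.
  have dV : is_derive t 1 (fun y : R => y^-1) (- t ^- 2) by have := @is_deriveV R id t 1 1 tn0; rewrite scaler1; apply.
  have dX := @is_deriveX R _ (fun y : R => y^-1) m t 1 _ dV.
  rewrite exprfctE in dX.
  have dE := @is_derive1_comp R expR (fun y : R => - c * y^-1) t _ _ (is_derive_expR _) (@is_deriveM R _ (cst (- c)) (fun y : R => y^-1) t 1 _ _ (is_derive_cst _ _ _) dV).
  have := @is_deriveM R _ (fun y : R => y^-1 ^+ m) _ t 1 _ _ dX dE.
  move=> H; apply: (@is_derive_eq _ _ _ _ _ _ _ _ H); rewrite /ebump t0 /=.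
  rewrite /GRing.scale/= !mulr0 !addr0.
  set E := expR _; rewrite -!exprVn !exprS; case: (m) => [|k].
    by rewrite /= !expr0 !mul0r; field.
  by rewrite /= !exprS !mulr1; ring.
(* At 0 the slope of [ebump m] is [ebump m.+1], since dividing by t raises the power; it tends to 0
   by the quadratic bound. *)
- apply/is_derive1_caratheodory; exists (fun y => ebump m.+1 c y); split.
  + move=> y; rewrite subr0 /ebump ltxx subr0; case: ifPn => y0; last by rewrite mul0r.
    by rewrite exprS; field; rewrite gt_eqF.
  + have [K K0 bK] : exists2 K, 0 < K & forall y, ebump m.+1 c y <= K * y ^+ 2.
      exists (m.+3`!%:R * c^-1 ^+ m.+3) => [|y]; last exact: ebump_le.
      by rewrite mulr_gt0 ?ltr0n ?fact_gt0// exprn_gt0// invr_gt0.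
    have e0 : ebump m.+1 c 0 = 0 by rewrite /ebump ltxx.
    rewrite /prop_for /continuous_at e0.
    apply: (@squeeze_cvgr _ _ _ _ (cst 0) (fun y => K * y ^+ 2)).
    * by apply: nearW => y; rewrite bK ebump_ge0.
    * exact: cvg_cst.
    * rewrite -[X in _ --> X](mulr0 K); apply: cvgZr.
      rewrite -[X in _ --> X](expr0n R 2); exact: exprn_continuous.
  + by rewrite /ebump ltxx !mulr0 addr0.
Qed.

Lemma continuous_ebump m c : 0 < c -> continuous (ebump m c).
Proof.
move=> c0 t; apply: differentiable_continuous; apply/derivable1_diffP.
by have [] := is_derive_ebump m t c0.
Qed.

End ebump.

Section test_algebra.
Context {R : realType} {N : nat}.
Local Notation E := 'rV[R]_N.
Local Notation mu := (@lebesgue_rV R N).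
Implicit Types (f g phi : E -> R).

(** An algebra closed under partial derivatives, products and translations, so that smoothness is a
    single induction and bounded support can be checked separately. *)
Inductive talg : (E -> R) -> Prop :=
| talg_ebump i m (c s r : R) : 0 < c -> talg (fun x => ebump m c (s * x ord0 i + r))
| talg_cst (a : R) : talg (fun=> a)
| talg_add f g : talg f -> talg g -> talg (fun x => f x + g x)
| talg_mul f g : talg f -> talg g -> talg (fun x => f x * g x).

Lemma is_derive_coord (i j : 'I_N) (g : R -> R) (x : E) (s r dg : R) :
  is_derive (s * x ord0 i + r) 1 g dg ->
  is_derive x (delta_mx ord0 j) (fun y : E => g (s * y ord0 i + r))
    ((i == j)%:R * s * dg).
Proof.
move=> dg'; have dl : is_derive (0 : R) 1 (fun h : R => s * (h * (i == j)%:R + x ord0 i) + r) (s * (i == j)%:R).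
  apply: is_derive_eq; rewrite /GRing.scale/=; ring.
have d0 : is_derive (s * ((0 : R) * (i == j)%:R + x ord0 i) + r) 1 g dg by rewrite mul0r add0r.
have [+ +] := @is_derive1_comp R g (fun h : R => s * (h * (i == j)%:R + x ord0 i) + r) 0 _ _ d0 dl.
rewrite /derivable /derive.
rewrite (_ : (fun h : R => h^-1 *: _) = (fun h : R => h^-1 *:
   (((fun y : E => g (s * y ord0 i + r)) \o shift x) (h *: delta_mx ord0 j) - g (s * x ord0 i + r)))); last first.
  apply/funext => h /=; rewrite !mxE eqxx /= mul0r add0r addr0.
  by rewrite [X in g (s * (X * _ + _) + _)](_ : _ = h)// /GRing.scale/= mulr1.
move=> h1 h2; split; first exact: h1.
by transitivity (dg * (s * (i == j)%:R)); [exact: h2|ring].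
Qed.

Lemma talg_partial f (j : 'I_N) : talg f ->
  exists2 g, talg g & forall x, is_derive x (delta_mx ord0 j) f (g x).
Proof.
elim=> [i m c s r c0|a|g h _ [g' tg' dg] _ [h' th' dh]|g h tg [g' tg' dg] th [h' th' dh]].
- exists (fun x => (i == j)%:R * s * (- m%:R * ebump m.+1 c (s * x ord0 i + r)
      + c * ebump m.+2 c (s * x ord0 i + r))).
    apply: talg_mul; first exact: talg_cst.
    by apply: talg_add; apply: talg_mul; solve [exact: talg_cst|exact: talg_ebump].
  by move=> x; apply: is_derive_coord; exact: is_derive_ebump.
- by exists (fun=> 0) => [|x]; [exact: talg_cst|exact: is_derive_cst].
- by exists (fun x => g' x + h' x) => [|x]; [exact: talg_add|exact: is_deriveD].
- exists (fun x => g x * h' x + h x * g' x) => [|x].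
    by apply: talg_add; exact: talg_mul.
  exact: is_deriveM.
Qed.

Lemma continuous_talg f : talg f -> continuous f.
Proof.
elim=> [i m c s r c0 x|a x|g h _ cg _ ch x|g h _ cg _ ch x].
- apply: (@continuous_comp _ _ _ (fun y : E => s * y ord0 i + r) (ebump m c)); last exact: continuous_ebump.
  have cx := @coord_continuous R 1 N ord0 i x.
  have cs := @cst_continuous _ _ s x; have cr := @cst_continuous _ _ r x.
  exact: (continuousD (continuousM cs cx) cr).
- exact: cst_continuous.
- exact: (continuousD (cg x) (ch x)).
- exact: (continuousM (cg x) (ch x)).
Qed.

Lemma talg_smooth f : talg f -> smooth f.
Proof.
move=> tf s; have ts : talg (iter_partial s f).
  elim: s => // i s IH /=; have [g tg dg] := talg_partial i IH.
  by rewrite (_ : partial _ _ = g)//; apply/funext => x; have [_] := dg x.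
split; first exact: continuous_talg.
by move=> i x; have [g _ dg] := talg_partial i ts; have [] := dg x.
Qed.

Definition bounded_support phi := exists M : R, forall x, phi x != 0 -> forall i, `|x ord0 i| <= M.

Definition bump_test phi := talg phi /\ bounded_support phi.

Lemma bump_test_function phi : bump_test phi -> test_function phi.
Proof.
move=> [tp [M pM]]; split; first exact: talg_smooth.
apply: bounded_closed_compact; last exact: closed_closure.
exists `|M|; split; first exact: num_real.
move=> K MK x clx; rewrite /= -[`|x|]/(mx_norm x) mx_normrE.
have K0 : 0 <= K by rewrite (le_trans _ (ltW MK)).
apply: bigmax_le => // -[k i] _ /=; rewrite ord1 leNgt; apply/negP => Kx.
have : nbhs x [set y : E | K < `|y ord0 i|].
  have cn : continuous (fun y : E => `|y ord0 i|).
    by move=> y; apply: (@continuous_comp _ _ _ (fun y : E => y ord0 i)); [exact: coord_continuous|exact: norm_continuous].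
  by have /cvgr_gt := cn x; apply.
move=> /clx[y [/= py Ky]]; have := pM _ py i.
by rewrite leNgt (le_lt_trans (ler_norm M))// (lt_trans MK).
Qed.

Lemma bump_testD phi psi : bump_test phi -> bump_test psi -> bump_test (fun x => phi x + psi x).
Proof.
move=> [tf [M fM]] [tg [M' gM]]; split; first exact: talg_add.
exists (Num.max M M') => x; have [f0|f0] := eqVneq (phi x) 0.
  by rewrite f0 add0r => /gM h i; rewrite (le_trans (h i))// le_max lexx orbT.
by move=> _ i; rewrite (le_trans (fM _ f0 i))// le_max lexx.
Qed.

Lemma bump_testM phi psi : bump_test phi -> talg psi -> bump_test (fun x => psi x * phi x).
Proof.
move=> [tf [M fM]] tg; split; first exact: talg_mul.
by exists M => x; rewrite mulf_eq0 negb_or => /andP[_ /fM].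
Qed.

Lemma bump_testZ phi a : bump_test phi -> bump_test (fun x => a * phi x).
Proof. by move=> h; apply: bump_testM h (talg_cst a). Qed.

Lemma talg_shift f (a : E) : talg f -> talg (fun x => f (x + a)).
Proof.
elim=> [i m c s r c0|b|g h _ cg _ ch|g h _ cg _ ch].
- rewrite [X in talg X](_ : _ = fun x : E => ebump m c (s * x ord0 i + (s * a ord0 i + r))).
    exact: talg_ebump.
  by apply/funext => x; rewrite mxE; congr ebump; ring.
- exact: talg_cst.
- exact: talg_add.
- exact: talg_mul.
Qed.

Lemma bump_test_shift phi (a : E) : bump_test phi -> bump_test (fun x => phi (x + a)).
Proof.
move=> [tp [M pM]]; split; first exact: talg_shift.
exists (M + \sum_i `|a ord0 i|) => x /pM h i.
rewrite (_ : x ord0 i = (x + a) ord0 i - a ord0 i); last by rewrite mxE; ring.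
rewrite (le_trans (ler_normB _ _))// lerD//.
by rewrite (bigD1 i)//= lerDl sumr_ge0.
Qed.

End test_algebra.

Lemma L1_indic d (T : measurableType d) (R : realType)
    (mu : {measure set T -> \bar R}) (A : set T) :
  measurable A -> (mu A < +oo)%E -> L1 mu (\1_A).
Proof.
move=> mA Ay; have mI : meas (\1_A : T -> R) by exact: measurable_indic.
apply/(L1_ge0P mu mI) => //; by rewrite integral_indic// setIT.
Qed.

Lemma cvgn_prod (R : realType) (I : Type) (s : seq I) (F : I -> nat -> R) (l : I -> R) :
  (forall i, F i n @[n --> \oo] --> l i) ->
  \prod_(i <- s) F i n @[n --> \oo] --> \prod_(i <- s) l i.
Proof.
move=> Fl; elim: s => [|i s IH].
  by rewrite big_nil; under eq_fun do rewrite big_nil; exact: cvg_cst.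
by rewrite big_cons; under eq_fun do rewrite big_cons; exact: cvgM.
Qed.

(** * Density of bump functions in L^2 *)

Section bump_dense.
Import HBNNSimple.
Context {R : realType} {N : nat}.
Local Notation E := 'rV[R]_N.
Local Notation mu := (@lebesgue_rV R N).
Implicit Types (f g phi : E -> R).

Definition obox (a b : E) : set E := [set x | forall i, a ord0 i < x ord0 i < b ord0 i].

Lemma measurable_obox a b : measurable (obox a b).
Proof.
rewrite (_ : obox a b = [set x | forall i, `]a ord0 i, b ord0 i[%classic (x ord0 i)]).
  by apply: (@measurable_box R N (fun i => `]a ord0 i, b ord0 i[%classic)) => i; exact: measurable_itv.
by apply/seteqP; split => x /= xl i; have := xl i; rewrite in_itv.
Qed.

Lemma bounded_support_L1 f (C M : R) : meas f -> (forall x, `|f x| <= C) ->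
  (forall x, f x != 0 -> forall i, `|x ord0 i| <= M) -> L1 mu f.
Proof.
move=> mf fC fM; pose a : E := const_mx (- M); pose l : R := 2 * `|M| + 1.
have l0 : 0 <= l by rewrite addr_ge0// mulr_ge0.
have C0 : 0 <= C by rewrite (le_trans _ (fC 0)).
apply: (@L1_le _ _ _ mu _ (fun x => C * \1_(cube a l) x)) => //.
  move=> x; have [->|f0] := eqVneq (f x) 0; first by rewrite normr0 mulr_ge0// indicE.
  rewrite indicE mem_set ?mulr1// => i; rewrite mxE.
  have := fM _ f0 i; rewrite ler_norml /l => /andP[h1 h2].
  have M1 := ler_norm M; apply: (introT andP); split; lra.
apply/L1Z/L1_indic; first exact: measurable_cube.
apply: (@le_lt_trans _ _ ((l ^+ N)%:E)); last exact: ltry.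
by apply: le_of_eq; exact: (lebesgue_rV_cube a l0).
Qed.

Lemma bounded_support_L2 f (C M : R) : meas f -> (forall x, `|f x| <= C) ->
  (forall x, f x != 0 -> forall i, `|x ord0 i| <= M) -> L2 mu f.
Proof.
move=> mf fC fM; split => //; apply: (@bounded_support_L1 _ (C ^+ 2) M).
- exact: measurable_funX.
- by move=> x; rewrite normrX lerXn2r ?nnegrE// (le_trans _ (fC 0)).
- by move=> x; rewrite sqrf_eq0; exact: fM.
Qed.

Lemma continuous_bounded_support f : continuous f -> bounded_support f ->
  exists C, forall x, `|f x| <= C.
Proof.
move=> cf [M fM].
pose K : set E := [set x | forall i, `|x ord0 i| <= M].
have cK : compact K.
  have := @rV_compact R N (fun=> `[- M, M]%classic) (fun _ => @segment_compact _ _ _).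
  by congr compact; apply/seteqP; split => x /= h i; have := h i; rewrite in_itv/= ler_norml.
have /compact_bounded[B [_ hB]] : compact (f @` K).
  by apply: continuous_compact => //; apply: continuous_subspaceT.
exists (`|B| + 1) => x; have [->|f0] := eqVneq (f x) 0; first by rewrite normr0 addr_ge0.
apply: hB; first by rewrite (le_lt_trans (ler_norm _))// ltrDl.
by exists x => //; exact: fM.
Qed.

Lemma bump_test_L2 phi : bump_test phi -> L2 mu phi.
Proof.
move=> [tp sp]; have cp := continuous_talg tp.
have [C pC] := continuous_bounded_support cp sp; have [M pM] := sp.
by apply: bounded_support_L2 pC pM; exact: measurable_continuous.
Qed.

(** The closure of the bump functions inside L^2. It is stable under linear combinations and
    dominated convergence, and these operations reach all of L^2 from boxes. *)
Definition approx_bump f := L2 mu f /\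
  forall e : R, 0 < e -> exists2 phi, bump_test phi & n2 mu (fun x => f x - phi x) <= e.

Lemma approx_bumpD f g : approx_bump f -> approx_bump g -> approx_bump (fun x => f x + g x).
Proof.
move=> [Lf af] [Lg ag]; split; first exact: L2D.
move=> e e0; have e20 : 0 < e / 2 by rewrite divr_gt0.
have [phi tp fp] := af _ e20; have [psi ts gs] := ag _ e20.
exists (fun x => phi x + psi x); first exact: bump_testD.
have Lp := bump_test_L2 tp; have Ls := bump_test_L2 ts.
rewrite (_ : (fun x => _) = fun x => (f x - phi x) + (g x - psi x)); last first.
  by apply/funext => x; ring.
rewrite (le_trans (n2D (L2B Lf Lp) (L2B Lg Ls)))//.
by rewrite [leRHS](_ : e = e / 2 + e / 2) ?lerD//; field.
Qed.

Lemma approx_bumpZ f a : approx_bump f -> approx_bump (fun x => a * f x).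
Proof.
move=> [Lf af]; split; first exact: L2Z.
move=> e e0; have a0 : 0 < `|a| + 1 by rewrite ltr_wpDl.
have [phi tp fp] := af _ (divr_gt0 e0 a0); exists (fun x => a * phi x); first exact: bump_testZ.
under eq_fun do rewrite -mulrBr.
rewrite n2Z; last exact: L2B (bump_test_L2 tp).
rewrite (le_trans (ler_wpM2l _ fp))// mulrCA ger_pMr// ler_pdivrMr// mul1r lerDl//.
Qed.

Lemma approx_bump0 : approx_bump (fun=> 0).
Proof.
split=> [|e e0]; first exact: L2_0.
exists (fun=> 0); first by split; [exact: talg_cst|exists 0 => x; rewrite eqxx].
by rewrite /n2; under eq_Rintegral do rewrite subrr expr0n/=; rewrite /Rintegral integral0 sqrtr0 ltW.
Qed.

Lemma approx_bump_dct (f_ : nat -> E -> R) f g : (forall n, approx_bump (f_ n)) ->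
  meas f -> L2 mu g -> (forall n x, `|f_ n x| <= g x) ->
  (forall x, f_ n x @[n --> \oo] --> f x) -> approx_bump f.
Proof.
move=> af mf Lg fg ff; have Lf_ n := (af n).1.
have Lf : L2 mu f by apply: L2_le Lg => // x; exact: cvgn_norm_le (ff x) (fg ^~ x).
split=> // e e0; have e20 : 0 < e / 2 by rewrite divr_gt0.
have c : \int[mu]_x (f_ n x - f x) ^+ 2 @[n --> \oo] --> 0.
  by apply: L2_dct Lg _ _ => //; [move=> n; exact: (Lf_ n).1|exact: aeW|exact: aeW].
have [n /(_ n (leqnn n))] := (cvgn_leP _ _).1 (n2_cvg0 c) _ e20.
rewrite subr0 ger0_norm ?n2_ge0// => fn; have [_ /(_ _ e20)[phi tp fp]] := af n.
exists phi => //; have Lp := bump_test_L2 tp.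
rewrite (_ : (fun x => _) = fun x => (f_ n x - phi x) - (f_ n x - f x)); last first.
  by apply/funext => x; ring.
rewrite (le_trans (n2B (L2B (Lf_ n) Lp) (L2B (Lf_ n) Lf)))//.
by rewrite [leRHS](_ : e = e / 2 + e / 2) ?lerD//; field.
Qed.

Lemma talg_prod (I : Type) (s : seq I) (F : I -> E -> R) :
  (forall i, talg (F i)) -> talg (fun x => \prod_(i <- s) F i x).
Proof.
move=> tF; elim: s => [|i s IH].
  by under eq_fun do rewrite big_nil; exact: talg_cst.
by under eq_fun do rewrite big_cons; exact: talg_mul.
Qed.

(** A factor exp(-c/t), for t > 0, tends to 1 as c tends to 0, so these products increase to the
    indicator of the open box. *)
Definition bump_prod (c : R) (a b x : E) : R :=
  \prod_(i < N) (ebump 0 c (x ord0 i - a ord0 i) * ebump 0 c (b ord0 i - x ord0 i)).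

Lemma bump_prod_test c a b : 0 < c -> bump_test (bump_prod c a b).
Proof.
move=> c0; split.
  apply: talg_prod => i; apply: talg_mul.
    by under eq_fun do rewrite -[X in X - _]mul1r; exact: talg_ebump.
  by under eq_fun do rewrite addrC -mulN1r; exact: talg_ebump.
exists (\sum_i (`|a ord0 i| + `|b ord0 i|)) => x px i.
have h : `|a ord0 i| + `|b ord0 i| <= \sum_i (`|a ord0 i| + `|b ord0 i|).
  by rewrite (bigD1 i)//= lerDl sumr_ge0// => j _; rewrite addr_ge0.
apply: le_trans h; move: px; rewrite /bump_prod (bigD1 i)//= mulf_eq0 negb_or => /andP[+ _].
rewrite mulf_eq0 negb_or => /andP[]; rewrite /ebump; case: ifPn; rewrite ?eqxx// subr_gt0 => ax _.
case: ifPn; rewrite ?eqxx// subr_gt0 => xb _.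
have h1 := ler_norm (b ord0 i); have h2 := ler_norm (- a ord0 i); rewrite normrN in h2.
by have := normr_ge0 (a ord0 i); have := normr_ge0 (b ord0 i); rewrite ler_norml => *; apply/andP; split; lra.
Qed.

Lemma ebump0_itv (c t : R) : 0 < c -> 0 <= ebump 0 c t <= (0 < t)%R%:R.
Proof.
move=> c0; rewrite ebump_ge0/= /ebump; case: ifPn => //= t0.
by rewrite expr0 mul1r expR_le1 mulNr oppr_le0 divr_ge0// ltW.
Qed.

Lemma ebump0_cvg (t : R) : ebump 0 n.+1%:R^-1 t @[n --> \oo] --> ((0 < t)%R%:R : R).
Proof.
have [t0|/le_gtF t0] := ltP 0 t; rewrite /ebump t0; last exact: cvg_cst.
under eq_fun do rewrite expr0 mul1r.
rewrite (_ : true%:R = expR (0 * t^-1)); last by rewrite mul0r expR0.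
apply: continuous_cvg; first exact: continuous_expR.
apply: cvgM; last exact: cvg_cst.
by have := cvgN (@cvg_harmonic R); rewrite oppr0; apply.
Qed.

Lemma indic_obox a b x : \1_(obox a b) x =
  \prod_(i < N) ((0 < x ord0 i - a ord0 i)%R%:R * (0 < b ord0 i - x ord0 i)%R%:R) :> R.
Proof.
rewrite indicE; have [xab|xab] := boolP (x \in _).
  rewrite big1// => i _; rewrite inE in xab; have /andP[h1 h2] := xab i.
  by rewrite !subr_gt0 h1 h2 mulr1.
have /existsNP[i /negP] : ~ forall i, a ord0 i < x ord0 i < b ord0 i by move=> h; move/negP : xab; apply; rewrite inE.
by rewrite (bigD1 i)//= !subr_gt0 -natrM mulnb => /negbTE ->; rewrite mul0r.
Qed.

Lemma indic_obox_L2 a b : L2 mu (\1_(obox a b) : E -> R).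
Proof.
apply: (@bounded_support_L2 _ 1 (\sum_i (`|a ord0 i| + `|b ord0 i|))).
- by apply: measurable_indic; exact: measurable_obox.
- by move=> x; rewrite indicE; case: (x \in _); rewrite ?normr0 ?normr1.
move=> x; rewrite indicE pnatr_eq0 eqb0 negbK inE => xab i; have /andP[h1 h2] := xab i.
have h : `|a ord0 i| + `|b ord0 i| <= \sum_i (`|a ord0 i| + `|b ord0 i|).
  by rewrite (bigD1 i)//= lerDl sumr_ge0// => j _; rewrite addr_ge0.
apply: le_trans h.
have h3 := ler_norm (b ord0 i); have h4 := ler_norm (- a ord0 i); rewrite normrN in h4.
by have := normr_ge0 (a ord0 i); have := normr_ge0 (b ord0 i); rewrite ler_norml => *; apply/andP; split; lra.
Qed.

Lemma approx_bump_obox a b : approx_bump (\1_(obox a b)).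
Proof.
apply: (@approx_bump_dct (fun n => bump_prod n.+1%:R^-1 a b) _ (\1_(obox a b))).
- move=> n; have tp : bump_test (bump_prod n.+1%:R^-1 a b) by apply: bump_prod_test; rewrite invr_gt0.
  split; first exact: bump_test_L2.
  move=> e e0; exists (bump_prod n.+1%:R^-1 a b) => //.
  by rewrite /n2; under eq_Rintegral do rewrite subrr expr0n/=; rewrite /Rintegral integral0 sqrtr0 ltW.
- by apply: measurable_indic; exact: measurable_obox.
- exact: indic_obox_L2.
- move=> n x; have c0 : 0 < n.+1%:R^-1 :> R by rewrite invr_gt0.
  rewrite indic_obox /bump_prod ger0_norm.
    apply: ler_prod => i _; have /andP[h1 h2] := ebump0_itv (x ord0 i - a ord0 i) c0.
    have /andP[h3 h4] := ebump0_itv (b ord0 i - x ord0 i) c0.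
    by rewrite mulr_ge0//= ler_pM.
  by apply: prodr_ge0 => i _; rewrite mulr_ge0// ebump_ge0.
- move=> x; rewrite indic_obox /bump_prod.
  by apply: cvgn_prod => i; apply: cvgM; exact: ebump0_cvg.
Qed.

Definition oboxes : set (set E) := [set A | exists a b, A = obox a b].

Lemma oboxes_setI : setI_closed oboxes.
Proof.
move=> _ _ [a [b ->]] [c [d ->]].
exists (\row_i Num.max (a ord0 i) (c ord0 i)), (\row_i Num.min (b ord0 i) (d ord0 i)).
apply/seteqP; split => x /=.
  by move=> [xab xcd] i; rewrite !mxE gt_max lt_min; have /andP[-> ->] := xab i; have /andP[-> ->] := xcd i.
by move=> h; split => i; have := h i; rewrite !mxE gt_max lt_min => /andP[/andP[h1 h2] /andP[h3 h4]]; rewrite ?h1 ?h2 ?h3 ?h4.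
Qed.

Lemma measurable_oboxes : (measurable : set (set E)) = <<s oboxes >>.
Proof.
apply/seteqP; split; last first.
  apply: smallest_sub; first exact: sigma_algebra_measurable.
  by move=> _ [a [b ->]]; exact: measurable_obox.
move=> A mA.
have : meas (fun x : g_sigma_algebraType oboxes => (x : E)).
  apply: measurable_fun_rV => i.
  apply: (measurability _ (RGenOInfty.measurableE R)) => //.
  move=> _ [_ [r ->] <-]; rewrite setTI.
  rewrite (_ : _ @^-1` _ = \bigcup_k obox (\row_j (if j == i then r else - k%:R)) (\row_j k%:R)).
    by apply: bigcupT_measurable => k; apply: sub_sigma_algebra; do 2 eexists.
  apply/seteqP; split => x /=; rewrite in_itv/= andbT.
    move=> rx; pose M := \sum_j `|x ord0 j|.
    exists (Num.truncn M).+1 => //= j; rewrite !mxE.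
    have xM : `|x ord0 j| < (Num.truncn M).+1%:R.
      have := truncnS_gt M; apply: le_lt_trans.
      by rewrite /M (bigD1 j)//= lerDl sumr_ge0.
    by move: xM; rewrite ltr_norml => /andP[h1 h2]; case: eqP => [ji|_]; rewrite ?h1 h2// ji rx.
  by move=> [k _ /(_ i)]; rewrite !mxE eqxx => /andP[].
by move=> /(_ measurableT _ mA); rewrite setTI.
Qed.

(** Dynkin's argument relative to a fixed box: the restriction keeps every indicator
    square-integrable, so that complements become differences. *)
Lemma approx_bump_setI (a b : E) (S : set E) : measurable S ->
  approx_bump (\1_(S `&` obox a b)).
Proof.
move=> mS; have mO := measurable_obox a b.
pose P (S : set E) := approx_bump (\1_(S `&` obox a b)).
apply: (@dynkin_induction _ _ oboxes P measurable_oboxes oboxes_setI); last by rewrite -measurable_oboxes.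
- by rewrite /P setTI; exact: approx_bump_obox.
- move=> _ [c [d ->]]; rewrite /P.
  have [e [f ->]] : oboxes (obox c d `&` obox a b).
    by apply: oboxes_setI; do 2 eexists.
  exact: approx_bump_obox.
- move=> X mX PX; rewrite /P.
  have := approx_bumpD (approx_bump_obox a b) (approx_bumpZ (-1) PX).
  congr approx_bump; apply/funext => x.
  rewrite !indicE !in_setI in_setC.
  by case: (x \in X); case: (x \in obox a b) => /=; ring.
- move=> F mF tF PF; rewrite /P.
  apply: (@approx_bump_dct (fun n x => \sum_(k < n) \1_(F k `&` obox a b) x) _ (\1_(obox a b))).
  + move=> n; elim: n => [|n IH]; first by under eq_fun do rewrite big_ord0; exact: approx_bump0.
    by under eq_fun do rewrite big_ord_recr/=; exact: approx_bumpD IH (PF n).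
  + by apply: measurable_indic; apply: measurableI => //; exact: bigcupT_measurable.
  + exact: indic_obox_L2.
  + move=> n x; rewrite ger0_norm ?sumr_ge0//.
    have [xO|xO] := boolP (x \in obox a b); last first.
      rewrite big1 => [|k _]; first by rewrite indicE.
      by rewrite indicE in_setI (negbTE xO) andbF.
    rewrite [leRHS]indicE xO.
    have [[k xk]|nk] := pselect (exists k : 'I_n, F k x).
      rewrite (bigD1 k)//= big1 ?addr0 => [|j jk]; first by rewrite indicE; case: (_ \in _).
      rewrite indicE memNset// => -[Fj _].
      have /trivIsetP/(_ j k I I) := tF; rewrite -val_eqE in jk => /(_ jk) /seteqP[+ _].
      by move=> /(_ x); apply.
    by rewrite big1// => k _; rewrite indicE memNset// => -[Fk _]; apply: nk; exists k.
  + move=> x; have [[k _ xk]|nk] := pselect ((\bigcup_k F k) x).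
      apply/cvgn_leP => e e0; exists k.+1 => n kn.
      rewrite (bigD1 (Ordinal kn))//= big1 ?addr0 => [|j jk].
        rewrite !indicE !in_setI (mem_set xk) (_ : x \in \bigcup_k F k) ?subrr ?normr0 ?ltW//.
        by rewrite inE; exists k.
      rewrite indicE memNset// => -[Fj _].
      have /trivIsetP/(_ j k I I) := tF; rewrite -val_eqE/= in jk => /(_ jk) /seteqP[+ _].
      by move=> /(_ x); apply.
    rewrite indicE memNset; last by move=> [].
    have z n : \sum_(k < n) \1_(F k `&` obox a b) x = 0 :> R.
      by rewrite big1// => k _; rewrite indicE memNset// => -[Fk _]; apply: nk; exists k.
    under eq_fun do rewrite z; exact: cvg_cst.
Qed.

Lemma approx_bump_L2 f : L2 mu f -> approx_bump f.
Proof.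
have ge0 g : L2 mu g -> (forall x, 0 <= g x) -> approx_bump g.
  move=> Lg g0; have mg := Lg.1.
  have mgE : meas (EFin \o g) by exact/measurable_EFinP.
  pose g_ := nnsfun_approx measurableT mgE.
  have g_cvg x : g_ n x @[n --> \oo] --> g x.
    by have := @cvg_nnsfun_approx _ _ _ _ measurableT _ mgE (fun y _ => g0 y : (0 <= (EFin \o g) y)%E) x I => /fine_cvg.
  have g_g n x : g_ n x <= g x.
    rewrite -(cvg_lim _ (g_cvg x))//; apply: nondecreasing_cvgn_le.
      by move=> m k mk; exact/lefP/nd_nnsfun_approx.
    by apply/cvg_ex; exists (g x); exact: g_cvg.
  (* Simple approximations from below, cut off by growing boxes: finite combinations of sets inside
     a box, all dominated by g itself. *)
  apply: (@approx_bump_dct (fun n x => g_ n x * \1_(obox (\row_i (- n%:R)) (\row_i n%:R)) x) _ g) => //.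
  - move=> n; set O := obox _ _.
    rewrite (_ : (fun x => _) = fun x => \sum_(y <- finmap.enum_fset (fset_set (range (g_ n)))) y * \1_((g_ n @^-1` [set y]) `&` O) x); last first.
      apply/funext => x; rewrite [in LHS]fimfunE fsbig_finite//= mulr_suml.
      by apply: eq_bigr => y _; rewrite indicI/= mulrA.
    elim: (finmap.enum_fset _) => [|y s IH].
      by under eq_fun do rewrite big_nil; exact: approx_bump0.
    under eq_fun do rewrite big_cons; apply: approx_bumpD IH.
    by apply/approx_bumpZ/approx_bump_setI; exact: measurable_funPTI.
  - move=> n x; rewrite ger0_norm ?mulr_ge0//.
    by rewrite indicE; case: (_ \in _); rewrite ?mulr1 ?mulr0.
  - move=> x; have M0 : 0 <= \sum_i `|x ord0 i| by rewrite sumr_ge0.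
    have : (fun n => g_ n x * 1) @ \oo --> g x by under eq_fun do rewrite mulr1; exact: g_cvg.
    apply: cvg_trans; apply: near_eq_cvg; exists (Num.truncn (\sum_i `|x ord0 i|)).+1 => // n /= Mn.
    rewrite indicE mem_set// => i; rewrite !mxE -ltr_norml.
    apply: lt_le_trans (_ : (Num.truncn (\sum_i `|x ord0 i|)).+1%:R <= _); last by rewrite ler_nat.
    by apply: le_lt_trans (truncnS_gt _); rewrite (bigD1 i)//= lerDl sumr_ge0.
move=> Lf; have mf := Lf.1.
have Lp : L2 mu (fun x => Num.max (f x) 0).
  apply: L2_le (L2_abs Lf) => [|x]; first exact: measurable_maxr.
  by rewrite ger0_norm ?le_max ?lexx ?orbT// ge_max ler_norm normr_ge0.
have Ln : L2 mu (fun x => Num.max (- f x) 0).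
  apply: L2_le (L2_abs Lf) => [|x]; first by apply: measurable_maxr => //; exact: measurableT_comp.
  by rewrite ger0_norm ?le_max ?lexx ?orbT// ge_max -normrN ler_norm normr_ge0.
have := approx_bumpD (ge0 _ Lp _) (approx_bumpZ (-1) (ge0 _ Ln _)).
rewrite (_ : (fun x => _) = f); first by apply => x; rewrite le_max lexx orbT.
apply/funext => x; rewrite /Num.max; case: ifPn => h1; case: ifPn => h2; lra.
Qed.

Lemma bump_dense f e : L2 mu f -> 0 < e ->
  exists2 phi, bump_test phi & n2 mu (fun x => f x - phi x) <= e.
Proof. by move=> /approx_bump_L2[_]; apply. Qed.

End bump_dense.

(** * The space H^1 *)

Section difference_quotients.
Context {R : realType} {N : nat}.
Local Notation E := 'rV[R]_N.
Local Notation mu := (@lebesgue_rV R N).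
Implicit Types (u f g phi : E -> R) (i : 'I_N) (t : R).

Definition unitv i : E := delta_mx ord0 i.

Definition dq i t u : E -> R := fun x => t^-1 * (u (x + t *: unitv i) - u x).

Lemma L2_shift (a : E) u : L2 mu u -> L2 mu (fun x => u (x + a)).
Proof.
move=> [mu' u2]; split; first exact: (measurable_comp_shift a mu').
exact: (L1_shift a u2).
Qed.

Lemma n2_shift (a : E) u : L2 mu u -> n2 mu (fun x => u (x + a)) = n2 mu u.
Proof. by move=> [_ u2]; rewrite /n2 (int_shift a u2). Qed.

Lemma L2_dq i t u : L2 mu u -> L2 mu (dq i t u).
Proof. by move=> Lu; apply: L2Z; apply: L2B => //; exact: L2_shift. Qed.

Lemma dq_adjoint i t u phi : L2 mu u -> L2 mu phi ->
  \int[mu]_x (dq i t u x * phi x) = - \int[mu]_x (u x * dq i (- t) phi x).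
Proof.
move=> Lu Lp; have Lus := L2_shift (t *: unitv i) Lu.
have Lps := L2_shift (- t *: unitv i) Lp.
have e1 : \int[mu]_x (u (x + t *: unitv i) * phi x) = \int[mu]_x (u x * phi (x - t *: unitv i)).
  rewrite -[RHS](int_shift (t *: unitv i)); last first.
    by have := L2_mul Lu Lps; congr L1; apply/funext => x; rewrite scaleNr.
  by apply: eq_Rintegral => x _; rewrite addrK.
transitivity (t^-1 * (\int[mu]_x (u (x + t *: unitv i) * phi x) - \int[mu]_x (u x * phi x))).
  rewrite -intB -?intZ; [|by apply: L1B; exact: L2_mul|exact: L2_mul|exact: L2_mul].
  by apply: eq_Rintegral => x _; rewrite /dq; ring.
rewrite e1 -[RHS]intN; last by apply: L2_mul => //; exact: L2_dq.
have Lps' : L2 mu (fun x => phi (x - t *: unitv i)).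
  by have := Lps; congr L2; apply/funext => x; rewrite scaleNr.
rewrite -intB -?intZ; [|by apply: L1B; exact: L2_mul|exact: L2_mul|exact: L2_mul].
by apply: eq_Rintegral => x _; rewrite /dq scaleNr invrN; ring.
Qed.

Lemma dnbhs_seq (t_ : nat -> R) (F : R -> R) (l : R) : (forall n, t_ n != 0) ->
  t_ n @[n --> \oo] --> 0 -> F h @[h --> 0^'] --> l -> F (t_ n) @[n --> \oo] --> l.
Proof.
move=> tn0 t0 Fl; apply: (cvg_comp t_ F) Fl => P.
rewrite /dnbhs /within/= => P0; have := t0 _ P0; rewrite /nbhs/=.
by apply: filterS => n /(_ (tn0 n)).
Qed.

Lemma cvg_dq i (t_ : nat -> R) phi x : derivable phi x (unitv i) ->
  (forall n, t_ n != 0) -> t_ n @[n --> \oo] --> 0 ->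
  dq i (t_ n) phi x @[n --> \oo] --> partial i phi x.
Proof.
move=> dp tn0 t0; rewrite /partial.
have e : (fun n => dq i (t_ n) phi x) = fun n => (t_ n)^-1 *: ((phi \o shift x) (t_ n *: unitv i) - phi x).
  by apply/funext => n; rewrite /dq /= (addrC x).
rewrite e; exact: (dnbhs_seq tn0 t0 (dp : (fun h => h^-1 *: ((phi \o shift x) (h *: unitv i) - phi x)) @ 0^' --> _)).
Qed.

Lemma test_bounded_support phi : test_function phi -> bounded_support phi.
Proof.
move=> [_ /compact_bounded[M [_ hM]]]; exists (`|M| + 1) => x px i.
have := hM (`|M| + 1); rewrite (le_lt_trans (ler_norm _)) ?ltrDl// => /(_ isT x).
have cx : closure [set x | phi x != 0] x by apply: subset_closure.
move=> /(_ cx); apply: le_trans; rewrite -[`|x|]/(mx_norm x) mx_normrE.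
by apply/bigmax_geP; right; exists (ord0, i).
Qed.

Lemma partial_support i phi (M : R) : (forall x, phi x != 0 -> forall j, `|x ord0 j| <= M) ->
  forall x, partial i phi x != 0 -> forall j, `|x ord0 j| <= M.
Proof.
move=> pM x; apply: contra_neqP => /existsNP[j /negP]; rewrite -ltNge => Mx.
rewrite /partial -(derive_cst (0 : R) x (delta_mx ord0 i)).
have cn : continuous (fun y : E => `|y ord0 j|).
  by move=> y; apply: (@continuous_comp _ _ _ (fun y : E => y ord0 j)); [exact: coord_continuous|exact: norm_continuous].
have nb : nbhs x [set y : E | M < `|y ord0 j|] by have /cvgr_gt := cn x; apply.
apply: near_eq_derive; apply: filterS nb => y My /=.
by apply/eqP; apply: contraTT My => /pM/(_ j); rewrite leNgt.
Qed.

Lemma partial_shift i phi (a x : E) : partial i (fun y => phi (y + a)) x = partial i phi (x + a).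
Proof.
rewrite /partial /derive.
rewrite (_ : (fun h => h^-1 *: (((fun y => phi (y + a)) \o shift x) (h *: delta_mx ord0 i) - phi (x + a)))
  = (fun h => h^-1 *: ((phi \o shift (x + a)) (h *: delta_mx ord0 i) - phi (x + a))))//.
by apply/funext => h /=; rewrite addrA.
Qed.

Lemma test_lipschitz i phi (C : R) : test_function phi -> (forall x, `|partial i phi x| <= C) ->
  forall x t, 0 < t -> `|phi (x + t *: unitv i) - phi x| <= C * t.
Proof.
move=> [sp _] pC x t t0.
pose g (h : R) := phi (x + h *: unitv i).
have dg (h : R) : is_derive h 1 g (partial i phi (x + h *: unitv i)).
  have [_ /(_ i (x + h *: unitv i))] := sp [::].
  rewrite /partial /= => dd; rewrite /g.
  have e : (fun k => k^-1 *: ((g \o shift h) (k *: (1 : R)) - g h)) =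
     (fun k => k^-1 *: ((phi \o shift (x + h *: unitv i)) (k *: unitv i) - phi (x + h *: unitv i))).
    by apply/funext => k; rewrite /g /= addrCA -scalerDl /GRing.scale/= mulr1.
  by split; rewrite /derivable /derive e.
have cg : {within `[0, t], continuous g}.
  apply: continuous_subspaceT => h; apply: differentiable_continuous; apply/derivable1_diffP.
  by have [] := dg h.
have [c _ gc] := MVT t0 (fun h _ => dg h) cg.
move: gc; rewrite /g scale0r addr0 subr0 => ->.
by rewrite normrM (gtr0_norm t0) ler_wpM2r// ltW.
Qed.

Lemma test_bounds i phi : test_function phi -> exists C M : R,
  [/\ 0 <= C, forall x, `|partial i phi x| <= C,
      forall x, phi x != 0 -> forall j, `|x ord0 j| <= M &
      forall x, partial i phi x != 0 -> forall j, `|x ord0 j| <= M].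
Proof.
move=> tp; have [M pM] := test_bounded_support tp.
have pM' := partial_support (i := i) pM.
have cp : continuous (partial i phi) by have [sp _] := tp; have [] := sp [:: i].
have [C pC] := continuous_bounded_support cp (ex_intro _ M pM').
by exists C, M; split => //; exact: le_trans (pC 0).
Qed.

Lemma test_continuous phi : test_function phi -> continuous phi.
Proof. by move=> [sp _]; have [] := sp [::]. Qed.

Lemma test_L2 phi : test_function phi -> L2 mu phi.
Proof.
move=> tp; have cp := test_continuous tp; have sp := test_bounded_support tp.
have [C pC] := continuous_bounded_support cp sp; have [M pM] := sp.
by apply: bounded_support_L2 pC pM; exact: measurable_continuous.
Qed.

Lemma partial_L2 i phi : test_function phi -> L2 mu (partial i phi).
Proof.
move=> tp; have [C [M [_ pC _ pM]]] := test_bounds i tp.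
apply: bounded_support_L2 pC pM; apply: measurable_continuous.
by have [sp _] := tp; have [] := sp [:: i].
Qed.

Lemma dqN_bound i phi : test_function phi -> exists C M : R,
  [/\ forall x s, 0 < s <= 1 -> `|dq i (- s) phi x| <= C &
      forall x s, 0 < s <= 1 -> dq i (- s) phi x != 0 -> forall j, `|x ord0 j| <= M].
Proof.
move=> tp; have [C [M [C0 pC pM _]]] := test_bounds i tp.
exists C, (M + 1); split => x s /andP[s0 s1].
  have si : 0 < s^-1 by rewrite invr_gt0.
  rewrite /dq normrM invrN normrN (gtr0_norm si) ler_pdivrMl// distrC.
  have := test_lipschitz tp pC (x - s *: unitv i) s0.
  by rewrite subrK scaleNr mulrC.
rewrite /dq => h j.
have [px|px] := eqVneq (phi x) 0; last by rewrite (le_trans (pM _ px j))// lerDl.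
have px' : phi (x + - s *: unitv i) != 0.
  by apply: contra_neq h => ->; rewrite px subrr mulr0.
have := pM _ px' j; rewrite !mxE eqxx /=.
rewrite mulNr => hh.
have ss : `|s * (j == i)%:R| <= 1.
  by rewrite normrM gtr0_norm//; case: (j == i); rewrite ?normr1 ?normr0 ?mulr1 ?mulr0.
rewrite (_ : x ord0 j = (x ord0 j - s * (j == i)%:R) + s * (j == i)%:R); last ring.
by rewrite (le_trans (ler_normD _ _))// lerD.
Qed.

Lemma dqN_cvg i phi (s_ : nat -> R) : test_function phi -> (forall n, 0 < s_ n <= 1) ->
  s_ n @[n --> \oo] --> 0 ->
  n2 mu (fun x => dq i (- s_ n) phi x - partial i phi x) @[n --> \oo] --> 0.
Proof.
move=> tp s01 s0; have [C [M [hC hM]]] := dqN_bound i tp.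
apply: n2_cvg0; pose K : set E := [set x | forall j, `|x ord0 j| <= M].
have mK : measurable K.
  rewrite (_ : K = [set x | forall i, `[- M, M]%classic (x ord0 i)]).
    by apply: (@measurable_box R N (fun i => `[- M, M]%classic)) => j; exact: measurable_itv.
  by apply/seteqP; split => x /= h j; have := h j; rewrite in_itv/= ler_norml.
apply: (@L2_dct _ _ _ mu _ _ (fun x => `|C| * \1_K x)).
- by move=> n; have [] := L2_dq i (- s_ n) (test_L2 tp).
- by have [] := partial_L2 i tp.
- apply: (@bounded_support_L2 _ _ _ `|C| M) => [|x|x].
  + by apply: measurable_funM => //; exact: measurable_indic.
  + by rewrite indicE; case: (x \in K); rewrite ?mulr1 ?mulr0 ?normr0 ?normr_id.
  + by rewrite indicE; have [|_] := boolP (x \in K); [rewrite inE|rewrite mulr0 eqxx].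
- apply: aeW => x n; have [->|h] := eqVneq (dq i (- s_ n) phi x) 0.
    by rewrite normr0 mulr_ge0// indicE.
  rewrite indicE mem_set ?mulr1; last exact: hM h.
  by rewrite (le_trans (hC _ _ (s01 n)))// ler_norm.
- apply: aeW => x; apply: cvg_dq.
  + by have [sp _] := tp; have [_] := sp [::]; apply.
  + by move=> n; rewrite oppr_eq0 gt_eqF//; have /andP[] := s01 n.
  + by rewrite -oppr0; exact: cvgN.
Qed.

(** Test with a bump function phi within e of f: |f|^2 = (f, f - phi) + (f, phi) is at most e |f| +
    C (|f| + e), and e is arbitrary. *)
Lemma dual_norm_le f (C : R) : L2 mu f -> 0 <= C ->
  (forall phi, bump_test phi -> `|\int[mu]_x (f x * phi x)| <= C * n2 mu phi) -> n2 mu f <= C.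
Proof.
move=> Lf C0 fC; have F0 := n2_ge0 mu f.
have [//|Cf] := leP (n2 mu f) C.
have F1 : 0 < n2 mu f by exact: le_lt_trans Cf.
suff h e : 0 < e -> n2 mu f * (n2 mu f - C) <= e * (n2 mu f + C).
  have : n2 mu f * (n2 mu f - C) <= 0.
    apply/ler_addgt0Pr => e e0; rewrite add0r.
    have S0 : 0 < n2 mu f + C by rewrite ltr_wpDr.
    by have := h _ (divr_gt0 e0 S0); rewrite divfK ?gt_eqF.
  by rewrite pmulr_rle0// subr_le0 leNgt Cf.
move=> e0; have [phi tp fp] := bump_dense Lf e0.
have Lp := bump_test_L2 tp.
have e1 : n2 mu f ^+ 2 = \int[mu]_x (f x * (f x - phi x)) + \int[mu]_x (f x * phi x).
  rewrite -intD; [|exact/L2_mul/L2B|exact: L2_mul].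
  by rewrite sqr_n2; apply: eq_Rintegral => x _; ring.
have h1 := cauchy_schwarz Lf (L2B Lf Lp); have h2 := fC _ tp.
have h3 : n2 mu phi <= n2 mu f + e.
  rewrite (_ : phi = fun x => f x - (f x - phi x)); last by apply/funext => x; ring.
  by rewrite (le_trans (n2B Lf (L2B Lf Lp)))// lerD2l.
have := ler_norm (\int[mu]_x (f x * (f x - phi x))); have := ler_norm (\int[mu]_x (f x * phi x)).
by have := n2_ge0 mu phi; nra.
Qed.

Lemma L2_eq_bump f g : L2 mu f -> L2 mu g ->
  (forall phi, bump_test phi -> \int[mu]_x (f x * phi x) = \int[mu]_x (g x * phi x)) ->
  {ae mu, forall x, f x = g x}.
Proof.
move=> Lf Lg fg; have Lfg := L2B Lf Lg.
have : n2 mu (fun x => f x - g x) <= 0.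
  apply: dual_norm_le => // phi tp; rewrite mul0r.
  under eq_Rintegral do rewrite mulrBl.
  have Lp := bump_test_L2 tp.
  by rewrite intB ?fg ?subrr ?normr0//; exact: L2_mul.
move=> n0; have h : \int[mu]_x (f x - g x) ^+ 2 = 0.
  by rewrite -sqr_n2; apply/eqP; rewrite sqrf_eq0 eq_le n0 n2_ge0.
have [_ I2] := Lfg; have := EFin_int I2; rewrite h => h'.
have mE : meas (EFin \o (fun x => (f x - g x) ^+ 2)) by apply/measurable_EFinP; exact: L1_meas I2.
have := ae_eq_integral_abs mu measurableT mE => -[+ _]; case.
  rewrite -[RHS]/(0%:E) [RHS]h'; apply: eq_integral => x _ /=; by rewrite ger0_norm// sqr_ge0.
move=> P [mP P0 PS]; exists P; split => // x /= fgx; apply: PS => /= h2; apply: fgx.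
by have /eqP := h2 I; rewrite eqe sqrf_eq0 subr_eq0 => /eqP.
Qed.

Lemma weak_partial_ae i u g g' : L2 mu g -> L2 mu g' -> weak_partial i u g ->
  weak_partial i u g' -> {ae mu, forall x, g x = g' x}.
Proof.
move=> Lg Lg' wg wg'; apply: L2_eq_bump => // phi /bump_test_function tp.
by apply: oppr_inj; rewrite -(wg _ tp) -(wg' _ tp).
Qed.

Lemma dq_weak i u phi (s_ : nat -> R) : L2 mu u -> test_function phi -> (forall n, 0 < s_ n <= 1) ->
  s_ n @[n --> \oo] --> 0 ->
  \int[mu]_x (dq i (s_ n) u x * phi x) @[n --> \oo] --> - \int[mu]_x (u x * partial i phi x).
Proof.
move=> Lu tp s01 s0; have Lp := test_L2 tp; have Lp' := partial_L2 i tp.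
apply/cvgn_leP => e e0; have u0 : 0 < n2 mu u + 1 by rewrite ltr_wpDl// n2_ge0.
have [M Mh] := (cvgn_leP _ _).1 (dqN_cvg i tp s01 s0) _ (divr_gt0 e0 u0).
exists M => n /Mh; rewrite subr0 ger0_norm ?n2_ge0// => h.
rewrite dq_adjoint// opprK addrC -intB; [|exact: L2_mul|exact/L2_mul/L2_dq].
under eq_Rintegral do rewrite -mulrBr.
have Ld := L2B (L2_dq i (- s_ n) Lp) Lp'.
rewrite (_ : (fun x => u x * (partial i phi x - dq i (- s_ n) phi x)) = fun x => - (u x * (dq i (- s_ n) phi x - partial i phi x))); last first.
  by apply/funext => x; ring.
rewrite intN ?normrN; last exact: L2_mul.
apply: (le_trans (cauchy_schwarz Lu Ld)); rewrite (le_trans (ler_wpM2l (n2_ge0 _ _) h))//.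
by rewrite mulrCA ger_pMr// ler_pdivrMr// mul1r lerDl.
Qed.

(** By duality. The quotient of step t is the mean of m translates of the quotient of step t/m.
    Moving translation and quotient onto the bump function phi, whose translates are again test
    functions, leaves the weak derivative of u plus an error that vanishes as m grows. *)
Lemma dq_le i u g t : L2 mu u -> L2 mu g -> weak_partial i u g -> 0 < t ->
  n2 mu (dq i t u) <= n2 mu g.
Proof.
move=> Lu Lg wg t0; apply: dual_norm_le; [exact: L2_dq|exact: n2_ge0|move=> phi bp].
have tp := bump_test_function bp; have Lp := test_L2 tp; have Lp' := partial_L2 i tp.
(* [M] exceeds t, so that every step t/(n + M) lies in (0, 1], the range in which quotients of test
   functions are controlled. *)
pose M := (Num.truncn t).+1; have tM : t < M%:R by exact: truncnS_gt.
pose s_ n : R := t / (n + M)%:R.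
have nM0 n : 0 < (n + M)%:R :> R by rewrite ltr0n addn_gt0 orbT.
have s01 n : 0 < s_ n <= 1.
  rewrite divr_gt0//= ler_pdivrMr// mul1r (le_trans (ltW tM))// ler_nat leq_addl//.
have s0 : s_ n @[n --> \oo] --> 0.
  rewrite -(mulr0 t); apply: cvgM; first exact: cvg_cst.
  have := @cvg_harmonic R; rewrite -(cvg_shiftn (Num.truncn t)) /M => h.
  under eq_fun do rewrite addnS; exact: h.
have key n : `|\int[mu]_x (dq i t u x * phi x)| <= n2 mu g * n2 mu phi
    + n2 mu u * n2 mu (fun x => dq i (- s_ n) phi x - partial i phi x).
  set m := (n + M)%N; have m0 : (0 < m)%N by rewrite addn_gt0 orbT.
  have ms : m%:R * s_ n = t by rewrite /s_ mulrC divfK// gt_eqF.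
  pose a j : E := (j%:R * s_ n) *: unitv i.
  have La j := L2_shift (a j) (L2_dq i (s_ n) Lu).
  have tele x : dq i t u x = \sum_(j < m) m%:R^-1 * dq i (s_ n) u (x + a j).
    rewrite -mulr_sumr /dq -mulr_sumr mulrA -invfM ms; congr (_ * _).
    rewrite (eq_bigr (fun j : 'I_m => u (x + a j.+1) - u (x + a j))); last first.
      by move=> j _; rewrite -addrA [in RHS]/a -natr1 mulrDl mul1r scalerDl.
    rewrite -(big_mkord xpredT (fun j => u (x + a j.+1) - u (x + a j))) telescope_sumr//.
    by rewrite /a mul0r scale0r addr0 ms.
  have b j : `|\int[mu]_x (dq i (s_ n) u (x + a j) * phi x)| <= n2 mu g * n2 mu phi
      + n2 mu u * n2 mu (fun x => dq i (- s_ n) phi x - partial i phi x).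
    have tps : test_function (fun x => phi (x - a j)).
      by apply: bump_test_function; exact: (bump_test_shift (- a j) bp).
    have Lps := test_L2 tps; have Lps' := partial_L2 i tps.
    have -> : \int[mu]_x (dq i (s_ n) u (x + a j) * phi x) = \int[mu]_x (dq i (s_ n) u x * phi (x - a j)).
      rewrite -[RHS](int_shift (a j)); last by apply: L2_mul => //; exact: L2_dq.
      by apply: eq_Rintegral => x _; rewrite addrK.
    rewrite dq_adjoint// normrN.
    set psi := fun x => phi (x - a j) in tps Lps Lps' *.
    have Ld := L2B (L2_dq i (- s_ n) Lps) Lps'.
    have -> : \int[mu]_x (u x * dq i (- s_ n) psi x) =
       \int[mu]_x (u x * (dq i (- s_ n) psi x - partial i psi x)) - \int[mu]_x (g x * psi x).
      rewrite -[X in _ = _ + X](wg _ tps) -intD; [|exact: L2_mul..].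
      by apply: eq_Rintegral => x _; ring.
    apply: (le_trans (ler_normB _ _)); rewrite addrC lerD//.
      by rewrite -(n2_shift (- a j) Lp); exact: cauchy_schwarz.
    apply: (le_trans (cauchy_schwarz Lu Ld)); apply: ler_wpM2l; first exact: n2_ge0.
    rewrite -(n2_shift (- a j) (L2B (L2_dq i (- s_ n) Lp) Lp')); apply: le_of_eq.
    by congr n2; apply/funext => x; rewrite partial_shift /dq /psi addrAC.
  have -> : \int[mu]_x (dq i t u x * phi x) =
      \sum_(j < m) m%:R^-1 * \int[mu]_x (dq i (s_ n) u (x + a j) * phi x).
    under eq_Rintegral do rewrite tele mulr_suml.
    rewrite int_sum => [|j]; last by under eq_fun do rewrite -mulrA; exact/L1Z/L2_mul.
    apply: eq_bigr => j _; under eq_Rintegral do rewrite -mulrA.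
    by rewrite intZ//; exact: L2_mul.
  rewrite -mulr_sumr normrM ger0_norm ?invr_ge0// ler_pdivrMl ?ltr0n//.
  rewrite mulr_natl -[X in _ *+ X](card_ord m) -sumr_const.
  by apply: (le_trans (ler_norm_sum _ _ _)); apply: ler_sum => j _; exact: b.
have cv : n2 mu g * n2 mu phi + n2 mu u * n2 mu (fun x => dq i (- s_ n) phi x - partial i phi x)
    @[n --> \oo] --> n2 mu g * n2 mu phi + n2 mu u * 0.
  apply: cvgD; first exact: cvg_cst.
  by apply: cvgM; [exact: cvg_cst|exact: dqN_cvg].
rewrite mulr0 addr0 in cv.
by rewrite -lerN2; apply: cvgn_le_cst (cvgN cv) _ => n; rewrite lerN2.
Qed.

End difference_quotients.

Section sobolev_space.
Context {R : realType} {N : nat}.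
Local Notation E := 'rV[R]_N.
Local Notation mu := (@lebesgue_rV R N).
Implicit Types (u v w g phi : E -> R) (i : 'I_N) (t : R).

Definition wd i u : E -> R := fun x => grad u x ord0 i.

(** One fixed null sequence of steps serves for all limits of difference quotients; being dyadic, it
    also provides mesh sizes and geometric errors. *)
Definition tn (n : nat) : R := 2^-1 ^+ n.

Lemma tn_gt0 n : 0 < tn n. Proof. by rewrite exprn_gt0// invr_gt0. Qed.

Lemma tn_itv n : 0 < tn n <= 1.
Proof. by rewrite tn_gt0/= exprn_ile1// ?invr_ge0// invf_le1 ?ler1n. Qed.

Lemma tn_cvg : tn n @[n --> \oo] --> 0.
Proof. by apply: cvg_expr; rewrite ger0_norm ?invr_ge0// invf_lt1// ltr1n. Qed.

Lemma H1_gradP u : H1 u -> L2_weak_gradient u (grad u).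
Proof. by move=> [_ [g ug]]; exact: (xgetPex (fun=> 0) (ex_intro _ g ug)). Qed.

Lemma H1_L2 u : H1 u -> L2 mu u.
Proof. by move=> [/Lfun2P]. Qed.

Lemma wd_L2 i u : H1 u -> L2 mu (wd i u).
Proof. by move=> /H1_gradP/(_ i)[/Lfun2P]. Qed.

Lemma wd_weak i u : H1 u -> weak_partial i u (wd i u).
Proof. by move=> /H1_gradP/(_ i)[]. Qed.

Lemma dq_wd_le i u t : H1 u -> 0 < t -> n2 mu (dq i t u) <= n2 mu (wd i u).
Proof.
by move=> hu t0; apply: dq_le => //; [exact: H1_L2|exact: wd_L2|exact: wd_weak].
Qed.

(** Weak convergence together with norms that do not exceed the norm of the limit gives strong
    convergence; a bump function close to the weak derivative is used for the weak part. *)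
Lemma dq_wd_cvg i u : H1 u -> n2 mu (fun x => dq i (tn n) u x - wd i u x) @[n --> \oo] --> 0.
Proof.
move=> hu; have Lu := H1_L2 hu; have Lg := wd_L2 i hu; have wg := wd_weak i hu.
apply: n2_cvg0; apply/cvgn_leP => e e0.
set g := wd i u in Lg wg *; have G0 := n2_ge0 mu g.
have K0 : 0 < 4 * n2 mu g + 2 by rewrite ltr_wpDl// mulr_ge0.
(* The weak term costs 2d, and replacing g by phi in two integrals costs 4 |g| d, which makes e in
   total. *)
pose d := e / (4 * n2 mu g + 2); have d0 : 0 < d by rewrite divr_gt0.
have [phi bp gp] := bump_dense Lg d0; have tp := bump_test_function bp; have Lp := test_L2 tp.
have [M Mh] := (cvgn_leP _ _).1 (dq_weak Lu tp tn_itv tn_cvg (i := i)) _ d0.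
exists M => n /Mh h; rewrite subr0 ger0_norm; last by apply: int_ge0 => x; exact: sqr_ge0.
have Ld := L2_dq i (tn n) Lu; rewrite (wg _ tp) opprK in h.
have -> : \int[mu]_x (dq i (tn n) u x - g x) ^+ 2 =
    (\int[mu]_x dq i (tn n) u x ^+ 2 - \int[mu]_x g x ^+ 2)
    - 2 * (\int[mu]_x (dq i (tn n) u x * phi x) - \int[mu]_x (g x * phi x))
    - 2 * (\int[mu]_x (dq i (tn n) u x * (g x - phi x)) - \int[mu]_x (g x * (g x - phi x))).
  have I1 := L2_mul Ld Lp; have I2 := L2_mul Lg Lp.
  have I3 := L2_mul Ld (L2B Lg Lp); have I4 := L2_mul Lg (L2B Lg Lp).
  have I5 := L1B I1 I2; have I6 := L1B I3 I4; have I7 := L1B Ld.2 Lg.2.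
  rewrite -(intB Ld.2 Lg.2) -(intB I1 I2) -(intB I3 I4) -(intZ 2 I5) -(intZ 2 I6).
  rewrite -(intB I7 (L1Z 2 I5)) -(intB (L1B I7 (L1Z 2 I5)) (L1Z 2 I6)).
  by apply: eq_Rintegral => x _; ring.
have h1 : \int[mu]_x dq i (tn n) u x ^+ 2 <= \int[mu]_x g x ^+ 2.
  by rewrite -!sqr_n2 lerXn2r ?nnegrE ?n2_ge0//; exact: dq_wd_le (tn_gt0 n).
have h2 := cauchy_schwarz Ld (L2B Lg Lp); have h3 := cauchy_schwarz Lg (L2B Lg Lp).
have h4 : n2 mu (dq i (tn n) u) <= n2 mu g by exact: dq_wd_le (tn_gt0 n).
have h5 := n2_ge0 mu (fun x => g x - phi x).
have h6 : `|\int[mu]_x (dq i (tn n) u x * (g x - phi x))| <= n2 mu g * d.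
  by apply: (le_trans h2); rewrite ler_pM ?n2_ge0.
have h7 : `|\int[mu]_x (g x * (g x - phi x))| <= n2 mu g * d.
  by apply: (le_trans h3); rewrite ler_pM ?n2_ge0.
have ed : e = 4 * (n2 mu g * d) + 2 * d by rewrite /d; field; rewrite gt_eqF.
move: h h6 h7; rewrite !ler_norml => /andP[? ?] /andP[? ?] /andP[? ?].
by rewrite ed; lra.
Qed.

(** Bounded difference quotients have a weak limit against test functions, and shifting the quotient
    onto the test function identifies it as a weak derivative. Boundedness along the steps [tn n] is
    the usual test for membership in H^1 below. *)
Lemma H1_intro u : L2 mu u -> (forall i, exists C : R, forall n, n2 mu (dq i (tn n) u) <= C) -> H1 u.
Proof.
move=> Lu uC; split; first exact/Lfun2P.
have /choice[g gP] i : exists g, L2 mu g /\ weak_partial i u g.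
  have [C hC] := uC i.
  have [g [Lg _ gw]] := @L2_weak_limit _ _ _ mu (fun n => dq i (tn n) u) C (@test_function R N)
    (fun phi => - \int[mu]_x (u x * partial i phi x))
    (fun n => L2_dq i (tn n) Lu) hC (fun phi => @test_L2 _ _ phi)
    (fun phi tp => dq_weak Lu tp tn_itv tn_cvg).
  by exists g; split => // phi tp; rewrite gw// opprK.
exists (fun x => \row_i g i x) => i; have [Lg wg] := gP i.
rewrite (_ : (fun x => _) = g i); last by apply/funext => x; rewrite mxE.
by split => //; exact/Lfun2P.
Qed.

Definition dirn n u w : R := \sum_i \int[mu]_x (dq i (tn n) u x * dq i (tn n) w x).

(* The Dirichlet form, the integral of grad u . grad w. *)
Definition dir u w : R := \sum_i \int[mu]_x (wd i u x * wd i w x).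

Lemma dirn_cvg u w : H1 u -> H1 w -> dirn n u w @[n --> \oo] --> dir u w.
Proof.
move=> hu hw; apply: cvg_big => [|i _]; first exact: add_continuous.
have Lu := wd_L2 i hu; have Lw := wd_L2 i hw.
have Lun n := L2_dq i (tn n) (H1_L2 hu); have Lwn n := L2_dq i (tn n) (H1_L2 hw).
have cu := dq_wd_cvg i hu; have cw := dq_wd_cvg i hw.
have c : n2 mu (fun x => dq i (tn n) u x - wd i u x) * n2 mu (wd i w)
    + n2 mu (wd i u) * n2 mu (fun x => dq i (tn n) w x - wd i w x) @[n --> \oo] --> 0.
  have := cvgD (cvgM cu (cvg_cst (n2 mu (wd i w)))) (cvgM (cvg_cst (n2 mu (wd i u))) cw).
  by rewrite mul0r mulr0 addr0; exact.
apply/cvgn_leP => e e0; have [M Mh] := (cvgn_leP _ _).1 c _ e0.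
exists M => n /Mh; rewrite subr0 ger0_norm; last first.
  by rewrite addr_ge0// mulr_ge0// n2_ge0.
apply: le_trans.
have -> : \int[mu]_x (dq i (tn n) u x * dq i (tn n) w x) - \int[mu]_x (wd i u x * wd i w x) =
   \int[mu]_x ((dq i (tn n) u x - wd i u x) * dq i (tn n) w x) +
   \int[mu]_x (wd i u x * (dq i (tn n) w x - wd i w x)).
  rewrite -intB; [|exact: L2_mul..]; rewrite -intD; [|by apply: L2_mul => //; exact: L2B..].
  by apply: eq_Rintegral => x _; ring.
apply: (le_trans (ler_normD _ _)); apply: lerD.
  apply: (le_trans (cauchy_schwarz (L2B (Lun n) Lu) (Lwn n))).
  by apply: ler_wpM2l; [exact: n2_ge0|exact: dq_wd_le (tn_gt0 n)].
exact: cauchy_schwarz Lu (L2B (Lwn n) Lw).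
Qed.

Lemma H1_lin (a : R) u w : H1 u -> H1 w -> H1 (fun x => a * u x + w x).
Proof.
move=> hu hw; have Lu := H1_L2 hu; have Lw := H1_L2 hw.
apply: H1_intro => [|i]; first exact/L2D/Lw/L2Z.
exists (`|a| * n2 mu (wd i u) + n2 mu (wd i w)) => n.
rewrite (_ : dq _ _ _ = fun x => a * dq i (tn n) u x + dq i (tn n) w x); last first.
  by apply/funext => x; rewrite /dq; ring.
have Lun := L2_dq i (tn n) Lu; have Lwn := L2_dq i (tn n) Lw.
apply: (le_trans (n2D (L2Z a Lun) Lwn)); rewrite n2Z//.
by apply: lerD; [apply: ler_wpM2l => //|]; apply: dq_wd_le => //; exact: tn_gt0.
Qed.

Lemma H1_0 : H1 ((fun=> 0) : E -> R).
Proof.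
apply: H1_intro => [|i]; first exact: L2_0.
exists 0 => n; rewrite /n2 /dq; under eq_Rintegral do rewrite subrr mulr0 expr0n/=.
by rewrite /Rintegral integral0 sqrtr0.
Qed.

Lemma H1Z (a : R) u : H1 u -> H1 (fun x => a * u x).
Proof. by move=> hu; have := H1_lin a hu H1_0; under eq_fun do rewrite addr0. Qed.

Lemma H1D u w : H1 u -> H1 w -> H1 (fun x => u x + w x).
Proof. by move=> hu hw; have := H1_lin 1 hu hw; under eq_fun do rewrite mul1r. Qed.

Lemma H1B u w : H1 u -> H1 w -> H1 (fun x => u x - w x).
Proof.
move=> hu /(H1Z (-1)) hw; have := H1D hu hw; by under eq_fun do rewrite mulN1r.
Qed.

(** [grad] is chosen separately for u and u', so even for functions that agree a.e. the two
    gradients are only known to agree a.e. *)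
Lemma H1_ae u u' : meas u' -> {ae mu, forall x, u x = u' x} -> H1 u ->
  H1 u' /\ forall i, {ae mu, forall x, wd i u x = wd i u' x}.
Proof.
move=> mu' uu' hu; have Lu := H1_L2 hu.
have Lu' : L2 mu u'.
  split => //; apply: ae_eq_L1 Lu.2; first exact: measurable_funX.
  by apply: filterS uu' => x ->.
have ip phi i : test_function phi ->
    \int[mu]_x (u' x * partial i phi x) = - \int[mu]_x (wd i u x * phi x).
  move=> tp; rewrite -(wd_weak i hu tp); have Lp := partial_L2 i tp.
  apply: ae_eq_int; [exact: measurable_funM Lp.1|exact: measurable_funM Lu.1 Lp.1|].
  by apply: filterS uu' => x ->.
have hu' : H1 u'.
  split; first exact/Lfun2P.
  exists (grad u) => i; split; first exact/Lfun2P/wd_L2.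
  by move=> phi tp; exact: ip.
split => // i; apply: (@weak_partial_ae _ _ i u'); [exact: wd_L2|exact: wd_L2| |exact: wd_weak].
by move=> phi tp; exact: ip.
Qed.

Lemma eq_cvgn (a b : nat -> R) (l : R) : a =1 b ->
  b n @[n --> \oo] --> l -> a n @[n --> \oo] --> l.
Proof. by move=> /funext ->. Qed.

Lemma cvgn_le_lim (a b : nat -> R) (l m : R) : (forall n, a n <= b n) ->
  a n @[n --> \oo] --> l -> b n @[n --> \oo] --> m -> l <= m.
Proof.
move=> ab al bm; rewrite -subr_ge0 -oppr_le0 opprB.
by apply: cvgn_le_cst (cvgB al bm) _ => n; rewrite subr_le0.
Qed.

Lemma dir_linl (a : R) u v w : H1 u -> H1 v -> H1 w ->
  dir (fun x => a * u x + v x) w = a * dir u w + dir v w.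
Proof.
move=> hu hv hw; apply: cvg_unique (dirn_cvg (H1_lin a hu hv) hw) _ => //.
have c : a * dirn n u w + dirn n v w @[n --> \oo] --> a * dir u w + dir v w.
  exact: (cvgD (cvgM (cvg_cst a) (dirn_cvg hu hw)) (dirn_cvg hv hw)).
apply: eq_cvgn c => n; rewrite /dirn mulr_sumr -big_split/=.
have Lu := H1_L2 hu; have Lv := H1_L2 hv; have Lw := H1_L2 hw.
apply: eq_bigr => i _; rewrite -intZ -?intD; [|exact/L1Z/L2_mul/L2_dq/Lw/L2_dq|exact/L2_mul/L2_dq/Lw/L2_dq|exact/L2_mul/L2_dq/Lw/L2_dq].
by apply: eq_Rintegral => x _; rewrite /dq; ring.
Qed.

Lemma dirC u w : dir u w = dir w u.
Proof. by apply: eq_bigr => i _; apply: eq_Rintegral => x _; rewrite mulrC. Qed.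

Lemma dir_linr (a : R) u v w : H1 u -> H1 v -> H1 w ->
  dir w (fun x => a * u x + v x) = a * dir w u + dir w v.
Proof. by move=> hu hv hw; rewrite dirC (dir_linl a hu hv hw) (dirC u) (dirC v). Qed.

Lemma dir_ge0 u : 0 <= dir u u.
Proof. by apply: sumr_ge0 => i _; apply: int_ge0 => x; rewrite -expr2 sqr_ge0. Qed.

Lemma H1_shift (a : E) u : H1 u -> H1 (fun x => u (x + a)).
Proof.
move=> hu; have Lu := H1_L2 hu; apply: H1_intro => [|i]; first exact: L2_shift.
exists (n2 mu (wd i u)) => n.
rewrite (_ : dq _ _ _ = fun x => dq i (tn n) u (x + a)); last first.
  by apply/funext => x; rewrite /dq addrAC.
by rewrite (n2_shift a (L2_dq _ _ Lu)); apply: dq_wd_le => //; exact: tn_gt0.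
Qed.

Lemma dir_shift (a : E) u w : H1 u -> H1 w ->
  dir (fun x => u (x + a)) (fun x => w (x + a)) = dir u w.
Proof.
move=> hu hw; have Lu := H1_L2 hu; have Lw := H1_L2 hw.
apply: cvg_unique (dirn_cvg (H1_shift a hu) (H1_shift a hw)) _ => //.
apply: eq_cvgn (dirn_cvg hu hw) => n.
apply: eq_bigr => i _; rewrite -[RHS](int_shift a); last exact/L2_mul/L2_dq/Lw/L2_dq.
by apply: eq_Rintegral => x _; rewrite /dq (addrAC x a).
Qed.

Lemma H1_lipschitz (F : R -> R) u : F 0 = 0 -> (forall a b, `|F a - F b| <= `|a - b|) ->
  meas (fun x => F (u x)) -> H1 u -> H1 (fun x => F (u x)).
Proof.
move=> F0 FL mF hu; have Lu := H1_L2 hu.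
have LF : L2 mu (fun x => F (u x)).
  by apply: L2_le (L2_abs Lu) => // x; have := FL (u x) 0; rewrite F0 !subr0.
apply: H1_intro => // i; exists (n2 mu (wd i u)) => n.
apply: le_trans (dq_wd_le i hu (tn_gt0 n)).
have La := L2_abs (L2_dq i (tn n) Lu).
apply: le_trans (_ : n2 mu (fun x => `|dq i (tn n) u x|) <= _).
  apply: n2_le La => [|x]; first by have [] := L2_dq i (tn n) LF.
  by rewrite /dq !normrM ler_wpM2l.
by rewrite /n2; under eq_Rintegral do rewrite sqr_normr.
Qed.

(** The inequality holds between difference quotients for every step 2^-n and survives the limit. It
    takes the place of a chain rule for Lipschitz truncations. *)
Lemma dir_le u u' w w' : H1 u -> H1 u' -> H1 w -> H1 w' ->
  (forall x y, (u y - u x) * (u' y - u' x) <= (w y - w x) * (w' y - w' x)) ->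
  dir u u' <= dir w w'.
Proof.
move=> hu hu' hw hw' h; apply: cvgn_le_lim (dirn_cvg hu hu') (dirn_cvg hw hw') => n.
have Lu := H1_L2 hu; have Lu' := H1_L2 hu'; have Lw := H1_L2 hw; have Lw' := H1_L2 hw'.
apply: ler_sum => i _; apply: int_le => [||x]; [exact/L2_mul/L2_dq/Lu'/L2_dq|exact/L2_mul/L2_dq/Lw'/L2_dq|].
rewrite /dq; set t := (tn n)^-1; set y : E := x + _.
rewrite [leLHS](_ : _ = t ^+ 2 * ((u y - u x) * (u' y - u' x))); last ring.
rewrite [leRHS](_ : _ = t ^+ 2 * ((w y - w x) * (w' y - w' x))); last ring.
by rewrite ler_wpM2l// sqr_ge0.
Qed.

End sobolev_space.

(** * Oscillation over cubes *)

Section oscillation.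
Context {R : realType} {N : nat}.
Local Notation E := 'rV[R]_N.
Local Notation mu := (@lebesgue_rV R N).
Implicit Types (u z f : E -> R) (i : 'I_N) (t l : R).

Lemma n2_step i t u : H1 u ->
  n2 mu (fun x => u (x + t *: unitv i) - u x) <= `|t| * n2 mu (wd i u).
Proof.
move=> hu; have Lu := H1_L2 hu.
have pos s : 0 < s -> n2 mu (fun x => u (x + s *: unitv i) - u x) <= s * n2 mu (wd i u).
  move=> s0; rewrite (_ : (fun x => _) = fun x => s * dq i s u x); last first.
    by apply/funext => x; rewrite /dq mulrA divff ?mul1r// gt_eqF.
  rewrite n2Z; last exact: L2_dq.
  by rewrite gtr0_norm// ler_pM2l//; exact: dq_wd_le.
have [t0|t0|->] := ltgtP t 0.
- have nt0 : 0 < - t by rewrite oppr_gt0.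
  rewrite ltr0_norm//; apply: le_trans (pos _ nt0).
  have Ls := L2B (L2_shift (- t *: unitv i) Lu) Lu.
  rewrite -(n2_shift (t *: unitv i) Ls) -n2N; apply: le_of_eq.
  by congr n2; apply/funext => x; rewrite scaleNr addrK; ring.
- by rewrite gtr0_norm//; exact: pos.
rewrite normr0 mul0r /n2; under eq_Rintegral do rewrite scale0r addr0 subrr expr0n/=.
by rewrite /Rintegral integral0 sqrtr0.
Qed.

Lemma n2_translation (y : E) u : H1 u ->
  n2 mu (fun x => u (x + y) - u x) <= \sum_i `|y ord0 i| * n2 mu (wd i u).
Proof.
move=> hu; have Lu := H1_L2 hu.
have h (s : seq 'I_N) : n2 mu (fun x => u (x + \sum_(i <- s) y ord0 i *: unitv i) - u x)
    <= \sum_(i <- s) `|y ord0 i| * n2 mu (wd i u).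
  elim: s => [|i s IH].
    rewrite !big_nil /n2; under eq_Rintegral do rewrite addr0 subrr expr0n/=.
    by rewrite /Rintegral integral0 sqrtr0.
  rewrite !big_cons; set Y := \sum_(j <- s) _ in IH *; set t := y ord0 i.
  have Lt := L2B (L2_shift (t *: unitv i) Lu) Lu.
  rewrite (_ : (fun x => _) = fun x => (u ((x + Y) + t *: unitv i) - u (x + Y)) + (u (x + Y) - u x)); last first.
    by apply/funext => x; rewrite addrA (addrAC x); ring.
  apply: (le_trans (n2D (L2_shift Y Lt) (L2B (L2_shift Y Lu) Lu))).
  by apply: lerD => //; rewrite (n2_shift Y Lt); exact: n2_step.
have := h (index_enum 'I_N).
suff -> : \sum_(i <- index_enum 'I_N) y ord0 i *: unitv i = y by [].
by rewrite [RHS]row_sum_delta.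
Qed.

Lemma n2_wd_le i u : n2 mu (wd i u) ^+ 2 <= dir u u.
Proof.
rewrite sqr_n2 /dir (bigD1 i)//= (_ : \int[mu]_x wd i u x ^+ 2 = \int[mu]_x (wd i u x * wd i u x)).
  by rewrite lerDl; apply: sumr_ge0 => j _; apply: int_ge0 => x; rewrite -expr2 sqr_ge0.
by apply: eq_Rintegral => x _; rewrite expr2.
Qed.

Lemma sqr_translation (y : E) l u : H1 u -> 0 <= l -> (forall i, `|y ord0 i| <= l) ->
  \int[mu]_x (u (x + y) - u x) ^+ 2 <= l ^+ 2 * (N%:R ^+ 2 * dir u u).
Proof.
move=> hu l0 yl; rewrite -sqr_n2.
have h : n2 mu (fun x => u (x + y) - u x) <= l * (N%:R * Num.sqrt (dir u u)).
  apply: (le_trans (n2_translation y hu)).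
  rewrite mulr_natl -[X in _ *+ X](card_ord N) -sumr_const mulr_sumr; apply: ler_sum => i _.
  apply: ler_pM => //; first exact: n2_ge0.
  by rewrite -(ger0_norm (n2_ge0 _ _)) -sqrtr_sqr ler_wsqrtr//; exact: n2_wd_le.
have h0 := n2_ge0 mu (fun x => u (x + y) - u x).
rewrite -(sqr_sqrtr (dir_ge0 u)) -!exprMn; apply: lerXn2r => //; rewrite nnegrE.
exact: le_trans h.
Qed.

Lemma measurable_addr2 : meas (fun xy : E * E => xy.1 + xy.2).
Proof.
apply: measurable_fun_rV => i.
rewrite (_ : (fun _ => _) = fun xy : E * E => xy.1 ord0 i + xy.2 ord0 i); last first.
  by apply/funext => xy; rewrite mxE.
by apply: measurable_funD; apply: (@measurableT_comp _ _ _ _ _ _ (fun x : E => x ord0 i)) => //; exact: measurable_coor.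
Qed.

Lemma osc_upper u (a : E) h l : H1 u -> 0 <= h -> 0 <= l ->
  (forall y, cube a h y -> forall i, `|y ord0 i| <= l) ->
  (\int[mu]_x \int[mu]_y (\1_(cube a h) y * (u (x + y) - u x) ^+ 2)%:E
    <= (h ^+ N * (l ^+ 2 * (N%:R ^+ 2 * dir u u)))%:E)%E.
Proof.
move=> hu h0 l0 yl; have Lu := H1_L2 hu; have mC := measurable_cube a h.
pose f (xy : E * E) := (\1_(cube a h) xy.2 * (u (xy.1 + xy.2) - u xy.1) ^+ 2)%:E.
have mf : meas f.
  apply/measurable_EFinP; apply: measurable_funM.
    by apply: (@measurableT_comp _ _ _ _ _ _ (\1_(cube a h) : E -> R)) => //; exact: measurable_indic.
  apply: measurable_funX; apply: measurable_funB.
    by apply: (@measurableT_comp _ _ _ _ _ _ u _ _ Lu.1); exact: measurable_addr2.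
  by apply: (@measurableT_comp _ _ _ _ _ _ u _ _ Lu.1).
have f0 xy : (0 <= f xy)%E by rewrite lee_fin mulr_ge0 ?sqr_ge0.
rewrite [leLHS](@fubini_tonelli _ _ _ _ _ mu mu f mf f0).
set K := l ^+ 2 * _.
have K0 : 0 <= K by rewrite mulr_ge0 ?sqr_ge0// mulr_ge0 ?sqr_ge0// dir_ge0.
apply: (@le_trans _ _ (\int[mu]_y (\1_(cube a h) y * K)%:E)%E).
  apply: ge0_le_integral => //.
  - by move=> y _; exact: integral_ge0.
  - exact: measurable_fun_fubini_tonelli_G.
  - by apply/measurable_EFinP; apply: measurable_funM => //; exact: measurable_indic.
  move=> y _; rewrite /f/=.
  have Ld := L2B (L2_shift y Lu) Lu.
  rewrite -EFin_int; last exact: L1Z Ld.2.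
  rewrite lee_fin intZ; last exact: Ld.2.
  rewrite indicE; have [|_] := boolP (y \in _); last by rewrite !mul0r.
  by rewrite inE => /yl yl'; rewrite !mul1r; apply: sqr_translation.
have IC : L1 mu (\1_(cube a h) : E -> R).
  apply: L1_indic => //; apply: (@le_lt_trans _ _ ((h ^+ N)%:E)); last exact: ltry.
  by apply: le_of_eq; exact: (lebesgue_rV_cube a h0).
under eq_integral do rewrite mulrC.
rewrite -EFin_int; last exact: L1Z.
rewrite lee_fin intZ// mulrC ler_wpM2r// -lee_fin EFin_int// integral_indic// setIT.
by apply: le_of_eq; exact: (lebesgue_rV_cube a h0).
Qed.

Lemma measurable_shiftl u (x : E) : meas u ->
  meas (fun y : E => u (x + y)).
Proof.
move=> mu'; rewrite (_ : (fun y => _) = fun y => u (y + x)); first exact: measurable_comp_shift.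
by apply/funext => y; rewrite addrC.
Qed.

Lemma lebesgue_rV_cubeE (a : E) l : 0 <= l -> mu (cube a l) = (l ^+ N)%:E.
Proof. exact: lebesgue_rV_cube. Qed.

(** For x in S at least half of the cube consists of y with |u(x+y)| <= |u(x)|/2, where the squared
    oscillation is at least u(x)^2/4. So the inner integral of [osc_upper] is at least l^N
    u(x)^2/8. *)
Lemma osc_lower u l (S : set E) : H1 u -> 0 < l -> measurable S ->
  (forall x, S x -> (mu (cube 0%R l `&` [set y | (`|u x| / 2 < `|u (x + y)|)%R]) <= (l ^+ N / 2)%:E)%E) ->
  \int[mu]_x (\1_S x * u x ^+ 2) <= 8 * (l ^+ 2 * (N%:R ^+ 2 * dir u u)).
Proof.
move=> hu l0 mS hS; have Lu := H1_L2 hu; have mC := measurable_cube (0 : E) l.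
have lN0 : 0 < l ^+ N by rewrite exprn_gt0.
have I1 : L1 mu (fun x => \1_S x * u x ^+ 2).
  apply: L1_le Lu.2 => [|x].
    by apply: measurable_funM; [exact: measurable_indic|exact: measurable_funX Lu.1].
  by rewrite indicE; case: (x \in S); rewrite ?mul1r ?mul0r ?normr0 ?ger0_norm ?sqr_ge0.
have I2 := L1Z (l ^+ N / 8) I1.
suff : l ^+ N / 8 * \int[mu]_x (\1_S x * u x ^+ 2) <= l ^+ N * (l ^+ 2 * (N%:R ^+ 2 * dir u u)).
  by rewrite -mulrA ler_pM2l// ler_pdivrMl.
rewrite -intZ// -lee_fin EFin_int//; apply: (@le_trans _ _ (\int[mu]_x \int[mu]_y (\1_(cube 0 l) y * (u (x + y) - u x) ^+ 2)%:E)%E); last first.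
  apply: osc_upper; rewrite ?(ltW l0)// => y yl i.
  by have := yl i; rewrite mxE add0r => /andP[h1 h2]; rewrite ger0_norm// ltW.
have mu_y x : meas (fun y : E => u (x + y)) by exact: measurable_shiftl Lu.1.
have mf x : meas (fun y => (\1_(cube 0 l) y * (u (x + y) - u x) ^+ 2)%:E).
  apply/measurable_EFinP; apply: measurable_funM; first exact: measurable_indic.
  by apply: measurable_funX; apply: measurable_funB.
apply: ge0_le_integral => //.
- by move=> x _; rewrite lee_fin mulr_ge0 ?divr_ge0 ?(ltW lN0)// mulr_ge0 ?sqr_ge0.
- by apply/measurable_EFinP; exact: L1_meas I2.
- pose f (xy : E * E) := (\1_(cube 0 l) xy.2 * (u (xy.1 + xy.2) - u xy.1) ^+ 2)%:E.
  apply: (@measurable_fun_fubini_tonelli_F _ _ _ _ _ mu f) => [|xy].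
    apply/measurable_EFinP; apply: measurable_funM.
      by apply: (@measurableT_comp _ _ _ _ _ _ (\1_(cube 0 l) : E -> R)) => //; exact: measurable_indic.
    apply: measurable_funX; apply: measurable_funB.
      by apply: (@measurableT_comp _ _ _ _ _ _ u _ _ Lu.1); exact: measurable_addr2.
    by apply: (@measurableT_comp _ _ _ _ _ _ u _ _ Lu.1).
  by rewrite lee_fin mulr_ge0 ?sqr_ge0.
move=> x _; rewrite indicE; have [|_] := boolP (x \in S); last first.
  by rewrite mul0r mulr0; apply: integral_ge0 => y _; rewrite lee_fin mulr_ge0 ?sqr_ge0.
rewrite inE mul1r => Sx; set B := [set y : E | (`|u x| / 2 < `|u (x + y)|)%R].
have mB : measurable B.
  rewrite -[B]setTI; apply: measurable_fun_ltr => //.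
  by apply: measurableT_comp => //; exact: mu_y.
have mQB : measurable (cube 0 l `\` B) by exact: measurableD.
apply: (@le_trans _ _ (\int[mu]_y ((u x ^+ 2 / 4)%:E * (\1_(cube 0 l `\` B) y)%:E)%E)%E); last first.
  apply: ge0_le_integral => //.
  - by move=> y _; rewrite -EFinM lee_fin mulr_ge0// divr_ge0 ?sqr_ge0.
  - by apply/measurable_EFinP; apply: measurable_funM => //; exact: measurable_indic.
  move=> y _; rewrite -EFinM lee_fin.
  rewrite !indicE; have [|_] := boolP (y \in _ `\` _); last by rewrite mulr0 mulr_ge0 ?sqr_ge0.
  rewrite inE => -[yQ /negP]; rewrite -leNgt => uy.
  rewrite mem_set// mul1r mulr1 -(sqr_normr (u x)) -[leRHS]sqr_normr.
  have h1 := lerB_dist (u x) (u (x + y)); rewrite distrC in h1.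
  by have h2 := normr_ge0 (u x); nra.
rewrite ge0_integralZl_EFin//; [|by apply/measurable_EFinP; exact: measurable_indic|by rewrite divr_ge0 ?sqr_ge0].
rewrite integral_indic// setIT.
rewrite (_ : (l ^+ N / 8 * u x ^+ 2)%:E = ((u x ^+ 2 / 4)%:E * (l ^+ N / 2)%:E)%E); last first.
  by rewrite -EFinM; congr EFin; field.
apply: lee_wpmul2l; first by rewrite lee_fin divr_ge0 ?sqr_ge0.
have e1 := lebesgue_rV_cubeE (0 : E) (ltW l0).
have f1 : (mu (cube 0%R l) < +oo)%E.
  by apply: (@le_lt_trans _ _ ((l ^+ N)%:E)); [apply: le_of_eq|exact: ltry].
have e2 : mu (cube 0%R l `\` B) = ((l ^+ N)%:E - mu (cube 0%R l `&` B))%E.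
  by apply: (etrans (measureD mC mB f1)); congr (_ - _)%E; exact: e1.
apply: (@le_trans _ _ ((l ^+ N)%:E - mu (cube 0%R l `&` B))%E); last first.
  by apply: le_of_eq; exact: esym e2.
rewrite leeBrDr; last first.
  rewrite ge0_fin_numE//; apply: le_lt_trans (hS _ Sx) _; exact: ltry.
apply: (le_trans (leeD2l _ (hS _ Sx))); rewrite -EFinD lee_fin.
by rewrite -splitr.
Qed.

(** With l^N = 2m the support fills at most half of any cube of side l, so [osc_lower] applies, with
    l^2 of order m^(2/N). For m < 1 this is weakened to m^tau; for m >= 1 the bound is trivial. The
    freedom in tau matters for N <= 2, where 2/N >= 1 while the level-set iteration wants tau <
    1. *)
Lemma faber_krahn (tau : R) : (0 < N)%N -> 0 <= tau <= 2 / N%:R ->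
  exists2 C, 0 < C & forall z m, H1 z -> 0 < m -> (mu [set x | (z x != 0)%R] <= m%:E)%E ->
    \int[mu]_x z x ^+ 2 <= C * m `^ tau * (dir z z + \int[mu]_x z x ^+ 2).
Proof.
move=> N0 /andP[tau0 tauN]; have NR : 0 < N%:R :> R by rewrite ltr0n.
exists (1 + 32 * N%:R ^+ 2) => [|z m hz m0 zm].
  by rewrite addr_gt0// mulr_gt0// exprn_gt0.
have Lz := H1_L2 hz; have D0 := dir_ge0 z.
have z20 : 0 <= \int[mu]_x z x ^+ 2 by apply: int_ge0 => x; exact: sqr_ge0.
have K0 : 0 <= 32 * N%:R ^+ 2 :> R by rewrite mulr_ge0 ?sqr_ge0.
have [m1|m1] := leP 1 m.
  have : 1 <= m `^ tau by rewrite -(powRr0 m); apply: ler_powR.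
  move=> P1; apply: le_trans (_ : dir z z + \int[mu]_x z x ^+ 2 <= _); first by rewrite lerDr.
  apply: ler_peMl; first exact: addr_ge0.
  by rewrite -[leLHS]mulr1; apply: ler_pM => //; rewrite lerDl.
pose l := (2 * m) `^ (N%:R^-1); have m20 : 0 < 2 * m by rewrite mulr_gt0.
have l0 : 0 < l by exact: powR_gt0.
have lN : l ^+ N = 2 * m.
  by rewrite -powR_mulrn ?(ltW l0)// -powRrM mulVf ?gt_eqF// powRr1// (ltW m20).
pose S := [set x | z x != 0].
have mS : measurable S.
  rewrite -[S]setTI (_ : S = z @^-1` (~` [set 0])); last by apply/seteqP; split => x /= /eqP.
  by apply: Lz.1 => //; apply: measurableC; exact: measurable_set1.
have h : \int[mu]_x (\1_S x * z x ^+ 2) <= 8 * (l ^+ 2 * (N%:R ^+ 2 * dir z z)).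
  apply: osc_lower => // x Sx; rewrite lN (_ : 2 * m / 2 = m); last by field.
  have mSx : measurable [set y : E | z (x + y) != 0].
    rewrite (_ : [set _ | _] = (fun y => y + x) @^-1` S).
      by rewrite -[X in measurable X]setTI; exact: measurable_shift.
    by apply/seteqP; split => y; rewrite /= /S /= addrC.
  apply: (@le_trans _ _ (mu [set y : E | (z (x + y) != 0)%R])).
    apply: le_measure; rewrite ?inE//.
      apply: measurableI; first exact: measurable_cube.
      rewrite -[X in measurable X]setTI; apply: measurable_fun_ltr => //.
      by apply: measurableT_comp => //; exact: measurable_shiftl Lz.1.
    move=> y [_ /=]; apply: contraTneq => ->; rewrite normr0 -leNgt.
    by rewrite divr_ge0.
  apply: le_trans zm; rewrite -(lebesgue_rV_shift x mS).
  apply: le_of_eq; congr (mu _).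
  by apply/seteqP; split => y; rewrite /= addrC.
have -> : \int[mu]_x z x ^+ 2 = \int[mu]_x (\1_S x * z x ^+ 2).
  apply: eq_Rintegral => x _; rewrite indicE; have [|] := boolP (x \in S); first by rewrite mul1r.
  by rewrite notin_setE /S/= => /negP; rewrite negbK => /eqP ->; rewrite expr0n mulr0.
apply: (le_trans h).
have l2 : l ^+ 2 <= 4 * m `^ tau.
  rewrite -powR_mulrn ?(ltW l0)// -powRrM powRM ?(ltW m0)//.
  apply: ler_pM; rewrite ?powR_ge0//.
    rewrite (_ : 4 = 2 `^ 2); last by rewrite powR_mulrn// -natrX.
    apply: ler_powR; first by rewrite ler1n.
    by rewrite ler_pdivrMl// ler_peMl// ler1n.
  by rewrite mulrC; apply: ger_powR => //; rewrite m0 (ltW m1).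
have P0 := powR_ge0 m tau.
have : l ^+ 2 * (N%:R ^+ 2 * dir z z) <= 4 * m `^ tau * (N%:R ^+ 2 * dir z z).
  by rewrite ler_wpM2r// mulr_ge0 ?sqr_ge0.
have X0 : 0 <= \int[mu]_x (\1_S x * z x ^+ 2) by apply: int_ge0 => x; rewrite mulr_ge0 ?sqr_ge0.
set X := \int[mu]_x _ in X0 *; set P := m `^ tau in P0 *.
have PX : 0 <= P * X by exact: mulr_ge0.
have PD : 0 <= P * dir z z by exact: mulr_ge0.
have NPX : 0 <= N%:R ^+ 2 * (P * X) by rewrite mulr_ge0 ?sqr_ge0.
rewrite -/X; nra.
Qed.

(** Where |u(x)| > lam, Chebyshev's inequality and the local mass bound show that |u| exceeds lam/2
    on at most half of the cube at x, which is what [osc_lower] asks for. *)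
Lemma lions_bound u l lam eta : H1 u -> 0 < l -> 0 < lam ->
  (forall x, \int[mu]_y (\1_(cube 0 l) y * u (y + x) ^+ 2) <= eta) ->
  4 / lam ^+ 2 * eta <= l ^+ N / 2 ->
  \int[mu]_x (\1_[set x | lam < `|u x|] x * u x ^+ 2) <= 8 * (l ^+ 2 * (N%:R ^+ 2 * dir u u)).
Proof.
move=> hu l0 lam0 ueta etal; have Lu := H1_L2 hu; have mC := measurable_cube (0 : E) l.
apply: osc_lower => //.
  by rewrite -[X in measurable X]setTI; apply: measurable_fun_ltr => //; apply: measurableT_comp => //; exact: Lu.1.
move=> x /= lx; set B := _ `&` _.
have mux : meas (fun y : E => u (x + y)) by exact: measurable_shiftl Lu.1.
have mB : measurable B.
  apply: measurableI => //; rewrite -[X in measurable X]setTI; apply: measurable_fun_ltr => //.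
  exact: measurableT_comp.
have I1 : L1 mu (fun y => \1_(cube 0 l) y * u (y + x) ^+ 2).
  apply: L1_le (L2_shift x Lu).2 => [|y].
    by apply: measurable_funM; [exact: measurable_indic|exact: measurable_funX (L2_shift x Lu).1].
  by rewrite indicE; case: (y \in _); rewrite ?mul1r ?mul0r ?normr0 ?ger0_norm ?sqr_ge0.
have I2 := L1Z (4 / lam ^+ 2) I1.
apply: (@le_trans _ _ (\int[mu]_y (4 / lam ^+ 2 * (\1_(cube 0 l) y * u (y + x) ^+ 2))%:E)%E); last first.
  by rewrite -EFin_int// lee_fin intZ// (le_trans _ etal)// ler_wpM2l// divr_ge0 ?sqr_ge0.
rewrite -(setIT B) -integral_indic//; apply: ge0_le_integral => //.
- by apply/measurable_EFinP; exact: measurable_indic.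
- by apply/measurable_EFinP; exact: L1_meas I2.
move=> y _; rewrite lee_fin indicE; have [|_] := boolP (y \in B); last first.
  by apply: mulr_ge0; [rewrite divr_ge0 ?sqr_ge0|rewrite mulr_ge0 ?sqr_ge0].
rewrite inE => -[yQ /= uy]; rewrite indicE mem_set// mul1r addrC.
rewrite mulrAC ler_pdivlMr ?exprn_gt0// mul1r -[u (x + y) ^+ 2]sqr_normr.
have : lam / 2 < `|u (x + y)| by apply: lt_trans uy; rewrite ltr_pM2r.
by nra.
Qed.

End oscillation.

(** * Sobolev embedding and compactness *)

Section shells.
Context d (T : measurableType d) {R : realType} (mu : {measure set T -> \bar R}).
Implicit Types (f : T -> R) (r s : R).

Lemma geometric_sum_le (q : R) n : 0 <= q < 1 -> \sum_(0 <= j < n) q ^+ j <= (1 - q)^-1.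
Proof.
move=> /andP[q0 q1]; have q1' : 0 < 1 - q by rewrite subr_gt0.
rewrite -[leRHS]mul1r ler_pdivlMr//.
have -> : (\sum_(0 <= j < n) q ^+ j) * (1 - q) = 1 - q ^+ n.
  elim: n => [|n IH]; first by rewrite big_nil mul0r expr0 subrr.
  by rewrite big_nat_recr//= mulrDl IH exprS; ring.
by rewrite gerBl exprn_ge0.
Qed.

(** A covering by sets of measure at most m_j, with f at most c_j on the one chosen for a point and
    c_j m_j geometric. The exponential weight, the Gamma integral, both parts of the kernel and the
    layers of a function are all integrated this way. *)
Lemma shell_L1 f (S : nat -> set T) (c m : nat -> R) C q :
  meas f -> (forall x, 0 <= f x) -> (forall j, measurable (S j)) ->
  (forall j, 0 <= c j) -> (forall j, (mu (S j) <= (m j)%:E)%E) ->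
  (forall x, f x != 0 -> exists2 j, S j x & f x <= c j) ->
  0 <= q < 1 -> (forall j, c j * m j <= C * q ^+ j) ->
  L1 mu f /\ \int[mu]_x f x <= C / (1 - q).
Proof.
move=> mf f0 mS c0 Sm fS q01 cm.
have C0 : 0 <= C.
  have := cm 0%N; rewrite expr0 mulr1; apply: le_trans; rewrite mulr_ge0// -lee_fin.
  exact: le_trans (Sm 0%N).
apply/L1_ge0_le => //.
pose G x := (\sum_(0 <= j <oo) (c j * \1_(S j) x)%:E)%E.
have mterm j : meas (fun x => (c j * \1_(S j) x)%:E).
  by apply/measurable_EFinP; apply: measurable_funM => //; exact: measurable_indic.
have term0 j x : (0 <= (c j * \1_(S j) x)%:E)%E by rewrite lee_fin mulr_ge0.
apply: (@le_trans _ _ (\int[mu]_x G x)%E).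
  apply: ge0_le_integral => //.
  - by move=> x _; rewrite lee_fin.
  - exact/measurable_EFinP.
  - by apply: ge0_emeasurable_sum => [j x _ _|j _]; [exact: term0|exact: mterm].
  move=> x _; have [->|/fS[j Sj fj]] := eqVneq (f x) 0; first exact: nneseries_ge0.
  apply: le_trans (_ : (c j * \1_(S j) x)%:E <= _)%E.
    by rewrite lee_fin indicE mem_set ?mulr1.
  by rewrite /G (@nneseriesD1 _ _ j)// leeDl// nneseries_ge0.
rewrite integral_nneseries//.
apply: lime_le; first by apply: is_cvg_nneseries => k _ _; exact: integral_ge0.
apply: nearW => n /=.
apply: (@le_trans _ _ (\sum_(0 <= j < n) (C * q ^+ j)%:E)%E).
  apply: lee_sum => j _.
  under eq_integral do rewrite EFinM.
  rewrite ge0_integralZl_EFin//; [|by apply/measurable_EFinP; exact: measurable_indic].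
  rewrite integral_indic// setIT.
  apply: le_trans (lee_wpmul2l _ (Sm j)) _; first by rewrite lee_fin.
  by rewrite -EFinM lee_fin.
by rewrite sumEFin lee_fin -mulr_sumr ler_wpM2l// geometric_sum_le.
Qed.

Lemma measurable_abs_powR r f : meas f ->
  meas (fun x => `|f x| `^ r).
Proof.
by move=> mu'; apply: (@measurableT_comp _ _ _ _ _ _ (fun x => x `^ r)) => //; exact: measurableT_comp.
Qed.

Lemma measurable_gt_abs c f : meas f -> measurable [set x | c < `|f x|].
Proof.
move=> mu'; rewrite -[X in measurable X]setTI; apply: measurable_fun_ltr => //.
exact: measurableT_comp.
Qed.

Lemma powR2n (j : nat) : (2 : R) `^ j%:R = 2 ^+ j.
Proof. by rewrite powR_mulrn. Qed.

Lemma powR_pos_add (a x y : R) : 0 < a -> a `^ (x + y) = a `^ x * a `^ y.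
Proof. by move=> a0; rewrite powRD//; apply/implyP => _; rewrite gt_eqF. Qed.

Lemma powR_lt1 (a x : R) : 1 < a -> x < 0 -> a `^ x < 1.
Proof.
move=> a1 x0; have a0 : 0 < a by exact: lt_trans a1.
by rewrite /powR gt_eqF// -expR0 ltr_expR nmulr_rlt0// ln_gt0.
Qed.

Lemma chebyshev_set f s c M (A : set T) : 0 < c -> 0 < s -> measurable A ->
  (forall x, A x -> c <= `|f x|) -> L1 mu (fun x => `|f x| `^ s) ->
  \int[mu]_x (`|f x| `^ s) <= M -> (mu A <= (c `^ (- s) * M)%:E)%E.
Proof.
move=> c0 s0 mA Ac Iu uM.
have P0 : 0 < c `^ (- s) by exact: powR_gt0.
apply: (@le_trans _ _ (\int[mu]_x (c `^ (- s) * `|f x| `^ s)%:E)%E); last first.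
  by rewrite -EFin_int ?lee_fin ?intZ ?ler_pM2l//; exact: L1Z.
rewrite -(setIT A) -integral_indic//; apply: ge0_le_integral => //.
- by apply/measurable_EFinP; exact: measurable_indic.
- by apply/measurable_EFinP; exact: L1_meas (L1Z _ Iu).
move=> x _; rewrite lee_fin indicE; have [|_] := boolP (x \in _); last by rewrite mulr_ge0 ?powR_ge0.
rewrite inE => /Ac cu; rewrite powRN ler_pdivlMl ?powR_gt0// mulr1.
by apply: ge0_ler_powR; rewrite ?nnegrE ?(ltW s0) ?(ltW c0).
Qed.

Lemma chebyshev_sqr f c M (A : set T) : 0 < c -> measurable A ->
  (forall x, A x -> c <= `|f x|) -> L2 mu f ->
  \int[mu]_x f x ^+ 2 <= M -> (mu A <= (M / c ^+ 2)%:E)%E.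
Proof.
move=> c0 mA Ac Lf fM.
have e : (fun x => `|f x| `^ 2) = fun x => f x ^+ 2.
  by apply/funext => x; rewrite powR_mulrn// sqr_normr.
have := @chebyshev_set f 2 c M A c0 _ mA Ac; rewrite e powRN powR_mulrn ?(ltW c0)// mulrC.
by apply => //; exact: Lf.2.
Qed.

Lemma dyadic_bracket (a : R) : 1 < a -> exists j : nat, 2 ^+ j < a <= 2 ^+ j.+1.
Proof.
move=> a1; have ex : exists j : nat, a <= 2 ^+ j.+1.
  exists (Num.truncn a).+1; apply: ltW; apply: lt_le_trans (truncnS_gt a) _.
  by rewrite -natrX ler_nat; apply: ltnW; apply: ltn_trans (ltn_expl _ _); [exact: ltnSn|].
exists (ex_minn ex); case: ex_minnP => -[|j] aj jmin; first by rewrite expr0 a1.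
by rewrite aj andbT ltNge; apply/negP => /jmin; rewrite ltnn.
Qed.

(** Level sets of measure 2^(-sj) give the j-th dyadic layer of |f|^r a share of order 2^((r-s)j), a
    convergent series as r < s; where |f| <= 1 the power is below f^2. *)
Lemma weak_to_strong f s r K : L2 mu f -> 2 <= r < s -> 0 <= K ->
  (forall j : nat, (mu [set x | (2 ^+ j < `|f x|)%R] <= (K * 2 `^ (- s * j%:R))%:E)%E) ->
  L1 mu (fun x => `|f x| `^ r) /\
  \int[mu]_x (`|f x| `^ r) <= \int[mu]_x f x ^+ 2 + 2 `^ r / (1 - 2 `^ (r - s)) * K.
Proof.
move=> Lu /andP[r2 rs] K0 uK; pose S (j : nat) : set T := [set x | 2 ^+ j < `|f x|].
have mS j : measurable (S j) by exact: measurable_gt_abs Lu.1.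
have mr := measurable_abs_powR r Lu.1.
have q01 : 0 <= (2 : R) `^ (r - s) < 1 by rewrite powR_ge0 powR_lt1 ?subr_lt0// ltr1n.
have mbig : meas (fun x => \1_(S 0%N) x * `|f x| `^ r).
  by apply: measurable_funM => //; exact: measurable_indic.
have [Lb Ib] : L1 mu (fun x => \1_(S 0%N) x * `|f x| `^ r) /\
    \int[mu]_x (\1_(S 0%N) x * `|f x| `^ r) <= (2 `^ r * K) / (1 - 2 `^ (r - s)).
  apply: (@shell_L1 _ S (fun j => 2 `^ (r * j.+1%:R)) (fun j => K * 2 `^ (- s * j%:R))) => //.
  - move=> x; rewrite indicE; have [|_] := boolP (x \in _); last by rewrite mul0r eqxx.
    rewrite inE /S /= expr0 => /dyadic_bracket[j /andP[j1 j2]] _; exists j => //.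
    rewrite mul1r mulrC powRrM powR2n.
    by apply: ge0_ler_powR; rewrite ?nnegrE ?exprn_ge0//; lra.
  - move=> j; apply: le_of_eq.
    rewrite -(powR_mulrn _ (powR_ge0 _ _)) -powRrM -[j.+1%:R]natr1 [r * (_ + _)]mulrDr mulr1 powR_pos_add//.
    by rewrite mulrBl powR_pos_add// mulNr; ring.
have fle x : `|f x| `^ r <= f x ^+ 2 + \1_(S 0%N) x * `|f x| `^ r.
  rewrite indicE; have [|/negP] := boolP (x \in _).
    by rewrite mul1r lerDr sqr_ge0.
  rewrite inE /S /= expr0 mul0r addr0 => /negP; rewrite -leNgt => u1.
  rewrite -sqr_normr -powR_mulrn//.
  have [->|un] := eqVneq (f x) 0; first by rewrite normr0 !powR0// gt_eqF//; lra.
  by apply: ger_powR => //; rewrite normr_gt0 un.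
have Lsum := L1D Lu.2 Lb.
have Lr : L1 mu (fun x => `|f x| `^ r).
  apply: L1_le Lsum => // x; rewrite ger0_norm ?powR_ge0//.
split => //; apply: le_trans (int_le Lr Lsum fle) _.
rewrite intD//; last exact: Lu.2.
by rewrite lerD2l mulrAC; exact: Ib.
Qed.

End shells.

(** * The subcritical Sobolev inequality and vanishing sequences *)

Section sobolev.
Context {R : realType} {N : nat}.
Local Notation E := 'rV[R]_N.
Local Notation mu := (@lebesgue_rV R N).
Implicit Types (u w f : E -> R) (l r s : R).

Definition hn u := dir u u + \int[mu]_x u x ^+ 2.

Lemma hn_ge0 u : H1 u -> 0 <= hn u.
Proof. by move=> hu; rewrite addr_ge0 ?dir_ge0//; apply: int_ge0 => x; exact: sqr_ge0. Qed.

(** The part of |u| between the heights c and 2c. Its increments are dominated by those of u, so its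
    energy is at most that of u. *)
Definition slice (c : R) u : E -> R := fun x => Num.min (Num.max (`|u x| - c) 0) c.

Lemma slice_cases (c x : R) : 0 < c -> let m := Num.min (Num.max (x - c) 0) c in
  [\/ m = 0 /\ x <= c, [/\ m = x - c, c <= x & x <= 2 * c] | m = c /\ 2 * c <= x].
Proof.
move=> c0 m; rewrite /m; have [xc|xc] := leP x c.
  by constructor 1; rewrite (max_idPr _) ?(min_idPl _)//; lra.
rewrite (max_idPl _); last by lra.
have [x2|x2] := leP x (2 * c).
  by constructor 2; rewrite (min_idPl _); [split => //; lra|lra].
by constructor 3; rewrite (min_idPr _); [split => //; lra|lra].
Qed.

Lemma slice_lip (c a b : R) : 0 < c ->
  `|Num.min (Num.max (`|a| - c) 0) c - Num.min (Num.max (`|b| - c) 0) c| <= `|a - b|.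
Proof.
move=> c0; apply: le_trans (ler_dist_dist a b).
move: `|a| `|b| => x y.
by case: (slice_cases x c0) => -[-> ? *]; case: (slice_cases y c0) => -[-> ? *];
  case: (ger0P (x - y)) => ?; rewrite ler_norml; apply/andP; split; lra.
Qed.

Lemma measurable_slice c u : meas u -> meas (slice c u).
Proof.
move=> mu'; apply: measurable_minr => //; apply: measurable_maxr => //.
by apply: measurable_funB => //; exact: measurableT_comp.
Qed.

Lemma slice_H1 c u : 0 < c -> H1 u -> H1 (slice c u).
Proof.
move=> c0 hu; apply: (H1_lipschitz (F := fun a => Num.min (Num.max (`|a| - c) 0) c)) => //.
- by rewrite normr0 sub0r (max_idPr _) ?(min_idPl _)//; lra.
- by move=> a b; exact: slice_lip.
exact: measurable_slice (H1_L2 hu).1.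
Qed.

Lemma hn_slice c u : 0 < c -> H1 u -> hn (slice c u) <= hn u.
Proof.
move=> c0 hu; have hs := slice_H1 c0 hu; apply: lerD.
  apply: dir_le => // x y; rewrite -!expr2 -(sqr_normr (_ - _)) -(sqr_normr (u y - _)).
  by rewrite ler_sqr ?nnegrE//; exact: slice_lip.
apply: int_le; [exact: (H1_L2 hs).2|exact: (H1_L2 hu).2|move=> x].
rewrite -sqr_normr -(sqr_normr (u x)) ler_sqr ?nnegrE//.
rewrite /slice; move: (normr_ge0 (u x)); move: `|u x| => a a0.
by case: (slice_cases a c0) => -[-> ? *]; rewrite ler_norml; apply/andP; split; lra.
Qed.

(** Faber-Krahn for the slice, which is supported in {|u| > c}, followed by Chebyshev on {|u| > 2c},
    where the slice equals c. *)
Lemma level_step (tau : R) : (0 < N)%N -> 0 <= tau <= 2 / N%:R ->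
  exists2 C : R, 0 < C & forall u c m h, H1 u -> 0 < c -> 0 < m ->
    (mu [set x | (c < `|u x|)%R] <= m%:E)%E -> hn (slice c u) <= h ->
    (mu [set x | (2 * c < `|u x|)%R] <= (C * m `^ tau * h / c ^+ 2)%:E)%E.
Proof.
move=> N0 t2; have [C C0 FK] := faber_krahn N0 t2; exists C => // u c m h hu c0 m0 um hh.
have Lu := H1_L2 hu; have hs := slice_H1 c0 hu; have Ls := H1_L2 hs.
have ss : (mu [set x | (slice c u x != 0)%R] <= m%:E)%E.
  apply: le_trans um; apply: le_measure; rewrite ?inE.
  - rewrite (_ : [set _ | _] = [set x | (0 < `|slice c u x|)%R]); first exact: measurable_gt_abs Ls.1.
    by apply/seteqP; split => x /=; rewrite normr_gt0.
  - exact: measurable_gt_abs Lu.1.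
  move=> x /=; rewrite /slice; apply: contraNT; rewrite -leNgt => uc.
  by rewrite (max_idPr _) ?(min_idPl _)//; lra.
have := FK _ _ hs m0 ss; rewrite -/(hn _) => fk.
have m2 : measurable [set x | (2 * c < `|u x|)%R] by exact: measurable_gt_abs Lu.1.
apply: (chebyshev_sqr c0 m2 _ Ls) => [x /= cu|].
  by rewrite /slice; clear -cu c0; case: (slice_cases `|u x| c0) => -[-> ? *]; rewrite ?ger0_norm; lra.
apply: le_trans fk _; rewrite ler_wpM2l// mulr_ge0 ?powR_ge0//; exact: ltW.
Qed.

(** Iterating [level_step] over c = 2^j reproduces a bound K 2^(-sj) as soon as s = s tau + 2, that
    is s = 2/(1 - tau), and C 2^s K^tau <= K. With tau = 2/N the exponent s is the critical
    2N/(N-2). *)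
Lemma weak_sobolev (tau : R) : (0 < N)%N -> 0 <= tau <= 2 / N%:R -> tau < 1 ->
  exists2 K : R, 0 < K & forall u, H1 u -> hn u <= 1 -> forall j : nat,
    (mu [set x | (2 ^+ j < `|u x|)%R] <= (K * 2 `^ (- (2 / (1 - tau)) * j%:R))%:E)%E.
Proof.
move=> N0 t2 t1; have [C C0 step] := level_step N0 t2.
pose s := 2 / (1 - tau); have st : s * tau + 2 = s by rewrite /s; field; lra.
pose K := Num.max 1 ((C * 2 `^ s) `^ (1 - tau)^-1).
have K1 : 1 <= K by rewrite le_max lexx.
have K0 : 0 < K by lra.
have KC : C * 2 `^ s <= K `^ (1 - tau).
  have -> : C * 2 `^ s = ((C * 2 `^ s) `^ (1 - tau)^-1) `^ (1 - tau).
    by rewrite -powRrM mulVf ?powRr1 ?mulr_ge0 ?powR_ge0//; lra.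
  by apply: ge0_ler_powR; rewrite ?nnegrE ?powR_ge0 ?le_max ?lexx ?orbT//; lra.
exists K => // u hu u1; have Lu := H1_L2 hu.
elim=> [|j IH].
  rewrite mulr0 powRr0 mulr1 expr0; have mS := measurable_gt_abs 1 Lu.1.
  apply: (@le_trans _ _ (1 / 1 ^+ 2)%:E); last by rewrite expr1n divr1 lee_fin.
  apply: (chebyshev_sqr ltr01 mS _ Lu) => [x /ltW//|]; apply: le_trans u1.
  by rewrite /hn lerDr dir_ge0.
have c0 : 0 < 2 ^+ j :> R by exact: exprn_gt0.
have m0 : 0 < K * 2 `^ (- s * j%:R) by rewrite mulr_gt0 ?powR_gt0.
have := step u (2 ^+ j) _ 1 hu c0 m0 IH (le_trans (hn_slice c0 hu) u1).
rewrite -exprS => /le_trans; apply; rewrite lee_fin mulr1.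
have -> : 2 ^+ j ^+ 2 = 2 `^ (2 * j%:R) :> R.
  by rewrite -exprM -powR2n natrM mulrC.
rewrite ler_pdivrMr ?powR_gt0// -mulrA -powR_pos_add//.
rewrite powRM ?powR_ge0 ?(ltW K0)// -powRrM.
have -> : - s * j.+1%:R + 2 * j%:R = - s + - s * j%:R * tau.
  have -> : - s * j%:R * tau = - j%:R * (s * tau) by ring.
  have -> : s * tau = s - 2 by lra.
  by rewrite -natr1; ring.
rewrite powR_pos_add// !mulrA ler_pM2r ?powR_gt0// powRN ler_pdivlMr ?powR_gt0//.
rewrite -[X in X * _ <= _]mulrC -mulrA mulrC.
rewrite -[leRHS](powRr1 (ltW K0)) -[in leRHS](subrK tau 1) powR_pos_add//.
by rewrite ler_pM2r ?powR_gt0.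
Qed.

Lemma dirZ (a b : R) u w : H1 u -> H1 w -> dir (fun x => a * u x) (fun x => b * w x) = a * b * dir u w.
Proof.
move=> hu hw; have d0 f : H1 f -> dir (cst 0) f = 0.
  by move=> hf; have := dir_linl 1 H1_0 H1_0 hf; under eq_fun do rewrite mulr0 addr0; lra.
have hbw := H1Z b hw.
have := dir_linl a hu H1_0 hbw; under eq_fun do rewrite addr0.
rewrite (d0 _ hbw) addr0 => ->.
have := dir_linr b hw H1_0 hu; under eq_fun do rewrite addr0.
by rewrite (dirC u (cst 0)) (d0 _ hu) addr0 => ->; rewrite mulrA.
Qed.

Lemma hn_Z a u : H1 u -> hn (fun x => a * u x) = a ^+ 2 * hn u.
Proof.
move=> hu; rewrite /hn dirZ// mulrDr expr2; congr (_ + _).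
by under eq_Rintegral do rewrite exprMn; rewrite intZ ?expr2//; exact: (H1_L2 hu).2.
Qed.

Lemma sobolev r : (0 < N)%N -> 2 <= r -> r * (N%:R - 2) < 2 * N%:R ->
  exists2 C : R, 0 < C & forall u l, H1 u -> 0 <= l -> hn u <= l ^+ 2 ->
    L1 mu (fun x => `|u x| `^ r) /\ \int[mu]_x (`|u x| `^ r) <= C * l `^ r.
Proof.
move=> N0 r2 rN; have NR : 0 < N%:R :> R by rewrite ltr0n.
(* tau is put halfway between 1 - 2/r and min(2/N, 1), so that r lies strictly below the weak
   exponent 2/(1 - tau). *)
have [tau [t0 tN t1 tr]] : exists tau : R, [/\ 0 <= tau, tau <= 2 / N%:R, tau < 1 & r < 2 / (1 - tau)].
  have r1 : 1 - 2 / r < 2 / N%:R.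
    rewrite -subr_gt0 (_ : _ - _ = (2 * N%:R - r * (N%:R - 2)) / (N%:R * r)); last by field; apply/andP; split; lra.
    by rewrite divr_gt0 ?mulr_gt0 ?subr_gt0//; lra.
  have rr : 2 / r <= 1 by rewrite ler_pdivrMr; lra.
  have rr0 : 0 < 2 / r by rewrite divr_gt0//; lra.
  have N2 : 0 < 2 / N%:R :> R by rewrite divr_gt0.
  pose m : R := Num.min (2 / N%:R) 1; have m1 : m <= 1 by rewrite ge_min lexx orbT.
  have mN : m <= 2 / N%:R by rewrite ge_min lexx.
  have rm : 1 - 2 / r < m by rewrite lt_min r1; lra.
  exists ((1 - 2 / r + m) / 2); split; [lra|lra|lra|].
  have : 2 / r * r = 2 by rewrite divfK//; lra.
  rewrite ltr_pdivlMr; last by lra.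
  by move: (2 / r) rr rr0 rm => X *; nra.
have [|K K0 wk] := weak_sobolev N0 _ t1; first exact/andP.
pose s := 2 / (1 - tau); pose C := 1 + 2 `^ r / (1 - 2 `^ (r - s)) * K.
have C1 u : H1 u -> hn u <= 1 -> L1 mu (fun x => `|u x| `^ r) /\ \int[mu]_x (`|u x| `^ r) <= C.
  move=> hu u1; have [|Lr Ir] := @weak_to_strong _ _ _ mu u s r K (H1_L2 hu) _ (ltW K0) (wk u hu u1).
    by rewrite r2.
  split=> //; apply: le_trans Ir _; rewrite lerD2r; apply: le_trans u1.
  by rewrite /hn lerDr dir_ge0.
have C0 : 0 < C.
  rewrite ltr_pwDl// mulr_ge0 ?(ltW K0)// divr_ge0 ?powR_ge0// subr_ge0 ltW// powR_lt1 ?subr_lt0//.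
  by rewrite ltr1n.
exists C => // u l hu l0 ul.
have key l' : 0 < l' -> hn u <= l' ^+ 2 -> L1 mu (fun x => `|u x| `^ r) /\ \int[mu]_x (`|u x| `^ r) <= C * l' `^ r.
  move=> l'0 ul'; have [||L1r Ir] := C1 (fun x => l'^-1 * u x) _ _; first exact: H1Z.
    by rewrite hn_Z// exprVn mulrC ler_pdivrMr ?mul1r// exprn_gt0.
  have e : (fun x => `|u x| `^ r) = fun x => l' `^ r * `|l'^-1 * u x| `^ r.
    apply/funext => x; rewrite normrM powRM// gtr0_norm ?invr_gt0// mulrA -powRM ?invr_ge0 ?(ltW l'0)//.
    by rewrite divff ?gt_eqF// powR1 mul1r.
  split; first by rewrite e; exact: L1Z.
  by rewrite e intZ// mulrC ler_pM2r ?powR_gt0.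
(* For l = 0 the estimate is the limit of the estimates with positive radii. *)
have [l00|/eqP ln] := eqVneq l 0; last by apply: key => //; rewrite lt_def l0 andbT; exact/eqP.
have u0 : hn u <= 0 by rewrite (le_trans ul)// l00 expr0n.
split; first by have [] := key 1 ltr01 (le_trans u0 _) => //; exact: sqr_ge0.
have r0 : 0 < r by lra.
rewrite l00 powR0 ?gt_eqF// mulr0; apply/ler_addgt0Pl => e e0; rewrite addr0.
have [||_ I] := key ((e / C) `^ r^-1) _ _; first by rewrite powR_gt0 ?divr_gt0.
  by apply: le_trans u0 _; exact: sqr_ge0.
apply: le_trans I _; rewrite -powRrM mulVf ?gt_eqF// powRr1 ?divr_ge0 ?(ltW e0) ?(ltW C0)//.
by rewrite mulrC divfK ?gt_eqF.
Qed.

(** Splits |u|^r at two heights. Up to lam it is at most lam^(r-2) u^2, above T at most T^(r-s)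
    |u|^s with a larger subcritical s, and in between it is at most T^(r-2) u^2, whose integral
    [lions_bound] makes small through the side l. The constants give each part eps/3, and eta is the
    mass bound that [lions_bound] then requires. *)
Lemma vanish r eps : (0 < N)%N -> 2 < r -> r * (N%:R - 2) < 2 * N%:R -> 0 < eps ->
  exists l eta : R, [/\ 0 < l, 0 < eta & forall u, H1 u -> hn u <= 1 ->
    (forall x, \int[mu]_y (\1_(cube 0 l) y * u (y + x) ^+ 2) <= eta) ->
    \int[mu]_x (`|u x| `^ r) <= eps].
Proof.
move=> N0 r2 rN e0; have NR : 0 < N%:R :> R by rewrite ltr0n.
have [s [rs sN]] : exists s : R, r < s /\ s * (N%:R - 2) < 2 * N%:R.
  have [N2|N2] := leP (N%:R - 2 : R) 0.
    by exists (r + 1); split; [lra|]; apply: le_lt_trans (_ : 0 < _); [rewrite mulr_ge0_le0//; lra|lra].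
  exists ((r + 2 * N%:R / (N%:R - 2)) / 2).
  have : r < 2 * N%:R / (N%:R - 2) by rewrite ltr_pdivlMr.
  have : 2 * N%:R / (N%:R - 2) * (N%:R - 2) = 2 * N%:R :> R by rewrite divfK ?gt_eqF.
  by move: (_ / (N%:R - 2)) => X h1 h2; split; nra.
have s2 : 2 <= s by lra.
have r2' := ltW r2.
have [C C0 sob] := sobolev N0 s2 sN.
pose T : R := (3 * C / eps) `^ (s - r)^-1.
have T0 : 0 < T by rewrite powR_gt0 ?divr_gt0 ?mulr_gt0.
have TE : T `^ (r - s) * C = eps / 3.
  rewrite -powRrM (_ : (s - r)^-1 * (r - s) = - 1); last by field; lra.
  rewrite powRN powRr1 ?divr_ge0 ?mulr_ge0 ?(ltW C0) ?(ltW e0)// invf_div; field; exact: lt0r_neq0.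
pose lam : R := (eps / 3) `^ (r - 2)^-1.
have lam0 : 0 < lam by rewrite powR_gt0 ?divr_gt0.
have lamE : lam `^ (r - 2) = eps / 3.
  by rewrite -powRrM mulVf ?powRr1 ?divr_ge0 ?ltW//; lra.
clearbody T lam.
have r20 : 0 <= r - 2 by lra.
have sr0 : 0 <= s - r by lra.
have D0 : 0 < 24 * T `^ (r - 2) * N%:R ^+ 2 by rewrite pmulr_lgt0 ?exprn_gt0// pmulr_lgt0 ?powR_gt0.
pose l := Num.sqrt (eps / (24 * T `^ (r - 2) * N%:R ^+ 2)).
have l0 : 0 < l by rewrite sqrtr_gt0 divr_gt0.
have lE : T `^ (r - 2) * (8 * (l ^+ 2 * N%:R ^+ 2)) = eps / 3.
  rewrite sqr_sqrtr ?divr_ge0 ?ltW//; field.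
  by rewrite !gt_eqF ?powR_gt0.
pose eta := lam ^+ 2 * l ^+ N / 8.
have eta0 : 0 < eta by rewrite divr_gt0 ?mulr_gt0 ?exprn_gt0.
exists l, eta; split => // u hu u1 ueta.
have {}lions : \int[mu]_x (\1_[set x | lam < `|u x|] x * u x ^+ 2) <= 8 * (l ^+ 2 * N%:R ^+ 2).
  apply: le_trans (lions_bound hu l0 lam0 ueta _) _.
    by apply: le_of_eq; rewrite /eta; field; rewrite gt_eqF.
  apply: ler_wpM2l => //; apply: ler_wpM2l; first exact: sqr_ge0.
  rewrite ler_piMr ?sqr_ge0//; apply: le_trans u1.
  by rewrite /hn lerDl; apply: int_ge0 => x; exact: sqr_ge0.
have Lu := H1_L2 hu; have [|Ls Is] := sob u 1 hu ler01 _.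
  by apply: le_trans u1 _; rewrite expr1n.
move: Is; rewrite powR1 mulr1 => Is.
have mS := measurable_gt_abs lam Lu.1.
have Li : L1 mu (fun x => \1_[set x | lam < `|u x|] x * u x ^+ 2).
  apply: L1_le Lu.2 => [|x]; first by apply: measurable_funM; [exact: measurable_indic|exact: L1_meas Lu.2].
  by rewrite indicE; case: (x \in _); rewrite ?mul1r ?mul0r ?normr0 ?ger0_norm ?sqr_ge0.
have [Cr _ sobr] := sobolev N0 r2' rN.
have [|Lr _] := sobr u 1 hu ler01 _; first by rewrite expr1n.
have pw x : `|u x| `^ r <= lam `^ (r - 2) * u x ^+ 2
    + (T `^ (r - 2) * (\1_[set x | lam < `|u x|] x * u x ^+ 2) + T `^ (r - s) * `|u x| `^ s).
  have [->|un] := eqVneq (u x) 0.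
    by rewrite normr0 powR0 ?gt_eqF ?expr0n ?mulr0 ?addr0 ?add0r ?mulr_ge0 ?powR_ge0//; lra.
  have p0 : 0 < `|u x| by rewrite normr_gt0.
  have e2 : `|u x| `^ r = `|u x| `^ (r - 2) * u x ^+ 2.
    by rewrite -sqr_normr -powR_mulrn// -powR_pos_add// subrK.
  have es : `|u x| `^ r = `|u x| `^ (r - s) * `|u x| `^ s by rewrite -powR_pos_add// subrK.
  have i0 : 0 <= \1_[set x | lam < `|u x|] x :> R by [].
  have X1 : 0 <= lam `^ (r - 2) * u x ^+ 2 by rewrite mulr_ge0 ?powR_ge0 ?sqr_ge0.
  have X2 : 0 <= T `^ (r - 2) * (\1_[set x | lam < `|u x|] x * u x ^+ 2).
    by rewrite mulr_ge0 ?powR_ge0// mulr_ge0 ?sqr_ge0.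
  have X3 : 0 <= T `^ (r - s) * `|u x| `^ s by rewrite mulr_ge0 ?powR_ge0.
  have [ul|ul] := leP `|u x| lam.
    apply: (@le_trans _ _ (lam `^ (r - 2) * u x ^+ 2)); last by rewrite lerDl addr_ge0.
    rewrite e2; apply: ler_wpM2r; first exact: sqr_ge0.
    by apply: ge0_ler_powR; rewrite ?nnegrE ?(ltW lam0) ?(ltW T0)//.
  move: X2; have -> : \1_[set x | lam < `|u x|] x = 1 :> R by rewrite indicE mem_set.
  rewrite mul1r => X2.
  have [uT|uT] := leP `|u x| T.
    apply: (@le_trans _ _ (T `^ (r - 2) * u x ^+ 2)); last by rewrite addrCA lerDl addr_ge0.
    rewrite e2; apply: ler_wpM2r; first exact: sqr_ge0.
    by apply: ge0_ler_powR; rewrite ?nnegrE ?(ltW lam0) ?(ltW T0)//.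
  apply: (@le_trans _ _ (T `^ (r - s) * `|u x| `^ s)); last by rewrite addrA lerDr addr_ge0.
  rewrite es; apply: ler_wpM2r; first exact: powR_ge0.
  rewrite -(opprB s r) !powRN lef_pV2 ?posrE ?powR_gt0//.
  by apply: ge0_ler_powR; rewrite ?nnegrE ?(ltW T0) ?(ltW uT)//.
have L12 := L1D (L1Z (T `^ (r - 2)) Li) (L1Z (T `^ (r - s)) Ls).
apply: le_trans (int_le Lr (L1D (L1Z (lam `^ (r - 2)) Lu.2) L12) pw) _.
rewrite intD//; [|exact: L1Z Lu.2].
rewrite intD//; [|exact: L1Z Li|exact: L1Z Ls].
rewrite !intZ//; last exact: Lu.2.
have u2 : \int[mu]_x u x ^+ 2 <= 1 by apply: le_trans u1; rewrite /hn lerDr dir_ge0.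
have t1 : lam `^ (r - 2) * \int[mu]_x u x ^+ 2 <= eps / 3 by rewrite lamE ler_piMr// divr_ge0// ltW.
have t2 : T `^ (r - 2) * \int[mu]_x (\1_[set x | lam < `|u x|] x * u x ^+ 2) <= eps / 3.
  by rewrite -lE ler_wpM2l ?powR_ge0.
have t3 : T `^ (r - s) * \int[mu]_x (`|u x| `^ s) <= eps / 3 by rewrite -TE ler_wpM2l ?powR_ge0.
lra.
Qed.

End sobolev.

(** Along one ultrafilter all the bounded sequences converge at once, so no nested subsequences are
    formed: the indices j with |c m j - L m| <= 2^-n for every m <= n belong to the ultrafilter and
    occur beyond any given index. *)
Lemma diagonal_subsequence {R : realType} (c : nat -> nat -> R) (M : nat -> R) :
  (forall m n, `|c m n| <= M m) ->
  exists psi : nat -> nat, (forall n, (psi n < psi n.+1)%N) /\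
    forall m, exists l : R, c m (psi n) @[n --> \oo] --> l.
Proof.
move=> cM; have [U [UU ooU]] := ultraFilterLemma (@eventually_filter).
have lim m : exists l : R, c m n @[n --> U] --> l.
  have := @segment_compact R (- M m) (M m); move=> /(_ (c m @ U) _ _)[|l [_ cl]].
    rewrite /fmap/= (_ : _ @^-1` _ = setT); first exact: filterT.
    by apply/seteqP; split => // n _; rewrite /= in_itv/= -ler_norml.
  exists l; apply/cvgrPdist_lt => e e0.
  have [//|] := @in_ultra_setVsetC _ U [set n | `|l - c m n| < e] _.
  move=> Un; have := cl (c m @` ~` [set n | `|l - c m n| < e]) (ball l e).
  have [||_ [[n ne <-]]] := cl (c m @` ~` [set n | `|l - c m n| < e]) (ball l e).
  - by rewrite /fmap/=; apply: filterS Un => n nn; exists n.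
  - exact: nbhsx_ballx.
  by rewrite /ball/= => /ne.
have [L cL] := choice lim.
have near_ n k : exists j : nat, (k < j)%N /\ forall m, (m <= n)%N -> `|c m j - L m| <= 2^-1 ^+ n.
  have : U [set j | (k < j)%N /\ forall m, (m <= n)%N -> `|c m j - L m| <= 2^-1 ^+ n].
    apply: filterI; first by apply: ooU; exists k.+1.
    suff h p : U [set j | forall m, (m < p)%N -> `|c m j - L m| <= 2^-1 ^+ n] by exact: (h n.+1).
    elim: p => [|p IH]; first by apply: filterS (@filterT _ U _).
    have e0 : 0 < (2^-1 : R) ^+ n by rewrite exprn_gt0 ?invr_gt0.
    have /cvgrPdist_le/(_ _ e0) := cL p; apply: filterS2 IH => j hj hp m.
    by rewrite ltnS leq_eqVlt => /orP[/eqP->|/hj//]; rewrite distrC.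
  by move/filter_ex => [j hj]; exists j.
have [nxt nxtP] : exists f : nat -> nat -> nat, forall n k, (k < f n k)%N /\
    forall m, (m <= n)%N -> `|c m (f n k) - L m| <= 2^-1 ^+ n.
  have /choice[f fP] : forall nk : nat * nat, exists j : nat, (nk.2 < j)%N /\
      forall m, (m <= nk.1)%N -> `|c m j - L m| <= 2^-1 ^+ nk.1 by move=> [n k]; exact: near_.
  by exists (fun n k => f (n, k)) => n k; exact: fP (n, k).
pose psi := fix psi n := if n is k.+1 then nxt n (psi k) else nxt 0%N 0%N.
exists psi; split=> [n|m]; first exact: (nxtP n.+1 (psi n)).1.
exists (L m); have psiP n : (m <= n)%N -> `|c m (psi n) - L m| <= 2^-1 ^+ n.
  by case: n => [|n] mn; exact: (nxtP _ _).2.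
apply/cvgrPdist_le => e e0.
have /cvgrPdist_le/(_ _ e0)[K _ KP] : (2^-1 : R) ^+ n @[n --> \oo] --> 0.
  by apply: cvg_expr; rewrite ger0_norm ?invr_ge0// invf_lt1// ltr1n.
exists (maxn m K) => // n /=; rewrite geq_max => /andP[mn Kn]; rewrite distrC.
apply: le_trans (psiP n mn) _; have := KP n Kn.
by rewrite sub0r normrN ger0_norm// exprn_ge0 ?invr_ge0.
Qed.

(** * Exponential weights *)

Section barrier.
Context {R : realType} {N : nat}.
Local Notation E := 'rV[R]_N.
Local Notation mu := (@lebesgue_rV R N).
Implicit Types (x y : E) (i : 'I_N) (d t : R).

Definition nrm1 x : R := \sum_i `|x ord0 i|.

(** One family for several ends: d = 1 gives the weight that localises L^2 convergence and an
    explicit positive element of H^1, d = 1/4 the cutoff of the positivity argument, small d the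
    barrier for decay. *)
Definition bar d x : R := expR (- (d * nrm1 x)).

Lemma nrm1_ge0 x : 0 <= nrm1 x. Proof. exact: sumr_ge0. Qed.

Lemma nrm1D x y : nrm1 (x + y) <= nrm1 x + nrm1 y.
Proof. by rewrite -big_split/=; apply: ler_sum => i _; rewrite mxE ler_normD. Qed.

Lemma nrm1N x : nrm1 (- x) = nrm1 x.
Proof. by apply: eq_bigr => i _; rewrite mxE normrN. Qed.

Lemma nrm1_unitv t i : nrm1 (t *: unitv i) = `|t|.
Proof.
rewrite /nrm1 (bigD1 i)//= big1 ?addr0 => [|j ji]; rewrite !mxE !eqxx/=.
  by rewrite mulr1.
by rewrite (negbTE ji) mulr0 normr0.
Qed.

Lemma bar_gt0 d x : 0 < bar d x. Proof. exact: expR_gt0. Qed.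

Lemma bar_ge0 d x : 0 <= bar d x. Proof. exact: expR_ge0. Qed.

Lemma bar_le1 d x : 0 <= d -> bar d x <= 1.
Proof. by move=> d0; rewrite -expR0 ler_expR oppr_le0 mulr_ge0// nrm1_ge0. Qed.

Lemma measurable_bar d : meas (bar d).
Proof.
apply: (@measurableT_comp _ _ _ _ _ _ expR) => //; apply: measurable_funN.
apply: measurable_funM => //; apply: measurable_sum => i.
by apply: measurableT_comp => //; exact: measurable_coor.
Qed.

Lemma bar_sqr d x : bar d x ^+ 2 = bar (2 * d) x.
Proof. by rewrite -expRM_natl /bar; congr expR; rewrite /=; ring. Qed.

Lemma bar_harnack d x y : 0 <= d -> bar d (x + y) <= expR (d * nrm1 y) * bar d x.
Proof.
move=> d0; rewrite -expRD ler_expR.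
have := ler_wpM2l d0 (nrm1D (x + y) (- y)); rewrite addrK nrm1N; lra.
Qed.

(** On the j-th shell the volume (2(j+1))^N meets exp(-dj). Half of the exponential absorbs the
    volume, by 1 + x <= exp(x) at x = d(j+1)/(2N), raised to the power N. *)
Lemma L1_bar d : (0 < N)%N -> 0 < d -> L1 mu (bar d).
Proof.
move=> N0 d0; have NR : 0 < N%:R :> R by rewrite ltr0n.
pose S (j : nat) := cube (\row_(i < N) (- j.+1%:R) : E) (2 * j.+1%:R).
have l0 (j : nat) : 0 <= 2 * j.+1%:R :> R by rewrite mulr_ge0.
have h2 : 0 < d / 2 by rewrite divr_gt0.
have [] // := @shell_L1 _ _ _ mu (bar d) S (fun j => expR (- (d * j%:R))) (fun j => (2 * j.+1%:R) ^+ N)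
  ((4 * N%:R / d) ^+ N * expR (d / 2)) (expR (- (d / 2))).
- exact: measurable_bar.
- by move=> x; exact: bar_ge0.
- by move=> j; exact: measurable_cube.
- by move=> j; apply: le_of_eq; exact: lebesgue_rV_cube.
- move=> x _; exists (Num.truncn (nrm1 x)).
    move=> i; have xi : `|x ord0 i| <= nrm1 x.
      by rewrite /nrm1 (bigD1 i)//= lerDl sumr_ge0.
    have := le_lt_trans xi (truncnS_gt (nrm1 x)); rewrite mxE ltr_norml => /andP[]; lra.
  rewrite ler_expR lerN2 ler_wpM2l ?(ltW d0)//.
  by have /andP[] := truncn_itv (nrm1_ge0 x).
- by rewrite expR_ge0 expR_lt1; lra.
move=> j; rewrite -expRM_natl -[leRHS]mulrA -expRD.
have -> : d / 2 + j%:R * - (d / 2) = - (d * j%:R) + d / 2 * j.+1%:R.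
  by rewrite -natr1; field.
rewrite expRD [leRHS]mulrCA ler_wpM2l ?expR_ge0//.
have -> : expR (d / 2 * j.+1%:R) = expR (d / 2 * j.+1%:R / N%:R) ^+ N.
  by rewrite -expRM_natl mulrCA divff ?mulr1// gt_eqF.
rewrite -exprMn; apply: lerXn2r; rewrite ?nnegrE ?mulr_ge0 ?expR_ge0 ?divr_ge0 ?invr_ge0 ?(ltW d0)//.
apply: (@le_trans _ _ (4 * N%:R / d * (d / 2 * j.+1%:R / N%:R))).
  by apply: le_of_eq; field; apply/andP; split; lra.
rewrite ler_wpM2l ?mulr_ge0 ?divr_ge0 ?invr_ge0 ?(ltW d0)//.
by apply: le_trans (expR_ge1Dx _); rewrite lerDr.
Qed.

Lemma L2_bar d : (0 < N)%N -> 0 < d -> L2 mu (bar d).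
Proof.
move=> N0 d0; split; first exact: measurable_bar.
by rewrite (_ : (fun _ => _) = bar (2 * d)); [apply: L1_bar => //; rewrite mulr_gt0|apply/funext => x; exact: bar_sqr].
Qed.

Lemma bar_diff d x y : 0 <= d -> `|bar d (x + y) - bar d x| <= (expR (d * nrm1 y) - 1) * bar d x.
Proof.
move=> d0; have h1 := bar_harnack x y d0.
have h2 : bar d x <= expR (d * nrm1 y) * bar d (x + y).
  by have := bar_harnack (x + y) (- y) d0; rewrite addrK nrm1N.
have e1 : 1 <= expR (d * nrm1 y) by rewrite -expR0 ler_expR mulr_ge0// nrm1_ge0.
have b0 := bar_gt0 d x; rewrite ler_norml; apply/andP; split; last by lra.
move: (expR _) (bar d (x + y)) (bar_gt0 d (x + y)) h1 h2 e1 => e b bp h1 h2 e1; nra.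
Qed.

Lemma bar_dq i d t x : 0 <= d -> 0 < t <= 1 -> `|dq i t (bar d) x| <= d * expR d * bar d x.
Proof.
move=> d0 /andP[t0 t1]; rewrite /dq normrM gtr0_norm ?invr_gt0// ler_pdivrMl//.
apply: le_trans (bar_diff _ _ d0) _; rewrite nrm1_unitv gtr0_norm// mulrA ler_wpM2r ?bar_ge0//.
have h := expR_ge1Dx (- (d * t)).
have e : expR (d * t) * expR (- (d * t)) = 1 by rewrite -expRD subrr expR0.
have e0 : 0 < expR (d * t) by exact: expR_gt0.
have le : expR (d * t) <= expR d by rewrite ler_expR ler_piMr.
have td : 0 <= t * d by rewrite mulr_ge0 // ltW.
apply: (@le_trans _ _ (t * d * expR (d * t))); last by rewrite -mulrA ler_wpM2l ?(ltW t0)// ler_wpM2l.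
move: (expR (d * t)) (expR (- _)) h e e0 => a b h e a0; nra.
Qed.

Lemma H1_bar d : (0 < N)%N -> 0 < d -> H1 (bar d).
Proof.
move=> N0 d0; have Lb := L2_bar N0 d0; apply: H1_intro => // i.
exists (n2 mu (fun x => d * expR d * bar d x)) => n.
apply: n2_le; [exact: (L2_dq _ _ Lb).1| |exact: L2Z].
by move=> x; apply: bar_dq; [exact: ltW|exact: tn_itv].
Qed.

End barrier.

(** * Dyadic cells and means *)

Section cells.
Context {R : realType} {N : nat}.
Local Notation E := 'rV[R]_N.
Local Notation mu := (@lebesgue_rV R N).
Implicit Types (u f g : E -> R) (x y : E) (i : 'I_N) (k : nat).

Definition corner k (c : 'rV[int]_N) : E := \row_i ((c ord0 i)%:~R * tn k).

Definition cell k c : set E := cube (corner k c) (tn k).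

Definition grid k x : 'rV[int]_N := \row_i Num.floor (x ord0 i / tn k).

Lemma cellP k c x : cell k c x <-> grid k x = c.
Proof.
have t0 := tn_gt0 (R := R) k; split => [cx|<- i]; last first.
  rewrite !mxE; have /andP[h1 h2] := mem_rg1_floor (x ord0 i / tn k).
  move: h1 h2; rewrite ler_pdivlMr// ltr_pdivrMr// => -> /=; rewrite mulrDl mul1r => ->//.
apply/rowP => i; rewrite mxE; apply: floor_def.
have := cx i; rewrite mxE => /andP[h1 h2].
by rewrite ler_pdivlMr// h1 ltr_pdivrMr//= intrD mulrDl mul1r.
Qed.

Lemma L1_cell k c : L1 mu (\1_(cell k c) : E -> R).
Proof.
have t0 := ltW (tn_gt0 (R := R) k).
apply: L1_indic; first exact: measurable_cube.
apply: (@le_lt_trans _ _ ((tn k ^+ N)%:E)); last exact: ltry.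
by apply: le_of_eq; exact: lebesgue_rV_cube.
Qed.

Lemma int_cell k c : \int[mu]_x (\1_(cell k c) x : R) = tn k ^+ N.
Proof.
have t0 := ltW (tn_gt0 (R := R) k).
apply: EFin_inj; rewrite EFin_int; last exact: L1_cell.
rewrite integral_indic//; last exact: measurable_cube.
by rewrite setIT; exact: lebesgue_rV_cube.
Qed.

Lemma L2_cell k c : L2 mu (\1_(cell k c) : E -> R).
Proof.
split; first by apply: measurable_indic; exact: measurable_cube.
rewrite (_ : (fun _ => _) = \1_(cell k c)); first exact: L1_cell.
by apply/funext => x; rewrite indicE; case: (_ \in _); rewrite ?expr1n ?expr0n.
Qed.

Definition cell_mean k u (c : 'rV[int]_N) : R := (tn k ^+ N)^-1 * \int[mu]_y (\1_(cell k c) y * u y).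

Definition gridmean k u x : R := cell_mean k u (grid k x).

Lemma measurable_grid k (F : 'rV[int]_N -> R) : meas (fun x => F (grid k x)).
Proof.
move=> _ Y mY; rewrite setTI.
rewrite (_ : _ @^-1` Y = \bigcup_(c in [set c | Y (F c)]) cell k c); last first.
  apply/seteqP; split => x /= => [Yx|[c Yc /cellP gc]]; last by rewrite /= gc.
  by exists (grid k x) => //; exact/cellP.
rewrite bigcup_mkcond; apply: countable_bigcupT_measurable => [|c]; first exact: countableP.
by case: ifP => // _; exact: measurable_cube.
Qed.

Lemma cell_mul_L1 k c u : L2 mu u -> L1 mu (fun y => \1_(cell k c) y * u y).
Proof. by move=> Lu; apply: L2_mul => //; exact: L2_cell. Qed.

Lemma cell_mean_sqr k c u : L2 mu u ->
  cell_mean k u c ^+ 2 <= (tn k ^+ N)^-1 * \int[mu]_y (\1_(cell k c) y * u y ^+ 2).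
Proof.
move=> Lu; have t0 : 0 < tn k ^+ N :> R by rewrite exprn_gt0// tn_gt0.
have Lc := L2_cell k c.
have L1u : L2 mu (fun y => \1_(cell k c) y * u y).
  apply: L2_le (L2_abs Lu); first by apply: measurable_funM; [exact: Lc.1|exact: Lu.1].
  by move=> x; rewrite indicE; case: (_ \in _); rewrite ?mul1r ?mul0r ?normr0.
have CS := cauchy_schwarz Lc L1u.
have e1 : \int[mu]_y (\1_(cell k c) y * (\1_(cell k c) y * u y)) = \int[mu]_y (\1_(cell k c) y * u y).
  by apply: eq_Rintegral => y _; rewrite indicE; case: (_ \in _); rewrite ?mul1r ?mul0r.
have e2 : \int[mu]_y (\1_(cell k c) y * u y) ^+ 2 = \int[mu]_y (\1_(cell k c) y * u y ^+ 2).
  by apply: eq_Rintegral => y _; rewrite indicE; case: (_ \in _); rewrite ?mul1r ?mul0r ?expr0n.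
have e3 : \int[mu]_y (\1_(cell k c) y) ^+ 2 = tn k ^+ N :> R.
  by rewrite -(int_cell k c); apply: eq_Rintegral => y _; rewrite indicE; case: (_ \in _); rewrite ?expr1n ?expr0n.
have CS2 : (\int[mu]_y (\1_(cell k c) y * u y)) ^+ 2 <= tn k ^+ N * \int[mu]_y (\1_(cell k c) y * u y ^+ 2).
  rewrite -e1 -e2 -e3 -sqr_normr -!sqr_n2 -exprMn.
  by apply: lerXn2r => //; rewrite nnegrE mulr_ge0 ?n2_ge0.
rewrite /cell_mean exprMn expr2 -mulrA ler_pM2l ?invr_gt0// ler_pdivrMl//.
Qed.

(** Poincare's inequality on a grid. By Cauchy-Schwarz the squared deviation at x is at most the
    mean over its cell of (u(y) - u(x))^2, and y - x ranges in a cube of twice the side about 0,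
    whence the factor 2^N. *)
Lemma gridmean_sqr k u : H1 u ->
  L1 mu (fun x => (u x - gridmean k u x) ^+ 2) /\
  \int[mu]_x (u x - gridmean k u x) ^+ 2 <= 2 ^+ N * (tn k ^+ 2 * (N%:R ^+ 2 * dir u u)).
Proof.
move=> hu; have Lu := H1_L2 hu; have t0 := tn_gt0 (R := R) k.
have tN : 0 < tn k ^+ N :> R by rewrite exprn_gt0.
set a : E := \row_i - tn k.
have mg := measurable_grid k (cell_mean k u).
apply/L1_ge0_le => [|x|]; [by apply: measurable_funX; apply: measurable_funB => //; exact: Lu.1|exact: sqr_ge0|].
pose F x := (\int[mu]_y (\1_(cube a (2 * tn k)) y * (u (x + y) - u x) ^+ 2)%:E)%E.
have mF : meas F.
  pose f (xy : E * E) := (\1_(cube a (2 * tn k)) xy.2 * (u (xy.1 + xy.2) - u xy.1) ^+ 2)%:E.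
  apply: (@measurable_fun_fubini_tonelli_F _ _ _ _ _ mu f) => [|xy].
    apply/measurable_EFinP; apply: measurable_funM.
      by apply: (@measurableT_comp _ _ _ _ _ _ (\1_(cube a (2 * tn k)) : E -> R)) => //; apply: measurable_indic; exact: measurable_cube.
    apply: measurable_funX; apply: measurable_funB.
      by apply: (@measurableT_comp _ _ _ _ _ _ u _ _ Lu.1); exact: measurable_addr2.
    by apply: (@measurableT_comp _ _ _ _ _ _ u _ _ Lu.1).
  by rewrite lee_fin mulr_ge0 ?sqr_ge0.
have F0 x : (0 <= F x)%E by apply: integral_ge0 => y _; rewrite lee_fin mulr_ge0 ?sqr_ge0.
apply: (@le_trans _ _ (\int[mu]_x ((tn k ^+ N)^-1%:E * F x))%E); last first.
  rewrite ge0_integralZl_EFin ?invr_ge0 ?(ltW tN)//.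
  have ya y : cube a (2 * tn k) y -> forall i, `|y ord0 i| <= tn k.
    move=> yc i; have := yc i; rewrite mxE => /andP[h1 h2]; rewrite ler_norml; apply/andP; split; lra.
  have h := @osc_upper _ _ u a (2 * tn k) (tn k) hu _ (ltW t0) ya.
  apply: le_trans (lee_wpmul2l _ (h _)) _; [by rewrite lee_fin invr_ge0 ltW|by rewrite mulr_ge0// ltW|].
  rewrite -EFinM lee_fin exprMn !mulrA; apply: le_of_eq.
  by rewrite -!mulrA; field; rewrite gt_eqF.
apply: ge0_le_integral => //.
- by move=> x _; rewrite lee_fin sqr_ge0.
- by apply/measurable_EFinP; apply: measurable_funX; apply: measurable_funB => //; exact: Lu.1.
- exact: measurable_funeM.
move=> x _; set c := grid k x; have cx : cell k c x by exact/cellP.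
pose g y : R := \1_(cell k c) y * (u y - u x).
have Lc := L2_cell k c.
have Lg : L2 mu g.
  have := L2B (L2_le (f := fun y => \1_(cell k c) y * u y) _ _ (L2_abs Lu)) (L2Z (u x) Lc).
  rewrite (_ : (fun _ => _ - _) = g); last by apply/funext => y; rewrite /g; ring.
  apply; first by apply: measurable_funM; [exact: Lc.1|exact: Lu.1].
  by move=> y; rewrite indicE; case: (_ \in _); rewrite ?mul1r ?mul0r ?normr0.
have em : cell_mean k g c = gridmean k u x - u x.
  rewrite /gridmean -/c /cell_mean.
  rewrite (_ : (fun y => \1_(cell k c) y * g y) = fun y => \1_(cell k c) y * u y - u x * \1_(cell k c) y); last first.
    by apply/funext => y; rewrite /g indicE; case: (_ \in _); rewrite /=; ring.
  rewrite intB ?intZ ?int_cell; [|exact: L1_cell|exact: cell_mul_L1|by apply: L1Z; exact: L1_cell].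
  by field; rewrite gt_eqF.
have h := cell_mean_sqr k c Lg; rewrite em -[X in X <= _]sqrrN opprB in h.
have Lg2 : L1 mu (fun y => \1_(cell k c) y * g y ^+ 2).
  rewrite (_ : (fun _ => _) = fun y => g y ^+ 2); first exact: Lg.2.
  by apply/funext => y; rewrite /g indicE; case: (_ \in _); rewrite ?mul1r ?mul0r ?expr0n.
apply: le_trans (_ : ((tn k ^+ N)^-1 * \int[mu]_y (\1_(cell k c) y * g y ^+ 2))%:E <= _)%E.
  by rewrite lee_fin; exact: h.
rewrite EFinM; apply: lee_wpmul2l; first by rewrite lee_fin invr_ge0 ltW.
rewrite -(int_shift x Lg2) EFin_int; last exact: (L1_shift x Lg2).
apply: ge0_le_integral => //.
- by move=> y _; rewrite lee_fin mulr_ge0 ?sqr_ge0.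
- by apply/measurable_EFinP; exact: L1_meas (L1_shift x Lg2).
- apply/measurable_EFinP; apply: measurable_funM; first by apply: measurable_indic; exact: measurable_cube.
  by apply: measurable_funX; apply: measurable_funB => //; exact: measurable_shiftl Lu.1.
move=> y _; rewrite lee_fin /g !indicE.
have [|_] := boolP (y + x \in _); last by rewrite mul0r mulr_ge0 ?sqr_ge0.
rewrite inE => yx; rewrite !mul1r [y + x]addrC mem_set ?mul1r// => i.
have := yx i; have := cx i; rewrite !mxE => /andP[h1 h2] /andP[h3 h4]; apply/andP; split; lra.
Qed.

End cells.

(** * Local compactness of bounded sequences in H^1 *)

Section rellich.
Context {R : realType} {N : nat}.
Local Notation E := 'rV[R]_N.
Local Notation mu := (@lebesgue_rV R N).
Implicit Types (u z f g : E -> R) (x y : E) (i : 'I_N) (t l r s : R) (k : nat).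

Lemma ae_shift (P : E -> Prop) (a : E) : {ae mu, forall x, P x} -> {ae mu, forall x, P (x + a)}.
Proof.
move=> [A [mA A0 PA]]; exists [set x | A (x + a)]; split.
- by rewrite -[X in measurable X]setTI; exact: measurable_shift.
- by rewrite -[RHS]A0; exact: lebesgue_rV_shift.
- by move=> x /= nP; apply: PA.
Qed.

Lemma hn_L2 u C : H1 u -> hn u <= C -> \int[mu]_x u x ^+ 2 <= C.
Proof. by move=> hu; apply: le_trans; rewrite /hn lerDr dir_ge0. Qed.

Lemma hn_dir u C : H1 u -> hn u <= C -> dir u u <= C.
Proof.
by move=> hu; apply: le_trans; rewrite /hn lerDl; apply: int_ge0 => x; exact: sqr_ge0.
Qed.

(** Fatou's lemma, for the squares of the functions and of each of their difference quotients, feeds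
    the difference quotient criterion. *)
Lemma H1_limit (v_ : nat -> E -> R) u C : (forall n, H1 (v_ n)) -> (forall n, hn (v_ n) <= C) ->
  meas u -> {ae mu, forall x, v_ n x @[n --> \oo] --> u x} -> H1 u.
Proof.
move=> hv vC mu' vu; have C0 : 0 <= C := le_trans (hn_ge0 (hv 0%N)) (vC 0%N).
have Lv n := H1_L2 (hv n).
have cvg_sqr (a : nat -> R) (b : R) : a n @[n --> \oo] --> b -> a n ^+ 2 @[n --> \oo] --> b ^+ 2.
  by move=> ab; rewrite expr2; under eq_cvg do rewrite expr2; exact: cvgM.
have Lu : L2 mu u.
  split => //; have [] // := @L1_fatou _ _ _ mu (fun n x => v_ n x ^+ 2) (fun x => u x ^+ 2) C.
  - by move=> n; exact: (Lv n).2.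
  - exact: measurable_funX.
  - by move=> n x; exact: sqr_ge0.
  - by move=> n; exact: hn_L2.
  - by move=> x; exact: sqr_ge0.
  by apply: filterS vu => x; exact: cvg_sqr.
apply: H1_intro => // i; exists (Num.sqrt C) => n.
have Ld f : L2 mu f -> L2 mu (dq i (tn n) f) by exact: L2_dq.
have [||||||_ I] := @L1_fatou _ _ _ mu (fun m x => dq i (tn n) (v_ m) x ^+ 2) (fun x => dq i (tn n) u x ^+ 2) C.
- by move=> m; exact: (Ld _ (Lv m)).2.
- exact: L1_meas (Ld _ Lu).2.
- by move=> m x; exact: sqr_ge0.
- move=> m; rewrite -sqr_n2; apply: le_trans (hn_dir (hv m) (vC m)).
  apply: le_trans (n2_wd_le i (v_ m)); apply: lerXn2r; rewrite ?nnegrE ?n2_ge0//.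
  by apply: dq_wd_le => //; exact: tn_gt0.
- by move=> x; exact: sqr_ge0.
- apply: filterS2 vu (ae_shift (tn n *: unitv i) vu) => x h1 h2; apply: cvg_sqr.
  by apply: cvgM; [exact: cvg_cst|exact: cvgB].
by rewrite /n2 ler_wsqrtr.
Qed.

Lemma sqr3_le (a b c : R) : (a + b + c) ^+ 2 <= 3 * (a ^+ 2 + b ^+ 2 + c ^+ 2).
Proof. by have := sqr_ge0 (a - b); have := sqr_ge0 (a - c); have := sqr_ge0 (b - c); nra. Qed.

(** For the Cauchy estimate: p and q are values of two functions of the sequence, r and s of their
    grid means, t of the common limit of these means, and b is the weight. *)
Lemma five_term (b p q r s t : R) : 0 <= b <= 1 -> (b * p - b * q) ^+ 2 <=
  3 * ((p - r) ^+ 2 + (q - s) ^+ 2) + 6 * ((b * r - b * t) ^+ 2 + (b * s - b * t) ^+ 2).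
Proof.
move=> /andP[b0 bb]; have h := sqr3_le (b * (p - r)) (b * (s - q)) (b * (r - s)).
have -> : b * p - b * q = b * (p - r) + b * (s - q) + b * (r - s) by ring.
apply: le_trans h _.
have bsq (c : R) : (b * c) ^+ 2 <= c ^+ 2 by rewrite exprMn ler_piMl ?sqr_ge0// expr_le1.
have h1 := bsq (p - r); have h2 := bsq (s - q).
have h3 : (s - q) ^+ 2 = (q - s) ^+ 2 by ring.
have h4 : (b * (r - s)) ^+ 2 <= 2 * ((b * r - b * t) ^+ 2 + (b * s - b * t) ^+ 2).
  have -> : b * (r - s) = (b * r - b * t) - (b * s - b * t) by ring.
  by move: (b * r - b * t) (b * s - b * t) => X Y; have := sqr_ge0 (X + Y); clear; nra.
move: h1 h2 h3 h4; clear; lra.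
Qed.

(** Cell means are bounded and there are countably many cells, so a diagonal subsequence makes all
    means converge. At a fixed scale the grid means then converge in the weighted L^2 space by
    domination, and by [gridmean_sqr] they are uniformly close to the functions; hence the
    subsequence is Cauchy there. *)
Theorem rellich (u_ : nat -> E -> R) (C : R) : (0 < N)%N -> (forall n, H1 (u_ n)) -> (forall n, hn (u_ n) <= C) ->
  exists u (psi : nat -> nat), [/\ H1 u, (forall n, psi n < psi n.+1)%N,
    {ae mu, forall x, u_ (psi n) x @[n --> \oo] --> u x} &
    \int[mu]_x (bar 1 x ^+ 2 * (u_ (psi n) x - u x) ^+ 2) @[n --> \oo] --> 0].
Proof.
move=> N0 hu uC; have C0 : 0 <= C := le_trans (hn_ge0 (hu 0%N)) (uC 0%N).
have Lu n := H1_L2 (hu n).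
have n2u n : n2 mu (u_ n) <= Num.sqrt C by rewrite ler_wsqrtr//; exact: hn_L2.
have mean_le k (z : 'rV[int]_N) n : `|\int[mu]_y (\1_(cell k z) y * u_ n y)| <= n2 mu (\1_(cell k z)) * Num.sqrt C.
  by apply: le_trans (cauchy_schwarz (L2_cell k z) (Lu n)) _; apply: ler_wpM2l => //; exact: n2_ge0.
(* [unpickle] numbers the pairs of a scale and a cell; all other numbers carry the value 0. *)
pose c m n := if unpickle m is Some (k, z) then \int[mu]_y (\1_(cell k z) y * u_ n y) else 0.
pose M m := if unpickle m is Some (k, z) then n2 mu (\1_(cell k z)) * Num.sqrt C else 0.
have cM m n : `|c m n| <= M m by rewrite /c /M; case: unpickle => [[k z]|]; [exact: mean_le|rewrite normr0].
have [psi0 [psi0S psi0P]] := diagonal_subsequence cM.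
pose v_ n := u_ (psi0 n).
have Lv n : L2 mu (v_ n) by exact: Lu.
have mean_cvg k (z : 'rV[int]_N) : exists l : R, cell_mean k (v_ n) z @[n --> \oo] --> l.
  have [l] := psi0P (pickle (k, z)); rewrite /c pickleK => hl.
  by exists ((tn k ^+ N)^-1 * l); apply: cvgM => //; exact: cvg_cst.
have bm := @measurable_bar R N 1; have Lb : L2 mu (bar 1 : E -> R) by exact: L2_bar.
pose f_ n x := bar 1 x * v_ n x.
have b1 x : `|bar 1 x| <= 1 by rewrite ger0_norm ?bar_ge0// bar_le1.
have Lmul g : L2 mu g -> L2 mu (fun x => bar 1 x * g x).
  move=> Lg; apply: L2_le (L2_abs Lg) => [|x]; first by apply: measurable_funM => //; exact: Lg.1.
  by rewrite normrM ler_piMl.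
have Lf n : L2 mu (f_ n) by exact: Lmul.
have cauchy e : 0 < e -> exists M : nat, forall m n, (M <= m)%N -> (M <= n)%N ->
    \int[mu]_x (f_ m x - f_ n x) ^+ 2 <= e.
  move=> e0; pose D : R := 2 ^+ N * (N%:R ^+ 2 * C).
  have D0 : 0 <= D by rewrite mulr_ge0 ?exprn_ge0// mulr_ge0 ?exprn_ge0.
  (* The budget: [five_term] costs 3 times two grid errors, at most e/2 by this choice of scale, and
     6 times two errors e/24 of the means. *)
  have [k kP] : exists k, 3 * (2 * (tn k ^+ 2 * D)) <= e / 2.
    have /cvgn_leP/(_ (e / (12 * (D + 1))))[|k /(_ k (leqnn k))] := @tn_cvg R.
      by rewrite divr_gt0// mulr_gt0//; lra.
    rewrite subr0 ger0_norm ?(ltW (tn_gt0 _))// => kD; exists k.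
    have D1 : 0 < D + 1 by lra.
    have /andP[t0 t1] := tn_itv (R := R) k.
    rewrite ler_pdivlMr ?mulr_gt0// in kD.
    have tD : tn k ^+ 2 * D <= tn k * D by rewrite ler_wpM2r// expr2 ler_piMl// ltW.
    move: (tn k) (tn k ^+ 2) t0 tD kD => a b t0 tD kD; nra.
  have [F FP] := choice (mean_cvg k).
  pose G n x := gridmean k (v_ n) x.
  have mG n : meas (G n) by exact: (measurable_grid k (cell_mean k (v_ n))).
  have mFG : meas (fun x => F (grid k x)) by exact: measurable_grid.
  have [B BP] : exists B : R, forall n x, `|G n x| <= B.
    exists ((tn k ^+ N)^-1 * (Num.sqrt (tn k ^+ N) * Num.sqrt C)) => n x.
    rewrite /G /gridmean /cell_mean normrM ger0_norm ?invr_ge0 ?exprn_ge0 ?(ltW (tn_gt0 _))//.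
    apply: ler_wpM2l; first by rewrite invr_ge0 exprn_ge0 ?(ltW (tn_gt0 _)).
    apply: le_trans (mean_le _ _ _) _; apply: ler_wpM2r; first exact: sqrtr_ge0.
    rewrite /n2 -(int_cell k (grid k x)); apply: le_of_eq; congr Num.sqrt.
    by apply: eq_Rintegral => y _; rewrite indicE; case: (_ \in _); rewrite ?expr1n ?expr0n.
  have LBb : L2 mu (fun x => B * bar 1 x) by exact: L2Z.
  have bGB n x : `|bar 1 x * G n x| <= B * bar 1 x.
    by rewrite normrM ger0_norm ?bar_ge0// mulrC ler_wpM2r ?bar_ge0.
  have mbG n : meas (fun x => bar 1 x * G n x) by exact: measurable_funM.
  have e24 : 0 < e / 24 by rewrite divr_gt0.
  have [M1 M1P] : exists M1 : nat, forall n, (M1 <= n)%N ->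
      `|\int[mu]_x (bar 1 x * G n x - bar 1 x * F (grid k x)) ^+ 2 - 0| <= e / 24.
    have := @L2_dct _ _ _ mu (fun n x => bar 1 x * G n x) (fun x => bar 1 x * F (grid k x)) (fun x => B * bar 1 x)
      mbG (measurable_funM bm mFG) LBb.
    move=> h; apply: (cvgn_leP _ _).1 _ e24; apply: h.
      by apply: aeW => x n; exact: bGB.
    by apply: aeW => x; apply: cvgM; [exact: cvg_cst|exact: FP].
  exists M1 => m n /M1P hm /M1P hn'.
  have LF : L2 mu (fun x => bar 1 x * F (grid k x)).
    apply: L2_le LBb => [|x]; first exact: measurable_funM.
    rewrite normrM ger0_norm ?bar_ge0// mulrC ler_wpM2r ?bar_ge0//.
    have h : `|G n x| @[n --> \oo] --> `|F (grid k x)| by apply: cvg_norm; exact: FP.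
    by apply: (cvgn_le_cst h) => j; exact: BP.
  have LbG j : L2 mu (fun x => bar 1 x * G j x) by apply: L2_le LBb => //; exact: bGB.
  have LGF j := L2B (LbG j) LF.
  have Lr j : L1 mu (fun x => (v_ j x - G j x) ^+ 2) by have [] := gridmean_sqr k (hu (psi0 j)).
  have Ir j : \int[mu]_x (v_ j x - G j x) ^+ 2 <= tn k ^+ 2 * D.
    have [_ /le_trans] := gridmean_sqr k (hu (psi0 j)); apply.
    rewrite mulrCA; apply: ler_wpM2l; first exact: sqr_ge0.
    apply: ler_wpM2l; first exact: exprn_ge0.
    by apply: ler_wpM2l; [exact: sqr_ge0|exact: hn_dir].
  pose g1 x := (v_ m x - G m x) ^+ 2 + (v_ n x - G n x) ^+ 2.
  pose g2 x := (bar 1 x * G m x - bar 1 x * F (grid k x)) ^+ 2 + (bar 1 x * G n x - bar 1 x * F (grid k x)) ^+ 2.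
  have Lg1 : L1 mu g1 by exact: L1D.
  have Lg2 : L1 mu g2 by apply: L1D; [exact: (LGF m).2|exact: (LGF n).2].
  have pw x : (f_ m x - f_ n x) ^+ 2 <= 3 * g1 x + 6 * g2 x.
    rewrite /f_ /g1 /g2; apply: five_term; rewrite bar_ge0.
    by have := b1 x; rewrite ger0_norm ?bar_ge0.
  apply: le_trans (int_le (L2B (Lf m) (Lf n)).2 (L1D (L1Z 3 Lg1) (L1Z 6 Lg2)) pw) _.
  rewrite intD; [|exact: L1Z|exact: L1Z]; rewrite !intZ// intD// intD; [|exact: (LGF m).2|exact: (LGF n).2].
  have arith (X I1 I2 J1 J2 : R) : 3 * (2 * X) <= e / 2 -> J1 <= e / 24 -> J2 <= e / 24 ->
    I1 <= X -> I2 <= X -> 3 * (I1 + I2) + 6 * (J1 + J2) <= e by clear; lra.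
  have h1 := Ir m; have h2 := Ir n.
  rewrite subr0 in hm; rewrite subr0 in hn'.
  have {}hm := le_trans (ler_norm _) hm; have {}hn' := le_trans (ler_norm _) hn'.
  exact: (arith _ _ _ _ _ kP hm hn' h1 h2).
have [f [psi1 [Lff psi1S psi1ae psi1cvg]]] := L2_complete Lf cauchy.
pose u x := (bar 1 x)^-1 * f x.
have fE x : f x = bar 1 x * u x by rewrite /u mulrA divff ?mul1r// gt_eqF ?bar_gt0.
have mu' : meas u.
  apply: measurable_funM; last exact: Lff.1.
  rewrite (_ : (fun _ => _) = bar (-1)); first exact: measurable_bar.
  by apply/funext => x; rewrite -expRN /bar; congr expR; ring.
have vu : {ae mu, forall x, v_ (psi1 n) x @[n --> \oo] --> u x}.
  apply: filterS psi1ae => x h.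
  rewrite (_ : (fun n => v_ (psi1 n) x) = fun n => (bar 1 x)^-1 * f_ (psi1 n) x); last first.
    by apply/funext => n; rewrite /f_ mulrA mulVf ?mul1r// gt_eqF ?bar_gt0.
  by apply: cvgM => //; exact: cvg_cst.
have psiS (p : nat -> nat) (pS : forall n, (p n < p n.+1)%N) a b : (a < b)%N -> (p a < p b)%N.
  by elim: b => // b IH; rewrite ltnS leq_eqVlt => /orP[/eqP->//|/IH /ltn_trans]; apply.
exists u, (psi0 \o psi1); split => //=.
- by apply: (@H1_limit (v_ \o psi1) u C) => // n; [exact: hu|exact: uC].
- by move=> n; apply: psiS => //; exact: psi1S.
have psi1ge n : (n <= psi1 n)%N by elim: n => // n IH; exact: leq_ltn_trans IH (psi1S n).
apply/cvgn_leP => e e0; have /cvgn_leP/(_ e e0)[M1 M1P] := psi1cvg.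
exists M1 => n Mn; have := M1P (psi1 n) (leq_trans Mn (psi1ge n)).
rewrite (_ : \int[mu]_x (f_ (psi1 n) x - f x) ^+ 2 = \int[mu]_x (bar 1 x ^+ 2 * (u_ (psi0 (psi1 n)) x - u x) ^+ 2))//.
by apply: eq_Rintegral => x _; rewrite fE /f_ /v_; ring.
Qed.

End rellich.

(** * The Riesz kernel *)

Section young.
Context {R : realType} {N : nat}.
Local Notation E := 'rV[R]_N.
Local Notation mu := (@lebesgue_rV R N).
Local Notation pm := (mu \x mu)%E.
Implicit Types (f g k : E -> R) (x y : E) (a b s t r : R) (z : E * E).

Lemma measurable_subr2 : meas (fun z : E * E => z.1 - z.2).
Proof.
apply: measurable_fun_rV => i.
rewrite (_ : (fun _ => _) = fun z : E * E => z.1 ord0 i - z.2 ord0 i); last first.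
  by apply/funext => z; rewrite !mxE.
by apply: measurable_funB; apply: (@measurableT_comp _ _ _ _ _ _ (fun x : E => x ord0 i)) => //; exact: measurable_coor.
Qed.

Lemma measurable_p1 f : meas f -> meas (fun z : E * E => f z.1).
Proof. by move=> mf; exact: measurableT_comp. Qed.

Lemma measurable_p2 f : meas f -> meas (fun z : E * E => f z.2).
Proof. by move=> mf; exact: measurableT_comp. Qed.

Lemma measurable_psub k : meas k -> meas (fun z : E * E => k (z.1 - z.2)).
Proof. by move=> mk; apply: measurableT_comp => //; exact: measurable_subr2. Qed.

Lemma pm_swap (F : E * E -> R) : meas F -> (forall z, 0 <= F z) ->
  (\int[pm]_z (F (z.2, z.1))%:E = \int[pm]_z (F z)%:E)%E.
Proof.
move=> mF F0; have mF' : meas (fun z : E * E => F (z.2, z.1)).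
  by apply: (@measurableT_comp _ _ _ _ _ _ F) => //; exact: measurable_swap.
rewrite (@fubini_tonelli1 _ _ _ _ _ mu mu (fun z => (F (z.2, z.1))%:E)); [|exact/measurable_EFinP|by move=> z; rewrite lee_fin].
by rewrite (@fubini_tonelli2 _ _ _ _ _ mu mu (fun z => (F z)%:E)); [|exact/measurable_EFinP|by move=> z; rewrite lee_fin].
Qed.

Lemma L1_pm_swap (F : E * E -> R) : L1 pm F -> L1 pm (fun z => F (z.2, z.1)) /\
  \int[pm]_z F (z.2, z.1) = \int[pm]_z F z.
Proof.
move=> LF; have mF := L1_meas LF.
have mF' : meas (fun z : E * E => F (z.2, z.1)).
  by apply: (@measurableT_comp _ _ _ _ _ _ F) => //; exact: measurable_swap.
have sw (G : E * E -> R) : L1 pm G -> (forall z, 0 <= G z) -> L1 pm (fun z => G (z.2, z.1)) /\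
    \int[pm]_z G (z.2, z.1) = \int[pm]_z G z.
  move=> LG G0; have e := pm_swap (L1_meas LG) G0.
  have mG' : meas (fun z : E * E => G (z.2, z.1)).
    by apply: (@measurableT_comp _ _ _ _ _ _ G) => //; [exact: L1_meas LG|exact: measurable_swap].
  have [] : L1 pm (fun z => G (z.2, z.1)) /\ \int[pm]_z G (z.2, z.1) <= \int[pm]_z G z.
    by apply/L1_ge0_le => //; rewrite e -EFin_int.
  by move=> LG' _; split => //; apply: EFin_inj; rewrite !EFin_int.
pose P z := (`|F z| + F z) / 2; pose M z := (`|F z| - F z) / 2.
have h z : 0 <= P z /\ 0 <= M z.
  by rewrite /P /M; have := ler_norm (F z); have := ler_norm (- F z); rewrite normrN; split; lra.
have LP : L1 pm P.
  rewrite (_ : P = fun z => 2^-1 * (`|F z| + F z)); last by apply/funext => z; rewrite /P mulrC.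
  by apply: L1Z; apply: L1D => //; exact: L1_abs.
have LM : L1 pm M.
  rewrite (_ : M = fun z => 2^-1 * (`|F z| - F z)); last by apply/funext => z; rewrite /M mulrC.
  by apply: L1Z; apply: L1B => //; exact: L1_abs.
have [LP' eP] := sw P LP (fun z => (h z).1); have [LM' eM] := sw M LM (fun z => (h z).2).
have e : F = fun z => P z - M z by apply/funext => z; rewrite /P /M; lra.
rewrite e; split; first exact: (L1B LP' LM').
by rewrite (intB LP LM) -eP -eM; exact: (intB LP' LM').
Qed.

Lemma L1_pm_le (F : E * E -> R) (c : R) : meas F -> (forall z, 0 <= F z) ->
  (\int[mu]_x \int[mu]_y (F (x, y))%:E <= c%:E)%E -> L1 pm F /\ \int[pm]_z F z <= c.
Proof.
move=> mF F0 h; apply/L1_ge0_le => //.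
by rewrite (@fubini_tonelli1 _ _ _ _ _ mu mu (fun z => (F z)%:E)); [exact: h|exact/measurable_EFinP|move=> z; rewrite lee_fin].
Qed.

Lemma measurable_pm_F (F : E * E -> R) : meas F -> (forall z, 0 <= F z) ->
  meas (fun x => \int[mu]_y (F (x, y))%:E)%E.
Proof.
move=> mF F0; apply: (@measurable_fun_fubini_tonelli_F _ _ _ _ _ mu (fun z => (F z)%:E)) => [|z].
  exact/measurable_EFinP.
by rewrite lee_fin.
Qed.

Lemma prod_tensor f g : L1 mu f -> L1 mu g -> (forall x, 0 <= f x) -> (forall x, 0 <= g x) ->
  L1 pm (fun z => f z.2 * g z.1) /\ \int[pm]_z (f z.2 * g z.1) <= \int[mu]_x f x * \int[mu]_x g x.
Proof.
move=> Lf Lg f0 g0.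
have mF : meas (fun z : E * E => f z.2 * g z.1).
  by apply: measurable_funM; [exact: measurable_p2 (L1_meas Lf)|exact: measurable_p1 (L1_meas Lg)].
have F0 (z : E * E) : 0 <= f z.2 * g z.1 by rewrite mulr_ge0.
apply: L1_pm_le => //.
rewrite /= -intZ//; rewrite EFin_int; last exact: L1Z.
apply: ge0_le_integral => //.
- by move=> x _; apply: integral_ge0 => y _; rewrite lee_fin mulr_ge0.
- exact: (measurable_pm_F mF F0).
- by apply/measurable_EFinP; exact: (L1_meas (L1Z _ Lg)).
move=> x _; under eq_integral do rewrite mulrC.
by rewrite -EFin_int; [rewrite intZ// mulrC|exact: L1Z].
Qed.

Lemma prod_conv f k : L1 mu f -> L1 mu k -> (forall x, 0 <= f x) -> (forall x, 0 <= k x) ->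
  (forall x, k (- x) = k x) ->
  L1 pm (fun z => f z.1 * k (z.1 - z.2)) /\ \int[pm]_z (f z.1 * k (z.1 - z.2)) <= \int[mu]_x f x * \int[mu]_x k x.
Proof.
move=> Lf Lk f0 k0 kN.
have mF : meas (fun z : E * E => f z.1 * k (z.1 - z.2)).
  by apply: measurable_funM; [exact: measurable_p1 (L1_meas Lf)|exact: measurable_psub (L1_meas Lk)].
have F0 (z : E * E) : 0 <= f z.1 * k (z.1 - z.2) by rewrite mulr_ge0.
apply: L1_pm_le => //.
rewrite mulrC -intZ//; rewrite EFin_int; last exact: L1Z.
apply: ge0_le_integral => //.
- by move=> x _; apply: integral_ge0 => y _; rewrite lee_fin mulr_ge0.
- exact: (measurable_pm_F mF F0).
- by apply/measurable_EFinP; exact: (L1_meas (L1Z _ Lf)).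
move=> x _ /=; rewrite (_ : (fun y => _) = fun y => (f x * k (y + - x))%:E); last first.
  by apply/funext => y; rewrite -kN opprB.
by rewrite -EFin_int; [rewrite intZ ?int_shift 1?mulrC//; exact: L1_shift|apply: L1Z; exact: L1_shift].
Qed.

Lemma prod_conv2 f k : L1 mu f -> L1 mu k -> (forall x, 0 <= f x) -> (forall x, 0 <= k x) ->
  (forall x, k (- x) = k x) ->
  L1 pm (fun z => f z.2 * k (z.1 - z.2)) /\ \int[pm]_z (f z.2 * k (z.1 - z.2)) <= \int[mu]_x f x * \int[mu]_x k x.
Proof.
move=> Lf Lk f0 k0 kN; have [L I] := prod_conv Lf Lk f0 k0 kN.
have [L' I'] := L1_pm_swap L; move: I; rewrite -I' /= in L' * => I.
have e : (fun z : E * E => f z.2 * k (z.2 - z.1)) = fun z => f z.2 * k (z.1 - z.2).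
  by apply/funext => z; rewrite -kN opprB.
by rewrite e in L' I; split.
Qed.

Lemma young_pointwise (f k g a b s : R) : 0 <= f -> 0 <= k -> 0 <= g -> 1 <= a -> 1 <= b -> 1 <= s ->
  a^-1 + b^-1 + s^-1 = 2 ->
  f * k * g <= f `^ b * g `^ a + f `^ b * k `^ s + k `^ s * g `^ a.
Proof.
move=> f0 k0 g0 a1 b1 s1 abs.
have r0 : 0 <= f `^ b * g `^ a + f `^ b * k `^ s + k `^ s * g `^ a.
  by rewrite !addr_ge0 ?mulr_ge0 ?powR_ge0.
have [->|fn] := eqVneq f 0; first by rewrite mul0r mul0r powR0 ?mul0r ?add0r ?mulr_ge0 ?powR_ge0//; lra.
have [->|kn] := eqVneq k 0; first by rewrite mulr0 mul0r addr_ge0 ?addr_ge0 ?mulr_ge0 ?powR_ge0.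
have [->|gn] := eqVneq g 0; first by rewrite mulr0 addr_ge0 ?addr_ge0 ?mulr_ge0 ?powR_ge0.
have fp : 0 < f by rewrite lt_def fn.
have kp : 0 < k by rewrite lt_def kn.
have gp : 0 < g by rewrite lt_def gn.
set X := f `^ b * g `^ a; set Y := f `^ b * k `^ s; set Z := k `^ s * g `^ a.
have X0 : 0 < X by rewrite mulr_gt0 ?powR_gt0.
have Y0 : 0 < Y by rewrite mulr_gt0 ?powR_gt0.
have Z0 : 0 < Z by rewrite mulr_gt0 ?powR_gt0.
have inv1 (c : R) : 1 <= c -> 0 <= 1 - c^-1 by move=> c1; rewrite subr_ge0 invf_le1//; lra.
have s1E : (1 - s^-1) + (1 - a^-1) + (1 - b^-1) = 1 by lra.
have la := inv1 _ a1; have lb := inv1 _ b1; have ls := inv1 _ s1.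
(* The exponents 1 - 1/s, 1 - 1/a, 1 - 1/b are nonnegative with sum 1, and each base is at most X +
   Y + Z. *)
have e : f * k * g = X `^ (1 - s^-1) * Y `^ (1 - a^-1) * Z `^ (1 - b^-1).
  rewrite /X /Y /Z !powRM ?powR_ge0// -!powRrM.
  have -> : f `^ (b * (1 - s^-1)) * g `^ (a * (1 - s^-1)) * (f `^ (b * (1 - a^-1)) * k `^ (s * (1 - a^-1)))
    * (k `^ (s * (1 - b^-1)) * g `^ (a * (1 - b^-1)))
    = (f `^ (b * (1 - s^-1)) * f `^ (b * (1 - a^-1))) * (k `^ (s * (1 - a^-1)) * k `^ (s * (1 - b^-1)))
      * (g `^ (a * (1 - s^-1)) * g `^ (a * (1 - b^-1))) by ring.
  rewrite -!powR_pos_add// -!mulrDr.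
  have -> : 1 - s^-1 + (1 - a^-1) = b^-1 by lra.
  have -> : 1 - a^-1 + (1 - b^-1) = s^-1 by lra.
  have -> : 1 - s^-1 + (1 - b^-1) = a^-1 by lra.
  by rewrite !divff ?powRr1//; lra.
have T0 : 0 < X + Y + Z by rewrite !addr_gt0.
have XT : X <= X + Y + Z by rewrite -addrA lerDl addr_ge0 // ltW.
have YT : Y <= X + Y + Z by rewrite addrAC lerDr addr_ge0 // ltW.
have ZT : Z <= X + Y + Z by rewrite lerDr addr_ge0 // ltW.
have -> : X + Y + Z = (X + Y + Z) `^ ((1 - s^-1) + (1 - a^-1) + (1 - b^-1)) by rewrite s1E powRr1 ?(ltW T0).
rewrite e (powR_pos_add ((1 - s^-1) + (1 - a^-1)) (1 - b^-1) T0) (powR_pos_add (1 - s^-1) (1 - a^-1) T0).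
by apply: ler_pM; rewrite ?mulr_ge0 ?powR_ge0//; [apply: ler_pM; rewrite ?powR_ge0//|];
  apply: ge0_ler_powR => //; rewrite nnegrE ltW.
Qed.

(* As 1/a + 1/b + 1/s = 2, the product k f g is a weighted geometric mean of these
   three terms. *)
Definition ymaj a b s k f g z : R :=
  f z.2 `^ b * g z.1 `^ a + f z.2 `^ b * k (z.1 - z.2) `^ s + k (z.1 - z.2) `^ s * g z.1 `^ a.

Definition pk k f g z : R := k (z.1 - z.2) * f z.2 * g z.1.

Definition even_kernel k := [/\ meas k, forall x, 0 <= k x & forall x, k (- x) = k x].

Lemma measurable_pk k f g : even_kernel k -> meas f -> meas g ->
  meas (pk k f g).
Proof.
move=> [mk _ _] mf mg; apply: measurable_funM; last exact: measurable_p1.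
by apply: measurable_funM; [exact: measurable_psub|exact: measurable_p2].
Qed.

Lemma measurable_powR_comp d (T : measurableType d) (f : T -> R) r : meas f -> meas (fun o : T => f o `^ r).
Proof. by move=> mf; apply: (@measurableT_comp _ _ _ _ _ _ (fun t : R => t `^ r)). Qed.

Section estimate.
Variables (a b s : R) (k : E -> R).
Hypotheses (ek : even_kernel k) (a1 : 1 <= a) (b1 : 1 <= b) (s1 : 1 <= s) (abs : a^-1 + b^-1 + s^-1 = 2).
Hypothesis Lk : L1 mu (fun x => k x `^ s).

Lemma ymaj_int f g : (forall x, 0 <= f x) -> (forall x, 0 <= g x) ->
  L1 mu (fun x => f x `^ b) -> L1 mu (fun x => g x `^ a) ->
  L1 pm (ymaj a b s k f g) /\ \int[pm]_z ymaj a b s k f g z <=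
    \int[mu]_x (f x `^ b) * \int[mu]_x (g x `^ a) + \int[mu]_x (f x `^ b) * \int[mu]_x (k x `^ s)
    + \int[mu]_x (g x `^ a) * \int[mu]_x (k x `^ s).
Proof.
move=> f0 g0 Lf Lg; have [mk k0 kN] := ek.
have p0 (h : E -> R) (r : R) x : 0 <= h x `^ r by exact: powR_ge0.
have kNs x : k (- x) `^ s = k x `^ s by rewrite kN.
have [L1' I1] := prod_tensor Lf Lg (p0 f b) (p0 g a).
have [L2' I2] := prod_conv2 Lf Lk (p0 f b) (p0 k s) kNs.
have [L3 I3] := prod_conv Lg Lk (p0 g a) (p0 k s) kNs.
have e : ymaj a b s k f g = fun z => (f z.2 `^ b * g z.1 `^ a + f z.2 `^ b * k (z.1 - z.2) `^ s) + g z.1 `^ a * k (z.1 - z.2) `^ s.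
  by apply/funext => z; rewrite /ymaj; ring.
have L12 := L1D L1' L2'.
rewrite e; split; first exact: (L1D L12 L3).
by rewrite (intD L12 L3) (intD L1' L2'); apply: lerD; [apply: lerD; [exact: I1|exact: I2]|exact: I3].
Qed.

Lemma pk_ymaj f g z : (forall x, 0 <= f x) -> (forall x, 0 <= g x) -> pk k f g z <= ymaj a b s k f g z.
Proof.
move=> f0 g0; have [_ k0 _] := ek; rewrite /pk (mulrC (k _)).
exact: young_pointwise.
Qed.

Lemma pk_ge0 f g z : (forall x, 0 <= f x) -> (forall x, 0 <= g x) -> 0 <= pk k f g z.
Proof. by move=> f0 g0; have [_ k0 _] := ek; rewrite /pk !mulr_ge0. Qed.

Lemma pk_young f g : meas f -> meas g -> (forall x, 0 <= f x) -> (forall x, 0 <= g x) ->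
  L1 mu (fun x => f x `^ b) -> L1 mu (fun x => g x `^ a) ->
  L1 pm (pk k f g) /\ \int[pm]_z pk k f g z <=
    \int[mu]_x (f x `^ b) * \int[mu]_x (g x `^ a) + \int[mu]_x (f x `^ b) * \int[mu]_x (k x `^ s)
    + \int[mu]_x (g x `^ a) * \int[mu]_x (k x `^ s).
Proof.
move=> mf mg f0 g0 Lf Lg; have [LY IY] := ymaj_int f0 g0 Lf Lg.
have LP : L1 pm (pk k f g).
  apply: L1_le LY => [|z]; first exact: measurable_pk.
  by rewrite ger0_norm ?pk_ge0 ?pk_ymaj.
by split => //; apply: le_trans IY; apply: int_le => // z; exact: pk_ymaj.
Qed.

(** Young's bound for t g in place of g, divided by t. The terms containing g^a get the factor
    t^(a-1), small with t; only f^b k^s, which is free of g, gets the large factor 1/t. *)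
Lemma pk_scaled f g (t : R) z : 0 < t -> (forall x, 0 <= f x) -> (forall x, 0 <= g x) ->
  pk k f g z <= t `^ (a - 1) * ymaj a b s k f g z + t^-1 * (f z.2 `^ b * k (z.1 - z.2) `^ s).
Proof.
move=> t0 f0 g0; have [_ k0 _] := ek.
have tg x : 0 <= t * g x by rewrite mulr_ge0 // ltW.
have := @pk_ymaj f (fun x => t * g x) z f0 tg.
rewrite {1}/pk /ymaj powRM ?(ltW t0)//.
have -> : t `^ a = t * t `^ (a - 1) by rewrite -{2}(powRr1 (ltW t0)) -powR_pos_add// addrC subrK.
move: (powR_ge0 (f z.2) b) (powR_ge0 (g z.1) a) (powR_ge0 (k (z.1 - z.2)) s) (powR_ge0 t (a - 1)).
rewrite /pk; move: (_ `^ b) (_ `^ a) (_ `^ s) (t `^ (a - 1)) => F G K T F0 G0 K0 T0 h.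
rewrite -(ler_pM2l t0) mulrDr [t * (t^-1 * _)]mulrA divff ?gt_eqF// mul1r.
have h2 : 0 <= t * T * (F * K) by rewrite !mulr_ge0 // ltW.
have -> : t * (k (z.1 - z.2) * f z.2 * g z.1) = k (z.1 - z.2) * f z.2 * (t * g z.1) by ring.
apply: le_trans h _; rewrite -subr_ge0 (_ : _ - _ = t * T * (F * K)) //; ring.
Qed.

End estimate.

End young.

Lemma indic_pred {T : Type} {R : realType} (P : pred T) (t : T) : \1_[set o | P o] t = (P t)%:R :> R.
Proof. by rewrite indicE; congr (_%:R); congr nat_of_bool; apply/idP/idP; rewrite inE. Qed.

(** * Convergence and positivity of the Gamma integral *)

Section gamma.
Context {R : realType}.
Local Notation leb := (@lebesgue_measure R).
Implicit Types (s t d : R).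

Lemma poly_exp (n : nat) d : 0 < d -> exists2 C : R, 0 <= C & forall j : nat,
  j.+1%:R ^+ n * expR (- (d * j%:R)) <= C * expR (- (d / 2)) ^+ j.
Proof.
move=> d0; have nR : 0 < n.+1%:R :> R by rewrite ltr0n.
pose C := (2 * n.+1%:R / d) ^+ n.+1 * expR (d / 2).
have c0 : 0 <= 2 * n.+1%:R / d by rewrite divr_ge0 ?mulr_ge0// ltW.
exists C => [|j]; first by rewrite mulr_ge0 ?expR_ge0 ?exprn_ge0.
have j1 : 1 <= j.+1%:R :> R by rewrite ler1n.
apply: (@le_trans _ _ (j.+1%:R ^+ n.+1 * expR (- (d * j%:R)))).
  by rewrite ler_wpM2r ?expR_ge0// ler_weXn2l.
rewrite /C -expRM_natl -[leRHS]mulrA -expRD.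
have -> : d / 2 + j%:R * - (d / 2) = - (d * j%:R) + d / 2 * j.+1%:R by rewrite -natr1; field.
rewrite expRD [leRHS]mulrCA mulrC ler_wpM2l ?expR_ge0//.
have -> : expR (d / 2 * j.+1%:R) = expR (d / 2 * j.+1%:R / n.+1%:R) ^+ n.+1.
  by rewrite -expRM_natl mulrCA divff ?mulr1// gt_eqF.
have e0 : 0 <= d / 2 * j.+1%:R / n.+1%:R by rewrite divr_ge0 ?mulr_ge0 ?divr_ge0// ltW.
rewrite -exprMn; apply: lerXn2r; rewrite ?nnegrE//; first by rewrite mulr_ge0 ?expR_ge0.
apply: (@le_trans _ _ (2 * n.+1%:R / d * (d / 2 * j.+1%:R / n.+1%:R))).
  by apply: le_of_eq; field; rewrite !gt_eqF.
rewrite ler_wpM2l//.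
by apply: le_trans (expR_ge1Dx _); rewrite lerDr.
Qed.

Let gf s t := t `^ (s - 1) * expR (- t).

Let measurable_gf s : meas (gf s).
Proof.
apply: measurable_funM => //; apply: (@measurableT_comp _ _ _ _ _ _ expR) => //.
Qed.

Lemma powR_ge1 (a x : R) : 1 <= a -> 0 <= x -> 1 <= a `^ x.
Proof. by move=> a1 x0; have := ler_powR a1 x0; rewrite powRr0. Qed.

Lemma powR_two_bound (s t : R) : 1 <= t <= 2 -> 2 `^ (- `|s|) <= t `^ s <= 2 `^ `|s|.
Proof.
move=> /andP[t1 t2]; have t0 : 0 <= t by lra.
have [s0|s0] := ger0P s; last rewrite opprK.
  apply/andP; split; last by apply: ge0_ler_powR; rewrite ?nnegrE.
  apply: (@le_trans _ _ 1); first by rewrite powRN invf_le1 ?powR_gt0 ?powR_ge1 ?ler1n.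
  exact: powR_ge1.
rewrite -[t `^ s]invrK -powRN; have n0 : 0 <= - s by lra.
have h1 : 1 <= t `^ (- s) by exact: powR_ge1.
have h2 : t `^ (- s) <= 2 `^ (- s) by apply: ge0_ler_powR; rewrite ?nnegrE.
apply/andP; split.
  have -> : 2 `^ s = (2 `^ (- s))^-1 by rewrite powRN invrK.
  by rewrite lef_pV2 ?posrE ?powR_gt0//; lra.
apply: (@le_trans _ _ 1); first by rewrite invf_le1 ?powR_gt0//; lra.
by apply: le_trans h2.
Qed.

Let leb0c (c : R) : 0 < c -> (leb `[0%R, c] <= c%:E)%E.
Proof. by move=> c0; rewrite lebesgue_measure_itv/= lte_fin c0 sube0. Qed.

(** The real integral of a non-integrable positive function is 0, so the positivity of
    [riesz_constant] rests on this. Dyadic shells serve near 0, unit shells near infinity. *)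
Lemma L1_gamma s : 0 < s -> L1 leb (fun t => \1_`]0, +oo[ t * gf s t).
Proof.
move=> s0.
have mg (A : set R) : measurable A -> meas (fun t => \1_A t * gf s t).
  by move=> mA; apply: measurable_funM => //; exact: measurable_indic.
have g0 (A : set R) t : 0 <= \1_A t * gf s t by rewrite mulr_ge0 ?mulr_ge0 ?powR_ge0 ?expR_ge0.
have q01 (y : R) : 0 < y -> 0 <= (2 : R) `^ (- y) < 1.
  by move=> y0; rewrite powR_ge0 powR_lt1 ?ltr1n//; lra.
have [L01 _] : L1 leb (fun t => \1_`]0, 1] t * gf s t) /\ \int[leb]_t (\1_`]0, 1] t * gf s t) <=
    2 `^ `|s - 1| / (1 - 2 `^ (- s)).
  apply: (@shell_L1 _ _ _ leb _ (fun j => `[0, 2 `^ (- j%:R)]%classic) (fun j => 2 `^ `|s - 1| * 2 `^ (- j%:R * (s - 1)))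
    (fun j => 2 `^ (- j%:R))) ; [exact: mg|exact: g0|by []|by move=> j; rewrite mulr_ge0 ?powR_ge0| | |exact: q01|].
  - by move=> j; apply: leb0c; exact: powR_gt0.
  - move=> t; rewrite indicE; have [|_] := boolP (t \in _); last by rewrite mul0r eqxx.
    rewrite inE /= in_itv/= => /andP[t0 t1] _.
    have [j /andP[j1 j2]] : exists j : nat, (2 : R) ^+ j <= t^-1 <= 2 ^+ j.+1.
      have [t_1|] := leP t^-1 1; last by move=> /dyadic_bracket[j /andP[j1 j2]]; exists j; rewrite (ltW j1).
      exists 0%N; rewrite expr0 expr1 invf_ge1// t1/=; lra.
    have tj : t = 2 `^ (- j%:R) * (t * 2 ^+ j).
      by rewrite powRN powR_mulrn// mulrCA mulVf ?mulr1// expf_neq0.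
    have t2j : 1 <= (t * 2 ^+ j)^-1 <= 2.
      have i1 : t * 2 ^+ j <= 1 by rewrite -ler_pdivlMl // mulr1.
      have i2 : 1 <= t * 2 ^+ j.+1 by rewrite -ler_pdivrMl // mulr1.
      have i3 : 0 < t * 2 ^+ j by rewrite mulr_gt0 ?exprn_gt0.
      rewrite invf_ge1// i1 -[X in X <= _]mul1r ler_pdivrMr//=.
      by rewrite mulrCA -exprS.
    exists j; rewrite /= ?in_itv/=.
      by rewrite (ltW t0) powRN powR_mulrn// -[t]invrK lef_pV2 ?posrE ?exprn_gt0 ?invr_gt0.
    rewrite mul1r /gf; apply: (@le_trans _ _ (t `^ (s - 1))).
      by rewrite ler_piMr ?powR_ge0// -expR0 ler_expR; lra.
    rewrite {1}tj powRM ?powR_ge0 ?mulr_ge0 ?(ltW t0)// -powRrM mulrC ler_wpM2r ?powR_ge0//.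
    rewrite -[t * _]invrK -powR_inv1 ?invr_ge0 ?mulr_ge0 ?(ltW t0)// -powRrM mulN1r.
    by have /andP[_] := powR_two_bound (- (s - 1)) t2j; rewrite normrN.
  - move=> j; rewrite -(powR_mulrn _ (powR_ge0 _ _)) -powRrM -mulrA -powR_pos_add// le_eqVlt.
    by apply/orP; left; apply/eqP; congr (_ * _ `^ _); ring.
pose n := (Num.truncn s).+1.
have [C C0 CP] := poly_exp n.+1 (ltr01 : 0 < 1 :> R).
have [L1oo _] : L1 leb (fun t => \1_`]1, +oo[ t * gf s t) /\ \int[leb]_t (\1_`]1, +oo[ t * gf s t) <=
    C / (1 - expR (- (1 / 2))).
  apply: (@shell_L1 _ _ _ leb _ (fun j => `[0, j.+1%:R]%classic) (fun j => j.+1%:R ^+ n * expR (- (1 * j%:R)))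
    (fun j => j.+1%:R)) ; [exact: mg|exact: g0|by []|by move=> j; rewrite mulr_ge0 ?expR_ge0| | | |].
  - by move=> j; apply: leb0c; rewrite ltr0n.
  - move=> t; rewrite indicE; have [|_] := boolP (t \in _); last by rewrite mul0r eqxx.
    rewrite inE /= in_itv/= andbT => t1 _; have t0 : 0 <= t by lra.
    have /andP[tl tu] := truncn_itv t0.
    exists (Num.truncn t); rewrite /= ?in_itv/= ?t0 ?(ltW tu)//.
    rewrite mul1r mul1r /gf; apply: ler_pM; rewrite ?powR_ge0 ?expR_ge0 ?ler_expR ?lerN2//.
    apply: (@le_trans _ _ (t `^ n%:R)); last by rewrite powR_mulrn// lerXn2r ?nnegrE// ltW.
    by rewrite ler_powR ?(ltW t1)//; have := truncnS_gt s; rewrite -/n; lra.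
  - by rewrite expR_ge0 expR_lt1; lra.
  - by move=> j; rewrite mulrAC -exprSr.
rewrite (_ : (fun _ => _) = fun t => \1_`]0, 1] t * gf s t + \1_`]1, +oo[ t * gf s t); first exact: L1D.
apply/funext => t; rewrite -mulrDl; congr (_ * _); rewrite !indicE !mem_setE !in_itv/= !andbT.
by case: (ltP 0 t) => t0; case: (leP t 1) => t1 //=; rewrite ?addr0 ?add0r//; lra.
Qed.

Lemma Gamma_gt0 s : 0 < s -> 0 < Gamma s.
Proof.
move=> s0; have LG := L1_gamma s0; rewrite /Gamma Rintegral_mkcond.
rewrite (_ : _ \_ _ = fun t => \1_`]0, +oo[ t * gf s t); last first.
  by apply/funext => t; rewrite patchE indicE; case: ifP => _; rewrite ?mul1r ?mul0r.
pose c : R := 2 `^ (- `|s - 1|) * expR (- 2).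
have c0 : 0 < c by rewrite mulr_gt0 ?powR_gt0 ?expR_gt0.
have m12 : (leb `[1%R, 2%R]%classic = 1%:E)%E.
  by rewrite lebesgue_measure_itv/= lte_fin ltr1n -EFinB; congr EFin; lra.
have L12 : L1 leb (\1_`[1, 2] : R -> R) by apply: L1_indic => //; apply: le_lt_trans (ltry 1); apply: le_of_eq; exact: m12.
apply: (@lt_le_trans _ _ (\int[leb]_t (c * \1_`[1, 2] t))).
  rewrite intZ// pmulr_rgt0//.
  suff -> : \int[leb]_t (\1_`[1, 2] t : R) = 1 by [].
  by apply: EFin_inj; rewrite EFin_int// integral_indic// setIT; exact: m12.
apply: int_le => //; first exact: L1Z.
move=> t; rewrite indicE; have [|_] := boolP (t \in _); last by rewrite mulr0 mulr_ge0 ?mulr_ge0 ?powR_ge0 ?expR_ge0.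
rewrite inE/= in_itv/= => t12; have /andP[t1 t2] := t12.
rewrite indicE mem_set/= ?in_itv/= ?andbT ?mul1r ?mulr1; last by lra.
have /andP[h _] := powR_two_bound (s - 1) t12.
by apply: ler_pM; rewrite ?powR_ge0 ?expR_ge0// ler_expR; lra.
Qed.

End gamma.

(** * Near and far parts of the Riesz kernel *)

Section riesz_kernel.
Context {R : realType} {N : nat} (alpha : R).
Local Notation E := 'rV[R]_N.
Local Notation mu := (@lebesgue_rV R N).
Hypotheses (N0 : (0 < N)%N) (a0 : 0 < alpha) (aN : alpha < N%:R).
Implicit Types (x : E) (s t : R).

Let K := @riesz R N alpha.
Let gam := N%:R - alpha.

Lemma riesz_constant_gt0 : 0 < @riesz_constant R N alpha.
Proof.
have g0 : 0 < N%:R - alpha by rewrite subr_gt0.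
rewrite divr_gt0 ?Gamma_gt0 ?divr_gt0//.
by rewrite !mulr_gt0 ?powR_gt0 ?pi_gt0 ?Gamma_gt0 ?divr_gt0.
Qed.

Lemma enorm_ge0 x : 0 <= enorm x. Proof. exact: sqrtr_ge0. Qed.

Lemma measurable_enorm : meas (@enorm R N).
Proof.
apply: (@measurableT_comp _ _ _ _ _ _ (@Num.sqrt R)); first by apply: continuous_measurable_fun; exact: sqrt_continuous.
by apply: measurable_sum => i; apply: measurable_funX; exact: measurable_coor.
Qed.

Lemma measurable_nrm1 : meas (@nrm1 R N).
Proof. by apply: measurable_sum => i; apply: measurableT_comp => //; exact: measurable_coor. Qed.

Lemma coord_enorm x i : `|x ord0 i| <= enorm x.
Proof. by rewrite -sqrtr_sqr ler_wsqrtr// (bigD1 i)//= lerDl sumr_ge0// => j _; exact: sqr_ge0. Qed.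

Lemma nrm1_enorm x : nrm1 x <= N%:R * enorm x.
Proof.
rewrite mulr_natl -[X in _ *+ X](card_ord N) -sumr_const.
by apply: ler_sum => i _; exact: coord_enorm.
Qed.

Lemma coord_nrm1 x i : `|x ord0 i| <= nrm1 x.
Proof. by rewrite /nrm1 (bigD1 i)//= lerDl sumr_ge0. Qed.

Lemma nrm1_eq0 x : nrm1 x = 0 -> x = 0.
Proof.
by move=> x0; apply/rowP => i; rewrite mxE; apply/normr0_eq0/le_anti; rewrite normr_ge0 andbT -x0 coord_nrm1.
Qed.

Lemma riesz_ge0 x : 0 <= K x.
Proof. by rewrite divr_ge0 ?powR_ge0// ltW// riesz_constant_gt0. Qed.

Lemma riesz_even x : K (- x) = K x.
Proof.
rewrite /K /riesz /enorm; congr (_ / (Num.sqrt _) `^ _).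
by apply: eq_bigr => i _; rewrite mxE sqrrN.
Qed.

Lemma measurable_riesz : meas K.
Proof.
rewrite (_ : K = fun x => riesz_constant N alpha * enorm x `^ (- gam)).
  by apply: measurable_funM => //; apply: measurable_powR_comp; exact: measurable_enorm.
by apply/funext => x; rewrite powRN.
Qed.

(** Passes from the Euclidean norm to the sum norm, whose balls fit into coordinate cubes, the sets
    of known volume. *)
Lemma riesz_bound : exists2 C : R, 0 < C & forall x, K x <= C * nrm1 x `^ (- gam).
Proof.
have g0 : 0 < gam by rewrite subr_gt0.
have c0 := riesz_constant_gt0; have NR : 0 < N%:R :> R by rewrite ltr0n.
exists (riesz_constant N alpha * N%:R `^ gam) => [|x]; first by rewrite mulr_gt0 ?powR_gt0.
rewrite /K /riesz -mulrA ler_wpM2l ?(ltW c0)// -/gam.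
have [e0|en] := eqVneq (enorm x) 0.
  by rewrite e0 powR0 ?gt_eqF// invr0 mulr_ge0 ?powR_ge0.
have ep : 0 < enorm x by rewrite lt_def en enorm_ge0.
have np : 0 < nrm1 x.
  rewrite lt_def nrm1_ge0 andbT; apply: contra_neq en => /nrm1_eq0 ->.
  by rewrite /enorm big1 ?sqrtr0// => i _; rewrite mxE expr0n.
rewrite powRN ler_pdivlMr ?powR_gt0// mulrC ler_pdivrMr ?powR_gt0// -powRM ?(ltW NR) ?(ltW ep)//.
apply: ge0_ler_powR; rewrite ?nnegrE ?(ltW g0) ?(ltW np)//; first by rewrite mulr_ge0 ?(ltW NR)// ltW.
exact: nrm1_enorm.
Qed.

Definition knear x := \1_[set x | nrm1 x <= 1] x * K x.
Definition kfar x := \1_[set x | 1 < nrm1 x] x * K x.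

Lemma riesz_split x : K x = knear x + kfar x.
Proof.
by rewrite /knear /kfar -mulrDl !indic_pred; case: (leP (nrm1 x) 1); rewrite ?addr0 ?add0r mul1r.
Qed.

Let m1 : measurable [set x : E | nrm1 x <= 1].
Proof. by rewrite -[X in measurable X]setTI; apply: measurable_fun_ler => //; exact: measurable_nrm1. Qed.

Let m2 : measurable [set x : E | 1 < nrm1 x].
Proof. by rewrite -[X in measurable X]setTI; apply: measurable_fun_ltr => //; exact: measurable_nrm1. Qed.

Lemma even_knear : even_kernel knear.
Proof.
split=> [|x|x].
- by apply: measurable_funM; [exact: measurable_indic|exact: measurable_riesz].
- by rewrite mulr_ge0 ?riesz_ge0.
- by rewrite /knear riesz_even !indic_pred nrm1N.
Qed.

Lemma even_kfar : even_kernel kfar.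
Proof.
split=> [|x|x].
- by apply: measurable_funM; [exact: measurable_indic|exact: measurable_riesz].
- by rewrite mulr_ge0 ?riesz_ge0.
- by rewrite /kfar riesz_even !indic_pred nrm1N.
Qed.

Let box (t : R) : set E := cube (\row_i (- t)) (4 * t).

Let box_mem t x : 0 < t -> nrm1 x <= t -> box t x.
Proof.
move=> t0 xt i; have := le_trans (coord_nrm1 x i) xt; rewrite mxE ler_norml => /andP[h1 h2].
by apply/andP; split; lra.
Qed.

Let box_vol t : 0 <= t -> (mu (box t) <= ((4 * t) ^+ N)%:E)%E.
Proof. by move=> t0; apply: le_of_eq; apply: lebesgue_rV_cube; rewrite mulr_ge0. Qed.

(** On the shell of radius 2^-j the s-th power of the kernel is of order 2^(gam s j) and the volume
    of order 2^(-N j). *)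
Lemma L1_knear s : 0 < s -> s * gam < N%:R -> L1 mu (fun x => knear x `^ s).
Proof.
move=> s0 sN; have [C C0 KC] := riesz_bound; have g0 : 0 < gam by rewrite subr_gt0.
have [mk k0 _] := even_knear.
have t0 (j : nat) : 0 < (2^-1 : R) ^+ j by rewrite exprn_gt0// invr_gt0.
have tE (j : nat) : (2^-1 : R) ^+ j = 2 `^ (- j%:R) by rewrite powRN powR_mulrn// exprVn.
have [] // := @shell_L1 _ _ _ mu (fun x => knear x `^ s) (fun j => box (2^-1 ^+ j))
  (fun j => C `^ s * 2 `^ (gam * s * j.+1%:R)) (fun j => (4 * 2^-1 ^+ j) ^+ N) (C `^ s * 2 `^ (gam * s) * 4 ^+ N) (2 `^ (gam * s - N%:R)).
- exact: measurable_powR_comp.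
- by move=> x; exact: powR_ge0.
- by move=> j; exact: measurable_cube.
- by move=> j; rewrite mulr_ge0 ?powR_ge0.
- by move=> j; apply: box_vol; exact: ltW.
- move=> x fx; have kx : knear x != 0 by apply: contra_neq fx => ->; rewrite powR0// gt_eqF.
  have x1 : nrm1 x <= 1.
    by rewrite leNgt; apply: contraNN kx; rewrite /knear indic_pred ltNge => /negbTE ->; rewrite mul0r.
  have kK : knear x = K x by rewrite /knear indicE mem_set// mul1r.
  (* At the origin the Euclidean norm power vanishes and its inverse is 0, so the kernel is 0 there
     and the origin is excluded by [kx]. *)
  have xp : 0 < nrm1 x.
    rewrite lt_def nrm1_ge0 andbT; apply: contra_neq kx => /nrm1_eq0 x0.
    rewrite kK /K /riesz x0 (_ : enorm 0 = 0) ?powR0 ?invr0 ?mulr0// ?gt_eqF//.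
    by rewrite /enorm big1 ?sqrtr0// => i _; rewrite mxE expr0n.
  have [j /andP[j1 j2]] : exists j : nat, (2 : R) ^+ j <= (nrm1 x)^-1 <= 2 ^+ j.+1.
    have [t_1|] := leP (nrm1 x)^-1 1; last by move=> /dyadic_bracket[j /andP[j1 j2]]; exists j; rewrite (ltW j1).
    exists 0%N; rewrite expr0 expr1 invf_ge1// x1/=; lra.
  exists j.
    by apply: box_mem => //; rewrite exprVn -[nrm1 x]invrK lef_pV2 ?posrE ?exprn_gt0 ?invr_gt0.
  rewrite kK [gam * s]mulrC -mulrA [s * _]mulrC powRrM -powRM ?powR_ge0 ?(ltW C0)//.
  apply: ge0_ler_powR; rewrite ?nnegrE ?(ltW s0) ?riesz_ge0//; first by rewrite mulr_ge0 ?powR_ge0// ltW.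
  apply: le_trans (KC x) _; rewrite ler_wpM2l ?(ltW C0)// mulrC powRrM powR2n -[nrm1 x]invrK -powR_inv1 ?invr_ge0 ?(ltW xp)//.
  rewrite -powRrM mulN1r opprK; apply: ge0_ler_powR; rewrite ?nnegrE ?(ltW g0) ?invr_ge0 ?(ltW xp)//.
- by rewrite powR_ge0 powR_lt1 ?ltr1n//; lra.
move=> j; rewrite exprMn -exprM mulnC exprM tE -!powR_mulrn ?powR_ge0// -!powRrM.
apply: le_of_eq; rewrite -[j.+1%:R]natr1 [gam * s * (_ + _)]mulrDr mulr1 [(gam * s - N%:R) * _]mulrBl !powR_pos_add//.
have -> : - N%:R * j%:R = - (N%:R * j%:R) :> R by rewrite mulNr.
ring.
Qed.

Lemma L1_kfar s : 0 < s -> N%:R < s * gam -> L1 mu (fun x => kfar x `^ s).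
Proof.
move=> s0 sN; have [C C0 KC] := riesz_bound; have g0 : 0 < gam by rewrite subr_gt0.
have [mk k0 _] := even_kfar.
have [] // := @shell_L1 _ _ _ mu (fun x => kfar x `^ s) (fun j => box (2 ^+ j.+1))
  (fun j => C `^ s * 2 `^ (- (gam * s) * j%:R)) (fun j => (4 * 2 ^+ j.+1) ^+ N) (C `^ s * 8 ^+ N) (2 `^ (N%:R - gam * s)).
- exact: measurable_powR_comp.
- by move=> x; exact: powR_ge0.
- by move=> j; exact: measurable_cube.
- by move=> j; rewrite mulr_ge0 ?powR_ge0.
- by move=> j; apply: box_vol; exact: exprn_ge0.
- move=> x fx; have kx : kfar x != 0 by apply: contra_neq fx => ->; rewrite powR0// gt_eqF.
  have x1 : 1 < nrm1 x.
    by rewrite ltNge; apply: contraNN kx; rewrite /kfar indic_pred leNgt => /negbTE ->; rewrite mul0r.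
  have kK : kfar x = K x by rewrite /kfar indicE mem_set// mul1r.
  have xp : 0 < nrm1 x by lra.
  have [j /andP[j1 j2]] := dyadic_bracket x1.
  exists j; first by apply: box_mem => //; exact: exprn_gt0.
  rewrite kK -mulNr -mulrA [s * _]mulrC mulrA powRrM -powRM ?powR_ge0 ?(ltW C0)//.
  apply: ge0_ler_powR; rewrite ?nnegrE ?(ltW s0) ?riesz_ge0//; first by rewrite mulr_ge0 ?powR_ge0// ltW.
  apply: le_trans (KC x) _; rewrite ler_wpM2l ?(ltW C0)// mulNr !powRN lef_pV2 ?posrE ?powR_gt0//.
  rewrite mulrC powRrM powR2n; apply: ge0_ler_powR; rewrite ?nnegrE ?(ltW g0) ?exprn_ge0 ?(ltW xp)//.
  exact: ltW.
- by rewrite powR_ge0 powR_lt1 ?ltr1n//; lra.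
move=> j; rewrite exprS mulrA (_ : 4 * 2 = 8 :> R); last by lra.
rewrite exprMn -exprM mulnC exprM -!powR2n -!powR_mulrn ?powR_ge0// -!powRrM.
apply: le_of_eq; have -> : (N%:R - gam * s) * j%:R = N%:R * j%:R + - (gam * s) * j%:R by ring.
by rewrite powR_pos_add//; ring.
Qed.

End riesz_kernel.

(** * Admissible exponents *)

Section exponents.
Context {R : realType}.

Lemma lin_open (c a d : R) : c * a < d -> exists2 h : R, 0 < h & forall b, `|b - a| <= h -> c * b < d.
Proof.
move=> cad; have k0 : 0 < `|c| + 1 by rewrite ltr_pwDr.
exists ((d - c * a) / (2 * (`|c| + 1))) => [|b]; first by rewrite divr_gt0 ?mulr_gt0 ?subr_gt0.
rewrite ler_pdivlMr ?mulr_gt0// => h.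
have h1 : c * (b - a) <= `|b - a| * (`|c| + 1).
  apply: le_trans (ler_norm _) _; rewrite normrM mulrC ler_wpM2l// lerDl//.
move: h h1; rewrite mulrCA mulrBr; lra.
Qed.

Definition subcritical (N : nat) (r : R) := 2 < r /\ r * (N%:R - 2) < 2 * N%:R.

Definition young_exponents (N : nat) (alpha p q a s : R) :=
  [/\ 1 < a, a^-1 + a^-1 + s^-1 = 2, 1 <= s, subcritical N (p * a) & subcritical N (q * a)].

(** s = a/(2(a-1)) solves 1/a + 1/a + 1/s = 2. At a = 2N/(N+alpha) it equals N/(N-alpha), the
    borderline for both parts of the kernel. There p a and q a are strictly subcritical, an open
    condition, so a + h and a - h remain admissible and put s below and above the borderline. *)
Lemma exponents (N : nat) (alpha p q : R) : (0 < N)%N -> 0 < alpha -> alpha < N%:R ->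
  (N%:R + alpha) / N%:R < p -> p * (N%:R - 2) < N%:R + alpha ->
  (N%:R + alpha) / N%:R < q -> q * (N%:R - 2) < N%:R + alpha ->
  exists a1 s1 a2 s2 : R, [/\ young_exponents N alpha p q a1 s1, young_exponents N alpha p q a2 s2,
    s1 * (N%:R - alpha) < N%:R & N%:R < s2 * (N%:R - alpha)].
Proof.
move=> N0 al0 alN hp hp' hq hq'; have NR : 0 < N%:R :> R by rewrite ltr0n.
have Na : 0 < N%:R + alpha by lra.
pose a := 2 * N%:R / (N%:R + alpha).
have aE : a * (N%:R + alpha) = 2 * N%:R by rewrite divfK// gt_eqF.
have ap : 0 < a by rewrite divr_gt0// mulr_gt0.
have a1 : 1 < a by rewrite ltr_pdivlMr//; lra.
have a2 : a < 2 by rewrite ltr_pdivrMr//; lra.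
have c1 r : (N%:R + alpha) / N%:R < r -> - r * a < - 2.
  by rewrite ltr_pdivrMr// => h; rewrite mulNr ltrN2 mulrA ltr_pdivlMr//; lra.
have c2 r : r * (N%:R - 2) < N%:R + alpha -> (r * (N%:R - 2)) * a < 2 * N%:R.
  by move=> h; rewrite -aE [ltRHS]mulrC ltr_pM2r.
have [h1 h10 H1] := lin_open (c1 p hp); have [h2 h20 H2] := lin_open (c1 q hq).
have [h3 h30 H3] := lin_open (c2 p hp'); have [h4 h40 H4] := lin_open (c2 q hq').
pose h := Num.min (Num.min (Num.min h1 h2) (Num.min h3 h4)) (Num.min ((a - 1) / 2) ((2 - a) / 2)).
have h0 : 0 < h by rewrite !lt_min h10 h20 h30 h40 !divr_gt0//; lra.
have [[k1 k2 k3 k4 k5] k6] : [/\ h <= h1, h <= h2, h <= h3, h <= h4 & h <= (a - 1) / 2] /\ h <= (2 - a) / 2.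
  by rewrite /h; do ![split]; rewrite !ge_min lexx ?orbT.
have good b : `|b - a| <= h -> young_exponents N alpha p q b (b / (2 * (b - 1))).
  move=> bh; have b12 : 1 < b /\ b < 2 by clear -bh a1 a2 k5 k6; move: bh; rewrite ler_norml => /andP[]; split; lra.
  have [b1 b2] := b12; split => //.
  - have bn : b != 0 by rewrite gt_eqF// (lt_trans ltr01).
    by rewrite invf_div; field.
  - by clear -b1 b2; rewrite ler_pdivlMr ?mul1r; lra.
  - by split; [have := H1 b (le_trans bh k1); clear; lra|have := H3 b (le_trans bh k3); clear; lra].
  - by split; [have := H2 b (le_trans bh k2); clear; lra|have := H4 b (le_trans bh k4); clear; lra].
exists (a + h), ((a + h) / (2 * (a + h - 1))), (a - h), ((a - h) / (2 * (a - h - 1))); split.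
- by apply: good; rewrite addrAC subrr add0r ger0_norm// ltW.
- by apply: good; rewrite addrAC subrr add0r normrN ger0_norm// ltW.
- rewrite mulrAC ltr_pdivrMr; last by lra.
  rewrite -subr_gt0 (_ : _ - _ = h * (N%:R + alpha)); first by rewrite mulr_gt0.
  by transitivity ((a + h) * (N%:R + alpha) - 2 * N%:R); [ring|rewrite mulrDl aE; ring].
- rewrite mulrAC ltr_pdivlMr; last by lra.
  rewrite -subr_gt0 (_ : _ - _ = h * (N%:R + alpha)); first by rewrite mulr_gt0.
  by transitivity (2 * N%:R - (a - h) * (N%:R + alpha)); [ring|rewrite mulrBl aE; ring].
Qed.

End exponents.

(* The exponents a1, s1 serve the part of the kernel near 0, and a2, s2 the rest. *)
Record setting (R : realType) (N : nat) := Setting {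
  st_alpha : R; st_p : R; st_q : R; st_a1 : R; st_s1 : R; st_a2 : R; st_s2 : R;
  st_N0 : (0 < N)%N;
  st_al0 : 0 < st_alpha;
  st_alN : st_alpha < N%:R;
  st_hp : (N%:R + st_alpha) / N%:R < st_p;
  st_hp' : st_p * (N%:R - 2) < N%:R + st_alpha;
  st_hq : (N%:R + st_alpha) / N%:R < st_q;
  st_hq' : st_q * (N%:R - 2) < N%:R + st_alpha;
  st_Y1 : young_exponents N st_alpha st_p st_q st_a1 st_s1;
  st_Y2 : young_exponents N st_alpha st_p st_q st_a2 st_s2;
  st_s1N : st_s1 * (N%:R - st_alpha) < N%:R;
  st_s2N : N%:R < st_s2 * (N%:R - st_alpha) }.

(** * Double integrals against the Riesz kernel *)

Section hls.
Context {R : realType} {N : nat}.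
Local Notation E := 'rV[R]_N.
Local Notation mu := (@lebesgue_rV R N).
Local Notation pm := (mu \x mu)%E.
Variable S : setting R N.
Implicit Types (u v f g : E -> R) (x y : E) (r t : R) (z : E * E).

Local Notation alpha := (st_alpha S).
Local Notation p := (st_p S).
Local Notation q := (st_q S).
Local Notation a1 := (st_a1 S).
Local Notation s1 := (st_s1 S).
Local Notation a2 := (st_a2 S).
Local Notation s2 := (st_s2 S).
Local Notation K := (@riesz R N alpha).
Local Notation kn := (@knear R N alpha).
Local Notation kf := (@kfar R N alpha).

Let N0 : (0 < N)%N := st_N0 S.
Let al0 : 0 < alpha := st_al0 S.
Let alN : alpha < N%:R := st_alN S.
Let Y1 : young_exponents N alpha p q a1 s1 := st_Y1 S.
Let Y2 : young_exponents N alpha p q a2 s2 := st_Y2 S.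
Let ekn : even_kernel kn. Proof. exact: even_knear. Qed.
Let ekf : even_kernel kf. Proof. exact: even_kfar. Qed.
Let a11 : 1 < a1. Proof. by case: Y1. Qed.
Let a21 : 1 < a2. Proof. by case: Y2. Qed.
Let s11 : 1 <= s1. Proof. by case: Y1. Qed.
Let s21 : 1 <= s2. Proof. by case: Y2. Qed.
Let e1 : a1^-1 + a1^-1 + s1^-1 = 2. Proof. by case: Y1. Qed.
Let e2 : a2^-1 + a2^-1 + s2^-1 = 2. Proof. by case: Y2. Qed.
Let Ln : L1 mu (fun x => kn x `^ s1).
Proof. by apply: L1_knear; [exact: N0|exact: al0|exact: alN|apply: lt_le_trans s11|exact: st_s1N]. Qed.
Let Lf : L1 mu (fun x => kf x `^ s2).
Proof. by apply: L1_kfar; [exact: N0|exact: al0|exact: alN|apply: lt_le_trans s21|exact: st_s2N]. Qed.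

(** Both exponents are asked for, since the near and the far kernel are always estimated together;
    [rho] adds the two integrals. *)
Definition XC f := [/\ meas f, forall x, 0 <= f x,
  L1 mu (fun x => f x `^ a1) & L1 mu (fun x => f x `^ a2)].

Definition rho f := \int[mu]_x (f x `^ a1) + \int[mu]_x (f x `^ a2).

Definition kap := \int[mu]_x (kn x `^ s1) + \int[mu]_x (kf x `^ s2).

Definition maj f g z := ymaj a1 a1 s1 kn f g z + ymaj a2 a2 s2 kf f g z.

(** The terms of [maj f g] that involve f and the kernel only. With f fixed they are a fixed
    integrable function, whatever g does. *)
Definition wt f z := f z.2 `^ a1 * kn (z.1 - z.2) `^ s1 + f z.2 `^ a2 * kf (z.1 - z.2) `^ s2.

Let I0 (h : E -> R) r : 0 <= \int[mu]_x (h x `^ r).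
Proof. by apply: int_ge0 => x; exact: powR_ge0. Qed.

Lemma rho_ge0 f : 0 <= rho f. Proof. exact: addr_ge0. Qed.
Lemma kap_ge0 : 0 <= kap. Proof. exact: addr_ge0. Qed.

Let sum_le (a b c d e f : R) : 0 <= a -> 0 <= b -> 0 <= c -> 0 <= d -> 0 <= e -> 0 <= f ->
  (a * c + a * e + c * e) + (b * d + b * f + d * f) <= (a + b) * (c + d) + (e + f) * ((a + b) + (c + d)).
Proof.
move=> *; rewrite -subr_ge0 (_ : _ - _ = a * d + b * c + (e * b + e * d + f * a + f * c)); last by ring.
by rewrite !addr_ge0 ?mulr_ge0.
Qed.

Lemma maj_int f g : XC f -> XC g -> L1 pm (maj f g) /\
  \int[pm]_z maj f g z <= rho f * rho g + kap * (rho f + rho g).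
Proof.
move=> [mf f0 f1 f2] [mg g0 g1 g2].
have [L1' I1] := ymaj_int ekn Ln f0 g0 f1 g1; have [L2' I2] := ymaj_int ekf Lf f0 g0 f2 g2.
split; first exact: L1D.
rewrite (intD L1' L2'); apply: le_trans (lerD I1 I2) _.
exact: sum_le.
Qed.

Lemma maj_ge0 f g z : 0 <= maj f g z.
Proof. by rewrite /maj /ymaj !addr_ge0 ?mulr_ge0 ?powR_ge0. Qed.

Lemma wt_int f : XC f -> L1 pm (wt f) /\ \int[pm]_z wt f z <= kap * rho f.
Proof.
move=> [mf f0 f1 f2]; have [_ kn0 knN] := ekn; have [_ kf0 kfN] := ekf.
have p0 (h : E -> R) r x : 0 <= h x `^ r by exact: powR_ge0.
have [L1' I1] := prod_conv2 f1 Ln (p0 f a1) (p0 kn s1) (fun x => congr1 (fun t => t `^ s1) (knN x)).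
have [L2' I2] := prod_conv2 f2 Lf (p0 f a2) (p0 kf s2) (fun x => congr1 (fun t => t `^ s2) (kfN x)).
split; first exact: L1D.
rewrite (intD L1' L2'); apply: le_trans (lerD I1 I2) _.
rewrite /kap /rho; move: (I0 f a1) (I0 f a2) (I0 kn s1) (I0 kf s2).
move: (\int[mu]_x (f x `^ a1)) (\int[mu]_x (f x `^ a2)) (\int[mu]_x (kn x `^ s1)) (\int[mu]_x (kf x `^ s2)) => a b c d *.
rewrite -subr_ge0 (_ : _ - _ = c * b + d * a); last by ring.
by rewrite addr_ge0 ?mulr_ge0.
Qed.

Lemma pk_split f g z : pk K f g z = pk kn f g z + pk kf f g z.
Proof. by rewrite /pk (riesz_split alpha (z.1 - z.2)); ring. Qed.

Lemma even_riesz : even_kernel K.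
Proof. by split; [exact: measurable_riesz|exact: riesz_ge0|exact: riesz_even]. Qed.

Lemma pk_maj f g z : (forall x, 0 <= f x) -> (forall x, 0 <= g x) -> pk K f g z <= maj f g z.
Proof.
by move=> f0 g0; rewrite pk_split; apply: lerD; apply: pk_ymaj => //; exact: ltW.
Qed.

Lemma pk_L1 f g : XC f -> XC g -> L1 pm (pk K f g) /\
  \int[pm]_z pk K f g z <= rho f * rho g + kap * (rho f + rho g).
Proof.
move=> Xf Xg; have [LM IM] := maj_int Xf Xg; have [mf f0 _ _] := Xf; have [mg g0 _ _] := Xg.
have LP : L1 pm (pk K f g).
  apply: L1_le LM => [|z]; first exact: (measurable_pk even_riesz).
  by rewrite ger0_norm ?(pk_ge0 even_riesz) ?pk_maj.
by split => //; apply: le_trans IM; apply: int_le => // z; exact: pk_maj.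
Qed.

(** The source of compactness for the double integral: an arbitrarily small multiple of a majorant
    that is bounded on bounded sets, plus a multiple of a term that sees f alone. The scale t is
    small enough that t^(a-1) <= d for both exponents. *)
Lemma pk_maj_scaled (d : R) : 0 < d -> exists2 C : R, 0 <= C & forall f g z,
  (forall x, 0 <= f x) -> (forall x, 0 <= g x) -> pk K f g z <= d * maj f g z + C * wt f z.
Proof.
move=> d0.
pose t := Num.min (d `^ (a1 - 1)^-1) (d `^ (a2 - 1)^-1).
have t0 : 0 < t by rewrite lt_min !powR_gt0.
have td (a : R) : 1 < a -> t <= d `^ (a - 1)^-1 -> t `^ (a - 1) <= d.
  move=> a_1 tle; have h : 0 < a - 1 by lra.
  apply: (@le_trans _ _ ((d `^ (a - 1)^-1) `^ (a - 1))).
    by apply: ge0_ler_powR; rewrite ?nnegrE ?powR_ge0 ?(ltW t0) ?(ltW h).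
  by rewrite -powRrM mulVf ?powRr1 ?(ltW d0)// gt_eqF.
exists t^-1 => [|f g z f0 g0]; first by rewrite invr_ge0 ltW.
rewrite pk_split.
have h1 := pk_scaled ekn (ltW a11) (ltW a11) s11 e1 z t0 f0 g0.
have h2 := pk_scaled ekf (ltW a21) (ltW a21) s21 e2 z t0 f0 g0.
have y1 : 0 <= ymaj a1 a1 s1 kn f g z by rewrite /ymaj !addr_ge0 ?mulr_ge0 ?powR_ge0.
have y2 : 0 <= ymaj a2 a2 s2 kf f g z by rewrite /ymaj !addr_ge0 ?mulr_ge0 ?powR_ge0.
have t1 := ler_wpM2r y1 (td a1 a11 ltac:(by rewrite /t ge_min lexx)).
have t2 := ler_wpM2r y2 (td a2 a21 ltac:(by rewrite /t ge_min lexx orbT)).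
apply: le_trans (lerD h1 h2) _.
have arith (T1 T2 U1 U2 A B c : R) : T1 <= d * U1 -> T2 <= d * U2 -> T1 + c * A + (T2 + c * B) <= d * (U1 + U2) + c * (A + B).
  by move=> k1 k2; rewrite !mulrDr [leRHS]addrACA; apply: lerD; apply: lerD.
exact: arith.
Qed.

Lemma pk_swap f g z : pk K f g z = pk K g f (z.2, z.1).
Proof. by rewrite /pk/= -[z.2 - z.1]opprB riesz_even; ring. Qed.

Lemma maj_swap f g z : maj f g z = maj g f (z.2, z.1).
Proof.
have [_ _ knN] := ekn; have [_ _ kfN] := ekf.
by rewrite /maj /ymaj/= -[z.2 - z.1]opprB knN kfN; ring.
Qed.

Lemma XC_powR r u : subcritical N (r * a1) -> subcritical N (r * a2) -> H1 u -> XC (fun x => `|u x| `^ r).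
Proof.
move=> [h1 h1'] [h2 h2'] hu; have mu' := (H1_L2 hu).1.
have key (a : R) : 2 < r * a -> r * a * (N%:R - 2) < 2 * N%:R -> L1 mu (fun x => (`|u x| `^ r) `^ a).
  move=> ra ra'; have [C _ /(_ u (Num.sqrt (hn u)) hu (sqrtr_ge0 _))[]] := sobolev N0 (ltW ra) ra'.
    by rewrite sqr_sqrtr ?hn_ge0.
  by under eq_fun do rewrite powRrM.
split; [exact: measurable_abs_powR|by move=> x; exact: powR_ge0|exact: key|exact: key].
Qed.

Lemma rho_bound r L : subcritical N (r * a1) -> subcritical N (r * a2) -> exists2 M : R, 0 <= M &
  forall u, H1 u -> hn u <= L -> rho (fun x => `|u x| `^ r) <= M.
Proof.
move=> [h1 h1'] [h2 h2'].
have [C1 C10 S1] := sobolev N0 (ltW h1) h1'; have [C2 C20 S2] := sobolev N0 (ltW h2) h2'.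
pose l := Num.sqrt L.
exists (C1 * l `^ (r * a1) + C2 * l `^ (r * a2)) => [|u hu uL].
  by rewrite addr_ge0 ?mulr_ge0 ?powR_ge0 // ltW.
have ul : hn u <= l ^+ 2 by rewrite sqr_sqrtr// (le_trans (hn_ge0 hu)).
have [_ I1] := S1 u l hu (sqrtr_ge0 _) ul; have [_ I2] := S2 u l hu (sqrtr_ge0 _) ul.
have e a : (fun x => (`|u x| `^ r) `^ a) = fun x => `|u x| `^ (r * a) by apply/funext => x; rewrite powRrM.
by rewrite /rho !e; apply: lerD; [exact: I1|exact: I2].
Qed.

Lemma rho_vanish r L eps : subcritical N (r * a1) -> subcritical N (r * a2) -> 0 < L -> 0 < eps ->
  exists l eta : R, [/\ 0 < l, 0 < eta & forall u, H1 u -> hn u <= L ->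
    (forall x, \int[mu]_y (\1_(cube 0 l) y * u (y + x) ^+ 2) <= eta) ->
    rho (fun x => `|u x| `^ r) <= eps].
Proof.
move=> [h1 h1'] [h2 h2'] L0 e0.
have key (s : R) : 2 < s -> s * (N%:R - 2) < 2 * N%:R -> exists l eta : R, [/\ 0 < l, 0 < eta & forall u, H1 u -> hn u <= L ->
    (forall x, \int[mu]_y (\1_(cube 0 l) y * u (y + x) ^+ 2) <= eta) -> \int[mu]_x (`|u x| `^ s) <= eps / 2].
  move=> sr sr'; pose c := Num.sqrt L; have c0 : 0 < c by rewrite sqrtr_gt0.
  have cs : 0 < c `^ s by exact: powR_gt0.
  have [|l [eta [l0 eta0 van]]] := @vanish R N s (eps / 2 / c `^ s) N0 sr sr' _; first by rewrite !divr_gt0.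
  exists l, (eta * L); split; [by []|exact: mulr_gt0|move=> u hu uL ul].
  have Lu := H1_L2 hu; have mC := measurable_cube (0 : E) l.
  have := van (fun x => c^-1 * u x) (H1Z _ hu).
  rewrite hn_Z// exprVn sqr_sqrtr ?(ltW L0)// ler_pdivrMl// mulr1 => /(_ uL) van'.
  have e : (fun x => `|c^-1 * u x| `^ s) = fun x => (c `^ s)^-1 * `|u x| `^ s.
    apply/funext => x; rewrite normrM powRM// gtr0_norm ?invr_gt0//; congr (_ * _).
    apply: (mulfI (lt0r_neq0 cs)); rewrite -powRM ?invr_ge0 ?(ltW c0)//.
    by rewrite !divff ?powR1 ?gt_eqF.
  have Ls : L1 mu (fun x => `|u x| `^ s).
    have [C _ /(_ u c hu (ltW c0))[]//] := sobolev N0 (ltW sr) sr'.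
    by rewrite sqr_sqrtr ?(ltW L0).
  move: van'; rewrite e intZ// ler_pdivrMl// mulrC divfK ?gt_eqF//; apply => x.
  have Lx : L1 mu (fun y => \1_(cube 0 l) y * u (y + x) ^+ 2).
    apply: L1_le (L2_shift x Lu).2 => [|y]; first by apply: measurable_funM; [exact: measurable_indic|exact: L1_meas (L2_shift x Lu).2].
    by rewrite indicE; case: (y \in _); rewrite ?mul1r ?mul0r ?normr0 ?ger0_norm ?sqr_ge0.
  rewrite (_ : (fun y => _) = fun y => L^-1 * (\1_(cube 0 l) y * u (y + x) ^+ 2)).
    by rewrite intZ// ler_pdivrMl// mulrC.
  by apply/funext => y; rewrite exprMn exprVn sqr_sqrtr ?(ltW L0)//; ring.
have [l1 [eta1 [l10 eta10 v1]]] := key _ h1 h1'; have [l2 [eta2 [l20 eta20 v2]]] := key _ h2 h2'.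
(* A larger cube at the same corner carries more mass, so the larger side with the smaller bound
   serves both exponents. *)
exists (Num.max l1 l2), (Num.min eta1 eta2); split; [by rewrite lt_max l10|by rewrite lt_min eta10|move=> u hu uL ul].
have Lu := H1_L2 hu.
have mono l (x : E) : l <= Num.max l1 l2 -> \int[mu]_y (\1_(cube 0 l) y * u (y + x) ^+ 2) <= Num.min eta1 eta2.
  move=> ll; apply: le_trans (ul x).
  have Lx l' : L1 mu (fun y => \1_(cube 0 l') y * u (y + x) ^+ 2).
    apply: L1_le (L2_shift x Lu).2 => [|y]; first by apply: measurable_funM; [apply: measurable_indic; exact: measurable_cube|exact: L1_meas (L2_shift x Lu).2].
    by rewrite indicE; case: (y \in _); rewrite ?mul1r ?mul0r ?normr0 ?ger0_norm ?sqr_ge0.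
  apply: int_le => // y; rewrite ler_wpM2r ?sqr_ge0// !indicE.
  have [yl|//] := boolP (y \in cube 0 l).
  rewrite mem_set// => i; move: yl; rewrite inE => /(_ i) /andP[y1 y2]; rewrite y1/=.
  by apply: lt_le_trans y2 _; rewrite lerD2l.
rewrite (splitr eps) /rho; under eq_Rintegral do rewrite -powRrM.
apply: lerD.
  by apply: v1 => // x; apply: le_trans (mono _ _ _) _; rewrite ?le_max ?ge_min ?lexx.
under eq_Rintegral do rewrite -powRrM.
by apply: v2 => // x; apply: le_trans (mono _ _ _) _; rewrite ?le_max ?ge_min ?lexx ?orbT.
Qed.

Definition BB f g := \int[pm]_z pk K f g z.

Definition DD u v := BB (fun x => `|u x| `^ p) (fun x => `|v x| `^ q).

Lemma XCp u : H1 u -> XC (fun x => `|u x| `^ p).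
Proof. by apply: XC_powR; [case: Y1|case: Y2]. Qed.

Lemma XCq u : H1 u -> XC (fun x => `|u x| `^ q).
Proof. by apply: XC_powR; [case: Y1|case: Y2]. Qed.

(** By Tonelli the nested extended-real integrals of [action] become one real integral on the
    product, where all later estimates are made. *)
Lemma D_action u v : H1 u -> H1 v ->
  fine (\int[mu]_x (riesz_conv alpha (fun y => `|u y| `^ p)%R x * (`|v x| `^ q)%:E))%E = DD u v.
Proof.
move=> hu hv; rewrite /DD /BB /Rintegral; apply: (congr1 fine).
have [mf f0 _ _] := XCp hu; have [mg g0 _ _] := XCq hv.
have mP := measurable_pk even_riesz mf mg.
rewrite (@fubini_tonelli1 _ _ _ _ _ mu mu (fun z => (pk K (fun x => `|u x| `^ p) (fun x => `|v x| `^ q) z)%:E)).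
- apply: eq_integral => x _; rewrite /riesz_conv /fubini_F/= muleC -ge0_integralZl_EFin//.
  + by apply: eq_integral => y _; rewrite -EFinM /pk/= mulrC.
  + by move=> y _; rewrite lee_fin mulr_ge0// riesz_ge0.
  + apply/measurable_EFinP; apply: measurable_funM => //.
    have [mK _ _] := even_riesz; rewrite (_ : (fun y => K (x - y)) = fun y => K (y + - x)).
      exact: measurable_comp_shift.
    by apply/funext => y; rewrite -(riesz_even alpha (x - y)) opprB.
- exact/measurable_EFinP.
- by move=> z; rewrite lee_fin (pk_ge0 even_riesz).
Qed.

End hls.

(** * Elementary power inequalities *)

Section elementary.
Context {R : realType}.
Implicit Types (p e a x y s t : R).

Lemma powR_near1 p e : 0 < e -> exists2 h : R, 0 < h < 1 & forall t, `|t - 1| <= h -> `|t `^ p - 1| <= e.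
Proof.
move=> e0; have dp := @is_derive1_powR R p 1 ltr01.
have : {for (1 : R), continuous (fun t : R => t `^ p)}.
  by apply/differentiable_continuous/derivable1_diffP; apply: ex_derive.
move=> /cvgrPdist_le /(_ e e0) /nbhs_ballP [d d0 dP].
exists (Num.min (d / 2) 2^-1) => [|t].
  have d0' : 0 < d by []; rewrite lt_min divr_gt0//= invr_gt0 gt_min ltr0n /=; apply/orP; right; lra.
rewrite le_min => /andP[td _]; rewrite distrC.
have := dP t; rewrite /= powR1; apply; rewrite /ball/= distrC; apply: le_lt_trans td _.
by rewrite ltr_pdivrMr// ltr_pMr// ltr1n.
Qed.

Lemma powR_tangent1 p e : 0 < e -> exists2 h : R, 0 < h < 1 & forall s, `|s| <= h ->
  `|(1 + s) `^ p - 1 - p * s| <= e * `|s|.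
Proof.
move=> e0; have dp := @is_derive1_powR R p 1 ltr01.
have [_ de] := dp; rewrite powR1 mulr1 in de.
have [+ _] := dp; rewrite /derivable => /cvg_ex[l hl].
have : 'D_1 (fun t : R => t `^ p) (1 : R) = l by apply: cvg_lim.
rewrite de => pl; rewrite -{}pl in hl.
move/cvgrPdist_le : hl => /(_ e e0) /nbhs_ballP [d d0 dP].
exists (Num.min (d / 2) 2^-1) => [|s].
  have d0' : 0 < d by []; rewrite lt_min divr_gt0//= invr_gt0 gt_min ltr0n /=; apply/orP; right; lra.
rewrite le_min => /andP[sd _].
have [->|sn] := eqVneq s 0; first by rewrite addr0 powR1 mulr0 subr0 subrr normr0 mulr0.
have := dP s; rewrite /ball/= sub0r normrN => /(_ _ sn).
rewrite /= powR1 [X in X + 1](_ : _ = s); last by rewrite -[LHS]/(s * 1) mulr1.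
move=> h; have {h} : `|p - s^-1 * ((s + 1) `^ p - 1)| <= e.
  by apply: h; apply: le_lt_trans sd _; rewrite ltr_pdivrMr// ltr_pMr// ltr1n.
move=> h; have -> : (1 + s) `^ p - 1 - p * s = - ((p - s^-1 * ((s + 1) `^ p - 1)) * s).
  by rewrite [1 + s]addrC; field.
by rewrite normrN normrM ler_wpM2r.
Qed.

(** Two regimes. If |u| <= h |a|, dividing by |a| reduces the claim to continuity of t^p at t = 1;
    otherwise |a| and |a - u| are bounded by multiples of |u|. *)
Lemma powR_brezis_lieb p e : 0 < p -> 0 < e -> exists2 C : R, 0 <= C & forall a u : R,
  `| `|a| `^ p - `|a - u| `^ p | <= e * `|a| `^ p + C * `|u| `^ p.
Proof.
move=> p0 e0; have [h /andP[h0 h1] hP] := powR_near1 p e0.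
have hi : 0 < h^-1 by rewrite invr_gt0.
exists (h^-1 `^ p + (h^-1 + 1) `^ p) => [|a u]; first by rewrite addr_ge0 ?powR_ge0.
have [uh|uh] := leP `|u| (h * `|a|).
  apply: (@le_trans _ _ (e * `|a| `^ p)); last by rewrite lerDl mulr_ge0 ?addr_ge0 ?powR_ge0.
  have [a0|an] := eqVneq a 0.
    move: uh; rewrite a0 normr0 mulr0 normr_le0 => /eqP ->.
    by rewrite subrr normr0 subrr normr0 mulr_ge0 ?powR_ge0// ltW.
  have ap : 0 < `|a| by rewrite normr_gt0.
  have e1 : `|a - u| = `|a| * (`|a - u| / `|a|) by rewrite mulrC divfK ?gt_eqF.
  rewrite e1 powRM ?divr_ge0// -[X in `|X - _|]mulr1 -mulrBr normrM ger0_norm ?powR_ge0// mulrC ler_wpM2r ?powR_ge0//.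
  rewrite distrC; apply: hP; rewrite -(ler_pM2r ap); apply: le_trans uh.
  rewrite -[X in _ * X](normr_id a) -normrM mulrBl divfK ?mul1r ?gt_eqF//.
  by apply: le_trans (ler_dist_dist _ _) _; rewrite addrAC subrr add0r normrN.
have ha : `|a| <= h^-1 * `|u| by rewrite ler_pdivlMl// ltW.
have hau : `|a - u| <= (h^-1 + 1) * `|u|.
  by apply: le_trans (ler_normB _ _) _; rewrite mulrDl mul1r lerD2r.
have X1 : `|a| `^ p <= h^-1 `^ p * `|u| `^ p.
  by rewrite -powRM ?(ltW hi)//; apply: ge0_ler_powR; rewrite ?nnegrE ?mulr_ge0 ?(ltW hi) ?(ltW p0).
have X2 : `|a - u| `^ p <= (h^-1 + 1) `^ p * `|u| `^ p.
  rewrite -powRM ?addr_ge0 ?(ltW hi)//.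
  by apply: ge0_ler_powR; rewrite ?nnegrE ?mulr_ge0 ?addr_ge0 ?(ltW hi) ?(ltW p0).
apply: le_trans (ler_normB _ _) _; rewrite (ger0_norm (powR_ge0 `|a| p)) (ger0_norm (powR_ge0 `|a - u| p)).
have X3 : 0 <= e * `|a| `^ p by rewrite mulr_ge0 ?powR_ge0// ltW.
rewrite [(_ + _) * `|u| `^ p]mulrDl -[leLHS]add0r; apply: lerD => //; exact: lerD.
Qed.

(** This is |x|^(p-2) x, written with the exponent p - 1 so that no singular power appears at 0 when
    1 < p < 2. *)
Definition sp p x := Num.sg x * `|x| `^ (p - 1).

Lemma sp_norm p x : 1 < p -> `|sp p x| = `|x| `^ (p - 1).
Proof.
move=> p1; rewrite /sp normrM normr_sg; have [->|xn] := eqVneq x 0; last first.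
  by rewrite mul1r ger0_norm// powR_ge0.
by rewrite mul0r normr0 powR0// subr_eq0 gt_eqF.
Qed.

Lemma powR_tangent p e : 1 < p -> 0 < e -> exists2 C : R, 0 <= C & forall x y,
  `| `|x + y| `^ p - `|x| `^ p - p * (sp p x * y)| <= e * (`|x| `^ (p - 1) * `|y|) + C * `|y| `^ p.
Proof.
move=> p1 e0; have p0 : 0 < p by lra.
have [h /andP[h0 h1] hP] := powR_tangent1 p e0.
have hi : 0 < h^-1 by rewrite invr_gt0.
pose C := (h^-1 + 1) `^ p + h^-1 `^ p + p * h^-1 `^ (p - 1).
have C0 : 0 <= C by rewrite !addr_ge0 ?mulr_ge0 ?powR_ge0// ltW.
exists C => // x y.
have pm a : 0 < a -> a `^ p = a `^ (p - 1) * a.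
  by move=> a0; rewrite -[X in _ = _ * X](powRr1 (ltW a0)) -powR_pos_add// subrK.
have [yh|yh] := leP `|y| (h * `|x|).
  apply: (@le_trans _ _ (e * (`|x| `^ (p - 1) * `|y|))); last by rewrite lerDl mulr_ge0 ?powR_ge0.
  have [x0|xn] := eqVneq x 0.
    move: yh; rewrite x0 normr0 mulr0 normr_le0 => /eqP ->.
    by rewrite addr0 normr0 powR0 ?gt_eqF// !mulr0 subr0 subrr normr0.
  have xp : 0 < `|x| by rewrite normr_gt0.
  pose s := y / x.
  have sh : `|s| <= h by rewrite normrM normfV ler_pdivrMr.
  have s1 : 0 <= 1 + s by move: sh; rewrite ler_norml => /andP[]; lra.
  have -> : `|x + y| = `|x| * (1 + s).
    by rewrite -[1 + s]ger0_norm// -normrM mulrDr mulr1 /s mulrCA divff ?mulr1.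
  have -> : sp p x * y = `|x| `^ p * s.
    have xs : `|x| * s = Num.sg x * y by rewrite normrEsg /s; field.
    by rewrite (pm _ xp) -mulrA xs /sp; ring.
  have -> : `|y| = `|x| * `|s| by rewrite -normrM /s mulrCA divff ?mulr1.
  rewrite powRM// [`|x| `^ (p - 1) * _]mulrA -pm//.
  have -> : `|x| `^ p * (1 + s) `^ p - `|x| `^ p - p * (`|x| `^ p * s) = `|x| `^ p * ((1 + s) `^ p - 1 - p * s) by ring.
  rewrite normrM (ger0_norm (powR_ge0 `|x| p)) [leRHS]mulrCA; apply: ler_wpM2l; [exact: powR_ge0|exact: hP].
have yp : 0 < `|y| by apply: le_lt_trans yh; rewrite mulr_ge0// ltW.
have hx : `|x| <= h^-1 * `|y| by rewrite ler_pdivlMl// ltW.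
have X1 : `|x + y| `^ p <= (h^-1 + 1) `^ p * `|y| `^ p.
  rewrite -powRM ?addr_ge0 ?(ltW hi)//; apply: ge0_ler_powR; rewrite ?nnegrE ?mulr_ge0 ?addr_ge0 ?(ltW hi) ?(ltW p0)//.
  by apply: le_trans (ler_normD _ _) _; rewrite mulrDl mul1r lerD2r.
have X2 : `|x| `^ p <= h^-1 `^ p * `|y| `^ p.
  by rewrite -powRM ?(ltW hi)//; apply: ge0_ler_powR; rewrite ?nnegrE ?mulr_ge0 ?(ltW hi) ?(ltW p0).
have X3 : `|p * (sp p x * y)| <= p * h^-1 `^ (p - 1) * `|y| `^ p.
  rewrite normrM (normrM (sp p x)) (ger0_norm (ltW p0)) sp_norm// -mulrA ler_wpM2l ?(ltW p0)//.
  rewrite (pm _ yp) mulrA ler_wpM2r// -powRM ?(ltW hi)//.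
  by apply: ge0_ler_powR; rewrite ?nnegrE ?mulr_ge0 ?(ltW hi)//; lra.
have X4 : 0 <= e * (`|x| `^ (p - 1) * `|y|) by rewrite mulr_ge0 ?mulr_ge0 ?powR_ge0// ltW.
rewrite -[leLHS]add0r; apply: lerD => //; apply: le_trans (ler_normB _ _) _; rewrite /C !mulrDl.
apply: lerD => //; apply: le_trans (ler_normB _ _) _.
by rewrite (ger0_norm (powR_ge0 `|x| p)) (ger0_norm (powR_ge0 `|x + y| p)); exact: lerD.
Qed.

End elementary.

Section gdct.
Context d (T : measurableType d) {R : realType} (mu : {measure set T -> \bar R}).

(** The positive part of |F_n - G| - H_n is dominated by |H| and tends to 0 a.e., so its integral
    tends to 0; what remains is H_n, of integral at most e. This is the analytic core of the
    Brezis-Lieb lemma. *)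
Lemma generalized_dct (F : nat -> T -> R) (G : T -> R) :
  (forall n, L1 mu (F n)) -> L1 mu G -> {ae mu, forall t, F n t @[n --> \oo] --> G t} ->
  (forall e : R, 0 < e -> exists (H : T -> R) (Hn : nat -> T -> R), [/\ L1 mu H,
     forall n, L1 mu (Hn n), forall n, \int[mu]_t Hn n t <= e, forall n t, 0 <= Hn n t &
     forall n t, `|F n t - G t| <= Hn n t + H t]) ->
  \int[mu]_t F n t @[n --> \oo] --> \int[mu]_t G t.
Proof.
move=> LF LG FG dom; apply/cvgn_leP => e e0.
have e2 : 0 < e / 2 by rewrite divr_gt0.
have [H [Hn [LH LHn IHn Hn0 FH]]] := dom _ e2.
pose D n t := `|F n t - G t|.
pose W n t := Num.max (D n t - Hn n t) 0.
have LD n : L1 mu (D n) by apply: L1_abs; exact: L1B.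
have mW n : meas (W n).
  by apply: measurable_maxr => //; apply: measurable_funB; [exact: L1_meas (LD n)|exact: L1_meas (LHn n)].
have D0 n t : 0 <= D n t by exact: normr_ge0.
have W0 n t : 0 <= W n t by rewrite le_max lexx orbT.
have H0 t : 0 <= Hn 0%N t + H t by apply: le_trans (FH 0%N t).
have WH n t : `|W n t| <= `|H t|.
  rewrite ger0_norm// ge_max normr_ge0 andbT; apply: le_trans (ler_norm _); rewrite lerBlDl; exact: FH.
have WD n t : W n t <= D n t by rewrite ge_max D0 andbT lerBlDr lerDl.
have [_ cW] := @ae_dct _ _ _ mu W (cst 0) (fun t => `|H t|) mW (measurable_cst _) ltac:(
  apply: filterS FG => t /cvgn_leP Ft; apply/cvgn_leP => e' e'0; have [M MP] := Ft e' e'0; exists M => n Mn;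
  rewrite subr0 ger0_norm//; apply: le_trans (WD n t) (MP n Mn)) (L1_abs LH) ltac:(by apply: aeW => t n; exact: WH).
rewrite (_ : \int[mu]_x cst 0 x = 0) in cW; last by rewrite /Rintegral integral0.
have LW n : L1 mu (W n) by apply: L1_le (LD n) => // t; rewrite ger0_norm.
have /cvgn_leP/(_ _ e2)[M MP] := cW; exists M => n Mn.
rewrite -intB//; apply: le_trans (int_abs (L1B (LF n) LG)) _.
apply: (@le_trans _ _ (\int[mu]_t (W n t + Hn n t))).
  by apply: int_le => [||t]; [exact: LD|exact: L1D|rewrite -lerBlDr le_max lexx].
rewrite intD// [leRHS]splitr; apply: lerD => //.
by have := MP n Mn; rewrite subr0 => /(le_trans (ler_norm _)).
Qed.

End gdct.

Local Opaque dir Rintegral.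

(** * The nonlocal term *)

Section H1_more.
Context {R : realType} {N : nat}.
Local Notation E := 'rV[R]_N.
Local Notation mu := (@lebesgue_rV R N).
Implicit Types (u v h : E -> R).

Lemma H1_abs u : H1 u -> H1 (fun x => `|u x|).
Proof.
move=> hu; apply: (H1_lipschitz (F := Num.norm)) => //; [exact: normr0|exact: ler_dist_dist|].
by apply: measurableT_comp => //; exact: (H1_L2 hu).1.
Qed.

Lemma dir_abs u : H1 u -> dir (fun x => `|u x|) (fun x => `|u x|) <= dir u u.
Proof.
move=> hu; have ha := H1_abs hu; apply: dir_le => // x y.
by rewrite -!expr2 -(sqr_normr (u y - _)) -sqr_normr ler_sqr ?nnegrE//; exact: ler_dist_dist.
Qed.

Lemma hn_abs u : H1 u -> hn (fun x => `|u x|) <= hn u.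
Proof.
move=> hu; apply: lerD; first exact: dir_abs.
by under eq_Rintegral do rewrite sqr_normr.
Qed.

Lemma dirD u v : H1 u -> H1 v -> dir (fun x => u x + v x) (fun x => u x + v x) = dir u u + 2 * dir u v + dir v v.
Proof.
move=> hu hv; have huv := H1D hu hv.
have e : (fun x => 1 * u x + v x) = (fun x => u x + v x) by apply/funext => x; rewrite mul1r.
have h1 := dir_linl 1 hu hv huv; rewrite e !mul1r in h1.
have h2 := dir_linr 1 hu hv hu; rewrite e !mul1r in h2.
have h3 := dir_linr 1 hu hv hv; rewrite e !mul1r in h3.
rewrite h1 h2 h3 [dir v u]dirC; move: (dir u u) (dir u v) (dir v v) => a b c; ring.
Qed.

Lemma dir_le_half u v : H1 u -> H1 v -> 2 * dir u v <= dir u u + dir v v.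
Proof.
move=> hu hv; have := dir_ge0 (fun x => u x + (- 1) * v x).
have e : (fun x => 1 * u x) = u by apply/funext => x; rewrite mul1r.
have h := dirZ 1 (- 1) hu hv; rewrite e in h.
rewrite (dirD hu (H1Z (-1) hv)) h (dirZ (-1) (-1) hv hv).
by move: (dir u u) (dir u v) (dir v v); clear => x y z; lra.
Qed.

Lemma hnD u v : H1 u -> H1 v -> hn (fun x => u x + v x) <= 2 * hn u + 2 * hn v.
Proof.
move=> hu hv; have Lu := H1_L2 hu; have Lv := H1_L2 hv.
have h1 : dir (fun x => u x + v x) (fun x => u x + v x) <= 2 * dir u u + 2 * dir v v.
  rewrite dirD//; have := dir_le_half hu hv; move: (dir u u) (dir u v) (dir v v); clear => a b c; lra.
have h2 : \int[mu]_x (u x + v x) ^+ 2 <= 2 * \int[mu]_x u x ^+ 2 + 2 * \int[mu]_x v x ^+ 2.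
  rewrite -!intZ; [|exact: Lv.2|exact: Lu.2].
  rewrite -intD; [|exact: L1Z Lu.2|exact: L1Z Lv.2].
  apply: int_le; [exact: (L2D Lu Lv).2|by apply: L1D; apply: L1Z; [exact: Lu.2|exact: Lv.2]|move=> x].
  by have := sqr_ge0 (u x - v x); move: (u x) (v x); clear => a b; nra.
rewrite /hn; apply: le_trans (lerD h1 h2) _; rewrite !mulrDr; apply: le_of_eq.
by rewrite addrACA.
Qed.

End H1_more.

(** * The derivative of the nonlocal term *)

Section calculus.
Context {R : realType} {N : nat} (S : setting R N).
Local Notation E := 'rV[R]_N.
Local Notation mu := (@lebesgue_rV R N).
Local Notation pm := (mu \x mu)%E.
Local Notation p := (st_p S).
Local Notation q := (st_q S).
Local Notation K := (@riesz R N (st_alpha S)).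
Implicit Types (u v f g h k F G : E -> R) (x y : E) (r : R) (z : E * E).

Let K0 x : 0 <= K x. Proof. by have [_ h _] := even_riesz S. Qed.

Lemma st_NR : 0 < N%:R :> R. Proof. by rewrite ltr0n; exact: st_N0 S. Qed.

Let gt1 (r : R) : (N%:R + st_alpha S) / N%:R < r -> 1 < r.
Proof. by rewrite ltr_pdivrMr ?st_NR// => h; have := st_al0 S; have := st_NR; nra. Qed.

Lemma st_p1 : 1 < p. Proof. exact: gt1 (st_hp S). Qed.
Lemma st_q1 : 1 < q. Proof. exact: gt1 (st_hq S). Qed.
Let p0 : 0 < p. Proof. exact: lt_trans st_p1. Qed.
Let q0 : 0 < q. Proof. exact: lt_trans st_q1. Qed.

Lemma pk_dom f g F G : meas f -> meas g ->
  (forall x, `|f x| <= F x) -> (forall x, `|g x| <= G x) -> XC S F -> XC S G ->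
  L1 pm (pk K f g) /\ forall z, `|pk K f g z| <= pk K F G z.
Proof.
move=> mf mg fF gG XF XG; have [LP _] := pk_L1 XF XG.
have pw z : `|pk K f g z| <= pk K F G z.
  rewrite /pk normrM (normrM (K _)) (ger0_norm (K0 _)); apply: ler_pM => //; first by rewrite mulr_ge0.
  exact: ler_wpM2l.
by split => //; apply: L1_le LP => //; exact: measurable_pk (even_riesz S) mf mg.
Qed.

Lemma BB_ge0 f g : (forall x, 0 <= f x) -> (forall x, 0 <= g x) -> 0 <= BB S f g.
Proof. by move=> f0 g0; apply: int_ge0 => z; exact: (pk_ge0 (even_riesz S)). Qed.

Lemma BB_le f g F G : meas f -> meas g ->
  (forall x, `|f x| <= F x) -> (forall x, `|g x| <= G x) -> XC S F -> XC S G -> `|BB S f g| <= BB S F G.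
Proof.
move=> mf mg fF gG XF XG; have [LP pw] := pk_dom mf mg fF gG XF XG; have [LF _] := pk_L1 XF XG.
by apply: le_trans (int_abs LP) _; apply: int_le => //; exact: L1_abs.
Qed.

Lemma DD_ge0 u v : 0 <= DD S u v.
Proof. by apply: BB_ge0 => x; exact: powR_ge0. Qed.

Lemma DD_L1 u v : H1 u -> H1 v -> L1 pm (pk K (fun x => `|u x| `^ p) (fun x => `|v x| `^ q)).
Proof. by move=> hu hv; have [] := pk_L1 (XCp S hu) (XCq S hv). Qed.

Lemma rho_bound_p L : exists2 M : R, 0 <= M & forall u, H1 u -> hn u <= L -> rho S (fun x => `|u x| `^ p) <= M.
Proof. by apply: rho_bound; [case: (st_Y1 S)|case: (st_Y2 S)]. Qed.

Lemma rho_bound_q L : exists2 M : R, 0 <= M & forall u, H1 u -> hn u <= L -> rho S (fun x => `|u x| `^ q) <= M.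
Proof. by apply: rho_bound; [case: (st_Y1 S)|case: (st_Y2 S)]. Qed.

Lemma maj_bound L : exists2 M : R, 0 <= M & forall u v, H1 u -> H1 v -> hn u <= L -> hn v <= L ->
  \int[pm]_z maj S (fun x => `|u x| `^ p) (fun x => `|v x| `^ q) z <= M.
Proof.
have [M1 M10 h1] := rho_bound_p L; have [M2 M20 h2] := rho_bound_q L; have k0 := kap_ge0 S.
exists (M1 * M2 + kap S * (M1 + M2)) => [|u v hu hv uL vL]; first by apply: addr_ge0; apply: mulr_ge0 => //; exact: addr_ge0.
have [_ I] := maj_int (XCp S hu) (XCq S hv); apply: le_trans I _.
have r1 := h1 u hu uL; have r2 := h2 v hv vL.
apply: lerD; first by apply: ler_pM; [exact: rho_ge0|exact: rho_ge0|exact: r1|exact: r2].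
by apply: ler_wpM2l; [exact: k0|apply: lerD; [exact: r1|exact: r2]].
Qed.

Lemma DD_bound L : exists2 M : R, 0 <= M & forall u v, H1 u -> H1 v -> hn u <= L -> hn v <= L -> DD S u v <= M.
Proof.
have [M M0 h] := maj_bound L; exists M => // u v hu hv uL vL; apply: le_trans (h u v hu hv uL vL).
apply: int_le; [exact: DD_L1|by have [] := maj_int (XCp S hu) (XCq S hv)|move=> z].
by apply: pk_maj => x; exact: powR_ge0.
Qed.

Lemma DDZ a b u v : H1 u -> H1 v -> DD S (fun x => a * u x) (fun x => b * v x) = `|a| `^ p * `|b| `^ q * DD S u v.
Proof.
move=> hu hv; rewrite /DD /BB -intZ; last exact: DD_L1.
by apply: eq_Rintegral => z _; rewrite /pk !normrM !powRM//; ring.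
Qed.

Lemma DD_abs u v : DD S (fun x => `|u x|) (fun x => `|v x|) = DD S u v.
Proof. by apply: eq_Rintegral => z _; rewrite /pk !normr_id. Qed.

Local Transparent Rintegral.

Lemma BB_fubini f g : meas f -> meas g -> (forall x, 0 <= f x) -> (forall x, 0 <= g x) ->
  BB S f g = fine (\int[mu]_x \int[mu]_y (pk K f g (x, y))%:E)%E.
Proof.
move=> mf mg f0 g0; rewrite /BB /Rintegral; apply: (congr1 fine).
rewrite (@fubini_tonelli1 _ _ _ _ _ mu mu (fun z => (pk K f g z)%:E))//.
  by apply/measurable_EFinP; exact: measurable_pk (even_riesz S) mf mg.
by move=> z; rewrite lee_fin (pk_ge0 (even_riesz S)).
Qed.

Local Opaque Rintegral.

Lemma BB_shift f g (a : E) : meas f -> meas g -> (forall x, 0 <= f x) -> (forall x, 0 <= g x) ->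
  BB S (fun x => f (x + a)) (fun x => g (x + a)) = BB S f g.
Proof.
move=> mf mg f0 g0; have mP := measurable_pk (even_riesz S) mf mg.
have mfa := measurable_comp_shift a mf; have mga := measurable_comp_shift a mg.
have P0 z : 0 <= pk K f g z by rewrite (pk_ge0 (even_riesz S)).
rewrite (BB_fubini mfa mga (fun x => f0 _) (fun x => g0 _)) (BB_fubini mf mg f0 g0); apply: (congr1 fine).
have e x : (\int[mu]_y (pk K (fun x => f (x + a)) (fun x => g (x + a)) (x, y))%:E = \int[mu]_y (pk K f g (x + a, y))%:E)%E.
  have m1 : meas (fun y => (pk K f g (x + a, y))%:E).
    by apply/measurable_EFinP; exact: (measurableT_comp mP (measurable_pair1 (x + a))).
  rewrite -(@ge0_integral_shift _ _ a (fun y => (pk K f g (x + a, y))%:E) m1); last by move=> y; rewrite lee_fin.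
  by apply: eq_integral => y _; rewrite /pk/= opprD addrACA subrr addr0.
under eq_integral do rewrite e.
apply: (@ge0_integral_shift _ _ a (fun x => \int[mu]_y (pk K f g (x, y))%:E)%E).
  exact: measurable_pm_F.
by move=> x; apply: integral_ge0 => y _; rewrite lee_fin.
Qed.

Lemma DD_shift (a : E) u v : H1 u -> H1 v -> DD S (fun x => u (x + a)) (fun x => v (x + a)) = DD S u v.
Proof.
move=> hu hv; have [mf f0 _ _] := XCp S hu; have [mg g0 _ _] := XCq S hv.
exact: (@BB_shift (fun x => `|u x| `^ p) (fun x => `|v x| `^ q) a).
Qed.

Lemma BB_ae f g f' g' : meas f -> meas g -> meas f' -> meas g' ->
  (forall x, 0 <= f x) -> (forall x, 0 <= g x) -> (forall x, 0 <= f' x) -> (forall x, 0 <= g' x) ->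
  {ae mu, forall x, f x = f' x} -> {ae mu, forall x, g x = g' x} -> BB S f g = BB S f' g'.
Proof.
move=> mf mg mf' mg' f0 g0 f'0 g'0 ff gg.
have m1 x (ff' gg' : E -> R) : meas ff' -> meas gg' -> meas (fun y => (pk K ff' gg' (x, y))%:E).
  move=> mff mgg; apply/measurable_EFinP.
  exact: (measurableT_comp (measurable_pk (even_riesz S) mff mgg) (measurable_pair1 x)).
have mF (ff' gg' : E -> R) : meas ff' -> meas gg' -> (forall x, 0 <= ff' x) -> (forall x, 0 <= gg' x) ->
    meas (fun x => \int[mu]_y (pk K ff' gg' (x, y))%:E)%E.
  move=> mff mgg ff0 gg0; apply: measurable_pm_F; first exact: measurable_pk (even_riesz S) mff mgg.
  by move=> z; rewrite (pk_ge0 (even_riesz S)).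
rewrite (BB_fubini mf mg f0 g0) (BB_fubini mf' mg' f'0 g'0); apply: (congr1 fine).
apply: ae_eq_integral => //; [exact: mF|exact: mF|].
apply: filterS gg => x gx _; apply: ae_eq_integral => //; [exact: m1|exact: m1|].
by apply: filterS ff => y fy _; rewrite /pk/= fy gx.
Qed.

Lemma DD_ae u v u' v' : H1 u -> H1 v -> H1 u' -> H1 v' ->
  {ae mu, forall x, u x = u' x} -> {ae mu, forall x, v x = v' x} -> DD S u v = DD S u' v'.
Proof.
move=> hu hv hu' hv' uu vv.
have [mf f0 _ _] := XCp S hu; have [mg g0 _ _] := XCq S hv.
have [mf' f0' _ _] := XCp S hu'; have [mg' g0' _ _] := XCq S hv'.
by apply: BB_ae => //; [apply: filterS uu => x ->|apply: filterS vv => x ->].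
Qed.

(* The derivative of DD at (u, v). *)
Definition DL u v h k := p * BB S (fun x => sp p (u x) * h x) (fun x => `|v x| `^ q)
  + q * BB S (fun x => `|u x| `^ p) (fun x => sp q (v x) * k x).

(** Remainder of a product: a0, a' and a1 are the value, the perturbed value and the linear part of
    the first factor, b0, b' and b1 those of the second. *)
Lemma rem_bound (a0 a' a1 b0 b' b1 U V c1 c2 d1 d2 : R) :
  `|a' - a0 - a1| <= d1 * U -> `|b' - b0 - b1| <= d2 * V -> `|a0| <= U -> `|b'| <= V ->
  `|a1| <= c1 * U -> `|b1| <= c2 * V ->
  `|a' * b' - a0 * b0 - a1 * b0 - a0 * b1| <= (d1 + d2 + c1 * c2 + c1 * d2) * (U * V).
Proof.
move=> h1 h2 h3 h4 h5 h6.
have -> : a' * b' - a0 * b0 - a1 * b0 - a0 * b1 =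
  (a' - a0 - a1) * b' + a0 * (b' - b0 - b1) + a1 * b1 + a1 * (b' - b0 - b1) by ring.
have -> : (d1 + d2 + c1 * c2 + c1 * d2) * (U * V) =
  d1 * U * V + U * (d2 * V) + (c1 * U) * (c2 * V) + (c1 * U) * (d2 * V) by ring.
apply: le_trans (ler_normD _ _) _; apply: lerD; last by rewrite normrM; exact: ler_pM.
apply: le_trans (ler_normD _ _) _; apply: lerD; last by rewrite normrM; exact: ler_pM.
by apply: le_trans (ler_normD _ _) _; apply: lerD; rewrite normrM; exact: ler_pM.
Qed.

Lemma measurable_sp r u : meas u -> meas (fun x => sp r (u x)).
Proof.
move=> mu'; rewrite (_ : (fun x => _) = fun x => Num.sg (u x) * `|u x| `^ (r - 1))//.
apply: measurable_funM; last exact: measurable_abs_powR.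
rewrite (_ : (fun x => _) = fun x => \1_[set x | 0 < u x] x - \1_[set x | u x < 0] x).
  apply: measurable_funB; apply: measurable_indic; rewrite -[X in measurable X]setTI; exact: measurable_fun_ltr.
by apply/funext => x; rewrite !indic_pred; case: sgrP => _; rewrite ?subr0 ?sub0r.
Qed.

Lemma sp_le r (a b U : R) : 1 < r -> 0 <= b -> `|a| <= U -> b <= U -> `|sp r a| * b <= U `^ r.
Proof.
move=> r1 b0 aU bU; have U0 : 0 <= U by exact: le_trans aU.
have [U00|Un] := eqVneq U 0.
  have -> : b = 0 by apply/le_anti; rewrite b0 -U00 bU.
  by rewrite mulr0 powR_ge0.
have Up : 0 < U by rewrite lt_def Un.
have -> : U `^ r = U `^ (r - 1) * U by rewrite -[X in _ = _ * X](powRr1 U0) -powR_pos_add// subrK.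
rewrite sp_norm//; apply: ler_pM; rewrite ?powR_ge0//.
by apply: ge0_ler_powR; rewrite ?nnegrE//; lra.
Qed.

(** b is thought of as having size l, and U majorises |a| + |b|/l. The remainder, the two values and
    the linear part are then all multiples of U^r, with factors e l + C l^r, 1, 1 and r l. *)
Lemma tangent_bound r (e C a b l U : R) : 1 < r -> 0 <= e -> 0 <= C -> 0 < l <= 1 ->
  (forall x y : R, `| `|x + y| `^ r - `|x| `^ r - r * (sp r x * y)| <= e * (`|x| `^ (r - 1) * `|y|) + C * `|y| `^ r) ->
  `|a| <= U -> l^-1 * `|b| <= U -> `|a| + l^-1 * `|b| <= U ->
  [/\ `| `|a + b| `^ r - `|a| `^ r - r * (sp r a * b)| <= (e * l + C * l `^ r) * U `^ r,
     `| `|a| `^ r| <= U `^ r, `| `|a + b| `^ r| <= U `^ r & `|r * (sp r a * b)| <= r * l * U `^ r].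
Proof.
move=> r1 e0 C0 /andP[l0 l1] T aU bU abU; have U0 : 0 <= U by exact: le_trans aU.
have r0 : 0 <= r by lra.
have be : `|b| = l * (l^-1 * `|b|) by rewrite mulrA divff ?mul1r ?gt_eqF.
have ib0 : 0 <= l^-1 * `|b| by rewrite mulr_ge0 ?invr_ge0// ltW.
have spb := sp_le r1 ib0 aU bU; rewrite sp_norm// in spb.
have br : `|b| `^ r <= l `^ r * U `^ r.
  rewrite be powRM// ?(ltW l0)//; apply: ler_wpM2l; first exact: powR_ge0.
  by apply: ge0_ler_powR; rewrite ?nnegrE.
split.
- apply: le_trans (T a b) _; rewrite mulrDl; apply: lerD.
    by rewrite -!mulrA; apply: ler_wpM2l => //; rewrite be mulrCA; apply: ler_wpM2l => //; exact: ltW.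
  by rewrite -mulrA; exact: ler_wpM2l.
- by rewrite ger0_norm ?powR_ge0//; apply: ge0_ler_powR; rewrite ?nnegrE.
- rewrite ger0_norm ?powR_ge0//; apply: ge0_ler_powR; rewrite ?nnegrE//.
  apply: le_trans (ler_normD _ _) _; apply: le_trans abU; rewrite lerD2l.
  by rewrite [leLHS]be; apply: ler_piMl.
- rewrite normrM (normrM (sp r a)) sp_norm// (ger0_norm r0) -mulrA; apply: ler_wpM2l => //.
  by rewrite be mulrCA; apply: ler_wpM2l => //; exact: ltW.
Qed.

Lemma small_powers (C1 C2 e : R) : 0 <= C1 -> 0 <= C2 -> 0 < e -> exists2 d : R, 0 < d <= 1 & forall l, 0 < l <= d ->
  C1 * l `^ (p - 1) + C2 * l `^ (q - 1) + p * q * l <= e.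
Proof.
move=> C10 C20 e0; have P1 := st_p1; have Q1 := st_q1.
have pq : 0 < p * q by rewrite mulr_gt0.
pose D := C1 + C2 + p * q; have D0 : 0 < D by rewrite ltr_wpDl ?addr_ge0.
pose n := e / D; have n0 : 0 < n by rewrite divr_gt0.
exists (Num.min 1 (Num.min n (Num.min (n `^ (p - 1)^-1) (n `^ (q - 1)^-1)))) => [|l].
  by rewrite !lt_min ltr01 n0 !powR_gt0//= ge_min lexx.
rewrite !le_min => /andP[l0 /and4P[l1 ln lp lq]].
have h r : 1 < r -> l <= n `^ (r - 1)^-1 -> l `^ (r - 1) <= n.
  move=> r1 lr; have r10 : 0 < r - 1 by lra.
  apply: (@le_trans _ _ ((n `^ (r - 1)^-1) `^ (r - 1))).
    by apply: ge0_ler_powR; rewrite ?nnegrE ?powR_ge0 ?(ltW l0) ?(ltW r10).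
  by rewrite -powRrM mulVf ?powRr1 ?(ltW n0)// gt_eqF.
have -> : e = C1 * n + C2 * n + p * q * n by rewrite -!mulrDl -/D /n mulrC divfK// gt_eqF.
by apply: lerD; [apply: lerD|]; apply: ler_wpM2l; rewrite ?(ltW pq)//; exact: h.
Qed.

(** U = |u| + |h|/l and W = |v| + |k|/l stay bounded in H^1 while l tends to 0, and each remainder
    is a factor of smaller order than l times the density of D(U, W). This makes the expansion
    uniform on bounded sets. *)
Lemma DD_tangent L e : 0 < e -> exists2 d : R, 0 < d <= 1 & forall u v h k l,
  H1 u -> H1 v -> H1 h -> H1 k -> hn u <= L -> hn v <= L -> 0 < l <= d -> hn h <= l ^+ 2 -> hn k <= l ^+ 2 ->
  `|DD S (fun x => u x + h x) (fun x => v x + k x) - DD S u v - DL u v h k| <= e * l.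
Proof.
move=> e0; have P1 := st_p1; have Q1 := st_q1.
have [M M0 MP] := DD_bound (2 * L + 2 * 1).
have M1 : 0 < M + 1 by lra.
(* (2 + p) e' and the terms from [small_powers] each amount to at most e/(2(M + 1)), and D(U, W) <=
   M, so the total stays below e l. *)
pose e' := e / (2 * (M + 1) * (2 + p)).
have e'0 : 0 < e' by rewrite divr_gt0// !mulr_gt0//; lra.
have [C1 C10 T1] := powR_tangent P1 e'0; have [C2 C20 T2] := powR_tangent Q1 e'0.
have C20' : 0 <= (1 + p) * C2 by rewrite mulr_ge0//; lra.
have eM : 0 < e / (2 * (M + 1)) by rewrite divr_gt0 ?mulr_gt0.
have [d /andP[d0 d1] dP] := small_powers C10 C20' eM.
exists d => [|u v h k l hu hv hh hk uL vL /andP[l0 ld] hl kl]; first by rewrite d0.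
have l1 : l <= 1 by exact: le_trans d1.
have l01 : 0 < l <= 1 by rewrite l0.
pose hh' x := l^-1 * h x; pose kk' x := l^-1 * k x.
have Hh' : H1 hh' by exact: H1Z. have Hk' : H1 kk' by exact: H1Z.
have hn1 (f : E -> R) : H1 f -> hn f <= l ^+ 2 -> hn (fun x => l^-1 * f x) <= 1.
  by move=> hf fl; rewrite hn_Z// exprVn ler_pdivrMl ?mulr1// exprn_gt0.
pose U x := `|u x| + `|hh' x|; pose W x := `|v x| + `|kk' x|.
have HU : H1 U by apply: H1D; exact: H1_abs.
have HW : H1 W by apply: H1D; exact: H1_abs.
have hnU : hn U <= 2 * L + 2 * 1.
  apply: le_trans (hnD (H1_abs hu) (H1_abs Hh')) _; apply: lerD; rewrite ler_pM2l//.
    exact: le_trans (hn_abs hu) uL.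
  by apply: le_trans (hn_abs Hh') (hn1 h hh hl).
have hnW : hn W <= 2 * L + 2 * 1.
  apply: le_trans (hnD (H1_abs hv) (H1_abs Hk')) _; apply: lerD; rewrite ler_pM2l//.
    exact: le_trans (hn_abs hv) vL.
  by apply: le_trans (hn_abs Hk') (hn1 k hk kl).
have U0 x : `|U x| = U x by rewrite ger0_norm// addr_ge0.
have W0 x : `|W x| = W x by rewrite ger0_norm// addr_ge0.
have XU := XCp S HU; have XW := XCq S HW.
have ifa (f : E -> R) x : l^-1 * `|f x| = `|l^-1 * f x| by rewrite normrM gtr0_norm ?invr_gt0.
have tu x : let Up := `|U x| `^ p in
  [/\ `| `|u x + h x| `^ p - `|u x| `^ p - p * (sp p (u x) * h x)| <= (e' * l + C1 * l `^ p) * Up,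
     `| `|u x| `^ p| <= Up, `| `|u x + h x| `^ p| <= Up & `|p * (sp p (u x) * h x)| <= p * l * Up].
  by rewrite U0; apply: tangent_bound; rewrite ?(ltW e'0) ?ifa// ?lerDl ?lerDr.
have tv x : let Wp := `|W x| `^ q in
  [/\ `| `|v x + k x| `^ q - `|v x| `^ q - q * (sp q (v x) * k x)| <= (e' * l + C2 * l `^ q) * Wp,
     `| `|v x| `^ q| <= Wp, `| `|v x + k x| `^ q| <= Wp & `|q * (sp q (v x) * k x)| <= q * l * Wp].
  by rewrite W0; apply: tangent_bound; rewrite ?(ltW e'0) ?ifa// ?lerDl ?lerDr.
pose a1 x := p * (sp p (u x) * h x); pose b1 x := q * (sp q (v x) * k x).
pose fu x := `|u x| `^ p; pose fv x := `|v x| `^ q.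
pose gu x := `|u x + h x| `^ p; pose gv x := `|v x + k x| `^ q.
pose Up x := `|U x| `^ p; pose Wq x := `|W x| `^ q.
have mu' := (H1_L2 hu).1; have mv := (H1_L2 hv).1; have mh := (H1_L2 hh).1; have mk := (H1_L2 hk).1.
have msu : meas (fun x => sp p (u x) * h x) by apply: measurable_funM => //; exact: measurable_sp.
have msv : meas (fun x => sp q (v x) * k x) by apply: measurable_funM => //; exact: measurable_sp.
have pl0 : 0 < p * l by rewrite mulr_gt0.
have ql0 : 0 < q * l by rewrite mulr_gt0.
have mfu : meas fu by exact: measurable_abs_powR.
have mfv : meas fv by exact: measurable_abs_powR.
have LA : L1 pm (pk K gu gv) by apply: DD_L1; exact: H1D.
have L0 : L1 pm (pk K fu fv) by exact: DD_L1.
have XX r (F : E -> R) : 0 < r -> XC S F -> XC S (fun x => r * F x).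
  move=> r0 [mF F0 F1 F2]; have sc a : L1 mu (fun x => F x `^ a) -> L1 mu (fun x => (r * F x) `^ a).
    move=> LFa; rewrite (_ : (fun _ => _) = fun x => r `^ a * F x `^ a); first exact: L1Z.
    by apply/funext => x; rewrite powRM// ltW.
  split; [exact: measurable_funM|by move=> x; rewrite mulr_ge0// ltW|exact: sc|exact: sc].
have LB : L1 pm (pk K a1 fv).
  have [||||||//] := @pk_dom a1 fv (fun x => p * l * Up x) Wq.
  - exact: measurable_funM.
  - exact: mfv.
  - by move=> x; have [] := tu x.
  - by move=> x; have [] := tv x.
  - exact: (XX (p * l) Up pl0 XU).
  - exact: XW.
have LC : L1 pm (pk K fu b1).
  have [||||||//] := @pk_dom fu b1 Up (fun x => q * l * Wq x).
  - exact: mfu.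
  - exact: measurable_funM.
  - by move=> x; have [] := tu x.
  - by move=> x; have [] := tv x.
  - exact: XU.
  - exact: (XX (q * l) Wq ql0 XW).
have LU : L1 pm (pk K Up Wq) by exact: DD_L1.
pose c := (e' * l + C1 * l `^ p) + (e' * l + C2 * l `^ q) + (p * l) * (q * l) + (p * l) * (e' * l + C2 * l `^ q).
have pw z : `|pk K gu gv z - pk K fu fv z - pk K a1 fv z - pk K fu b1 z| <= c * pk K Up Wq z.
  have [x1 x2 x3 x4] := tu z.2; have [y1 y2 y3 y4] := tv z.1.
  have hz := rem_bound x1 y1 x2 y3 x4 y4; rewrite -/c in hz.
  rewrite /pk (_ : _ - _ = K (z.1 - z.2) * (gu z.2 * gv z.1 - fu z.2 * fv z.1 - a1 z.2 * fv z.1 - fu z.2 * b1 z.1)); last by ring.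
  rewrite normrM ger0_norm// (_ : c * _ = K (z.1 - z.2) * (c * (Up z.2 * Wq z.1))); last by ring.
  exact: ler_wpM2l.
have eDL : DL u v h k = \int[pm]_z pk K a1 fv z + \int[pm]_z pk K fu b1 z.
  rewrite /DL /BB -!intZ.
  - by congr (_ + _); apply: eq_Rintegral => z _; rewrite /pk /a1 /b1 /fu /fv; ring.
  - rewrite (_ : pk _ _ _ = fun z => q^-1 * pk K fu b1 z); first exact: L1Z.
    by apply/funext => z; rewrite /pk /b1 /fu; field; rewrite gt_eqF.
  - rewrite (_ : pk _ _ _ = fun z => p^-1 * pk K a1 fv z); first exact: L1Z.
    by apply/funext => z; rewrite /pk /a1 /fv; field; rewrite gt_eqF.
have LI := L1B (L1B (L1B LA L0) LB) LC.
have -> : DD S (fun x => u x + h x) (fun x => v x + k x) - DD S u v - DL u v h k =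
    \int[pm]_z (pk K gu gv z - pk K fu fv z - pk K a1 fv z - pk K fu b1 z).
  by rewrite (intB (L1B (L1B LA L0) LB) LC) (intB (L1B LA L0) LB) (intB LA L0) eDL opprD addrA.
apply: le_trans (int_abs LI) _.
apply: le_trans (int_le (L1_abs LI) (L1Z c LU) pw) _; rewrite intZ//.
have lp r : l `^ r = l * l `^ (r - 1) by rewrite -[X in X * _](powRr1 (ltW l0)) -powR_pos_add// addrC subrK.
have el0 : 0 <= e' * l := mulr_ge0 (ltW e'0) (ltW l0).
have A1 : 0 <= e' * l + C1 * l `^ p := addr_ge0 el0 (mulr_ge0 C10 (powR_ge0 l p)).
have A2 : 0 <= e' * l + C2 * l `^ q := addr_ge0 el0 (mulr_ge0 C20 (powR_ge0 l q)).
have c0 : 0 <= c.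
  apply: addr_ge0; last exact: mulr_ge0 (ltW pl0) A2.
  by apply: addr_ge0; [exact: addr_ge0 A1 A2|exact: mulr_ge0 (ltW pl0) (ltW ql0)].
have cl : c <= l * (e' * (2 + p) + (C1 * l `^ (p - 1) + (1 + p) * C2 * l `^ (q - 1) + p * q * l)).
  rewrite -subr_ge0 (_ : _ - _ = p * (1 - l) * (e' * l + C2 * l `^ q)); last by rewrite /c (lp p) (lp q); ring.
  by rewrite mulr_ge0// mulr_ge0 ?subr_ge0// ltW.
have DM : \int[pm]_z pk K Up Wq z <= M by exact: MP.
have D0' : 0 <= \int[pm]_z pk K Up Wq z by exact: DD_ge0.
apply: (@le_trans _ _ (l * (e' * (2 + p) + e / (2 * (M + 1))) * (M + 1))).
  apply: ler_pM; [exact: c0|exact: D0'| |by apply: le_trans DM _; rewrite lerDl].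
  apply: le_trans cl _; rewrite ler_pM2l// lerD2l; apply: dP; by rewrite l0.
apply: le_of_eq; rewrite /e'; field.
have p2 : 0 < 2 + p by exact: addr_gt0.
by rewrite !gt_eqF.
Qed.

End calculus.

Lemma half_frac (R : realFieldType) (C e : R) : 0 <= C -> 0 <= e -> C * (e / (2 * (C + 1))) <= e / 2.
Proof.
move=> C0 e0; have C1 : 0 < C + 1 by lra.
by rewrite mulrA ler_pdivrMr ?mulr_gt0//; nra.
Qed.

Lemma int_lin4 d (T : measurableType d) (R : realType) (mu : {measure set T -> \bar R}) (a b c e : R) (f g h k : T -> R) :
  L1 mu f -> L1 mu g -> L1 mu h -> L1 mu k ->
  \int[mu]_t ((a * f t + b * g t) + (c * h t + e * k t)) =
  (a * \int[mu]_t f t + b * \int[mu]_t g t) + (c * \int[mu]_t h t + e * \int[mu]_t k t).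
Proof.
move=> Lf Lg Lh Lk.
rewrite (intD (L1D (L1Z a Lf) (L1Z b Lg)) (L1D (L1Z c Lh) (L1Z e Lk))).
by rewrite (intD (L1Z a Lf) (L1Z b Lg)) (intD (L1Z c Lh) (L1Z e Lk)) (intZ a Lf) (intZ b Lg) (intZ c Lh) (intZ e Lk).
Qed.

(** * Weak convergence to zero *)

Section weak_convergence.
Context {R : realType} {N : nat}.
Local Notation E := 'rV[R]_N.
Local Notation mu := (@lebesgue_rV R N).
Local Notation pm := (mu \x mu)%E.
Implicit Types (u f g h : E -> R) (x : E).

Lemma int_gt0 d (T : measurableType d) (nu : {measure set T -> \bar R}) (f : T -> R) (B : set T) :
  L1 nu f -> (forall t, 0 <= f t) -> measurable B -> (forall t, B t -> 0 < f t) -> (0 < nu B)%E ->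
  0 < \int[nu]_t f t.
Proof.
move=> Lf f0 mB fB nB; rewrite lt_def int_ge0// andbT; apply/eqP => I0.
have mf : meas (EFin \o f) by apply/measurable_EFinP; exact: L1_meas Lf.
have : (\int[nu]_t `|(EFin \o f) t| = 0)%E.
  under eq_integral do rewrite /= ger0_norm//.
  by rewrite -EFin_int// I0.
move/(ae_eq_integral_abs nu measurableT mf) => -[C [mC C0 fC]].
suff : (nu B <= nu C)%E by rewrite C0 leNgt nB.
apply: le_measure; rewrite ?inE// => t Bt; apply: fC => /= /(_ I) [] ft0.
by have := fB t Bt; rewrite ft0 ltxx.
Qed.

Lemma ae_pm1 (P : E -> Prop) : {ae mu, forall x, P x} -> {ae pm, forall z, P z.1}.
Proof.
move=> [A [mA A0 PA]]; exists (A `*` setT); split.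
- exact: measurableX.
- transitivity (mu A * mu setT)%E; first exact: product_measure1E.
  by rewrite [X in (X * _)%E](A0 : _ = 0%E) mul0e.
- by move=> z /= nP; split => //; exact: PA.
Qed.

Lemma ae_pm2 (P : E -> Prop) : {ae mu, forall x, P x} -> {ae pm, forall z, P z.2}.
Proof.
move=> [A [mA A0 PA]]; exists (setT `*` A); split.
- exact: measurableX.
- transitivity (mu setT * mu A)%E; first exact: product_measure1E.
  by rewrite [X in (_ * X)%E](A0 : _ = 0%E) mule0.
- by move=> z /= nP; split => //; exact: PA.
Qed.

Lemma cvg_abs_powR (a_ : nat -> R) (b r : R) : 0 < r -> a_ n @[n --> \oo] --> b ->
  `|a_ n| `^ r @[n --> \oo] --> `|b| `^ r.
Proof.
move=> r0 /cvgn_leP ab; apply/cvgn_leP => e e0.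
pose e' := e / (2 * (`|b| `^ r + 1)).
have b1 : 0 < `|b| `^ r + 1 by rewrite ltr_wpDl ?powR_ge0.
have e'0 : 0 < e' by rewrite divr_gt0 ?mulr_gt0.
have [C C0 BL] := powR_brezis_lieb r0 e'0.
have C1 : 0 < C + 1 by rewrite ltr_wpDl.
pose d := e / (2 * (C + 1)); have d0 : 0 < d by rewrite divr_gt0 ?mulr_gt0.
have [M MP] := ab (d `^ r^-1) (powR_gt0 _ d0); exists M => n Mn.
have := BL b (b - a_ n); rewrite (_ : b - (b - a_ n) = a_ n); last by ring.
rewrite distrC => /le_trans; apply; rewrite [leRHS]splitr; apply: lerD.
  by rewrite mulrC; exact: half_frac (powR_ge0 _ _) (ltW e0).
apply: (@le_trans _ _ (C * d)).
  apply: ler_wpM2l => //; rewrite distrC; apply: (@le_trans _ _ ((d `^ r^-1) `^ r)).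
    by apply: ge0_ler_powR; rewrite ?nnegrE ?powR_ge0 ?(ltW r0)// MP.
  by rewrite -powRrM mulVf ?powRr1 ?(ltW d0)// gt_eqF.
exact: half_frac (ltW e0).
Qed.

Lemma bar_lower (M : R) x : (forall i, `|x ord0 i| <= M) -> (bar 1 x)^-1 <= expR (N%:R * M).
Proof.
move=> xM; rewrite /bar -expRN opprK mul1r ler_expR /nrm1.
by rewrite mulr_natl -[X in _ *+ X](card_ord N) -sumr_const; apply: ler_sum => i _.
Qed.

(** Replace f by a bump function phi. On its bounded support the weight [bar 1] is bounded below, so
    phi / [bar 1] is square-integrable and the weighted convergence can be used. *)
Lemma weak0 (z_ : nat -> E -> R) (C : R) f : (forall n, L2 mu (z_ n)) -> (forall n, n2 mu (z_ n) <= C) ->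
  \int[mu]_x (bar 1 x ^+ 2 * z_ n x ^+ 2) @[n --> \oo] --> 0 -> L2 mu f ->
  \int[mu]_x (z_ n x * f x) @[n --> \oo] --> 0.
Proof.
move=> Lz zC zcvg Lf; have C0 : 0 <= C := le_trans (n2_ge0 _ _) (zC 0%N).
have C1 : 0 < C + 1 by rewrite ltr_wpDl.
apply/cvgn_leP => e e0; have e2 : 0 < e / 2 by rewrite divr_gt0.
have e'0 : 0 < e / (2 * (C + 1)) by rewrite divr_gt0 ?mulr_gt0.
have [phi bphi fphi] := bump_dense Lf e'0.
have tphi := bump_test_function bphi; have Lphi := test_L2 tphi.
have bm := @measurable_bar R N 1.
have [M phiM] := bphi.2.
have [D phiD] := continuous_bounded_support (test_continuous tphi) bphi.2.
pose g x := (bar 1 x)^-1 * phi x.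
have Lg : L2 mu g.
  apply: (@bounded_support_L2 _ _ g (expR (N%:R * M) * D) M).
  - apply: measurable_funM; last exact: Lphi.1.
    rewrite (_ : (fun _ => _) = bar (-1)); first exact: measurable_bar.
    by apply/funext => x; rewrite -expRN /bar; congr expR; ring.
  - move=> x; have [px|px] := eqVneq (phi x) 0.
      by rewrite /g px mulr0 normr0 mulr_ge0 ?expR_ge0// (le_trans _ (phiD x)).
    rewrite /g normrM ger0_norm ?invr_ge0 ?bar_ge0//; apply: ler_pM => //; first by rewrite invr_ge0 bar_ge0.
    by apply: bar_lower; exact: phiM.
  - by move=> x gx; apply: phiM; apply: contra_neq gx => p0; rewrite /g p0 mulr0.
have Lbz n : L2 mu (fun x => bar 1 x * z_ n x).
  apply: L2_le (L2_abs (Lz n)) => [|x]; first by apply: measurable_funM => //; exact: (Lz n).1.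
  by rewrite normrM ler_piMl// ger0_norm ?bar_ge0// bar_le1.
have n2g : 0 < n2 mu g + 1 by rewrite ltr_wpDl// n2_ge0.
have bz0 : n2 mu (fun x => bar 1 x * z_ n x) @[n --> \oo] --> 0.
  by apply: n2_cvg0; under eq_cvg do under eq_Rintegral do rewrite exprMn.
have /cvgn_leP/(_ (e / 2 / (n2 mu g + 1)) (divr_gt0 e2 n2g))[K KP] := bz0.
exists K => n Kn; rewrite subr0.
have -> : (fun x => z_ n x * f x) = fun x => z_ n x * (f x - phi x) + bar 1 x * z_ n x * g x.
  by apply/funext => x; rewrite /g; field; rewrite gt_eqF ?bar_gt0.
have Ld := L2B Lf Lphi.
rewrite intD; [|exact: L2_mul|exact: L2_mul].
apply: le_trans (ler_normD _ _) _; rewrite [leRHS]splitr; apply: lerD.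
  apply: le_trans (cauchy_schwarz (Lz n) Ld) _.
  apply: (@le_trans _ _ (C * (e / (2 * (C + 1))))).
    by apply: ler_pM; [exact: n2_ge0|exact: n2_ge0|exact: zC|exact: fphi].
  exact: half_frac (ltW e0).
apply: le_trans (cauchy_schwarz (Lbz n) Lg) _.
have := KP n Kn; rewrite subr0 ger0_norm ?n2_ge0// ler_pdivlMr// => h.
apply: le_trans h; apply: ler_wpM2l; first exact: n2_ge0.
by rewrite lerDl.
Qed.

(** Each partial derivative of u is replaced by a bump function, onto which the derivative of z_n is
    moved by the definition of weak derivatives. *)
Lemma weak0_dir (z_ : nat -> E -> R) (C : R) u : (0 < N)%N -> (forall n, H1 (z_ n)) -> (forall n, hn (z_ n) <= C) ->
  \int[mu]_x (bar 1 x ^+ 2 * z_ n x ^+ 2) @[n --> \oo] --> 0 -> H1 u ->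
  dir u (z_ n) @[n --> \oo] --> 0.
Proof.
move=> N0 hz zC zcvg hu; have C0 : 0 <= C := le_trans (hn_ge0 (hz 0%N)) (zC 0%N).
have Lz n := H1_L2 (hz n).
have n2z n : n2 mu (z_ n) <= Num.sqrt C by rewrite ler_wsqrtr//; exact: hn_L2.
have n2wd i n : n2 mu (wd i (z_ n)) <= Num.sqrt C.
  rewrite -(ger0_norm (n2_ge0 mu _)) -sqrtr_sqr ler_wsqrtr//.
  by apply: le_trans (n2_wd_le i (z_ n)) _; exact: hn_dir.
have h i : \int[mu]_x (wd i u x * wd i (z_ n) x) @[n --> \oo] --> 0.
  apply/cvgn_leP => e e0; have e2 : 0 < e / 2 by rewrite divr_gt0.
  have sC : 0 < Num.sqrt C + 1 by rewrite ltr_wpDl// sqrtr_ge0.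
  have e'0 : 0 < e / (2 * (Num.sqrt C + 1)) by rewrite divr_gt0 ?mulr_gt0.
  have Lu := wd_L2 i hu.
  have [phi bphi fphi] := bump_dense Lu e'0.
  have tphi := bump_test_function bphi; have Lphi := test_L2 tphi.
  have /cvgn_leP/(_ _ e2)[K KP] := weak0 Lz n2z zcvg (partial_L2 i tphi).
  exists K => n Kn; rewrite subr0.
  have Lw := wd_L2 i (hz n).
  have -> : (fun x => wd i u x * wd i (z_ n) x) = fun x => (wd i u x - phi x) * wd i (z_ n) x + wd i (z_ n) x * phi x.
    by apply/funext => x; ring.
  have Ld := L2B Lu Lphi.
  rewrite intD; [|exact: L2_mul|exact: L2_mul].
  apply: le_trans (ler_normD _ _) _; rewrite [leRHS]splitr; apply: lerD.
    apply: le_trans (cauchy_schwarz Ld Lw) _.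
    apply: (@le_trans _ _ (e / (2 * (Num.sqrt C + 1)) * Num.sqrt C)).
      by apply: ler_pM; [exact: n2_ge0|exact: n2_ge0|exact: fphi|exact: n2wd].
    by rewrite mulrC; exact: half_frac (sqrtr_ge0 _) (ltW e0).
  have := wd_weak i (hz n) tphi => /(congr1 (fun t => - t)); rewrite opprK => <-; rewrite normrN.
  by have := KP n Kn; rewrite subr0.
have s (r : seq 'I_N) : \sum_(i <- r) \int[mu]_x (wd i u x * wd i (z_ n) x) @[n --> \oo] --> 0.
  elim: r => [|i r IH].
    by apply: (eq_cvgn (b := fun=> 0)) => [n|]; [rewrite big_nil|exact: cvg_cst].
  apply: (eq_cvgn (b := fun n => \int[mu]_x (wd i u x * wd i (z_ n) x) + \sum_(j <- r) \int[mu]_x (wd j u x * wd j (z_ n) x))) => [n|].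
    by rewrite big_cons.
  by rewrite -[X in _ --> X]addr0; exact: cvgD.
Local Transparent dir.
exact: (s (index_enum 'I_N)).
Local Opaque dir.
Qed.

End weak_convergence.

(** * Splitting of the nonlocal term *)

Section splitting.
Context {R : realType} {N : nat} (S : setting R N).
Local Notation E := 'rV[R]_N.
Local Notation mu := (@lebesgue_rV R N).
Local Notation pm := (mu \x mu)%E.
Local Notation p := (st_p S).
Local Notation q := (st_q S).
Local Notation K := (@riesz R N (st_alpha S)).
Implicit Types (u v f g h F G : E -> R) (x : E) (r : R) (z : E * E).

Let K0 x : 0 <= K x. Proof. by have [_ h _] := even_riesz S. Qed.
Let p0 : 0 < p. Proof. exact: lt_trans (st_p1 S). Qed.
Let q0 : 0 < q. Proof. exact: lt_trans (st_q1 S). Qed.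

Let pw r u x := `|u x| `^ r.

Lemma split_pointwise (P e1 e2 C1 C2 a u b v : R) : 0 <= P ->
  `| `|a| `^ p - `|a - u| `^ p | <= e1 * `|a| `^ p + C1 * `|u| `^ p ->
  `| `|b| `^ q - `|b - v| `^ q | <= e2 * `|b| `^ q + C2 * `|v| `^ q ->
  `|P * `|a| `^ p * `|b| `^ q - P * `|a - u| `^ p * `|b - v| `^ q| <=
  e2 * (P * `|a| `^ p * `|b| `^ q) + C2 * (P * `|a| `^ p * `|v| `^ q)
  + (e1 * (P * `|a| `^ p * `|b - v| `^ q) + C1 * (P * `|u| `^ p * `|b - v| `^ q)).
Proof.
move=> P0; move: (powR_ge0 `|a| p) (powR_ge0 `|b - v| q).
move: (`|a| `^ p) (`|a - u| `^ p) (`|u| `^ p) (`|b| `^ q) (`|b - v| `^ q) (`|v| `^ q) => A A' U B B' V A0 B0 h1 h2.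
have -> : P * A * B - P * A' * B' = P * (A * (B - B') + B' * (A - A')) by ring.
have -> : e2 * (P * A * B) + C2 * (P * A * V) + (e1 * (P * A * B') + C1 * (P * U * B')) =
  P * (A * (e2 * B + C2 * V) + B' * (e1 * A + C1 * U)) by ring.
rewrite normrM (ger0_norm P0); apply: ler_wpM2l => //; apply: le_trans (ler_normD _ _) _.
by rewrite !normrM (ger0_norm A0) (ger0_norm B0); apply: lerD; exact: ler_wpM2l.
Qed.

(** The Brezis-Lieb lemma on the product space. The elementary inequality leaves two terms in the
    full sequences with a small factor e1, and two mixed terms, for (u_n, v) and (u, v_n - v), with
    one factor fixed. [pk_maj_scaled] bounds the latter by d times a bounded majorant plus a fixed
    integrable weight. *)
Lemma DD_split (u_ v_ : nat -> E -> R) u v (L : R) : (forall n, H1 (u_ n)) -> (forall n, H1 (v_ n)) ->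
  (forall n, hn (u_ n) <= L) -> (forall n, hn (v_ n) <= L) -> H1 u -> H1 v ->
  {ae mu, forall x, u_ n x @[n --> \oo] --> u x} -> {ae mu, forall x, v_ n x @[n --> \oo] --> v x} ->
  DD S (u_ n) (v_ n) - DD S (fun x => u_ n x - u x) (fun x => v_ n x - v x) @[n --> \oo] --> DD S u v.
Proof.
move=> hu hv uL vL Hu Hv uu vv.
have hz n := H1B (hu n) Hu; have hy n := H1B (hv n) Hv.
pose L' := Num.max (2 * L + 2 * hn u) (Num.max (2 * L + 2 * hn v) (Num.max L (Num.max (hn u) (hn v)))).
have hnB f g : H1 f -> H1 g -> hn (fun x => f x - g x) <= 2 * hn f + 2 * hn g.
  move=> hf hg; have := hnD hf (H1Z (-1) hg); rewrite hn_Z// sqrrN expr1n mul1r.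
  by under [X in hn X <= _]eq_fun do rewrite mulN1r.
have zL n : hn (fun x => u_ n x - u x) <= L'.
  by rewrite le_max (le_trans (hnB _ _ (hu n) Hu))// lerD2r ler_pM2l// uL.
have yL n : hn (fun x => v_ n x - v x) <= L'.
  rewrite le_max; apply/orP; right; rewrite le_max; apply/orP; left.
  by rewrite (le_trans (hnB _ _ (hv n) Hv))// lerD2r ler_pM2l// vL.
have uL' n : hn (u_ n) <= L' by rewrite /L' !le_max uL !orbT.
have vL' n : hn (v_ n) <= L' by rewrite /L' !le_max vL !orbT.
have UL' : hn u <= L' by rewrite /L' !le_max lexx !orbT.
have VL' : hn v <= L' by rewrite /L' !le_max lexx !orbT.
have [M1 M10 M1P] := DD_bound S L'; have [M2 M20 M2P] := maj_bound S L'.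
pose M := M1 + M2 + 1; have M0 : 0 < M by rewrite ltr_wpDl// addr_ge0.
have M1M : M1 <= M by rewrite /M -addrA lerDl addr_ge0.
have M2M : M2 <= M by rewrite /M addrAC lerDr addr_ge0.
pose F n z := pk K (pw p (u_ n)) (pw q (v_ n)) z - pk K (pw p (fun x => u_ n x - u x)) (pw q (fun x => v_ n x - v x)) z.
pose G := pk K (pw p u) (pw q v).
have LF1 n := DD_L1 S (hu n) (hv n); have LF2 n := DD_L1 S (hz n) (hy n).
have LG : L1 pm G by exact: DD_L1.
have LF n : L1 pm (F n) by exact: L1B (LF1 n) (LF2 n).
apply: (eq_cvgn (b := fun n => \int[pm]_z F n z)) => [n|]; first exact: (esym (intB (LF1 n) (LF2 n))).
apply: (generalized_dct (G := G)) => //.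
  have z0 r (f_ : nat -> R) (f : R) : 0 < r -> f_ n @[n --> \oo] --> f -> `|f_ n - f| `^ r @[n --> \oo] --> 0.
    move=> r0 ff; have e : `|f - f| `^ r = 0 by rewrite subrr normr0 powR0 ?gt_eqF.
    by rewrite -[X in _ --> X]e; apply: cvg_abs_powR => //; apply: cvgB => //; exact: cvg_cst.
  apply: filterS2 (ae_pm2 uu) (ae_pm1 vv) => z cu cv.
  rewrite -[X in _ --> X]subr0; apply: cvgB.
    by apply: cvgM; [apply: cvgM; [exact: cvg_cst|exact: cvg_abs_powR]|exact: cvg_abs_powR].
  rewrite (_ : 0 = K (z.1 - z.2) * 0 * 0); last by rewrite !mulr0.
  by apply: cvgM; [apply: cvgM; [exact: cvg_cst|exact: z0]|exact: z0].
(* The two terms with e1 cost e1 M each, e/2 together, and d below is such that (C1 + C2) d M <=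
   e/2. *)
move=> e e0; pose e1 := e / (4 * M).
have e10 : 0 < e1 by rewrite divr_gt0// mulr_gt0.
have [C1 C10 B1] := powR_brezis_lieb p0 e10; have [C2 C20 B2] := powR_brezis_lieb q0 e10.
have C12 : 0 < C1 + C2 + 1 by rewrite ltr_wpDl// addr_ge0.
pose d := e / (2 * (C1 + C2 + 1) * M); have d0 : 0 < d by rewrite divr_gt0// !mulr_gt0.
have [D D0 DP] := pk_maj_scaled S d0.
have Xu := XCp S Hu; have Xv := XCq S Hv; have Xun n := XCp S (hu n); have Xyn n := XCq S (hy n).
have [LWu _] := wt_int Xu; have [LWv _] := wt_int Xv; have [LWv' _] := L1_pm_swap LWv.
pose H z := G z + (C1 * D * wt S (pw p u) z + C2 * D * wt S (pw q v) (z.2, z.1)).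
pose Hn n z := (e1 * pk K (pw p (u_ n)) (pw q (v_ n)) z + e1 * pk K (pw p (u_ n)) (pw q (fun x => v_ n x - v x)) z)
   + (C2 * d * maj S (pw p (u_ n)) (pw q v) z + C1 * d * maj S (pw p u) (pw q (fun x => v_ n x - v x)) z).
have LM1 n : L1 pm (maj S (pw p (u_ n)) (pw q v)) by have [] := maj_int (Xun n) Xv.
have LM2 n : L1 pm (maj S (pw p u) (pw q (fun x => v_ n x - v x))) by have [] := maj_int Xu (Xyn n).
have LP2 n := DD_L1 S (hu n) (hy n).
have LA n := L1D (L1Z e1 (LF1 n)) (L1Z e1 (LP2 n)).
have LB n := L1D (L1Z (C2 * d) (LM1 n)) (L1Z (C1 * d) (LM2 n)).
have pw0 r f x : 0 <= pw r f x by exact: powR_ge0.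
have pk0 f g z : (forall x, 0 <= f x) -> (forall x, 0 <= g x) -> 0 <= pk K f g z.
  by move=> f0 g0; exact: (pk_ge0 (even_riesz S)).
exists H, Hn; split.
- exact: L1D LG (L1D (L1Z _ LWu) (L1Z _ LWv')).
- by move=> n; exact: L1D (LA n) (LB n).
- move=> n; rewrite [leLHS](int_lin4 e1 e1 (C2 * d) (C1 * d) (LF1 n) (LP2 n) (LM1 n) (LM2 n)).
  have i1 : \int[pm]_z pk K (pw p (u_ n)) (pw q (v_ n)) z <= M.
    by apply: le_trans M1M; exact: (M1P _ _ (hu n) (hv n) (uL' n) (vL' n)).
  have i2 : \int[pm]_z pk K (pw p (u_ n)) (pw q (fun x => v_ n x - v x)) z <= M.
    by apply: le_trans M1M; exact: (M1P _ _ (hu n) (hy n) (uL' n) (yL n)).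
  have i3 : \int[pm]_z maj S (pw p (u_ n)) (pw q v) z <= M.
    by apply: le_trans M2M; exact: (M2P _ _ (hu n) Hv (uL' n) VL').
  have i4 : \int[pm]_z maj S (pw p u) (pw q (fun x => v_ n x - v x)) z <= M.
    by apply: le_trans M2M; exact: (M2P _ _ Hu (hy n) UL' (yL n)).
  apply: (@le_trans _ _ ((e1 * M + e1 * M) + (C2 * d * M + C1 * d * M))).
    have c2d : 0 <= C2 * d := mulr_ge0 C20 (ltW d0).
    have c1d : 0 <= C1 * d := mulr_ge0 C10 (ltW d0).
    exact: (lerD (lerD (ler_wpM2l (ltW e10) i1) (ler_wpM2l (ltW e10) i2)) (lerD (ler_wpM2l c2d i3) (ler_wpM2l c1d i4))).
  have -> : e1 * M + e1 * M = e / 2 by rewrite /e1; field; rewrite gt_eqF.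
  rewrite -[leRHS]/e [leRHS]splitr lerD2l -mulrDl -mulrDl /d.
  rewrite (_ : (C2 + C1) * _ * M = (e / 2) * ((C2 + C1) / (C1 + C2 + 1))); last by field; rewrite !gt_eqF.
  rewrite ler_piMr ?divr_ge0 ?(ltW e0)// ler_pdivrMr// mul1r addrC lerDl//.
- have c2d : 0 <= C2 * d := mulr_ge0 C20 (ltW d0).
  have c1d : 0 <= C1 * d := mulr_ge0 C10 (ltW d0).
  move=> n z; apply: addr_ge0.
    by apply: addr_ge0; apply: (mulr_ge0 (ltW e10)); apply: pk0 => x; exact: pw0.
  by apply: addr_ge0; [apply: (mulr_ge0 c2d); exact: maj_ge0|apply: (mulr_ge0 c1d); exact: maj_ge0].
- move=> n z; rewrite /F; apply: le_trans (ler_normB _ _) _.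
  rewrite [`|G z|]ger0_norm; last exact: pk0.
  have h1 := split_pointwise (K0 (z.1 - z.2)) (B1 (u_ n z.2) (u z.2)) (B2 (v_ n z.1) (v z.1)).
  have h2 := DP (pw p u) (pw q (fun x => v_ n x - v x)) z (pw0 _ _) (pw0 _ _).
  have h3 := DP (pw q v) (pw p (u_ n)) (z.2, z.1) (pw0 _ _) (pw0 _ _).
  rewrite -pk_swap -maj_swap in h3.
  have h2' := ler_wpM2l C10 h2; have h3' := ler_wpM2l C20 h3.
  apply: le_trans (lerD h1 (lexx _)) _.
  rewrite -/(pk K (pw p (u_ n)) (pw q (v_ n)) z) -/(pk K (pw p (u_ n)) (pw q v) z)
    -/(pk K (pw p (u_ n)) (pw q (fun x => v_ n x - v x)) z) -/(pk K (pw p u) (pw q (fun x => v_ n x - v x)) z).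
  rewrite /Hn /H; move: h2' h3'.
  move: (pk K (pw p (u_ n)) (pw q (v_ n)) z) (pk K (pw p (u_ n)) (pw q v) z)
    (pk K (pw p (u_ n)) (pw q (fun x => v_ n x - v x)) z) (pk K (pw p u) (pw q (fun x => v_ n x - v x)) z)
    (maj S (pw p (u_ n)) (pw q v) z) (maj S (pw p u) (pw q (fun x => v_ n x - v x)) z) (G z)
    (wt S (pw p u) z) (wt S (pw q v) (z.2, z.1)).
  clear; move=> P1 P2 P3 P4 m1 m2 g w1 w2 h2 h3.
  apply: (@le_trans _ _ (e1 * P1 + C2 * (d * m1 + D * w2) + (e1 * P3 + C1 * (d * m2 + D * w1)) + g)).
    by rewrite lerD2r; apply: lerD; [rewrite lerD2l|rewrite lerD2l].
  by apply: le_of_eq; ring.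
Qed.

End splitting.

Lemma cvg_sub (R : realType) (a : nat -> R) (l : R) (psi : nat -> nat) : (forall n, (psi n < psi n.+1)%N) ->
  a n @[n --> \oo] --> l -> a (psi n) @[n --> \oo] --> l.
Proof.
move=> ps /cvgn_leP al; apply/cvgn_leP => e /al [M MP]; exists M => n Mn; apply: MP; apply: leq_trans Mn _.
by elim: n => // n IH; exact: leq_ltn_trans IH (ps n).
Qed.

Lemma strict_comp (f g : nat -> nat) : (forall n, (f n < f n.+1)%N) -> (forall n, (g n < g n.+1)%N) ->
  forall n, (f (g n) < f (g n.+1))%N.
Proof.
move=> fs gs n; have h a b : (a < b)%N -> (f a < f b)%N.
  by elim: b => // b IH; rewrite ltnS leq_eqVlt => /orP[/eqP->//|/IH /ltn_trans]; apply.
exact: h.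
Qed.

Lemma weighted_sqr (R : realType) (a b c d : R) : 1 <= c * d -> a ^+ 2 <= 2 * c * (d * (a - b) ^+ 2) + 2 * b ^+ 2.
Proof.
move=> cd; have h : (a - b) ^+ 2 <= c * d * (a - b) ^+ 2 by apply: ler_peMl => //; exact: sqr_ge0.
have := sqr_ge0 (a - b - b); nra.
Qed.

Lemma half_sub (R : realType) (s t : R) : 0 < s -> t <= 1 -> s / 2 <= s - s / 2 * t.
Proof. by move=> s0 t1; nra. Qed.

Lemma split_arith1 (R : realType) (a b c d e f g t : R) :
  - (t / 5) <= a - g <= t / 5 -> - (t / 5) <= e <= t / 5 -> - (t / 5) <= b <= t / 5 ->
  a + 2 * b + c + (d + 2 * e + f) <= 1 -> c + f <= 1 - (g + d) + t.
Proof. by move=> *; lra. Qed.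

Lemma split_arith2 (R : realType) (s t a b c k e e1 : R) :
  0 < e -> s - t < a -> a - b - c <= e / 4 -> t <= e / 4 -> b <= s * (1 - k + e1) -> s * e1 <= e / 4 -> s * k <= c + e.
Proof. by move=> *; nra. Qed.

Lemma powR_base_lt1 (R : realType) (a x : R) : 0 < a -> a < 1 -> 0 < x -> a `^ x < 1.
Proof. by move=> a0 a1 x0; rewrite /powR gt_eqF// -expR0 ltr_expR pmulr_rlt0// ln_lt0// a0. Qed.

(** * Maximisers *)

Section energy.
Context {R : realType} {N : nat}.
Local Notation E := 'rV[R]_N.
Local Notation mu := (@lebesgue_rV R N).
Implicit Types (u v f g h a b : E -> R) (x y : E) (m M t : R).

Definition pot a m M := [/\ 0 < m, meas a & forall x, m <= a x <= M].

Definition qa a u := dir u u + \int[mu]_x (a x * u x ^+ 2).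

Lemma pot_L1 a m M f g : pot a m M -> L2 mu f -> L2 mu g -> L1 mu (fun x => a x * (f x * g x)).
Proof.
move=> [m0 ma aM] Lf Lg; have Lfg := L2_mul Lf Lg.
apply: (L1_le (g := fun x => M * `|f x * g x|)).
- by apply: measurable_funM => //; exact: L1_meas Lfg.
- by move=> x; have /andP[h1 h2] := aM x; rewrite normrM ger0_norm ?ler_wpM2r// (le_trans (ltW m0)).
- by apply: L1Z; exact: L1_abs.
Qed.

Lemma pot_L1s a m M f : pot a m M -> L2 mu f -> L1 mu (fun x => a x * f x ^+ 2).
Proof. by move=> pa Lf; have := pot_L1 pa Lf Lf; under eq_fun do rewrite -expr2. Qed.

Lemma qa_lower a m M u : pot a m M -> H1 u -> Num.min 1 m * hn u <= qa a u.
Proof.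
move=> pa hu; have Lu := H1_L2 hu; have [m0 _ aM] := pa.
rewrite /hn /qa mulrDr; apply: lerD; first by rewrite ler_piMl ?dir_ge0// ge_min lexx.
have i0 : 0 <= \int[mu]_x u x ^+ 2 by apply: int_ge0 => x; exact: sqr_ge0.
apply: (@le_trans _ _ (m * \int[mu]_x u x ^+ 2)); first by apply: ler_wpM2r => //; rewrite ge_min lexx orbT.
rewrite -(intZ m Lu.2); apply: int_le; [exact: (L1Z m Lu.2)|exact: (pot_L1s pa Lu)|move=> x].
by apply: ler_wpM2r; [exact: sqr_ge0|have /andP[] := aM x].
Qed.

Lemma qa_ge0 a m M u : pot a m M -> H1 u -> 0 <= qa a u.
Proof.
move=> pa hu; have [m0 _ _] := pa; apply: le_trans (qa_lower pa hu).
by rewrite mulr_ge0 ?hn_ge0// le_min ler01 ltW.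
Qed.

Lemma qa_mono a b m M m' M' u : pot a m M -> pot b m' M' -> H1 u -> (forall x, a x <= b x) -> qa a u <= qa b u.
Proof.
move=> pa pb hu ab; have Lu := H1_L2 hu; apply: lerD; first exact: lexx.
apply: int_le; [exact: (pot_L1s pa Lu)|exact: (pot_L1s pb Lu)|move=> x].
by apply: ler_wpM2r; [exact: sqr_ge0|exact: ab].
Qed.

Lemma qaZ a m M t u : pot a m M -> H1 u -> qa a (fun x => t * u x) = t ^+ 2 * qa a u.
Proof.
move=> pa hu; have Lu := H1_L2 hu; rewrite /qa dirZ// mulrDr -expr2; congr (_ + _).
rewrite -(intZ (t ^+ 2) (pot_L1s pa Lu)); apply: eq_Rintegral => x _; ring.
Qed.

Definition qb a u v := dir u v + \int[mu]_x (a x * (u x * v x)).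

Lemma qaD a m M u v : pot a m M -> H1 u -> H1 v ->
  qa a (fun x => u x + v x) = qa a u + 2 * qb a u v + qa a v.
Proof.
move=> pa hu hv; have Lu := H1_L2 hu; have Lv := H1_L2 hv.
have L1' := pot_L1s pa Lu; have L2' := pot_L1 pa Lu Lv; have L3' := pot_L1s pa Lv.
have e : \int[mu]_x (a x * (u x + v x) ^+ 2) = \int[mu]_x (a x * u x ^+ 2)
    + 2 * \int[mu]_x (a x * (u x * v x)) + \int[mu]_x (a x * v x ^+ 2).
  rewrite -(intZ 2 L2') -(intD L1' (L1Z 2 L2')) -(intD (L1D L1' (L1Z 2 L2')) L3').
  by apply: eq_Rintegral => x _; ring.
rewrite /qa /qb dirD// e.
move: (dir _ _) (dir u v) (dir v v) (\int[mu]_x _) (\int[mu]_x (a x * (u x * v x))) (\int[mu]_x (a x * v x ^+ 2)); clear => *; ring.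
Qed.

Lemma qa_shift a (c : E) m M u : pot a m M -> H1 u -> qa (fun x => a (x + c)) (fun x => u (x + c)) = qa a u.
Proof.
move=> pa hu; rewrite /qa (dir_shift c hu hu); congr (_ + _).
exact: (int_shift c (pot_L1s pa (H1_L2 hu))).
Qed.

Lemma pot_shift a (c : E) m M : pot a m M -> pot (fun x => a (x + c)) m M.
Proof. by move=> [m0 ma aM]; split => //; exact: measurable_comp_shift. Qed.

Lemma enorm_nrm1 x : enorm x <= nrm1 x.
Proof.
rewrite -(ger0_norm (nrm1_ge0 x)) -sqrtr_sqr ler_wsqrtr// /nrm1.
elim: (index_enum 'I_N) => [|i r IH]; first by rewrite !big_nil expr0n.
rewrite !big_cons sqrrD -[_ ^+ 2 + _ *+ 2 + _]addrA; apply: lerD; first by rewrite sqr_normr.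
by apply: (le_trans IH); rewrite lerDr mulrn_wge0// mulr_ge0// sumr_ge0.
Qed.

(** If infinitely many centres stay bounded, a further subsequence of them converges and continuity
    gives a translate of a. Otherwise the centres leave every ball, and at each fixed y the limit of
    a at infinity is reached. *)
Lemma trans_limit a (Ai : R) (x_ : nat -> E) : (0 < N)%N -> continuous a ->
  a x @[x --> infty_nbhs] --> Ai ->
  exists (psi : nat -> nat) (b : E -> R), [/\ (forall n, psi n < psi n.+1)%N,
    forall y, a (y + x_ (psi n)) @[n --> \oo] --> b y &
    (exists c : E, b = fun x => a (x + c)) \/ b = cst Ai].
Proof.
move=> N0 ca aAi.
have [[M hM]|hM] := pselect (exists M : R, forall n, exists2 m, (n < m)%N & enorm (x_ m) <= M).
- have /choice[f fP] : forall n, exists k : nat, (n < k)%N /\ enorm (x_ k) <= M by move=> n; have [k ? ?] := hM n; exists k.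
  pose psi0 := fix psi0 n := if n is k.+1 then f (psi0 k) else f 0%N.
  have psi0S n : (psi0 n < psi0 n.+1)%N by exact: (fP (psi0 n)).1.
  have psi0M n : enorm (x_ (psi0 n)) <= M by case: n => [|n]; exact: (fP _).2.
  (* The coordinates of the centres as sequences numbered by m, with the default 0 for m >= N, in
     the form that the diagonal extraction expects. *)
  pose cc (m n : nat) := if (m < N)%N =P true is ReflectT mN then x_ (psi0 n) ord0 (Ordinal mN) else 0.
  have M0 : 0 <= M by apply: le_trans (psi0M 0%N); exact: enorm_ge0.
  have ccM (m n : nat) : `|cc m n| <= M.
    by rewrite /cc; case: eqP => [mN|_]; [exact: le_trans (coord_enorm _ _) (psi0M n)|rewrite normr0].
  have [psi1 [psi1S psi1P]] := diagonal_subsequence ccM.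
  have [L LP] := choice psi1P.
  pose c : E := \row_i L i.
  exists (psi0 \o psi1), (fun x => a (x + c)); split.
  + by move=> n /=; exact: (strict_comp psi0S psi1S).
  + move=> y; apply: (cvg_comp (fun n => y + x_ (psi0 (psi1 n))) a (G := nbhs (y + c))); last exact: ca.
    apply: cvgD; first exact: cvg_cst.
    apply: cvg_rV => i; rewrite mxE; have := LP i; rewrite /cc.
    by case: eqP => [iN|]; [rewrite (_ : Ordinal iN = i)//; exact: val_inj|rewrite ltn_ord].
  + by left; exists c.
exists id, (cst Ai); split => //; last by right.
move=> y; apply/cvgrPdist_le => e e0.
have /cvgrPdist_le/(_ e e0)[M MP] := aAi.
have [n0 n0P] : exists n0 : nat, forall k : nat, (n0 < k)%N -> N%:R * M + nrm1 y < enorm (x_ k).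
  apply: contrapT => h; apply: hM; exists (N%:R * M + nrm1 y) => n; apply: contrapT => h2.
  by apply: h; exists n => k nk; rewrite ltNge; apply/negP => xk; apply: h2; exists k.
exists n0.+1 => // n /= nn; apply: MP.
have := n0P n nn; have := enorm_nrm1 (x_ n); have := nrm1D (y + x_ n) (- y); rewrite nrm1N addrAC subrr add0r.
have := nrm1_enorm (y + x_ n) => h1 h2 h3 h4.
have NR : 0 < N%:R :> R by rewrite ltr0n.
rewrite -(ltr_pM2l NR); apply: lt_le_trans h1.
by have := lt_le_trans h4 (le_trans h3 h2); rewrite ltrD2r.
Qed.

End energy.

(** * Existence of a maximiser *)

Section maximizer.
Context {R : realType} {N : nat} (S : setting R N).
Local Notation E := 'rV[R]_N.
Local Notation mu := (@lebesgue_rV R N).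
Local Notation pm := (mu \x mu)%E.
Local Notation p := (st_p S).
Local Notation q := (st_q S).
Local Notation K := (@riesz R N (st_alpha S)).
Variables (A : E -> R) (A0 Ai B : R).
Hypotheses (cA : continuous A) (A00 : 0 < A0) (AA0 : forall x, A0 <= A x).
Hypotheses (Alim : A x @[x --> infty_nbhs] --> Ai) (AAi : forall x, A x <= Ai) (B0 : 0 < B).
Implicit Types (u v w f g h k : E -> R) (x y : E) (t e : R) (z : E * E).

Let N0 : (0 < N)%N := st_N0 S.
Let p0 : 0 < p. Proof. exact: lt_trans (st_p1 S). Qed.
Let q0 : 0 < q. Proof. exact: lt_trans (st_q1 S). Qed.

Lemma pot_A : pot A A0 Ai.
Proof. by split => // [|x]; [exact: measurable_continuous|rewrite AA0 AAi]. Qed.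

Lemma pot_B : pot (cst B : E -> R) B B.
Proof. by split => // x /=; rewrite lexx. Qed.

Definition QQ a u v := qa a u + qa (cst B) v.

Definition m0 : R := Num.min 1 (Num.min A0 B).

Lemma m0_gt0 : 0 < m0. Proof. by rewrite !lt_min ltr01 A00 B0. Qed.

Lemma hn_QQ a u v : pot a A0 Ai -> H1 u -> H1 v -> m0 * hn u <= QQ a u v /\ m0 * hn v <= QQ a u v.
Proof.
move=> pa hu hv; have h1 := qa_lower pa hu; have h2 := qa_lower pot_B hv.
have g1 := qa_ge0 pa hu; have g2 := qa_ge0 pot_B hv.
have k1 : m0 * hn u <= qa a u.
  by apply: le_trans h1; apply: ler_wpM2r; [exact: hn_ge0|rewrite /m0 !le_min !ge_min !lexx ?orbT].
have k2 : m0 * hn v <= qa (cst B) v.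
  by apply: le_trans h2; apply: ler_wpM2r; [exact: hn_ge0|rewrite /m0 !le_min !ge_min !lexx ?orbT].
by split; [apply: le_trans k1 _; rewrite lerDl|apply: le_trans k2 _; rewrite lerDr].
Qed.

Definition LL : R := m0^-1.

Lemma hn_LL a u v : pot a A0 Ai -> H1 u -> H1 v -> QQ a u v <= 1 -> hn u <= LL /\ hn v <= LL.
Proof.
move=> pa hu hv Q1; have [h1 h2] := hn_QQ pa hu hv; have m00 := m0_gt0.
by rewrite /LL -[m0^-1]mulr1; split; rewrite ler_pdivlMl//; [exact: le_trans h1 Q1|exact: le_trans h2 Q1].
Qed.

Lemma QQZ a t u v : pot a A0 Ai -> H1 u -> H1 v ->
  QQ a (fun x => t * u x) (fun x => t * v x) = t ^+ 2 * QQ a u v.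
Proof. by move=> pa hu hv; rewrite /QQ (qaZ t pa hu) (qaZ t pot_B hv) [RHS]mulrDr. Qed.

Definition Dset : set R := [set t | exists u v, [/\ H1 u, H1 v, QQ A u v <= 1 & t = DD S u v]].

Definition SS : R := sup Dset.

Lemma Dset_sup : has_sup Dset.
Proof.
split.
  exists (DD S (fun=> 0) (fun=> 0)), (fun=> 0), (fun=> 0); split => //; [exact: H1_0|exact: H1_0|].
  have e : (fun=> 0) = (fun x : E => 0 * (fun=> 0 : R) x) by apply/funext => x; rewrite mul0r.
  by rewrite e (QQZ 0 pot_A H1_0 H1_0) expr0n mul0r.
have [M M0 MP] := DD_bound S LL; exists M => t [u [v [hu hv Q1 ->]]].
by have [h1 h2] := hn_LL pot_A hu hv Q1; exact: MP.
Qed.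

Lemma SS_ub u v : H1 u -> H1 v -> QQ A u v <= 1 -> DD S u v <= SS.
Proof.
by move=> hu hv Q1; apply: (ub_le_sup (proj2 Dset_sup)); exists u, v; split.
Qed.

Lemma SS_adherent e : 0 < e -> exists u v, [/\ H1 u, H1 v, QQ A u v <= 1 & SS - e < DD S u v].
Proof.
move=> e0; have [t [u [v [hu hv Q1 ->]]] h] := sup_adherent e0 Dset_sup.
by exists u, v; split.
Qed.

(** D has degree p + q and Q degree 2, so D scales like Q to this power. *)
Definition theta : R := (p + q) / 2.

Lemma theta_gt1 : 1 < theta.
Proof. by have := st_p1 S; have := st_q1 S; rewrite /theta => *; lra. Qed.

Lemma SS_hom s u v : 0 < s -> H1 u -> H1 v -> QQ A u v <= s -> DD S u v <= SS * s `^ theta.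
Proof.
move=> s0 hu hv Qs; pose t := (Num.sqrt s)^-1.
have r0 : 0 < Num.sqrt s by rewrite sqrtr_gt0.
have t0 : 0 < t by rewrite invr_gt0.
have := SS_ub (H1Z t hu) (H1Z t hv).
rewrite (QQZ t pot_A hu hv) DDZ// exprVn sqr_sqrtr ?(ltW s0)// ler_pdivrMl// mulr1 => /(_ Qs).
rewrite (gtr0_norm t0) -powR_pos_add// /t -powR_inv1 ?(ltW r0)// -powRrM mulN1r powRN.
rewrite -powR12_sqrt ?(ltW s0)// -powRrM ler_pdivrMl ?powR_gt0// mulrC.
by rewrite (_ : 2^-1 * (p + q) = theta)// /theta mulrC.
Qed.

Lemma DD_gt0 u v : H1 u -> H1 v -> (forall x, 0 < u x) -> (forall x, 0 < v x) -> 0 < DD S u v.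
Proof.
(* Two cubes without a common point, because the kernel is 0 at the origin by convention and
   positive elsewhere. *)
move=> hu hv u0 v0; pose c1 : E := 0; pose c2 : E := \row_i 2.
have V c : mu (cube c 1) = 1%:E by apply: etrans (lebesgue_rV_cube c ler01) _; rewrite expr1n.
apply: (@int_gt0 _ _ _ pm _ (cube c1 1 `*` cube c2 1)).
- exact: DD_L1.
- by move=> z; apply: (pk_ge0 (even_riesz S)) => x; exact: powR_ge0.
- by apply: measurableX; exact: measurable_cube.
- move=> z [z1 z2]; rewrite /pk; apply: mulr_gt0; last by rewrite powR_gt0// normr_gt0 gt_eqF.
  apply: mulr_gt0; last by rewrite powR_gt0// normr_gt0 gt_eqF.
  apply: divr_gt0; first exact: (riesz_constant_gt0 (st_al0 S) (st_alN S)).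
  apply: powR_gt0.
  rewrite lt_def enorm_ge0 andbT; apply/eqP => z0; pose i0 := Ordinal N0.
  have := coord_enorm (z.1 - z.2) i0; rewrite z0 normr_le0 !mxE => /eqP e.
  have := z1 i0; have := z2 i0; rewrite !mxE; lra.
apply: (@lt_le_trans _ _ (mu (cube c1 1) * mu (cube c2 1))%E); first by rewrite !V mule1 lte01.
apply: le_of_eq; apply: esym.
by apply: product_measure1E; exact: measurable_cube.
Qed.

Lemma SS_gt0 : 0 < SS.
Proof.
have hb : H1 (bar 1 : E -> R) by exact: H1_bar.
have d0 : 0 < DD S (bar 1) (bar 1) by apply: DD_gt0 => // x; exact: bar_gt0.
pose s := Num.max 1 (QQ A (bar 1) (bar 1)).
have s0 : 0 < s by rewrite lt_max ltr01.
have := SS_hom s0 hb hb; rewrite le_max lexx orbT => /(_ isT) h.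
by rewrite -(pmulr_lgt0 _ (powR_gt0 theta s0)); exact: lt_le_trans d0 h.
Qed.

(** Vanishing of u alone is enough: in [pk_maj_scaled] the majorant gets a small factor and is
    bounded, and the remaining weight depends on u only and shrinks with [rho]. *)
Lemma D_small L e : 0 < L -> 0 < e -> exists l eta : R, [/\ 0 < l, 0 < eta & forall u v, H1 u -> H1 v -> hn u <= L -> hn v <= L ->
  (forall x, \int[mu]_y (\1_(cube 0 l) y * u (y + x) ^+ 2) <= eta) -> DD S u v <= e].
Proof.
move=> L0 e0; have [M M0 MP] := maj_bound S L.
have M1 : 0 < M + 1 by rewrite ltr_wpDl.
pose d := e / (2 * (M + 1)); have d0 : 0 < d by rewrite divr_gt0 ?mulr_gt0.
have [C C0 CP] := pk_maj_scaled S d0; have k0 := kap_ge0 S.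
have Ck : 0 <= C * kap S by exact: mulr_ge0.
pose e' := e / (2 * (C * kap S + 1)); have e'0 : 0 < e' by rewrite divr_gt0 ?mulr_gt0// ltr_wpDl.
have [l [eta [l0 eta0 van]]] := @rho_vanish _ _ S p L e' (ltac:(by case: (st_Y1 S))) (ltac:(by case: (st_Y2 S))) L0 e'0.
exists l, eta; split => // u v hu hv uL vL ux.
have Xu := XCp S hu; have Xv := XCq S hv.
have [LM _] := maj_int Xu Xv; have [LW IW] := wt_int Xu.
apply: le_trans (int_le (DD_L1 S hu hv) (L1D (L1Z d LM) (L1Z C LW)) _) _.
  by move=> z; apply: CP => x; exact: powR_ge0.
rewrite (intD (L1Z d LM) (L1Z C LW)) (intZ d LM) (intZ C LW) [leRHS]splitr; apply: lerD.
  apply: (@le_trans _ _ (d * M)); first by apply: ler_wpM2l; [exact: ltW|exact: MP].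
  by rewrite mulrC; exact: half_frac (ltW e0).
apply: (@le_trans _ _ (C * kap S * e')); last exact: (half_frac Ck (ltW e0)).
rewrite -mulrA; apply: ler_wpM2l => //; apply: le_trans IW _; apply: ler_wpM2l => //.
exact: van.
Qed.

Lemma QQ_shift a (c : E) u v : pot a A0 Ai -> H1 u -> H1 v ->
  QQ (fun x => a (x + c)) (fun x => u (x + c)) (fun x => v (x + c)) = QQ a u v.
Proof.
move=> pa hu hv; rewrite /QQ (qa_shift c pa hu); congr (_ + _).
exact: (qa_shift c pot_B hv).
Qed.

Lemma SS_hom_shift (c : E) s u v : 0 < s -> H1 u -> H1 v ->
  QQ (fun x => A (x + c)) u v <= s -> DD S u v <= SS * s `^ theta.
Proof.
move=> s0 hu hv Qs; have hu' := H1_shift (- c) hu; have hv' := H1_shift (- c) hv.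
have e f : (fun x => f (x + c + - c)) = f by apply/funext => x; rewrite addrK.
rewrite -(DD_shift S (- c) hu hv); apply: SS_hom => //.
by rewrite -(QQ_shift c pot_A hu' hv') !e.
Qed.

Lemma SS_hom_infty s u v : 0 < s -> H1 u -> H1 v -> QQ (cst Ai) u v <= s ->
  QQ A u v <= QQ (cst Ai) u v /\ DD S u v <= SS * s `^ theta.
Proof.
move=> s0 hu hv Qs.
have pAi : pot (cst Ai : E -> R) A0 Ai by split => // x /=; rewrite lexx andbT; exact: le_trans (AA0 0) (AAi 0).
have h : QQ A u v <= QQ (cst Ai) u v by rewrite /QQ lerD2r; exact: (qa_mono pot_A pAi hu).
by split => //; apply: SS_hom => //; exact: le_trans h Qs.
Qed.

(** On the cube the weight [bar 1] is bounded below, so the weighted convergence is plain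
    convergence there, and the local mass survives up to the factor 2 of a^2 <= 2 (a - b)^2 + 2
    b^2. *)
Lemma mass_limit (u_ : nat -> E -> R) u l (eta : R) : 0 < l -> (forall n, L2 mu (u_ n)) -> L2 mu u ->
  (forall n, eta < \int[mu]_y (\1_(cube 0 l) y * u_ n y ^+ 2)) ->
  \int[mu]_x (bar 1 x ^+ 2 * (u_ n x - u x) ^+ 2) @[n --> \oo] --> 0 ->
  eta <= 2 * \int[mu]_x u x ^+ 2.
Proof.
move=> l0 Lu_ Lu un ucvg; apply/ler_addgt0Pr => e e0.
pose c := expR (N%:R * l); have c0 : 0 < c by exact: expR_gt0.
have ec : 0 < e / (2 * c ^+ 2) by rewrite divr_gt0// mulr_gt0// exprn_gt0.
have /cvgn_leP/(_ _ ec)[n nP] := ucvg; have {nP} := nP n (leqnn n); rewrite subr0 => /(le_trans (ler_norm _)) nP.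
apply: (le_trans (ltW (un n))).
have Ld := L2B (Lu_ n) Lu; have mC := measurable_cube (0 : E) l.
have Lb : L2 mu (fun x => bar 1 x * (u_ n x - u x)).
  apply: L2_le (L2_abs Ld) => [|x]; first by apply: measurable_funM; [exact: measurable_bar|exact: Ld.1].
  by rewrite normrM ler_piMl// ger0_norm ?bar_ge0// bar_le1.
have Lb2 : L1 mu (fun x => bar 1 x ^+ 2 * (u_ n x - u x) ^+ 2).
  by have := Lb.2; under eq_fun do rewrite exprMn.
have Lc : L1 mu (fun y => \1_(cube 0 l) y * u_ n y ^+ 2).
  apply: L1_le (Lu_ n).2 => [|y]; first by apply: measurable_funM; [exact: measurable_indic|exact: L1_meas (Lu_ n).2].
  by rewrite indicE; case: (y \in _); rewrite ?mul1r ?mul0r ?normr0 ?ger0_norm ?sqr_ge0.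
apply: le_trans (int_le Lc (L1D (L1Z (2 * c ^+ 2) Lb2) (L1Z 2 Lu.2)) _) _.
  move=> y; rewrite indicE; have [|_] := boolP (y \in _); last first.
    rewrite mul0r; apply: addr_ge0; apply: mulr_ge0 => //; try exact: sqr_ge0.
      by apply: mulr_ge0 => //; exact: sqr_ge0.
    by apply: mulr_ge0; exact: sqr_ge0.
  rewrite inE mul1r => yl.
  have bc : 1 <= c ^+ 2 * bar 1 y ^+ 2.
    rewrite -exprMn; apply: exprn_ege1.
    rewrite -ler_pdivrMr ?bar_gt0// mul1r; apply: bar_lower => i.
    by have := yl i; rewrite mxE add0r => /andP[h1 h2]; rewrite ger0_norm// ltW.
  exact: weighted_sqr.
rewrite (intD (L1Z _ Lb2) (L1Z _ Lu.2)) (intZ _ Lb2) (intZ _ Lu.2) addrC lerD2l.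
rewrite -ler_pdivlMl ?mulr_gt0 ?exprn_gt0// mulrC; exact: nP.
Qed.

(** The potentials vary with n, so weak convergence is applied to |z_n| against |u|, and the
    potential is replaced by its upper bound. *)
Lemma cross_limit (a_ : nat -> E -> R) (z_ : nat -> E -> R) (C m M0 : R) u : (forall n, pot (a_ n) m M0) ->
  (forall n, H1 (z_ n)) -> (forall n, hn (z_ n) <= C) ->
  \int[mu]_x (bar 1 x ^+ 2 * z_ n x ^+ 2) @[n --> \oo] --> 0 -> H1 u ->
  qb (a_ n) u (z_ n) @[n --> \oo] --> 0.
Proof.
move=> pa hz zC zcvg hu; rewrite -[X in _ --> X]addr0.
apply: cvgD; first exact: (weak0_dir N0 hz zC zcvg hu).
have Lz n := H1_L2 (hz n); have Lu := H1_L2 hu.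
have n2z n : n2 mu (fun x => `|z_ n x|) <= Num.sqrt C.
  rewrite /n2 ler_wsqrtr//; under eq_Rintegral do rewrite sqr_normr.
  exact: hn_L2.
have zcvg' : \int[mu]_x (bar 1 x ^+ 2 * `|z_ n x| ^+ 2) @[n --> \oo] --> 0.
  by under eq_cvg do under eq_Rintegral do rewrite sqr_normr.
have /cvgn_leP h := weak0 (fun n => L2_abs (Lz n)) n2z zcvg' (L2_abs Lu).
have Ai0 : 0 < M0 by have [h1 _ /(_ 0)/andP[h2 h3]] := pa 0%N; exact: lt_le_trans h1 (le_trans h2 h3).
apply/cvgn_leP => e e0; have [M MP] := h (e / M0) (divr_gt0 e0 Ai0); exists M => n Mn.
have := MP n Mn; rewrite !subr0 => /(le_trans (ler_norm _)); rewrite ler_pdivlMr// => h'.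
apply: le_trans (int_abs (pot_L1 (pa n) Lu (Lz n))) _; apply: le_trans h'; rewrite mulrC.
have Lzu := L2_mul (L2_abs (Lz n)) (L2_abs Lu).
rewrite -[leRHS](intZ M0 Lzu); apply: int_le; [exact: (L1_abs (pot_L1 (pa n) Lu (Lz n)))|exact: (L1Z M0 Lzu)|move=> x].
have [m1 _ /(_ x)/andP[h1 h2]] := pa n.
by rewrite normrM ger0_norm ?(le_trans (ltW m1))// normrM [`|u x| * _]mulrC; apply: ler_wpM2r => //; exact: mulr_ge0.
Qed.

Theorem maximizer : exists u v, [/\ H1 u, H1 v, QQ A u v = 1 & DD S u v = SS].
Proof.
have SS0 := SS_gt0; have m00 := m0_gt0.
have LL0 : 0 < LL by rewrite invr_gt0.
have SS2 : 0 < SS / 2 by rewrite divr_gt0.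
have [l [eta [l0 eta0 small]]] := D_small LL0 SS2.
(* This error keeps D above SS/2 along the whole maximising sequence, while vanishing would push it
   to SS/2 or below. *)
have en0 n : 0 < SS / 2 * tn n by rewrite mulr_gt0// tn_gt0.
have /choice[w_ wP] : forall n, exists w : (E -> R) * (E -> R), [/\ H1 w.1, H1 w.2, QQ A w.1 w.2 <= 1 & SS - SS / 2 * tn n < DD S w.1 w.2].
  by move=> n; have [u [v h]] := SS_adherent (en0 n); exists (u, v).
have /choice[x_ xP] : forall n, exists x : E, eta < \int[mu]_y (\1_(cube 0 l) y * (w_ n).1 (y + x) ^+ 2).
  move=> n; have [hu hv Q1 D1] := wP n; have [hL1 hL2] := hn_LL pot_A hu hv Q1.
  apply: contrapT => h; have := small _ _ hu hv hL1 hL2.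
  have hx (x : E) : \int[mu]_y (\1_(cube 0 l) y * (w_ n).1 (y + x) ^+ 2) <= eta.
    by rewrite leNgt; apply/negP => hx; apply: h; exists x.
  move=> /(_ hx); rewrite leNgt => /negP; apply; apply: le_lt_trans D1.
  have /andP[_ t1] := tn_itv (R := R) n.
  exact: half_sub.
have [psi0 [At [psi0S AtP Atcase]]] := trans_limit x_ N0 cA Alim.
pose u0 n x := (w_ (psi0 n)).1 (x + x_ (psi0 n)); pose v0 n x := (w_ (psi0 n)).2 (x + x_ (psi0 n)).
pose a0 n x := A (x + x_ (psi0 n)).
have hu0 n : H1 (u0 n) by have [h _ _ _] := wP (psi0 n); exact: H1_shift.
have hv0 n : H1 (v0 n) by have [_ h _ _] := wP (psi0 n); exact: H1_shift.
have pa0 n : pot (a0 n) A0 Ai by exact: pot_shift pot_A.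
have Q0 n : QQ (a0 n) (u0 n) (v0 n) <= 1.
  by have [h1 h2 h3 _] := wP (psi0 n); rewrite (QQ_shift _ pot_A h1 h2).
have D0 n : SS - SS / 2 * tn (psi0 n) < DD S (u0 n) (v0 n).
  by have [h1 h2 _ h3] := wP (psi0 n); rewrite (DD_shift S _ h1 h2).
have uL0 n : hn (u0 n) <= LL by have [] := hn_LL (pa0 n) (hu0 n) (hv0 n) (Q0 n).
have vL0 n : hn (v0 n) <= LL by have [] := hn_LL (pa0 n) (hu0 n) (hv0 n) (Q0 n).
have [u [psi1 [Hu psi1S uae uw]]] := rellich N0 hu0 uL0.
have [v [psi2 [Hv psi2S vae vw]]] := rellich N0 (fun n => hv0 (psi1 n)) (fun n => vL0 (psi1 n)).
pose ph n := psi1 (psi2 n); have phS := strict_comp psi1S psi2S.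
pose U n := u0 (ph n); pose V n := v0 (ph n); pose a_ n := a0 (ph n).
have HU n : H1 (U n) by exact: hu0. have HV n : H1 (V n) by exact: hv0.
have Uae : {ae mu, forall x, U n x @[n --> \oo] --> u x}.
  by apply: filterS uae => x; exact: (cvg_sub psi2S).
have Uw : \int[mu]_x (bar 1 x ^+ 2 * (U n x - u x) ^+ 2) @[n --> \oo] --> 0 by exact: (cvg_sub psi2S uw).
pose z_ n x := U n x - u x; pose y_ n x := V n x - v x.
have Hz n : H1 (z_ n) by exact: H1B. have Hy n : H1 (y_ n) by exact: H1B.
have hnB f g : H1 f -> H1 g -> hn (fun x => f x - g x) <= 2 * hn f + 2 * hn g.
  move=> hf hg; have := hnD hf (H1Z (-1) hg); rewrite hn_Z// sqrrN expr1n mul1r.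
  by under [X in hn X <= _]eq_fun do rewrite mulN1r.
have zC n : hn (z_ n) <= 2 * LL + 2 * hn u.
  by apply: le_trans (hnB _ _ (HU n) Hu) _; rewrite lerD2r ler_pM2l//; exact: uL0.
have yC n : hn (y_ n) <= 2 * LL + 2 * hn v.
  by apply: le_trans (hnB _ _ (HV n) Hv) _; rewrite lerD2r ler_pM2l//; exact: vL0.
have cu := cross_limit (fun n => pa0 (ph n)) Hz zC Uw Hu.
have yw : \int[mu]_x (bar 1 x ^+ 2 * y_ n x ^+ 2) @[n --> \oo] --> 0 by exact: vw.
have cv : qb (cst B) v (y_ n) @[n --> \oo] --> 0.
  exact: (cross_limit (fun=> pot_B) Hy yC yw Hv).
have pAt : pot At A0 Ai.
  case: Atcase => [[c ->]|->]; first exact: pot_shift pot_A.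
  by split => // x /=; rewrite lexx andbT; exact: le_trans (AA0 0) (AAi 0).
have cA0 : qa (a_ n) u @[n --> \oo] --> qa At u.
  apply: cvgD; first exact: cvg_cst.
  have Lu := H1_L2 Hu.
  have Ai0 : 0 < Ai := lt_le_trans A00 (le_trans (AA0 0) (AAi 0)).
  have [|||||_] := @dct _ _ _ mu (fun n x => a_ n x * u x ^+ 2) (fun x => At x * u x ^+ 2) (fun x => Ai * u x ^+ 2) => //.
  - by move=> n; exact: L1_meas (pot_L1s (pa0 (ph n)) Lu).
  - by move=> x; apply: cvgM; [exact: (cvg_sub phS (AtP x))|exact: cvg_cst].
  - exact: L1_meas (pot_L1s pAt Lu).
  - exact: (L1Z Ai Lu.2).
  - move=> n x; rewrite normrM ger0_norm; last by have [_ _ /(_ x)/andP[h _]] := pa0 (ph n); exact: le_trans (ltW A00) h.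
    rewrite ger0_norm ?sqr_ge0//; apply: ler_wpM2r; first exact: sqr_ge0.
    by have [_ _ /(_ x)/andP[]] := pa0 (ph n).
pose kappa := QQ At u v.
have k0 : 0 < kappa.
  have eu := mass_limit l0 (fun n => H1_L2 (HU n)) (H1_L2 Hu) (fun n => xP (psi0 (ph n))) Uw.
  have [h _] := hn_QQ pAt Hu Hv; apply: lt_le_trans h; rewrite pmulr_rgt0//.
  apply: (@lt_le_trans _ _ (\int[mu]_x u x ^+ 2)); last exact: hn_L2 (lexx _).
  by rewrite -(pmulr_rgt0 _ (ltr0n _ 2)); exact: lt_le_trans eta0 eu.
have split_u n : qa (a_ n) (U n) = qa (a_ n) u + 2 * qb (a_ n) u (z_ n) + qa (a_ n) (z_ n).
  rewrite -(qaD (pa0 (ph n)) Hu (Hz n)); congr qa; apply/funext => x; rewrite /z_; ring.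
have split_v n : qa (cst B) (V n) = qa (cst B) v + 2 * qb (cst B) v (y_ n) + qa (cst B) (y_ n).
  rewrite -(qaD pot_B Hv (Hy n)); congr qa; apply/funext => x; rewrite /y_; ring.
have Qz e : 0 < e -> exists M : nat, forall n, (M <= n)%N -> QQ (a_ n) (z_ n) (y_ n) <= 1 - kappa + e.
  move=> e0; have e5 : 0 < e / 5 by rewrite divr_gt0.
  have /cvgn_leP/(_ _ e5)[M1 h1] := cu; have /cvgn_leP/(_ _ e5)[M2 h2] := cv; have /cvgn_leP/(_ _ e5)[M3 h3] := cA0.
  exists (maxn M1 (maxn M2 M3)) => n; rewrite !geq_max => /and3P[n1 n2' n3].
  have := Q0 (ph n); rewrite -/(a_ n) -/(U n) -/(V n) /QQ split_u split_v /kappa /QQ.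
  have := h1 n n1; have := h2 n n2'; have := h3 n n3; rewrite !subr0 !ler_norml.
  exact: split_arith1.
have Qz0 n : 0 <= QQ (a_ n) (z_ n) (y_ n).
  by apply: addr_ge0; [exact: qa_ge0 (pa0 (ph n)) (Hz n)|exact: qa_ge0 pot_B (Hy n)].
have k1 : kappa <= 1.
  rewrite leNgt; apply/negP => k1; have e0 : 0 < (kappa - 1) / 2 by rewrite divr_gt0// subr_gt0.
  have [M /(_ M (leqnn M)) h] := Qz _ e0; have := le_trans (Qz0 M) h; lra.
have Dsp := DD_split (S:=S) HU HV (fun n => uL0 (ph n)) (fun n => vL0 (ph n)) Hu Hv Uae vae.
(* The remainder has energy at most 1 - kappa + e1 <= 1, a range in which s^theta <= s. So it
   contributes at most SS (1 - kappa) in the limit, and the weak limit must supply SS kappa. *)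
have Dk : SS * kappa <= DD S u v.
  apply/ler_addgt0Pr => e e0.
  pose e1 := Num.min kappa (e / (4 * SS)).
  have e10 : 0 < e1 by rewrite lt_min k0 divr_gt0// mulr_gt0.
  have e1k : e1 <= kappa by rewrite ge_min lexx.
  have e1e : SS * e1 <= e / 4.
    by rewrite mulrC -ler_pdivlMr// -mulrA -invfM; rewrite ge_min lexx orbT.
  have [M1 h1] := Qz _ e10.
  have e4 : 0 < e / 4 by rewrite divr_gt0.
  have /cvgn_leP/(_ _ e4)[M2 h2] := Dsp.
  have /cvgn_leP/(_ (e / 4 / (SS / 2)))[|M3 h3] := @tn_cvg R; first by rewrite divr_gt0.
  pose n := maxn M1 (maxn M2 M3).
  have n1 : (M1 <= n)%N by rewrite leq_maxl.
  have n2' : (M2 <= n)%N by rewrite /n leq_max leq_maxl orbT.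
  have n3 : (M3 <= psi0 (ph n))%N.
    have ge (f : nat -> nat) : (forall n, (f n < f n.+1)%N) -> forall i : nat, (i <= f i)%N.
      by move=> fS; elim=> // k IH; exact: leq_ltn_trans IH (fS k).
    by apply: leq_trans (ge _ (strict_comp psi0S phS) n); rewrite /n !leq_max leqnn !orbT.
  have s0 : 0 < 1 - kappa + e1 by rewrite ltr_wpDl ?subr_ge0.
  have s1 : 1 - kappa + e1 <= 1 by rewrite -addrA gerDl addrC subr_le0.
  have Dz : DD S (z_ n) (y_ n) <= SS * (1 - kappa + e1).
    apply: le_trans (SS_hom_shift s0 (Hz n) (Hy n) (h1 n n1)) _.
    apply: ler_wpM2l; first exact: ltW.
    rewrite -[leRHS](powRr1 (ltW s0)); apply: ger_powR; first by rewrite s0.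
    by apply: ltW; exact: theta_gt1.
  have := D0 (ph n); have := h2 n n2'; have := h3 _ n3; rewrite subr0 ger0_norm ?(ltW (tn_gt0 _))//.
  rewrite ler_pdivlMr// -/(U n) -/(V n) ler_norml => g3 /andP[_ g2] g1.
  have g3' : SS / 2 * tn (psi0 (ph n)) <= e / 4 by rewrite mulrC.
  move: g1 g2 g3' Dz e1e; rewrite -/(z_ n) -/(y_ n); exact: split_arith2 e0.
have Dk2 : DD S u v <= SS * kappa `^ theta.
  case: Atcase => [[c e]|e]; first by apply: (SS_hom_shift (c := c)) => //; rewrite -e.
  by have [] := @SS_hom_infty kappa u v k0 Hu Hv (ltac:(by rewrite -e)).
(* SS kappa <= D(u, v) <= SS kappa^theta, with theta > 1, excludes 0 < kappa < 1. *)
have kk : kappa = 1.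
  apply/le_anti; rewrite k1/=; have := le_trans Dk Dk2; rewrite ler_pM2l// => h.
  rewrite leNgt; apply/negP => k1'.
  have : kappa `^ theta < kappa.
    have -> : theta = (theta - 1) + 1 by rewrite subrK.
    rewrite powR_pos_add// powRr1 ?(ltW k0)// gtr_pMl//.
    by apply: powR_base_lt1 => //; rewrite subr_gt0; exact: theta_gt1.
  by rewrite ltNge h.
have D1 : DD S u v = SS.
  by move: Dk Dk2; rewrite kk powR1 !mulr1 => g1 g2; apply/le_anti; rewrite g1 g2.
case: Atcase => [[c e]|e].
  exists (fun x => u (x - c)), (fun x => v (x - c)); have hu' := H1_shift (- c) Hu; have hv' := H1_shift (- c) Hv.
  have e' f : (fun x : E => f (x + c - c)) = f :> (E -> R) by apply/funext => x; rewrite addrK.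
  split; [exact: hu'|exact: hv'| |by rewrite (DD_shift S (- c) Hu Hv)].
  by rewrite -(QQ_shift c pot_A hu' hv') !e' -e.
(* The centres escaped, and (u, v) is optimal for the constant potential, which dominates [A]. Were
   its energy for [A] below 1, homogeneity would give D(u, v) < SS. *)
have kA : QQ (cst Ai) u v <= 1 by rewrite -kk /kappa e.
have [h _] := SS_hom_infty ltr01 Hu Hv kA.
exists u, v; split => //; apply/le_anti; rewrite (le_trans h kA)/=.
rewrite leNgt; apply/negP => Q1.
pose s := Num.max (QQ A u v) 2^-1.
have s0 : 0 < s by rewrite lt_max invr_gt0 ltr0n orbT.
have s1 : s < 1 by rewrite gt_max Q1 invf_lt1// ltr1n.
have := SS_hom s0 Hu Hv; rewrite le_max lexx => /(_ isT); rewrite D1 -{1}[SS]mulr1 ler_pM2l// leNgt => /negP; apply.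
by apply: powR_base_lt1 => //; exact: lt_trans theta_gt1.
Qed.

End maximizer.

Local Transparent Rintegral.

Lemma int_0 d (T : measurableType d) (R : realType) (mu : {measure set T -> \bar R}) : \int[mu]_x (0 : R) = 0.
Proof. by rewrite /Rintegral integral0. Qed.

Local Opaque dir Rintegral.

Lemma frechet_arith (R : realType) (C c e e' l Q X : R) : 0 <= c -> 0 <= Q <= C * l ^+ 2 -> `|X| <= e' * l ->
  C * l <= e -> c * e' <= e / 2 -> 0 < l -> `|2^-1 * Q - c * X| <= e * l.
Proof.
move=> c0 /andP[Q0 QC] XE Cl ce l0; apply: le_trans (ler_normB _ _) _.
rewrite (normrM _ Q) (ger0_norm Q0) (normrM c) (ger0_norm c0) (ger0_norm (_ : 0 <= 2^-1)) ?invr_ge0//.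
rewrite [leRHS](splitr (e * l)); apply: lerD.
  rewrite mulrC ler_pM2r ?invr_gt0//; apply: le_trans QC _; rewrite expr2 mulrA ler_pM2r//.
apply: le_trans (ler_wpM2l c0 XE) _; rewrite mulrA [leRHS]mulrAC; exact: (ler_wpM2r (ltW l0) ce).
Qed.

Lemma perturbation_arith (R : realType) (t b g : R) : 0 < t -> t <= 1 -> 0 <= g ->
  `|2 * t * b + t ^+ 2 * g| <= t * (2 * `|b| + g).
Proof.
move=> t0 t1 g0; apply: le_trans (ler_normD _ _) _; rewrite mulrDr; apply: lerD.
  by rewrite !normrM (gtr0_norm t0) ger0_norm// -mulrA mulrCA.
rewrite (ger0_norm (mulr_ge0 (sqr_ge0 t) g0)); apply: ler_wpM2r => //.
by rewrite expr2 ler_piMl// ltW.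
Qed.

Lemma criticality_arith (R : realType) (t Q c th e H D s X Dt C e0 : R) : 0 < t -> 0 < Q -> 0 < c -> c <= 1 -> c * th = 1 -> 0 <= e ->
  `|2^-1 * (Q * (1 + s)) - c * Dt - (2^-1 * Q - c * (Q / 2)) - t * D| <= e * (t * H) ->
  Dt <= Q / 2 * X -> `|X - 1 - th * s| <= e * `|s| -> Q * `|s| <= t * C -> e * (C + H) <= e0 -> 0 <= e0 + D.
Proof.
move=> t0 Q0 c0 c1 ct e0' T DX Xs sQ eC.
have h1 : c * (Dt - Q / 2) <= c * (Q / 2 * (X - 1)) by rewrite ler_pM2l// mulrBr mulr1 lerB.
have h2 : c * (Q / 2 * (X - 1)) <= Q / 2 * s + c * (Q / 2 * (e * `|s|)).
  have -> : Q / 2 * s = c * (Q / 2 * (th * s)) by rewrite -[in LHS](mul1r s) -ct; ring.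
  rewrite -mulrDr -mulrDr; apply: ler_wpM2l; first exact: ltW.
  apply: ler_wpM2l; first by rewrite divr_ge0// ltW.
  by move: Xs; rewrite ler_norml => /andP[_]; lra.
have h3 : c * (Q / 2 * (e * `|s|)) <= e * (t * C).
  have -> : c * (Q / 2 * (e * `|s|)) = (c / 2) * (e * (Q * `|s|)) by ring.
  have p1 : 0 <= e * (Q * `|s|) by rewrite !mulr_ge0// ltW.
  apply: le_trans (ler_wpM2l e0' sQ); apply: ler_piMl => //; lra.
have h4 : 0 <= t * (e0 + D).
  have h5 : t * (e * (C + H)) <= t * e0 by rewrite ler_pM2l.
  by move: T; rewrite ler_norml => /andP[T1 T2]; lra.
by rewrite pmulr_rge0 in h4.
Qed.

(** * Criticality and the Nehari level *)

Section energy_bilinear.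
Context {R : realType} {N : nat}.
Local Notation E := 'rV[R]_N.
Local Notation mu := (@lebesgue_rV R N).
Implicit Types (u v f a : E -> R) (x : E) (m M t : R).

Lemma dir_gradient u : H1 u -> L1 mu (fun x => enorm (grad u x) ^+ 2) /\
  \int[mu]_x enorm (grad u x) ^+ 2 = dir u u.
Proof.
move=> hu; have -> : (fun x => enorm (grad u x) ^+ 2) = fun x => \sum_i (wd i u x * wd i u x).
  apply/funext => x; rewrite /enorm sqr_sqrtr; first by apply: eq_bigr => i _; rewrite expr2.
  by apply: sumr_ge0 => i _; exact: sqr_ge0.
have Lw i : L1 mu (fun x => wd i u x * wd i u x) by apply: L2_mul; exact: wd_L2.
by split; [exact: L1_sum|exact: int_sum].
Qed.

Lemma qb_linr a m M (t : R) u v (w : E -> R) : pot a m M -> H1 u -> H1 v -> H1 w ->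
  qb a u (fun x => t * v x + w x) = t * qb a u v + qb a u w.
Proof.
move=> pa hu hv hw; have Lu := H1_L2 hu; have Lv := pot_L1 pa Lu (H1_L2 hv); have Lw := pot_L1 pa Lu (H1_L2 hw).
rewrite /qb dir_linr// mulrDr.
rewrite (_ : \int[mu]_x (a x * (u x * (t * v x + w x))) = t * \int[mu]_x (a x * (u x * v x)) + \int[mu]_x (a x * (u x * w x))).
  by move: (dir u v) (dir u w) (\int[mu]_x (a x * (u x * w x))) (\int[mu]_x _) => *; ring.
by rewrite -(intZ t Lv) -(intD (L1Z t Lv) Lw); apply: eq_Rintegral => x _; ring.
Qed.

Lemma qbZ a m M (t : R) u v : pot a m M -> H1 u -> H1 v -> qb a u (fun x => t * v x) = t * qb a u v.
Proof.
move=> pa hu hv; have e0 : qb a u (fun=> 0) = 0.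
  have := qb_linr 1 pa hu H1_0 H1_0; under [X in qb a u X]eq_fun do rewrite mul1r addr0.
  by rewrite mul1r => /(congr1 (fun z => z - qb a u (fun=> 0))); rewrite subrr addrK.
have := qb_linr t pa hu hv H1_0; under [X in qb a u X]eq_fun do rewrite addr0.
by rewrite e0 addr0.
Qed.

Lemma qb_self a u : qb a u u = qa a u.
Proof.
by rewrite /qb /qa (_ : (fun x => a x * (u x * u x)) = fun x => a x * u x ^+ 2).
Qed.

Lemma qa_upper a m M u : pot a m M -> H1 u -> qa a u <= Num.max 1 M * hn u.
Proof.
move=> pa hu; have Lu := H1_L2 hu; have [m0 _ aM] := pa.
rewrite /hn /qa mulrDr; apply: lerD; first by rewrite ler_peMl ?dir_ge0// le_max lexx.
have i0 : 0 <= \int[mu]_x u x ^+ 2 by apply: int_ge0 => x; exact: sqr_ge0.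
apply: (@le_trans _ _ (M * \int[mu]_x u x ^+ 2)); last by apply: ler_wpM2r => //; rewrite le_max lexx orbT.
rewrite -(intZ M Lu.2); apply: int_le; [exact: (pot_L1s pa Lu)|exact: (L1Z M Lu.2)|move=> x].
by apply: ler_wpM2r; [exact: sqr_ge0|have /andP[] := aM x].
Qed.

Lemma qb_bound a m M u v : pot a m M -> H1 u -> H1 v -> `|2 * qb a u v| <= qa a u + qa a v.
Proof.
move=> pa hu hv; have h1 := qa_ge0 pa (H1D hu hv); rewrite (qaD pa hu hv) in h1.
have h2 := qa_ge0 pa (H1D hu (H1Z (-1) hv)); rewrite (qaD pa hu (H1Z (-1) hv)) (qaZ (-1) pa hv) in h2.
have e : qb a u (fun x => -1 * v x) = - qb a u v by rewrite (qbZ _ pa hu hv) mulN1r.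
rewrite e in h2; move: h1 h2; rewrite ler_norml.
by move: (qa a u) (qb a u v) (qa a v) => *; lra.
Qed.

Lemma Hnorm_sqr (w : (E -> R) * (E -> R)) : Hpair w -> Hnorm w ^+ 2 = hn w.1 + hn w.2.
Proof.
move=> [h1 h2]; have [g1 e1] := dir_gradient h1; have [g2 e2] := dir_gradient h2.
have L2' (f : E -> R) : H1 f -> L1 mu (fun x => `|f x| ^+ 2) /\ \int[mu]_x `|f x| ^+ 2 = \int[mu]_x f x ^+ 2.
  move=> hf; rewrite (_ : (fun x => `|f x| ^+ 2) = fun x => f x ^+ 2); first by split => //; exact: (H1_L2 hf).2.
  by apply/funext => x; rewrite sqr_normr.
have [k1 f1] := L2' _ h1; have [k2 f2] := L2' _ h2.
have e : \int[mu]_x (enorm (grad w.1 x) ^+ 2 + `|w.1 x| ^+ 2 + enorm (grad w.2 x) ^+ 2 + `|w.2 x| ^+ 2) = hn w.1 + hn w.2.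
  by rewrite (intD (L1D (L1D g1 k1) g2) k2) (intD (L1D g1 k1) g2) (intD g1 k1) e1 e2 f1 f2 -addrA.
by rewrite /Hnorm e sqr_sqrtr// addr_ge0 ?hn_ge0.
Qed.

Lemma Hnorm_ge0 (w : (E -> R) * (E -> R)) : 0 <= Hnorm w. Proof. exact: sqrtr_ge0. Qed.

Lemma Hnorm_hn (w : (E -> R) * (E -> R)) l : Hpair w -> Hnorm w <= l -> hn w.1 <= l ^+ 2 /\ hn w.2 <= l ^+ 2.
Proof.
move=> hw wl; have [h1 h2] := hw; have := Hnorm_sqr hw.
have : Hnorm w ^+ 2 <= l ^+ 2 by apply: lerXn2r; rewrite ?nnegrE ?Hnorm_ge0//; exact: le_trans (Hnorm_ge0 w) wl.
have := hn_ge0 h1; have := hn_ge0 h2.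
by move: (hn w.1) (hn w.2) (Hnorm w ^+ 2) (l ^+ 2) => *; split; lra.
Qed.

Lemma HpairZ (t : R) (w : (E -> R) * (E -> R)) : Hpair w -> Hpair (t *: w).
Proof. by move=> [h1 h2]; split; exact: H1Z. Qed.

Lemma Hpair0 : Hpair (0 : (E -> R) * (E -> R)).
Proof. by split; exact: H1_0. Qed.

Lemma HpairD (w w' : (E -> R) * (E -> R)) : Hpair w -> Hpair w' -> Hpair (w + w').
Proof. by move=> [h1 h2] [h3 h4]; split; exact: H1D. Qed.

Lemma HnormZ (t : R) (w : (E -> R) * (E -> R)) : Hpair w -> Hnorm (t *: w) = `|t| * Hnorm w.
Proof.
move=> hw; have [h1 h2] := hw; apply/eqP; rewrite -(eqrXn2 (ltn0Sn 1)) ?Hnorm_ge0 ?mulr_ge0 ?Hnorm_ge0//; apply/eqP.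
rewrite exprMn sqr_normr !Hnorm_sqr//; last exact: HpairZ.
by rewrite mulrDr -!hn_Z.
Qed.

(** Scales to the unit ball by a radius slightly above [Hnorm w], because [Hnorm w] may be 0. *)
Lemma homogeneous_bound (L : (E -> R) * (E -> R) -> R) C : 0 <= C ->
  (forall (t : R) w, 0 < t -> Hpair w -> L (t *: w) = t * L w) ->
  (forall w, Hpair w -> hn w.1 <= 1 -> hn w.2 <= 1 -> `|L w| <= C) ->
  forall w, Hpair w -> `|L w| <= C * Hnorm w.
Proof.
move=> C0 LZ LC w hw; apply/ler_addgt0Pr => e e0.
pose l := Hnorm w + e / (C + 1).
have C1 : 0 < C + 1 by rewrite ltr_wpDl.
have ec : 0 < e / (C + 1) by rewrite divr_gt0.
have l0 : 0 < l by rewrite ltr_wpDl ?Hnorm_ge0.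
have [] := @Hnorm_hn (l^-1 *: w) 1 (HpairZ _ hw).
  rewrite HnormZ// ger0_norm ?invr_ge0 ?(ltW l0)// ler_pdivrMl// mulr1 lerDl; exact: ltW.
move=> a1 a2; rewrite expr1n in a1; rewrite expr1n in a2; have := LC _ (HpairZ l^-1 hw) a1 a2.
rewrite LZ ?invr_gt0// normrM ger0_norm ?invr_ge0 ?(ltW l0)// ler_pdivrMl// => h.
apply: le_trans h _; rewrite mulrC /l mulrDr lerD2l mulrA ler_pdivrMr// mulrC ler_pM2l//.
by rewrite lerDl.
Qed.

(** [frechet] picks some derivative. Comparing two derivatives at t h for small t shows that they
    agree on [Hpair], so the picked one may be computed. *)
Lemma is_frechet_unique (F L L' : (E -> R) * (E -> R) -> R) w h :
  is_frechet F w L -> is_frechet F w L' -> Hpair h -> L h = L' h.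
Proof.
move=> [L1' _ L3] [K1 _ K3] hh.
have Lz (G : (E -> R) * (E -> R) -> R) t : (forall (a : R) h k, Hpair h -> Hpair k -> G (a *: h + k) = a * G h + G k) ->
    G (t *: h) = t * G h.
  move=> GL; have := GL 1 0 0 Hpair0 Hpair0; rewrite scale1r addr0 mul1r => /eqP; rewrite -subr_eq subrr => /eqP g0.
  by have := GL t h 0 hh Hpair0; rewrite addr0 -g0 addr0.
apply/eqP; rewrite -subr_eq0 -normr_le0; apply/ler_addgt0Pr => e e0; rewrite [leRHS]add0r.
pose e1 := e / (2 * (Hnorm h + 1)).
have H0 : 0 < Hnorm h + 1 by rewrite ltr_wpDl ?Hnorm_ge0.
have e10 : 0 < e1 by rewrite divr_gt0// mulr_gt0.
have [d d0 dP] := L3 e1 e10; have [d' d'0 d'P] := K3 e1 e10.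
pose t := Num.min d d' / (2 * (Hnorm h + 1)).
have m0 : 0 < Num.min d d' by rewrite lt_min d0.
have t0 : 0 < t by rewrite divr_gt0// mulr_gt0.
have Ht : Hnorm (t *: h) < Num.min d d'.
  rewrite HnormZ// gtr0_norm// /t -mulrA gtr_pMr// ltr_pdivrMl ?mulr_gt0// mulr1.
  by have := Hnorm_ge0 h; move: (Hnorm h) => *; lra.
have /andP[t1 t2] : (Hnorm (t *: h) < d) && (Hnorm (t *: h) < d') by rewrite -lt_min.
have := dP _ (HpairZ t hh) t1; have := d'P _ (HpairZ t hh) t2.
rewrite (Lz L t L1') (Lz L' t K1) HnormZ// (gtr0_norm t0) => h1 h2.
have : t * `|L h - L' h| <= t * e.
  rewrite -{1}(gtr0_norm t0) -normrM mulrBr.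
  have -> : t * L h - t * L' h = (F (w + t *: h) - F w - t * L' h) - (F (w + t *: h) - F w - t * L h) by ring.
  apply: le_trans (ler_normB _ _) _; apply: le_trans (lerD h1 h2) _.
  rewrite mulrCA -mulrDr ler_pM2l// -mulr2n -mulr_natl mulrA.
  have -> : 2 * e1 * Hnorm h = e * (Hnorm h / (Hnorm h + 1)) by rewrite /e1; field; rewrite gt_eqF.
  by rewrite ler_piMr ?(ltW e0)// ler_pdivrMr// mul1r lerDl.
by rewrite ler_pM2l.
Qed.

Lemma int_sqr_eq0 u : L2 mu u -> \int[mu]_x u x ^+ 2 <= 0 -> {ae mu, forall x, u x = 0}.
Proof.
move=> Lu u0.
have i0 : \int[mu]_x u x ^+ 2 = 0 by apply/le_anti; rewrite u0/=; apply: int_ge0 => x; exact: sqr_ge0.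
have := EFin_int Lu.2; rewrite i0 => e.
have m2 : meas (fun x => (u x ^+ 2)%:E) by apply/measurable_EFinP; exact: L1_meas Lu.2.
have /(ae_eq_integral_abs mu measurableT m2) : (\int[mu]_x `|(u x ^+ 2)%:E| = 0)%E.
  apply: etrans (esym e); apply: eq_integral => x _; by rewrite gee0_abs// lee_fin sqr_ge0.
apply: filterS => x /(_ I) [] /eqP; by rewrite sqrf_eq0 => /eqP.
Qed.

End energy_bilinear.

(** * Rescaled maximisers are ground states *)

Section ground_state.
Context {R : realType} {N : nat} (S : setting R N).
Local Notation E := 'rV[R]_N.
Local Notation mu := (@lebesgue_rV R N).
Local Notation pm := (mu \x mu)%E.
Local Notation p := (st_p S).
Local Notation q := (st_q S).
Local Notation K := (@riesz R N (st_alpha S)).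
Local Notation W := ((E -> R) * (E -> R))%type.
Variables (A : E -> R) (A0 Ai B : R).
Hypotheses (cA : continuous A) (A00 : 0 < A0) (AA0 : forall x, A0 <= A x).
Hypotheses (Alim : A x @[x --> infty_nbhs] --> Ai) (AAi : forall x, A x <= Ai) (B0 : 0 < B).
Implicit Types (u v f g h k F : E -> R) (x : E) (r t e : R) (z : E * E) (w : W).

Let N0 : (0 < N)%N := st_N0 S.
Let p0 : 0 < p. Proof. exact: lt_trans (st_p1 S). Qed.
Let q0 : 0 < q. Proof. exact: lt_trans (st_q1 S). Qed.
Let pA : pot A A0 Ai. Proof. exact: pot_A. Qed.
Let pB : pot (cst B : E -> R) B B. Proof. exact: pot_B. Qed.
Local Notation SS := (SS S A B).
Local Notation theta := (theta S).
Let SSp : 0 < SS. Proof. exact: (SS_gt0 S cA A00 AA0 AAi B0). Qed.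
Let th1 : 1 < theta. Proof. exact: theta_gt1. Qed.

Notation act := (action (st_alpha S) A (cst B) p q).

Lemma action_QQ w : Hpair w -> act w = 2^-1 * QQ B A w.1 w.2 - 2 / (p + q) * DD S w.1 w.2.
Proof.
move=> [h1 h2]; rewrite /action (D_action S h1 h2); congr (_ * _ - _).
have [g1 e1] := dir_gradient h1; have [g2 e2] := dir_gradient h2.
have e f x : `|f x| ^+ 2 = f x ^+ 2 by exact: sqr_normr.
have k1 := pot_L1s pA (H1_L2 h1); have k2 := pot_L1s pB (H1_L2 h2).
rewrite (_ : (fun x => _) = fun x => enorm (grad w.1 x) ^+ 2 + A x * w.1 x ^+ 2 + enorm (grad w.2 x) ^+ 2 + cst B x * w.2 x ^+ 2).
  by rewrite (intD (L1D (L1D g1 k1) g2) k2) (intD (L1D g1 k1) g2) (intD g1 k1) e1 e2 -addrA.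
by apply/funext => x; rewrite !e.
Qed.

Lemma sp_dom r u h x : 1 < r -> `|sp r (u x) * h x| <= `| `|u x| + `|h x| | `^ r.
Proof.
move=> r1; rewrite normrM [X in _ <= X `^ _]ger0_norm ?addr_ge0//.
by apply: sp_le => //; rewrite ?lerDl ?lerDr.
Qed.

Let msp r u h : H1 u -> H1 h -> meas (fun x => sp r (u x) * h x).
Proof. by move=> hu hh; apply: measurable_funM; [exact: measurable_sp (H1_L2 hu).1|exact: (H1_L2 hh).1]. Qed.

Let H1s u h : H1 u -> H1 h -> H1 (fun x => `|u x| + `|h x|).
Proof. by move=> hu hh; apply: H1D; exact: H1_abs. Qed.

Lemma pk_sp1 u v h : H1 u -> H1 v -> H1 h ->
  L1 pm (pk K (fun x => sp p (u x) * h x) (fun x => `|v x| `^ q)) /\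
  `|BB S (fun x => sp p (u x) * h x) (fun x => `|v x| `^ q)| <= DD S (fun x => `|u x| + `|h x|) v.
Proof.
move=> hu hv hh; have d x : `|sp p (u x) * h x| <= `| `|u x| + `|h x| | `^ p by apply: sp_dom; exact: st_p1.
have d' x : `| `|v x| `^ q| <= `|v x| `^ q by rewrite ger0_norm ?powR_ge0.
have X1 := XCp S (H1s hu hh); have X2 := XCq S hv; have [mv _ _ _] := X2.
split; first by have [] := pk_dom (msp p hu hh) mv d d' X1 X2.
exact: (BB_le (msp p hu hh) mv d d' X1 X2).
Qed.

Lemma pk_sp2 u v k : H1 u -> H1 v -> H1 k ->
  L1 pm (pk K (fun x => `|u x| `^ p) (fun x => sp q (v x) * k x)) /\
  `|BB S (fun x => `|u x| `^ p) (fun x => sp q (v x) * k x)| <= DD S u (fun x => `|v x| + `|k x|).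
Proof.
move=> hu hv hk; have d x : `|sp q (v x) * k x| <= `| `|v x| + `|k x| | `^ q by apply: sp_dom; exact: st_q1.
have d' x : `| `|u x| `^ p| <= `|u x| `^ p by rewrite ger0_norm ?powR_ge0.
have X1 := XCq S (H1s hv hk); have X2 := XCp S hu; have [mv _ _ _] := X2.
split; first by have [] := pk_dom mv (msp q hv hk) d' d X2 X1.
exact: (BB_le mv (msp q hv hk) d' d X2 X1).
Qed.

Lemma BB_linl u v h h' t : H1 u -> H1 v -> H1 h -> H1 h' ->
  BB S (fun x => sp p (u x) * (t * h x + h' x)) (fun x => `|v x| `^ q) =
  t * BB S (fun x => sp p (u x) * h x) (fun x => `|v x| `^ q) + BB S (fun x => sp p (u x) * h' x) (fun x => `|v x| `^ q).
Proof.
move=> hu hv hh hh'; have [l1 _] := pk_sp1 hu hv hh; have [l2 _] := pk_sp1 hu hv hh'.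
by rewrite /BB -(intZ t l1) -(intD (L1Z t l1) l2); apply: eq_Rintegral => z _; rewrite /pk; ring.
Qed.

Lemma BB_linr u v k k' t : H1 u -> H1 v -> H1 k -> H1 k' ->
  BB S (fun x => `|u x| `^ p) (fun x => sp q (v x) * (t * k x + k' x)) =
  t * BB S (fun x => `|u x| `^ p) (fun x => sp q (v x) * k x) + BB S (fun x => `|u x| `^ p) (fun x => sp q (v x) * k' x).
Proof.
move=> hu hv hh hh'; have [l1 _] := pk_sp2 hu hv hh; have [l2 _] := pk_sp2 hu hv hh'.
by rewrite /BB -(intZ t l1) -(intD (L1Z t l1) l2); apply: eq_Rintegral => z _; rewrite /pk; ring.
Qed.

Lemma DL_lin u v h k h' k' t : H1 u -> H1 v -> H1 h -> H1 k -> H1 h' -> H1 k' ->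
  DL S u v (fun x => t * h x + h' x) (fun x => t * k x + k' x) = t * DL S u v h k + DL S u v h' k'.
Proof.
move=> hu hv hh hk hh' hk'; rewrite /DL BB_linl// BB_linr//.
move: (BB S _ _) (BB S (fun x => sp p (u x) * h' x) _) (BB S _ (fun x => sp q (v x) * k x)) (BB S _ _) => *; ring.
Qed.

Lemma sp_self r (x : R) : 1 < r -> sp r x * x = `|x| `^ r.
Proof.
move=> r1; rewrite /sp mulrAC -normrEsg; have [->|xn] := eqVneq x 0.
  by rewrite normr0 mul0r powR0// gt_eqF// (lt_trans ltr01).
have x0 : 0 < `|x| by rewrite normr_gt0.
by rewrite -{1}(powRr1 (ltW x0)) -powR_pos_add// addrC subrK.
Qed.

Lemma DL_self u v : DL S u v u v = (p + q) * DD S u v.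
Proof.
rewrite /DL mulrDl; congr (_ * _ + _ * _); congr BB; apply/funext => x; apply: sp_self.
  exact: st_p1.
exact: st_q1.
Qed.

Definition daction u v w := qb A u w.1 + qb (cst B) v w.2 - 2 / (p + q) * DL S u v w.1 w.2.

Lemma daction_lin u v (t : R) w w' : H1 u -> H1 v -> Hpair w -> Hpair w' ->
  daction u v (t *: w + w') = t * daction u v w + daction u v w'.
Proof.
move=> hu hv [h1 h2] [h3 h4]; rewrite /daction.
rewrite [qb A u _](_ : _ = t * qb A u w.1 + qb A u w'.1); last exact: (qb_linr t pA hu h1 h3).
rewrite [qb (cst B) v _](_ : _ = t * qb (cst B) v w.2 + qb (cst B) v w'.2); last exact: (qb_linr t pB hv h2 h4).
rewrite [DL S u v _ _](_ : _ = t * DL S u v w.1 w.2 + DL S u v w'.1 w'.2); last exact: (DL_lin t hu hv h1 h2 h3 h4).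
move: (qb A u w.1) (qb A u w'.1) (qb _ v w.2) (qb _ v w'.2) (DL S u v w.1 w.2) (DL S u v w'.1 w'.2) => *; ring.
Qed.

Lemma dactionZ u v (t : R) w : H1 u -> H1 v -> Hpair w -> daction u v (t *: w) = t * daction u v w.
Proof.
move=> hu hv hw; have h0 := Hpair0 (R := R) (N := N).
have := daction_lin t hu hv hw h0; rewrite addr0 => ->.
have e0 : daction u v 0 = 0.
  have := daction_lin 1 hu hv h0 h0; rewrite scale1r addr0 mul1r => /eqP.
  by rewrite -subr_eq subrr => /eqP.
by rewrite e0 addr0.
Qed.

Lemma daction_bound u v : H1 u -> H1 v -> exists C : R, forall w, Hpair w -> `|daction u v w| <= C * Hnorm w.
Proof.
move=> hu hv.
pose mA := Num.max 1 Ai; pose mB := Num.max 1 B.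
have [M M0 MP] := DD_bound S (2 * (hn u + hn v + 1) + 2).
pose c := 2 / (p + q).
have pq0 : 0 < p + q by exact: addr_gt0.
have c0 : 0 <= c by rewrite divr_ge0// ltW.
pose C := qa A u + mA + (qa (cst B) v + mB) + c * (p * M + q * M).
have qA := qa_ge0 pA hu; have qB := qa_ge0 pB hv.
have mA0 : 0 <= mA by rewrite le_max ler01.
have mB0 : 0 <= mB by rewrite le_max ler01.
have C0 : 0 <= C.
  apply: addr_ge0; first by apply: addr_ge0; exact: addr_ge0.
  by apply: mulr_ge0 => //; apply: addr_ge0; apply: mulr_ge0 => //; exact: ltW.
exists C; apply: homogeneous_bound => // [t w t0 hw|w [h1 h2] w1 w2].
  exact: dactionZ.
have b1 := qb_bound pA hu h1; have b2 := qb_bound pB hv h2.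
have a1 : qa A w.1 <= mA by apply: le_trans (qa_upper pA h1) _; rewrite ler_piMr.
have a2 : qa (cst B) w.2 <= mB by apply: le_trans (qa_upper pB h2) _; rewrite ler_piMr.
have L0 := hn_ge0 hu; have L0' := hn_ge0 hv.
have uL : hn u <= hn u + hn v + 1 by rewrite -addrA lerDl addr_ge0.
have vL : hn v <= hn u + hn v + 1 by rewrite addrAC lerDr addr_ge0.
have LM f : hn f <= hn u + hn v + 1 -> hn f <= 2 * (hn u + hn v + 1) + 2.
  move=> fL; have L00 : 0 <= hn u + hn v + 1 := addr_ge0 (addr_ge0 L0 L0') ler01.
  by apply: le_trans fL _; apply: ler_wpDr => //; rewrite ler_peMl// ler1n.
have [_ d1] := pk_sp1 hu hv h1; have [_ d2] := pk_sp2 hu hv h2.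
have hs f g : H1 f -> H1 g -> hn f <= hn u + hn v + 1 -> hn g <= 1 -> hn (fun x => `|f x| + `|g x|) <= 2 * (hn u + hn v + 1) + 2.
  move=> hf hg fl gl; apply: le_trans (hnD (H1_abs hf) (H1_abs hg)) _.
  apply: lerD; first by rewrite ler_pM2l//; exact: le_trans (hn_abs hf) fl.
  by rewrite -[leRHS]mulr1 ler_pM2l//; exact: le_trans (hn_abs hg) gl.
have m1 : DD S (fun x => `|u x| + `|w.1 x|) v <= M.
  apply: MP; [exact: H1s|exact: hv|exact: (hs _ _ hu h1 uL w1)|exact: LM].
have m2 : DD S u (fun x => `|v x| + `|w.2 x|) <= M.
  apply: MP; [exact: hu|exact: H1s|exact: LM|exact: (hs _ _ hv h2 vL w2)].
have dl : `|DL S u v w.1 w.2| <= p * M + q * M.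
  rewrite /DL; apply: le_trans (ler_normD _ _) _; rewrite (normrM p) (normrM q) (gtr0_norm p0) (gtr0_norm q0).
  by apply: lerD; apply: ler_wpM2l; [exact: ltW|exact: le_trans d1 m1|exact: ltW|exact: le_trans d2 m2].
rewrite /daction; apply: le_trans (ler_normB _ _) _; apply: lerD; last first.
  by rewrite (normrM c) (ger0_norm c0); exact: ler_wpM2l.
have hf (b s m : R) : `|2 * b| <= s + m -> `|b| <= s + m.
  by rewrite normrM ger0_norm// => g; apply: le_trans g; rewrite ler_peMl// ler1n.
apply: le_trans (ler_normD _ _) _; apply: lerD; apply: hf.
  by apply: le_trans b1 _; rewrite lerD2l.
by apply: le_trans b2 _; rewrite lerD2l.
Qed.

Lemma QQ_add u v w : H1 u -> H1 v -> Hpair w ->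
  QQ B A (fun x => u x + w.1 x) (fun x => v x + w.2 x) =
  QQ B A u v + 2 * (qb A u w.1 + qb (cst B) v w.2) + QQ B A w.1 w.2.
Proof.
move=> hu hv [h1 h2]; rewrite /QQ (qaD pA hu h1) (qaD pB hv h2).
move: (qa A u) (qb A u w.1) (qa A w.1) (qa _ v) (qb _ v w.2) (qa _ w.2) => *; ring.
Qed.

Lemma QQ_upper w : Hpair w -> 0 <= QQ B A w.1 w.2 <= Num.max (Num.max 1 Ai) (Num.max 1 B) * Hnorm w ^+ 2.
Proof.
move=> hw; have [h1 h2] := hw; apply/andP; split; first by apply: addr_ge0; [exact: qa_ge0 pA h1|exact: qa_ge0 pB h2].
rewrite Hnorm_sqr// mulrDr; apply: lerD.
  by apply: le_trans (qa_upper pA h1) _; apply: ler_wpM2r; [exact: hn_ge0|rewrite le_max lexx].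
by apply: le_trans (qa_upper pB h2) _; apply: ler_wpM2r; [exact: hn_ge0|rewrite le_max lexx orbT].
Qed.

Lemma action_expansion u v w : H1 u -> H1 v -> Hpair w ->
  act ((u, v) + w) - act (u, v) - daction u v w = 2^-1 * QQ B A w.1 w.2
   - 2 / (p + q) * (DD S (fun x => u x + w.1 x) (fun x => v x + w.2 x) - DD S u v - DL S u v w.1 w.2).
Proof.
move=> hu hv hw; have h0 : Hpair (u, v) by []. rewrite (action_QQ h0) (action_QQ (HpairD h0 hw)).
rewrite [QQ B A ((u, v) + w).1 _](QQ_add hu hv hw) /daction.
rewrite [DD S ((u, v) + w).1 _](_ : _ = DD S (fun x => u x + w.1 x) (fun x => v x + w.2 x))//=.
move: (QQ B A u v) (qb A u w.1) (qb _ v w.2) (QQ B A w.1 w.2) (DD S u v) (DD S _ _) (DL S u v w.1 w.2) (2 / (p + q)) => *; by field.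
Qed.

Lemma daction_frechet u v : H1 u -> H1 v -> is_frechet act (u, v) (daction u v).
Proof.
move=> hu hv; split.
- by move=> t h k hh hk; exact: daction_lin.
- exact: daction_bound.
move=> e e0; pose L := Num.max (hn u) (hn v); pose C := Num.max (Num.max 1 Ai) (Num.max 1 B).
have C0 : 0 < C by rewrite !lt_max ltr01.
have pq0 : 0 < p + q by exact: addr_gt0.
have c0 : 0 <= 2 / (p + q) by rewrite divr_ge0// ltW.
have e'0 : 0 < (p + q) * e / 4 by rewrite divr_gt0// mulr_gt0.
have [d /andP[d0 _] dP] := @DD_tangent _ _ S L _ e'0.
have eC : 0 < e / C by rewrite divr_gt0.
exists (Num.min d (e / C)) => [|w hw wd]; first by rewrite lt_min d0.
rewrite (action_expansion hu hv hw); apply/ler_addgt0Pr => e2 e20.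
(* [Hnorm w] may be 0 while the expansion of D asks for a positive radius, so l lies slightly above
   it; the excess costs e2. *)
pose l := Num.min (Num.min d (e / C)) (Hnorm w + e2 / e).
have wl : Hnorm w < l by rewrite lt_min wd ltrDl divr_gt0.
have l0 : 0 < l by apply: le_lt_trans wl; exact: Hnorm_ge0.
have [ld lC le2] : [/\ l <= d, l <= e / C & l <= Hnorm w + e2 / e] by rewrite /l !ge_min !lexx ?orbT.
apply: (@le_trans _ _ (e * l)); last first.
  by apply: le_trans (ler_wpM2l (ltW e0) le2) _; rewrite mulrDr mulrCA divff ?gt_eqF// mulr1.
have [w1 w2] := Hnorm_hn hw (ltW wl); have [h1 h2] := hw.
apply: (@frechet_arith _ C _ _ ((p + q) * e / 4)) => //.
- have /andP[Q0 Q1] := QQ_upper hw; rewrite Q0/=; apply: le_trans Q1 _; rewrite ler_pM2l//.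
  by apply: lerXn2r; rewrite ?nnegrE ?Hnorm_ge0 ?(ltW l0)// ltW.
- by apply: dP => //; rewrite ?l0 // /L le_max lexx ?orbT.
- by rewrite mulrC -ler_pdivlMr.
by apply: le_of_eq; field; rewrite gt_eqF.
Qed.

Lemma nehari_functionalE w : Hpair w -> nehari_functional (st_alpha S) A (cst B) p q w = QQ B A w.1 w.2 - 2 * DD S w.1 w.2.
Proof.
case: w => u v hw; have [hu hv] := hw; have F := daction_frechet hu hv; rewrite /nehari_functional /frechet.
have F' := xgetPex (fun=> 0) (ex_intro _ _ F : exists L, [set L | is_frechet act (u, v) L] L).
rewrite (is_frechet_unique F' F hw) /daction DL_self/=.
have pq0 : p + q != 0 by rewrite gt_eqF ?addr_gt0.
rewrite -[DD S u v in RHS](mulKf pq0).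
by rewrite !qb_self/= [in RHS]mulrA.
Qed.

(** The positive root of SS s^theta = s/2, which is the least value that Q can take on the Nehari
    set. *)
Definition qmin : R := (2 * SS)^-1 `^ (theta - 1)^-1.

Lemma qmin_gt0 : 0 < qmin.
Proof. by rewrite powR_gt0// invr_gt0 mulr_gt0. Qed.

Let th10 : 0 < theta - 1. Proof. by rewrite subr_gt0. Qed.

Lemma qmin_powR : qmin `^ (theta - 1) = (2 * SS)^-1.
Proof. by rewrite /qmin -powRrM mulVf ?powRr1 ?gt_eqF// ltW// invr_gt0 mulr_gt0. Qed.

Lemma qmin_eq : SS * qmin `^ theta = qmin / 2.
Proof.
have -> : theta = (theta - 1) + 1 by rewrite subrK.
rewrite powR_pos_add ?qmin_gt0// powRr1 ?(ltW qmin_gt0)// qmin_powR.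
by field; rewrite gt_eqF.
Qed.

Lemma qmin_le s : 0 < s -> s / 2 <= SS * s `^ theta -> qmin <= s.
Proof.
move=> s0 h; rewrite leNgt; apply/negP => sq; move: h; apply/negP; rewrite -ltNge.
have -> : theta = (theta - 1) + 1 by rewrite subrK.
rewrite powR_pos_add// powRr1 ?(ltW s0)// mulrA mulrC ltr_pM2l//.
have : s `^ (theta - 1) < qmin `^ (theta - 1).
  by apply: gt0_ltr_powR; rewrite ?nnegrE ?(ltW s0) ?(ltW qmin_gt0).
by rewrite qmin_powR invfM -ltr_pdivlMl// mulrC.
Qed.

Lemma daction0_ge0 u v w : H1 u -> H1 v -> QQ B A u v = qmin -> DD S u v = qmin / 2 -> Hpair w -> 0 <= daction u v w.
Proof.
move=> hu hv Qe De hw; apply/ler_addgt0Pl => e0 e00.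
pose be := qb A u w.1 + qb (cst B) v w.2; pose ga := QQ B A w.1 w.2.
have /andP[ga0 _] := QQ_upper hw; rewrite -/ga in ga0.
pose C := 2 * `|be| + ga; have C0 : 0 <= C by rewrite addr_ge0// mulr_ge0.
have H0 : 0 <= Hnorm w by exact: Hnorm_ge0.
pose e := e0 / (C + Hnorm w + 1); have D0 : 0 < C + Hnorm w + 1 by rewrite ltr_wpDl// addr_ge0.
have ep : 0 < e by rewrite divr_gt0.
have q0' := qmin_gt0.
have [h /andP[h0 h1] hP] := powR_tangent1 theta ep.
have [_ _ /(_ e ep)[d dp dP]] := daction_frechet hu hv.
(* With t <= 1 the relative change s of Q is at most t C / qmin; the second bound brings |s| below
   h, and the third puts t w into the ball where the expansion of the functional holds. *)
pose t := Num.min 1 (Num.min (h * qmin / (C + 1)) (d / (Hnorm w + 1) / 2)).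
have C1 : 0 < C + 1 by rewrite ltr_wpDl.
have H1' : 0 < Hnorm w + 1 by rewrite ltr_wpDl.
have t0 : 0 < t by rewrite !lt_min ltr01 !divr_gt0// mulr_gt0.
have [t1 th td] : [/\ t <= 1, t <= h * qmin / (C + 1) & t <= d / (Hnorm w + 1) / 2] by rewrite /t !ge_min !lexx ?orbT.
have htw : Hnorm (t *: w) < d.
  rewrite HnormZ// gtr0_norm//; apply: (@le_lt_trans _ _ (t * (Hnorm w + 1))); first by rewrite ler_pM2l// lerDl.
  apply: le_lt_trans (ler_wpM2r (ltW H1') td) _.
  by rewrite mulrAC divfK ?gt_eqF// ltr_pdivrMr// ltr_pMr// ltr1n.
have := dP _ (HpairZ t hw) htw; rewrite HnormZ// (gtr0_norm t0) => tan.
pose s := (2 * t * be + t ^+ 2 * ga) / qmin.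
have sC : `|s| <= t * C / qmin.
  rewrite /s normrM [ `|qmin^-1| ]gtr0_norm ?invr_gt0// ler_pM2r ?invr_gt0//.
  exact: perturbation_arith.
have sh : `|s| <= h.
  apply: le_trans sC _; rewrite ler_pdivrMr//; apply: (@le_trans _ _ (t * (C + 1))); first by rewrite ler_pM2l// lerDl.
  by rewrite -ler_pdivlMr.
have Qt : QQ B A (fun x => u x + (t *: w).1 x) (fun x => v x + (t *: w).2 x) = qmin * (1 + s).
  have [w1 w2] := hw.
  rewrite (QQ_add hu hv (HpairZ t hw)) Qe.
  rewrite [QQ B A (t *: w).1 _](_ : _ = t ^+ 2 * ga); last exact: (QQZ B0 t pA w1 w2).
  rewrite [qb A u _](_ : _ = t * qb A u w.1); last exact: (qbZ t pA hu w1).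
  rewrite [qb (cst B) v _](_ : _ = t * qb (cst B) v w.2); last exact: (qbZ t pB hv w2).
  by rewrite -mulrDr -/be /s; field; rewrite gt_eqF.
have s1 : 0 < 1 + s by rewrite addrC -[s]opprK addrC subr_gt0 (le_lt_trans _ h1)// (le_trans _ sh)// -normrN ler_norm.
have [w1 w2] := HpairZ t hw.
have Dt : DD S (fun x => u x + (t *: w).1 x) (fun x => v x + (t *: w).2 x) <= qmin / 2 * (1 + s) `^ theta.
  have := SS_hom S cA A00 AA0 AAi B0 (mulr_gt0 q0' s1) (H1D hu w1) (H1D hv w2).
  rewrite Qt => /(_ (lexx _)) h'; apply: le_trans h' _.
  by rewrite powRM ?(ltW q0') ?(ltW s1)// mulrA qmin_eq.
move: tan; rewrite (dactionZ t hu hv hw).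
have h00 : Hpair (u, v) by []. rewrite (action_QQ h00) (action_QQ (HpairD h00 (HpairZ t hw))).
rewrite [QQ B A ((u, v) + _).1 _]Qt [DD S ((u, v) + _).1 _](_ : _ = DD S (fun x => u x + (t *: w).1 x) (fun x => v x + (t *: w).2 x))//=.
rewrite Qe De => tan.
have c0 : 0 < 2 / (p + q) by rewrite divr_gt0// addr_gt0.
have ct : 2 / (p + q) * theta = 1 by rewrite /theta; field; rewrite gt_eqF// addr_gt0.
have c1 : 2 / (p + q) <= 1 by rewrite ler_pdivrMr ?addr_gt0// mul1r; exact: ltW (ltrD (st_p1 S) (st_q1 S)).
have sq : qmin * `|s| <= t * C by rewrite mulrC -ler_pdivlMr.
have eD : e * (C + Hnorm w) <= e0.
  by rewrite /e mulrAC -mulrA ler_piMr ?(ltW e00)// ler_pdivrMr// mul1r lerDl.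
exact: (criticality_arith t0 q0' c0 c1 ct (ltW ep) tan Dt (hP s sh) sq eD).
Qed.

Lemma daction_eq0 u v w : H1 u -> H1 v -> QQ B A u v = qmin -> DD S u v = qmin / 2 -> Hpair w -> daction u v w = 0.
Proof.
move=> hu hv Qe De hw; apply/le_anti; rewrite (daction0_ge0 hu hv Qe De hw) andbT.
have := daction0_ge0 hu hv Qe De (HpairZ (-1) hw).
by rewrite (dactionZ (-1) hu hv hw) mulN1r oppr_ge0.
Qed.

(** On the Nehari set Q = 2 D <= 2 SS Q^theta forces Q >= qmin, and there the functional is Q (1/2 -
    1/(p+q)), which increases with Q. *)
Theorem ground_state_of u v : H1 u -> H1 v -> QQ B A u v = qmin -> DD S u v = qmin / 2 ->
  [/\ critical_point act (u, v), ~ Hzero (u, v) & (act (u, v))%:E = nehari_level (st_alpha S) A (cst B) p q].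
Proof.
move=> hu hv Qe De; have h0 : Hpair (u, v) by [].
have q0' := qmin_gt0; have pq0 : 0 < p + q by exact: addr_gt0.
have nz : ~ Hzero (u, v).
  move=> z; have : DD S u v = DD S (fun=> 0) (fun=> 0).
    by apply: (@DD_ae _ _ S u v (fun=> 0) (fun=> 0) hu hv H1_0 H1_0); apply: filterS z => x [].
  have := DDZ S 0 0 hu hv; rewrite normr0 (powR0 (lt0r_neq0 p0)) mul0r mul0r De.
  under [X in DD S X _]eq_fun do rewrite mul0r; under [X in DD S _ X]eq_fun do rewrite mul0r.
  by move=> -> /eqP; rewrite mulf_eq0 invr_eq0 pnatr_eq0 orbF gt_eqF.
have aE : act (u, v) = qmin * (2^-1 - (p + q)^-1).
  by rewrite action_QQ//= Qe De; field; rewrite gt_eqF.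
split => //.
  split => //; have [F1 F2 F3] := daction_frechet hu hv.
  have z w := @daction_eq0 u v w hu hv Qe De.
  split.
  - by move=> *; rewrite mulr0 addr0.
  - by exists 0 => *; rewrite normr0 mul0r.
  - move=> e /F3[d d0 dP]; exists d => // h hh hd.
    by have := dP h hh hd; rewrite z.
apply/le_anti; apply/andP; split; last first.
  apply: ereal_inf_lbound; exists (u, v) => //; split => //.
  by rewrite nehari_functionalE//= Qe De; field.
apply: le_ereal_inf_tmp => _ [[f g] [hw wz w0] <-]; rewrite lee_fin.
have {}w0 : QQ B A f g = 2 * DD S f g := subr0_eq (etrans (esym (nehari_functionalE hw)) w0).
have [hf hg] := hw; have [m1 m2] := hn_QQ B0 pA hf hg.
have m00 := m0_gt0 A00 B0.
have Q0 : 0 < QQ B A f g.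
  rewrite ltNge; apply/negP => Q0; apply: wz.
  have s0 k : H1 k -> m0 A0 B * hn k <= QQ B A f g -> {ae mu, forall x, k x = 0}.
    move=> hk mk; apply: int_sqr_eq0; first exact: H1_L2.
    apply: (@hn_L2 _ _ k 0 hk); rewrite -(pmulr_rle0 _ m00); exact: le_trans mk Q0.
  by apply: filterS2 (s0 f hf m1) (s0 g hg m2) => x.
have qm : qmin <= QQ B A f g.
  apply: qmin_le => //; apply: le_trans (SS_hom S cA A00 AA0 AAi B0 Q0 hf hg (lexx _)).
  by rewrite w0 mulrC mulKf// pnatr_eq0.
rewrite aE (action_QQ hw) [DD S _ _](_ : _ = QQ B A f g / 2); last by rewrite w0 mulrC mulKf// pnatr_eq0.
rewrite [leRHS](_ : _ = QQ B A f g * (2^-1 - (p + q)^-1)); last by field; rewrite gt_eqF.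
apply: ler_wpM2r => //; rewrite subr_ge0 lef_pV2 ?posrE//.
exact: ltW (ltrD (st_p1 S) (st_q1 S)).
Qed.

Let BB0l g : BB S (fun=> 0) g = 0.
Proof. by rewrite /BB /pk; under eq_Rintegral do rewrite mulr0 mul0r; exact: int_0. Qed.

Let BB0r f : BB S f (fun=> 0) = 0.
Proof. by rewrite /BB /pk; under eq_Rintegral do rewrite mulr0; exact: int_0. Qed.

Let qb0 a m M u : pot a m M -> H1 u -> qb a u (fun=> 0) = 0.
Proof.
move=> pa hu; have := qbZ 0 pa hu H1_0; rewrite [RHS]mul0r.
by under [X in qb a u X]eq_fun do rewrite mulr0.
Qed.

Lemma euler_lagrange1 u v h : H1 u -> H1 v -> QQ B A u v = qmin -> DD S u v = qmin / 2 -> H1 h ->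
  qb A u h = 2 * p / (p + q) * BB S (fun x => sp p (u x) * h x) (fun x => `|v x| `^ q).
Proof.
move=> hu hv Qe De hh; have hw : Hpair (h, fun=> 0) by split => //; exact: H1_0.
have := daction_eq0 hu hv Qe De hw; rewrite /daction /DL/= (qb0 pB hv).
rewrite (_ : (fun x => sp q (v x) * 0) = fun=> 0); last by apply/funext => x; rewrite mulr0.
rewrite BB0r mulr0 !addr0 => /subr0_eq ->.
by move: (BB S _ _) => b; field; rewrite gt_eqF ?addr_gt0.
Qed.

Lemma euler_lagrange2 u v h : H1 u -> H1 v -> QQ B A u v = qmin -> DD S u v = qmin / 2 -> H1 h ->
  qb (cst B) v h = 2 * q / (p + q) * BB S (fun x => `|u x| `^ p) (fun x => sp q (v x) * h x).
Proof.
move=> hu hv Qe De hh; have hw : Hpair (fun=> 0, h) by split => //; exact: H1_0.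
have := daction_eq0 hu hv Qe De hw; rewrite /daction /DL/= (qb0 pA hu).
rewrite (_ : (fun x => sp p (u x) * 0) = fun=> 0); last by apply/funext => x; rewrite mulr0.
rewrite BB0l mulr0 !add0r => /subr0_eq ->.
by move: (BB S _ _) => b; field; rewrite gt_eqF ?addr_gt0.
Qed.

(** Absolute values keep D and do not raise Q. Scaling by sqrt(qmin) turns D = SS into SS qmin^theta
    = qmin/2, and Q cannot drop below qmin, since D <= SS Q^theta would then fail. *)
Lemma ground_state_pair : exists u v, [/\ H1 u, H1 v, forall x, 0 <= u x /\ 0 <= v x,
  QQ B A u v = qmin & DD S u v = qmin / 2].
Proof.
have [u [v [hu hv Q1 D1]]] := maximizer S cA A00 AA0 Alim AAi B0.
have q0' := qmin_gt0; have t0 : 0 < Num.sqrt qmin by rewrite sqrtr_gt0.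
have hu' := H1_abs hu; have hv' := H1_abs hv.
set t := Num.sqrt qmin in t0.
have De : DD S (fun x => t * `|u x|) (fun x => t * `|v x|) = qmin / 2.
  rewrite DDZ// DD_abs D1 (gtr0_norm t0) -powR_pos_add// /t -powR12_sqrt ?(ltW q0')// -powRrM.
  by rewrite (_ : 2^-1 * (p + q) = theta) 1?mulrC ?qmin_eq// /theta mulrC.
have qA (a : E -> R) m M k : pot a m M -> H1 k -> qa a (fun x => `|k x|) <= qa a k.
  move=> pa hk; apply: lerD; first exact: dir_abs.
  by rewrite (_ : (fun x => a x * `|k x| ^+ 2) = fun x => a x * k x ^+ 2)//; apply/funext => x; rewrite sqr_normr.
have Qle : QQ B A (fun x => t * `|u x|) (fun x => t * `|v x|) <= qmin.
  rewrite (QQZ B0 t pA hu' hv') /t sqr_sqrtr ?(ltW q0')// ler_piMr ?(ltW q0')// -Q1.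
  by apply: lerD; [exact: qA pA hu|exact: qA pB hv].
exists (fun x => t * `|u x|), (fun x => t * `|v x|); split => //; [exact: H1Z|exact: H1Z| |].
  by move=> x; split; apply: mulr_ge0 => //; exact: ltW.
apply/le_anti; rewrite Qle/= leNgt; apply/negP => Qlt.
(* The entry qmin/2 keeps s positive, as [SS_hom] requires, and still below qmin. *)
pose s := Num.max (QQ B A (fun x => t * `|u x|) (fun x => t * `|v x|)) (qmin / 2).
have s0 : 0 < s by rewrite lt_max divr_gt0// orbT.
have s1 : s < qmin by rewrite gt_max Qlt ltr_pdivrMr// ltr_pMr// ltr1n.
have := SS_hom S cA A00 AA0 AAi B0 s0 (H1Z t hu') (H1Z t hv').
rewrite le_max lexx De => /(_ isT) h.
have : qmin <= s by apply: qmin_le => //; apply: le_trans h; rewrite ler_pM2r ?invr_gt0// ltW.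
by rewrite leNgt s1.
Qed.

End ground_state.

(** * Integrability and decay *)

Section bootstrap_exponents.
Context {R : realType}.
Implicit Types (a b e p q s S g x y N al : R).

(** 1/s is kept above 1 - al/N by e, which makes the power of the near kernel integrable, and |v|^q
    is taken in L^(S/q). 1/a is what Young's relation leaves, capped so that a >= 1; the minimum
    records which of the two constraints binds. *)
Lemma near_exponents N al e q S : 0 < N -> 0 < al -> al < N -> 0 < e -> e <= al / N -> 0 < q -> q < S ->
  exists a s, [/\ 1 <= a, 1 <= s, a^-1 + (S / q)^-1 + s^-1 = 2, s * (N - al) < N &
    S / a = Num.min S (S * (1 + al / N - e) - q)].
Proof.
move=> N0 al0 alN e0 eN q0 qS; have S0 : 0 < S by exact: lt_trans qS.
pose iis := Num.max (1 - q / S) (1 - al / N + e).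
have aN1 : al / N < 1 by rewrite ltr_pdivrMr// mul1r.
have qS1 : q / S < 1 by rewrite ltr_pdivrMr// mul1r.
have qS0 : 0 < q / S by rewrite divr_gt0.
have is0 : 0 < iis by rewrite lt_max subr_gt0 qS1.
have is1 : iis <= 1 by rewrite ge_max; apply/andP; split; lra.
have isa : 1 - al / N < iis by rewrite lt_max; apply/orP; right; lra.
pose ia := 2 - q / S - iis.
have ia0 : 0 < ia by rewrite subr_gt0; apply: le_lt_trans is1 _; lra.
have ia1 : ia <= 1.
  have h : 1 - q / S <= iis by rewrite le_max lexx.
  by rewrite /ia; lra.
exists ia^-1, iis^-1; split.
- by rewrite invf_ge1.
- by rewrite invf_ge1.
- by rewrite !invrK invf_div /ia; ring.
- rewrite mulrC ltr_pdivrMr// mulrC -ltr_pdivrMr// mulrBl divff ?gt_eqF//.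
- rewrite invrK /ia /iis; have [h|h] := leP (1 - q / S) (1 - al / N + e).
    rewrite min_r; first by field; rewrite !gt_eqF.
    rewrite -(ler_pM2l S0) in h; move: h; rewrite (_ : S * (1 - q / S) = S - q); last by field; rewrite gt_eqF.
    by rewrite !mulrDr !mulrN; lra.
  rewrite min_l; first by field; rewrite gt_eqF.
  rewrite -(ltr_pM2l S0) in h; move: h; rewrite (_ : S * (1 - q / S) = S - q); last by field; rewrite gt_eqF.
  by rewrite !mulrDr !mulrN; lra.
Qed.

(** Here a = 1 and 1/b + 1/s = 1. The bound b < N/al makes the power of the far kernel integrable,
    and q b is kept in [2, S], where integrability of |v|^(q b) follows by interpolation. *)
Lemma far_exponents N al q S : 0 < N -> 0 < al -> al < N -> (N + al) / N < q -> q < S -> 2 < S ->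
  exists b s, [/\ 1 <= b, 1 <= s, 1^-1 + b^-1 + s^-1 = 2, N < s * (N - al) & 2 <= q * b <= S].
Proof.
move=> N0 al0 alN hq qS S2.
have q1 : 1 < q by apply: lt_trans hq; rewrite ltr_pdivlMr// mul1r ltrDl.
have q0 : 0 < q by exact: lt_trans q1.
have NA : 1 < N / al by rewrite ltr_pdivlMr// mul1r.
pose b := Num.max (2 / q) (Num.min ((1 + N / al) / 2) (S / q)).
have b1 : 1 < b by rewrite lt_max lt_min; apply/orP; right; apply/andP; split; [lra|by rewrite ltr_pdivlMr// mul1r].
have bN : b < N / al.
  rewrite gt_max; apply/andP; split.
    rewrite ltr_pdivrMr//; apply: (@lt_le_trans _ _ (N / al * ((N + al) / N))).
      rewrite (_ : _ * _ = N / al + 1); last by field; rewrite !gt_eqF.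
      lra.
    by rewrite ler_pM2l ?divr_gt0// ltW.
  by rewrite gt_min; apply/orP; left; lra.
have b0 : 0 < b by exact: lt_trans b1.
have ib0 : 0 < 1 - b^-1 by rewrite subr_gt0 invf_lt1.
exists b, (1 - b^-1)^-1; split.
- exact: ltW.
- by rewrite invf_ge1// gerBl invr_ge0 ltW.
- by rewrite invrK invr1; ring.
- rewrite mulrC ltr_pdivlMr// mulrBr mulr1 ltrD2l ltrN2 ltr_pdivlMr// -ltr_pdivlMl// mulrC//.
- apply/andP; split; first by rewrite mulrC -ler_pdivrMr// le_max lexx.
  rewrite mulrC -ler_pdivlMr// ge_max ge_min lexx orbT andbT ler_pM2r ?invr_gt0//; exact: ltW.
Qed.

(** All conditions become weaker as S grows, so the slack [G] at S0 yields one gain g that serves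
    for every S >= S0; e takes up at most half of this slack. *)
Lemma gain_exponents N al p q S0 : 0 < N -> 0 < al -> 0 < p -> 0 < q -> 2 < S0 -> p < S0 -> q < S0 ->
  p - 2 < 2 / N * S0 -> q - 2 < 2 / N * S0 -> p + q - 2 < (2 + al) / N * S0 -> p + q - 1 < (1 + al / N) * S0 ->
  exists e g, [/\ 0 < e, e <= al / N, 0 < g & forall S, S0 <= S ->
    [/\ p - 1 <= Num.min S (S * (1 + al / N - e) - q), q - 1 <= Num.min S (S * (1 + al / N - e) - p),
     S + g < 2 + S * (2 / N) + Num.min S (S * (1 + al / N - e) - q) - p &
     S + g < 2 + S * (2 / N) + Num.min S (S * (1 + al / N - e) - p) - q]].
Proof.
move=> N0 al0 p0 q0 S2 pS qS h1 h2 h3 h4.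
have S00 : 0 < S0 by exact: lt_trans S2.
rewrite mulrDl in h3; move: h1 h2 h3 h4.
set A := 2 / N; set B := al / N => h1 h2 h3 h4.
have A0 : 0 < A by rewrite divr_gt0.
have B0 : 0 < B by rewrite divr_gt0.
pose G := Num.min (Num.min (A * S0 - (p - 2)) (A * S0 - (q - 2)))
  (Num.min ((A + B) * S0 - (p + q - 2)) ((1 + B) * S0 - (p + q - 1))).
have G0 : 0 < G by rewrite !lt_min !subr_gt0 h1 h2 h3 h4.
have [g1 g2 g3 g4] : [/\ G <= A * S0 - (p - 2), G <= A * S0 - (q - 2),
    G <= (A + B) * S0 - (p + q - 2) & G <= (1 + B) * S0 - (p + q - 1)].
  by rewrite /G !ge_min !lexx ?orbT.
pose e := Num.min B (G / (2 * S0)).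
have e0 : 0 < e by rewrite lt_min B0 divr_gt0// mulr_gt0.
have eB : e <= B by rewrite ge_min lexx.
have eS : e * S0 <= G / 2.
  by apply: (@le_trans _ _ (G / (2 * S0) * S0)); [rewrite ler_pM2r// ge_min lexx orbT|rewrite invfM -!mulrA mulVf ?mulr1 ?gt_eqF].
exists e, (G / 4); split => //; first by rewrite divr_gt0.
move=> S SS0; clear -SS0 A0 B0 e0 eB eS g1 g2 g3 g4 G0 S2 pS qS S00 p0 q0; clearbody e G.
have x1 : A * S0 <= A * S by rewrite ler_pM2l.
have x2 : (1 + B - e) * S0 <= (1 + B - e) * S by rewrite ler_wpM2l//; lra.
have x3 : (A + B - e) * S0 <= (A + B - e) * S by rewrite ler_wpM2l//; lra.
move: x1 x2 x3 g3 g4 eS; rewrite !mulrDl !mulNr !mul1r !mulrDr !mulr1 !mulrN.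
rewrite ![S * _]mulrC => x1 x2 x3 g3' g4' eS.
by split; [rewrite le_min; apply/andP; split; lra|rewrite le_min; apply/andP; split; lra|
  case: (leP S _) => ?; lra|case: (leP S _) => ?; lra].
Qed.

(** t1, ..., t4 are the values of S at which the four gain conditions turn into equalities. All lie
    below 2N/(N-2) by the upper bounds on p and q; the comparison is multiplied out by N - 2 so as
    to cover N = 1 and N = 2 as well. *)
Lemma start_exponent (n : nat) al p q : (0 < n)%N -> 0 < al -> al < n%:R ->
  1 < p -> 1 < q -> p * (n%:R - 2) < n%:R + al -> q * (n%:R - 2) < n%:R + al ->
  exists S, [/\ 2 < S, p < S, q < S, p - 2 < 2 / n%:R * S & q - 2 < 2 / n%:R * S] /\
    [/\ p + q - 2 < (2 + al) / n%:R * S, p + q - 1 < (1 + al / n%:R) * S & S * (n%:R - 2) < 2 * n%:R].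
Proof.
move=> n0 al0 aln p1 q1 hp hq; have N0 : 0 < n%:R :> R by rewrite ltr0n.
have N2 : n%:R = 1 :> R \/ 2 <= n%:R :> R.
  by case: n n0 {aln hp hq N0} => // -[|n] _; [left|right; rewrite ler_nat].
set N := n%:R in N0 N2 aln hp hq *.
pose t1 := N * (p - 2) / 2; pose t2 := N * (q - 2) / 2; pose t3 := N * (p + q - 2) / (2 + al).
pose t4 := N * (p + q - 1) / (N + al).
have a2 : 0 < 2 + al by lra.
have Na : 0 < N + al by lra.
pose sub x := (N - 2) * x < 2 * N.
have sm x y : sub x -> sub y -> sub (Num.max x y) by move=> sx sy; rewrite /sub; case: (leP x y) => _.
have [h h0 hP] : exists2 h : R, 0 < h & forall b, `|b - Num.max (Num.max 2 (Num.max p q)) (Num.max (Num.max t1 t2) (Num.max t3 t4))| <= h -> (N - 2) * b < 2 * N.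
  apply: lin_open; apply: (sm); [apply: (sm); [|apply: sm]|apply: (sm); apply: (sm)]; rewrite /sub.
  - lra.
  - rewrite mulrC; lra.
  - rewrite mulrC; lra.
  - rewrite /t1 (_ : _ * _ = N / 2 * (p * (N - 2) - 2 * N + 4)); last by field.
    rewrite -[ltRHS](divfK (_ : N / 2 != 0)); last by rewrite gt_eqF// divr_gt0.
    rewrite [ltRHS]mulrC ltr_pM2l ?divr_gt0// (_ : 2 * N / (N / 2) = 4); last by field; rewrite gt_eqF.
    lra.
  - rewrite /t2 (_ : _ * _ = N / 2 * (q * (N - 2) - 2 * N + 4)); last by field.
    rewrite -[ltRHS](divfK (_ : N / 2 != 0)); last by rewrite gt_eqF// divr_gt0.
    rewrite [ltRHS]mulrC ltr_pM2l ?divr_gt0// (_ : 2 * N / (N / 2) = 4); last by field; rewrite gt_eqF.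
    lra.
  - rewrite /t3 mulrA ltr_pdivrMr// (_ : _ * _ = N * (p * (N - 2) + q * (N - 2) - 2 * (N - 2))); last by ring.
    by rewrite [ltRHS](_ : _ = N * (2 * (2 + al))) ?ltr_pM2l//; [lra|ring].
  - rewrite /t4 mulrA ltr_pdivrMr// (_ : _ * _ = N * (p * (N - 2) + q * (N - 2) - (N - 2))); last by ring.
    rewrite [ltRHS](_ : _ = N * (2 * (N + al))) ?ltr_pM2l//; last by ring.
    by case: N2 => [->|N2]; lra.
set m := Num.max (Num.max 2 _) _ in hP.
have mP : [/\ 2 <= m, p <= m, q <= m, t1 <= m & t2 <= m] /\ t3 <= m /\ t4 <= m by rewrite /m !le_max !lexx ?orbT.
move: mP => [[m1 m2 m3 m4 m5] [m6 m7]].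
have hh : 0 < h by [].
exists (m + h); split; split.
- by apply: le_lt_trans m1 _; rewrite ltrDl.
- by apply: le_lt_trans m2 _; rewrite ltrDl.
- by apply: le_lt_trans m3 _; rewrite ltrDl.
- have : t1 < m + h by apply: le_lt_trans m4 _; rewrite ltrDl.
  by rewrite -(ltr_pM2l (_ : 0 < 2 / N)) ?divr_gt0// (_ : 2 / N * t1 = p - 2)// /t1; field; rewrite gt_eqF.
- have : t2 < m + h by apply: le_lt_trans m5 _; rewrite ltrDl.
  by rewrite -(ltr_pM2l (_ : 0 < 2 / N)) ?divr_gt0// (_ : 2 / N * t2 = q - 2)// /t2; field; rewrite gt_eqF.
- have : t3 < m + h by apply: le_lt_trans m6 _; rewrite ltrDl.
  by rewrite -(ltr_pM2l (_ : 0 < (2 + al) / N)) ?divr_gt0// (_ : _ * t3 = p + q - 2)// /t3; field; rewrite !gt_eqF.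
- have : t4 < m + h by apply: le_lt_trans m7 _; rewrite ltrDl.
  have N1 : 0 < 1 + al / N by rewrite addr_gt0// divr_gt0.
  by rewrite -(ltr_pM2l N1) (_ : _ * t4 = p + q - 1)// /t4; field; rewrite !gt_eqF.
- by rewrite mulrC; apply: hP; rewrite addrAC subrr add0r gtr0_norm.
Qed.

End bootstrap_exponents.

(** * Pairing with the Riesz potential *)

Section pairing.
Context {R : realType} {N : nat}.
Local Notation E := 'rV[R]_N.
Local Notation mu := (@lebesgue_rV R N).
Local Notation pm := (mu \x mu)%E.
Implicit Types (f k F G : E -> R) (x : E) (r s t a b : R) (z : E * E).

Lemma L1_interpolate f r s : L2 mu f -> L1 mu (fun x => `|f x| `^ s) -> 2 <= r <= s -> L1 mu (fun x => `|f x| `^ r).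
Proof.
move=> Lf Ls /andP[r2 rs]; apply: (L1_le _ _ (L1D Lf.2 Ls)); first exact: measurable_abs_powR Lf.1.
move=> x; rewrite ger0_norm ?powR_ge0//; have [h|h] := leP `|f x| 1.
  apply: ler_wpDr; first exact: powR_ge0.
  rewrite -sqr_normr -powR_mulrn//; have [->|fn] := eqVneq (f x) 0.
    by rewrite normr0 !powR0 ?pnatr_eq0// gt_eqF//; lra.
  by apply: ger_powR => //; rewrite h normr_gt0 fn.
apply: ler_wpDl; first exact: sqr_ge0.
by apply: ler_powR => //; exact: ltW.
Qed.

(** Young's inequality for F/t, multiplied by t: the bound becomes linear in t although the
    exponents are not. *)
Lemma kernel_pairing k a b s G : even_kernel k -> 1 <= a -> 1 <= b -> 1 <= s -> a^-1 + b^-1 + s^-1 = 2 ->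
  L1 mu (fun x => k x `^ s) -> meas G -> (forall x, 0 <= G x) -> L1 mu (fun x => G x `^ b) ->
  exists2 C : R, 0 <= C & forall F t, meas F -> (forall x, 0 <= F x) -> 0 < t ->
    L1 mu (fun x => F x `^ a) -> \int[mu]_x (F x `^ a) <= t `^ a ->
    L1 pm (pk k F G) /\ \int[pm]_z pk k F G z <= C * t.
Proof.
move=> ek a1 b1 s1 abs Lk mG G0 LG.
have I0 (h : E -> R) r : 0 <= \int[mu]_x (h x `^ r) by apply: int_ge0 => x; exact: powR_ge0.
pose gb := \int[mu]_x (G x `^ b); pose ks := \int[mu]_x (k x `^ s).
exists (gb + ks + gb * ks) => [|F t mF F0 t0 LF It]; first exact: addr_ge0 (addr_ge0 (I0 _ _) (I0 _ _)) (mulr_ge0 (I0 _ _) (I0 _ _)).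
have ti : 0 <= t^-1 by rewrite invr_ge0 ltW.
have ta : 0 < t `^ a by rewrite powR_gt0.
have eF : (fun x => (t^-1 * F x) `^ a) = fun x => (t `^ a)^-1 * F x `^ a.
  by apply/funext => x; rewrite powRM// -powRN -powR_inv1 ?(ltW t0)// -powRrM mulN1r.
have LF' : L1 mu (fun x => (t^-1 * F x) `^ a) by rewrite eF; exact: L1Z.
have IF' : \int[mu]_x ((t^-1 * F x) `^ a) <= 1.
  by rewrite eF (intZ _ LF) ler_pdivrMl// mulr1.
have mF' : meas (fun x => t^-1 * F x) by exact: measurable_funM.
have F'0 x : 0 <= t^-1 * F x by exact: mulr_ge0.
have bas : b^-1 + a^-1 + s^-1 = 2 by rewrite [b^-1 + _]addrC.
have [LP IP] := pk_young ek b1 a1 s1 bas Lk mF' mG F'0 G0 LF' LG.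
have eP : pk k F G = fun z => t * pk k (fun x => t^-1 * F x) G z.
  by apply/funext => z; rewrite /pk; field; rewrite gt_eqF.
rewrite eP; split; first exact: L1Z.
rewrite (intZ t LP) mulrC ler_pM2r//; apply: le_trans IP _; rewrite -/gb -/ks.
have := I0 (fun x => t^-1 * F x) a; move: (\int[mu]_x ((t^-1 * F x) `^ a)) IF' => i i1 i0.
have g0 : 0 <= gb by exact: I0. have k0 : 0 <= ks by exact: I0.
apply: lerD => //; apply: lerD; exact: ler_piMl.
Qed.

Variables (al : R).
Hypotheses (N0 : (0 < N)%N) (al0 : 0 < al) (alN : al < N%:R).
Local Notation K := (@riesz R N al).

(** The near part uses the L^a norm of F and the far part its L^1 norm, both controlled by the same
    t. *)
Lemma riesz_pairing a b s b' s' G : 1 <= a -> 1 <= b -> 1 <= s -> a^-1 + b^-1 + s^-1 = 2 -> s * (N%:R - al) < N%:R ->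
  1 <= b' -> 1 <= s' -> 1^-1 + b'^-1 + s'^-1 = 2 -> N%:R < s' * (N%:R - al) ->
  meas G -> (forall x, 0 <= G x) -> L1 mu (fun x => G x `^ b) -> L1 mu (fun x => G x `^ b') ->
  exists2 C : R, 0 <= C & forall F t, meas F -> (forall x, 0 <= F x) -> 0 < t ->
    L1 mu F -> \int[mu]_x F x <= t ->
    L1 mu (fun x => F x `^ a) -> \int[mu]_x (F x `^ a) <= t `^ a ->
    L1 pm (pk K F G) /\ \int[pm]_z pk K F G z <= C * t.
Proof.
move=> a1 b1 s1 abs sN b'1 s'1 abs' s'N mG G0 Lb Lb'.
have s0 : 0 < s by exact: lt_le_trans s1. have s'0 : 0 < s' by exact: lt_le_trans s'1.
have [C1 C10 P1] := kernel_pairing (even_knear al0 alN) a1 b1 s1 abs (L1_knear N0 al0 alN s0 sN) mG G0 Lb.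
have [C2 C20 P2] := kernel_pairing (even_kfar al0 alN) (lexx 1) b'1 s'1 abs' (L1_kfar N0 al0 alN s'0 s'N) mG G0 Lb'.
exists (C1 + C2) => [|F t mF F0 t0 LF IF LFa IFa]; first exact: addr_ge0.
have [L1' I1] := P1 F t mF F0 t0 LFa IFa.
have eF : (fun x => F x `^ 1) = F by apply/funext => x; rewrite powRr1.
have [L2' I2] : L1 pm (pk (@kfar R N al) F G) /\ \int[pm]_z pk (@kfar R N al) F G z <= C2 * t.
  by apply: P2 => //; rewrite ?eF// powRr1// ltW.
have e : pk K F G = fun z => pk (@knear R N al) F G z + pk (@kfar R N al) F G z.
  by apply/funext => z; rewrite /pk (riesz_split al (z.1 - z.2)); ring.
rewrite e; split; first exact: L1D.
by rewrite (intD L1' L2') mulrDl; exact: lerD.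
Qed.

End pairing.

(** * Improved integrability from slices *)

Section bootstrap.
Context {R : realType} {N : nat}.
Local Notation E := 'rV[R]_N.
Local Notation mu := (@lebesgue_rV R N).
Local Notation pm := (mu \x mu)%E.
Implicit Types (u v h F : E -> R) (x y : E) (r s t c m M p q S : R) (z : E * E).

Lemma truncation_energy (a : E -> R) m M u T : pot a m M -> H1 u -> H1 T ->
  (forall x y, (T y - T x) * (T y - T x) <= (u y - u x) * (T y - T x)) -> (forall x, T x ^+ 2 <= u x * T x) ->
  Num.min 1 m * hn T <= qb a u T.
Proof.
move=> pa hu hT h1 h2; have LT := H1_L2 hT; have Lu := H1_L2 hu; have [m0 _ aM] := pa.
have d := dir_le hT hT hu hT h1.
have i0 : 0 <= \int[mu]_x T x ^+ 2 by apply: int_ge0 => x; exact: sqr_ge0.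
rewrite /hn /qb mulrDr; apply: lerD.
  apply: le_trans d; rewrite -[leRHS]mul1r; apply: ler_wpM2r; first exact: dir_ge0.
  by rewrite ge_min lexx.
apply: (@le_trans _ _ (m * \int[mu]_x T x ^+ 2)); first by apply: ler_wpM2r => //; rewrite ge_min lexx orbT.
rewrite -(intZ m LT.2); apply: int_le; [exact: (L1Z m LT.2)|exact: (pot_L1 pa Lu LT)|move=> x].
by have /andP[b1 b2] := aM x; apply: ler_pM; rewrite ?sqr_ge0 ?(ltW m0).
Qed.

Lemma slice_energy (a : E -> R) m M u c : pot a m M -> H1 u -> (forall x, 0 <= u x) -> 0 < c ->
  Num.min 1 m * hn (slice c u) <= qb a u (slice c u).
Proof.
move=> pa hu u0 c0; apply: (truncation_energy pa hu (slice_H1 c0 hu)) => [x y|x].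
  rewrite /slice !ger0_norm//; have := slice_cases (u x) c0; have := slice_cases (u y) c0.
  move: (Num.min (Num.max (u x - c) 0) c) (Num.min (Num.max (u y - c) 0) c) => s t /=.
  by move=> [[-> ?]|[-> ? ?]|[-> ?]] [[-> ?]|[-> ? ?]|[-> ?]]; nra.
rewrite /slice !ger0_norm//; have := slice_cases (u x) c0; have := u0 x.
move: (Num.min (Num.max (u x - c) 0) c) => s /= ux.
by move=> [[-> ?]|[-> ? ?]|[-> ?]]; nra.
Qed.

(** Where s does not vanish, w = b/c >= 1 and F <= c^p w^(p-1); since (p-1) a <= S, both w^(p-1) and
    w^((p-1)a) are at most w^S. *)
Lemma slice_weight p S a c (b s : R) : 1 < p -> 1 <= a -> 0 < c -> p - 1 <= S / a -> 0 <= b -> 0 <= s <= c -> (b <= c -> s = 0) ->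
  let F := sp p b * s in [/\ 0 <= F, F <= c `^ (p - S) * b `^ S & F `^ a <= c `^ (p * a - S) * b `^ S].
Proof.
move=> p1 a1 c0 pS b0 /andP[s0 sc] bc F.
have a0 : 0 < a by exact: lt_le_trans a1.
have S0 : 0 < S by rewrite -(pmulr_lgt0 _ (_ : 0 < a^-1)) ?invr_gt0//; apply: lt_le_trans pS; rewrite subr_gt0.
have spb : sp p b = b `^ (p - 1).
  rewrite /sp; have [->|bn] := eqVneq b 0; first by rewrite sgr0 mul0r powR0// subr_eq0 gt_eqF.
  by rewrite ger0_norm// gtr0_sg ?mul1r// lt_def bn.
have [bc'|cb] := leP b c.
  by rewrite /F (bc bc') mulr0 powR0 ?gt_eqF//; split => //; rewrite mulr_ge0 ?powR_ge0.
have F0 : 0 <= F by rewrite /F spb mulr_ge0 ?powR_ge0.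
have bp : 0 < b by exact: lt_trans cb.
pose w := b / c; have w1 : 1 <= w by rewrite ler_pdivlMr// mul1r ltW.
have w0 : 0 < w by exact: lt_le_trans w1.
have bw : b = c * w by rewrite /w mulrCA divff ?mulr1// gt_eqF.
have pSa : (p - 1) * a <= S by rewrite -ler_pdivlMr.
have pS' : p - 1 <= S by apply: le_trans pSa; rewrite ler_peMr// subr_ge0 ltW.
have FL : F <= c `^ p * w `^ (p - 1).
  have -> : c `^ p * w `^ (p - 1) = b `^ (p - 1) * c.
    rewrite bw powRM ?(ltW c0) ?(ltW w0)// mulrAC -[X in _ * X * _](powRr1 (ltW c0)) -powR_pos_add// subrK//.
  by rewrite /F spb; apply: ler_wpM2l => //; exact: powR_ge0.
have wS r : c `^ (r - S) * b `^ S = c `^ r * w `^ S.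
  by rewrite bw powRM ?(ltW c0) ?(ltW w0)// mulrA -powR_pos_add// subrK.
split => //; rewrite wS.
  apply: le_trans FL _; apply: ler_wpM2l; first exact: powR_ge0.
  exact: ler_powR.
apply: (@le_trans _ _ ((c `^ p * w `^ (p - 1)) `^ a)).
  by apply: ge0_ler_powR; rewrite ?nnegrE ?(ltW a0)// mulr_ge0 ?powR_ge0.
rewrite powRM ?powR_ge0// -!powRrM; apply: ler_wpM2l; first exact: powR_ge0.
exact: ler_powR.
Qed.

Lemma slice_range c (x : R) : 0 < c -> let s := Num.min (Num.max (x - c) 0) c in 0 <= s <= c /\ (x <= c -> s = 0).
Proof.
move=> c0; have := slice_cases x c0; move: (Num.min _ _) => s /=.
by move=> [[-> ?]|[-> ? ?]|[-> ?]]; split=> *; try (apply/andP; split); lra.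
Qed.

Variable al : R.
Local Notation K := (@riesz R N al).

Definition el_eq (a : E -> R) c p q u v := forall h, H1 h ->
  qb a u h = c * \int[pm]_z pk K (fun x => sp p (u x) * h x) (fun x => `|v x| `^ q) z.

(** Tests the equation with the slice T of u at height k. The weight u^(p-1) T has L^1 and L^a norms
    of order at most k^(p - S/a), which the pairing bound turns into an energy bound for T. *)
Lemma slice_growth (A : E -> R) m M c p q S a CP u v : pot A m M -> 0 < c -> 1 < p -> 1 <= a -> 0 < S -> p - 1 <= S / a -> 0 <= CP ->
  H1 u -> (forall x, 0 <= u x) -> el_eq A c p q u v -> L1 mu (fun x => `|u x| `^ S) ->
  (forall F t, meas F -> (forall x, 0 <= F x) -> 0 < t ->
    L1 mu F -> \int[mu]_x F x <= t -> L1 mu (fun x => F x `^ a) -> \int[mu]_x (F x `^ a) <= t `^ a ->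
    L1 pm (pk K F (fun x => `|v x| `^ q)) /\ \int[pm]_z pk K F (fun x => `|v x| `^ q) z <= CP * t) ->
  exists2 C : R, 0 <= C & forall k : R, 1 <= k -> hn (slice k u) <= C * k `^ (p - S / a).
Proof.
move=> pA c0 p1 a1 S0 pS CP0 hu u0 el LS P.
have a0 : 0 < a by exact: lt_le_trans a1.
have eu : (fun x => `|u x| `^ S) = fun x => u x `^ S by apply/funext => x; rewrite ger0_norm.
rewrite eu in LS; pose I := \int[mu]_x (u x `^ S).
have I0 : 0 <= I by apply: int_ge0 => x; exact: powR_ge0.
have I1 : 1 <= 1 + I by rewrite lerDl.
have [m0 _ _] := pA; have m1 : 0 < Num.min 1 m by rewrite lt_min ltr01.
exists ((Num.min 1 m)^-1 * (c * (CP * (1 + I)))) => [|k k1].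
  by apply: mulr_ge0; [rewrite invr_ge0 ltW|apply: mulr_ge0; [exact: ltW|apply: mulr_ge0 => //; exact: le_trans I1]].
have k0 : 0 < k by exact: lt_le_trans k1.
have hT := slice_H1 k0 hu; pose T := slice k u; pose F x := sp p (u x) * T x.
have Fw x : [/\ 0 <= F x, F x <= k `^ (p - S) * u x `^ S & F x `^ a <= k `^ (p * a - S) * u x `^ S].
  have Tk : 0 <= T x <= k /\ (u x <= k -> T x = 0).
    by rewrite /T /slice ger0_norm//; exact: slice_range.
  by have [h1 h2] := Tk; exact: (slice_weight p1 a1 k0 pS (u0 x) h1 h2).
have mF : meas F by apply: measurable_funM; [exact: measurable_sp (H1_L2 hu).1|exact: (H1_L2 hT).1].
have LF : L1 mu F.
  apply: (L1_le mF _ (L1Z (k `^ (p - S)) LS)) => x; have [f0 f1 _] := Fw x; by rewrite ger0_norm.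
have LFa : L1 mu (fun x => F x `^ a).
  apply: (L1_le _ _ (L1Z (k `^ (p * a - S)) LS)) => [|x]; first exact: measurable_powR_comp.
  by have [f0 _ f2] := Fw x; rewrite ger0_norm ?powR_ge0.
pose t := k `^ (p - S / a) * (1 + I).
have t0 : 0 < t by rewrite mulr_gt0 ?powR_gt0//; exact: lt_le_trans I1.
have IF : \int[mu]_x F x <= t.
  apply: le_trans (int_le LF (L1Z _ LS) (fun x => let: And3 _ h _ := Fw x in h)) _.
  rewrite (intZ _ LS) -/I; apply: ler_pM => //; [exact: powR_ge0| |by rewrite lerDr].
  by apply: ler_powR => //; rewrite lerD2l lerN2 ler_pdivrMr// ler_peMr// ltW.
have IFa : \int[mu]_x (F x `^ a) <= t `^ a.
  apply: le_trans (int_le LFa (L1Z _ LS) (fun x => let: And3 _ _ h := Fw x in h)) _.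
  rewrite (intZ _ LS) -/I /t powRM ?powR_ge0//; last exact: le_trans I1.
  rewrite -powRrM mulrBl divfK ?gt_eqF//; apply: ler_wpM2l; first exact: powR_ge0.
  apply: (@le_trans _ _ (1 + I)); first by rewrite lerDr.
  rewrite -{1}[1 + I]powRr1; last exact: le_trans I1.
  exact: ler_powR.
have F0 x : 0 <= F x by have [] := Fw x.
have [_ IP] := P F t mF F0 t0 LF IF LFa IFa.
have := slice_energy pA hu u0 k0; rewrite (el _ hT) -/F => en.
rewrite -mulrA -ler_pdivrMl ?invr_gt0// invrK; apply: le_trans en _.
rewrite -!mulrA ler_pM2l//; apply: le_trans IP _; rewrite /t.
by rewrite [k `^ _ * _]mulrC.
Qed.

(** Chebyshev bounds the level set at height 2^j by a multiple of 2^(-Sj). With the slice energy,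
    [level_step] for tau = 2/N improves this to 2^(-sj), where s = 2 + 2S/N + S/a - p, and every
    power from 2 up to, but excluding, s is integrable. *)
Lemma slice_improve p S a C u r : (0 < N)%N -> 0 < S -> 0 <= C -> H1 u -> L1 mu (fun x => `|u x| `^ S) ->
  (forall k : R, 1 <= k -> hn (slice k u) <= C * k `^ (p - S / a)) ->
  2 <= r -> r < 2 + S * (2 / N%:R) + S / a - p -> L1 mu (fun x => `|u x| `^ r).
Proof.
move=> N0 S0 C0 hu LS hC r2 rS; pose tau : R := 2 / N%:R.
have tN : 0 <= tau <= 2 / N%:R by rewrite lexx divr_ge0.
have [C1 C10 step] := level_step N0 tN.
pose I := \int[mu]_x (`|u x| `^ S).
have I0 : 0 <= I by apply: int_ge0 => x; exact: powR_ge0.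
have I1 : 0 < 1 + I by rewrite ltr_pwDl.
pose s := 2 + S * (2 / N%:R) + S / a - p.
pose K0 := C1 * (1 + I) `^ tau * C; have K00 : 0 <= K0 by rewrite !mulr_ge0 ?powR_ge0// ltW.
pose K1 := Num.max (1 + I) (K0 * 2 `^ s).
have Lu := H1_L2 hu.
have ch k : 0 < k -> (mu [set x | (k < `|u x|)%R] <= (k `^ (- S) * (1 + I))%:E)%E.
  move=> k0; apply: (@chebyshev_set _ _ _ mu u S k (1 + I)) => //.
  - exact: measurable_gt_abs Lu.1.
  - by move=> x /= /ltW.
  - by rewrite -/I lerDr.
apply: (@weak_to_strong _ _ _ mu u s r K1 Lu _ _ _).1.
- by rewrite r2.
- by rewrite le_max ltW.
move=> [|j].
  rewrite expr0 mulr0 powRr0 mulr1; apply: le_trans (ch _ ltr01) _.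
  by rewrite powR1 mul1r lee_fin le_max lexx.
have k1 : 1 <= 2 ^+ j :> R by rewrite exprn_ege1// ler1n.
have k0 : 0 < 2 ^+ j :> R by exact: lt_le_trans k1.
set k : R := 2 ^+ j in k1 k0.
have m0 : 0 < k `^ (- S) * (1 + I) by rewrite mulr_gt0 ?powR_gt0.
rewrite exprS; apply: le_trans (step u k _ _ hu k0 m0 (ch k k0) (hC k k1)) _.
rewrite lee_fin.
have -> : C1 * (k `^ (- S) * (1 + I)) `^ tau * (C * k `^ (p - S / a)) / k ^+ 2 = K0 * k `^ (- s).
  rewrite powRM ?powR_ge0 ?(ltW I1)// -powRrM -powR_mulrn ?(ltW k0)// -powRN /K0.
  have -> : - s = - S * tau + (p - S / a) + - 2%:R by rewrite /s /tau; ring.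
  rewrite !powR_pos_add//; ring.
apply: (@le_trans _ _ (K0 * 2 `^ s * 2 `^ (- s * j.+1%:R))); last first.
  by apply: ler_wpM2r; [exact: powR_ge0|rewrite le_max lexx orbT].
rewrite -mulrA -powR_pos_add// (_ : s + - s * j.+1%:R = j%:R * - s); last by rewrite -natr1; ring.
by rewrite powRrM powR2n.
Qed.

End bootstrap.

(** * Integrability of all orders and exponential barriers *)

Section regularity.
Context {R : realType} {N : nat}.
Local Notation E := 'rV[R]_N.
Local Notation mu := (@lebesgue_rV R N).
Local Notation pm := (mu \x mu)%E.
Implicit Types (u v f g h F : E -> R) (x y : E) (r s t c m M p q S k d : R) (z : E * E).
Variable al : R.
Hypotheses (N0 : (0 < N)%N) (al0 : 0 < al) (alN : al < N%:R).
Local Notation K := (@riesz R N al).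

Let NR : 0 < N%:R :> R. Proof. by rewrite ltr0n. Qed.

Let powR_abs q b v : (fun x => (`|v x| `^ q) `^ b) = fun x => `|v x| `^ (q * b).
Proof. by apply/funext => x; rewrite powRrM. Qed.

Lemma bootstrap_step (A : E -> R) m M c p q S (g e : R) u v : pot A m M -> 0 < c -> 1 < p -> 0 < g ->
  (N%:R + al) / N%:R < q -> q < S -> 2 < S -> 0 < e -> e <= al / N%:R ->
  p - 1 <= Num.min S (S * (1 + al / N%:R - e) - q) ->
  S + g < 2 + S * (2 / N%:R) + Num.min S (S * (1 + al / N%:R - e) - q) - p ->
  H1 u -> H1 v -> (forall x, 0 <= u x) -> el_eq al A c p q u v ->
  L1 mu (fun x => `|u x| `^ S) -> L1 mu (fun x => `|v x| `^ S) -> L1 mu (fun x => `|u x| `^ (S + g)).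
Proof.
move=> pA c0 p1 g0 hq qS S2 e0 eN pS gS hu hv u0 el Lu Lv.
have q0 : 0 < q by apply: le_lt_trans hq; rewrite divr_ge0 ?addr_ge0 ?(ltW al0)//.
have [a [s [a1 s1 abs sN Sa]]] := near_exponents NR al0 alN e0 eN q0 qS.
have [b' [s' [b'1 s'1 abs' s'N qb]]] := far_exponents NR al0 alN hq qS S2.
have mG : meas (fun x => `|v x| `^ q) by exact: measurable_abs_powR (H1_L2 hv).1.
have LG : L1 mu (fun x => (`|v x| `^ q) `^ (S / q)) by rewrite powR_abs mulrCA divff ?mulr1// gt_eqF.
have LG' : L1 mu (fun x => (`|v x| `^ q) `^ b') by rewrite powR_abs; exact: L1_interpolate (H1_L2 hv) Lv qb.
have Sq1 : 1 <= S / q by rewrite ler_pdivlMr// mul1r ltW.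
have [CP CP0 P] := riesz_pairing N0 al0 alN a1 Sq1 s1 abs sN b'1 s'1 abs' s'N mG (fun x => powR_ge0 _ _) LG LG'.
rewrite -Sa in pS gS; have S0 : 0 < S by exact: lt_trans S2.
have [C C0 hC] := slice_growth pA c0 p1 a1 S0 pS CP0 hu u0 el Lu P.
by apply: (slice_improve N0 S0 C0 hu Lu hC) => //; lra.
Qed.

(** Each round adds the same g to the exponent of both components, starting from the subcritical S0
    of Sobolev's inequality. The components advance together because each equation draws on the
    integrability of the other. *)
Theorem bootstrap (A B : E -> R) mA MA mB MB c1 c2 p q u v : pot A mA MA -> pot B mB MB -> 0 < c1 -> 0 < c2 ->
  1 < p -> 1 < q -> (N%:R + al) / N%:R < p -> (N%:R + al) / N%:R < q ->
  p * (N%:R - 2) < N%:R + al -> q * (N%:R - 2) < N%:R + al ->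
  H1 u -> H1 v -> (forall x, 0 <= u x) -> (forall x, 0 <= v x) ->
  el_eq al A c1 p q u v -> el_eq al B c2 q p v u ->
  forall r, 2 <= r -> L1 mu (fun x => `|u x| `^ r) /\ L1 mu (fun x => `|v x| `^ r).
Proof.
move=> pA pB c10 c20 p1 q1 hp hq hp' hq' hu hv u0 v0 el1 el2.
have [S0 [[S2 pS qS pS' qS'] [pq1 pq2 SN]]] := start_exponent N0 al0 alN p1 q1 hp' hq'.
have p0 : 0 < p by exact: lt_trans p1. have q0 : 0 < q by exact: lt_trans q1.
have [e [g [e0 eN g0 gP]]] := gain_exponents NR al0 p0 q0 S2 pS qS pS' qS' pq1 pq2.
have st (n : nat) : L1 mu (fun x => `|u x| `^ (S0 + n%:R * g)) /\ L1 mu (fun x => `|v x| `^ (S0 + n%:R * g)).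
  elim: n => [|n [Lu Lv]].
    rewrite mul0r addr0; have [C _ CP] := sobolev N0 (ltW S2) SN.
    have hs f : H1 f -> L1 mu (fun x => `|f x| `^ S0).
      move=> hf; have [] // := CP f (Num.sqrt (hn f)) hf (sqrtr_ge0 _).
      by rewrite sqr_sqrtr ?hn_ge0.
    by split; exact: hs.
  rewrite -natr1 mulrDl mul1r addrA; set S := S0 + n%:R * g in Lu Lv *.
  have SS : S0 <= S by rewrite lerDl mulr_ge0// ltW.
  have [h1 h2 h3 h4] := gP S SS.
  have [qS1 pS1 S21] : [/\ q < S, p < S & 2 < S] by split; exact: lt_le_trans SS.
  split; first exact: (bootstrap_step pA c10 p1 g0 hq qS1 S21 e0 eN h1 h3 hu hv u0 el1 Lu Lv).
  exact: (bootstrap_step pB c20 q1 g0 hp pS1 S21 e0 eN h2 h4 hv hu v0 el2 Lv Lu).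
move=> r r2; pose n := (Num.truncn (r / g)).+1.
have rn : r <= S0 + n%:R * g.
  apply: (@le_trans _ _ (n%:R * g)); last by rewrite lerDr; apply: ltW; exact: lt_trans S2.
  rewrite -ler_pdivrMr// ltW// /n; exact: truncnS_gt.
have [Lu Lv] := st n; have rr : 2 <= r <= S0 + n%:R * g by rewrite r2.
by split; [exact: L1_interpolate (H1_L2 hu) Lu rr|exact: L1_interpolate (H1_L2 hv) Lv rr].
Qed.

(** Boundedness of the potential I_alpha * |v|^q in dual form, tested against nonnegative F in L^1:
    both parts of the kernel use Young's inequality with a = 1. *)
Lemma riesz_bounded q v : (N%:R + al) / N%:R < q -> H1 v -> (forall r, 2 <= r -> L1 mu (fun x => `|v x| `^ r)) ->
  exists2 C : R, 0 <= C & forall F t, meas F -> (forall x, 0 <= F x) -> 0 < t ->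
    L1 mu F -> \int[mu]_x F x <= t -> \int[pm]_z pk K F (fun x => `|v x| `^ q) z <= C * t.
Proof.
move=> hq hv Lv.
have q1 : 1 < q by apply: lt_trans hq; rewrite ltr_pdivlMr// mul1r ltrDl.
pose b := Num.max (N%:R / al + 1) 2.
have b2 : 2 <= b by rewrite le_max lexx orbT.
have b1 : 1 < b by lra.
have b0 : 0 < b by lra.
have bN : N%:R / al < b by rewrite lt_max; apply/orP; left; lra.
have ib : 0 < 1 - b^-1 by rewrite subr_gt0 invf_lt1.
pose s := (1 - b^-1)^-1.
have s1 : 1 <= s by rewrite invf_ge1// gerBl invr_ge0 ltW.
have abs : 1^-1 + b^-1 + s^-1 = 2 by rewrite /s invrK invr1; ring.
have sN : s * (N%:R - al) < N%:R.
  rewrite mulrC ltr_pdivrMr// mulrBr mulr1 ltrD2l ltrN2 ltr_pdivrMr// -ltr_pdivrMl// mulrC//.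
have qq : q < q * b by rewrite ltr_pMr//; lra.
have q2 : 2 < 2 * q by lra.
have q0 : 0 < q by exact: lt_trans q1.
pose S := 2 * q + 2.
have [b' [s' [b'1 s'1 abs' s'N qb]]] := @far_exponents _ N%:R al q S NR al0 alN hq (ltac:(rewrite /S; lra)) (ltac:(rewrite /S; lra)).
have mG : meas (fun x => `|v x| `^ q) by exact: measurable_abs_powR (H1_L2 hv).1.
have LG : L1 mu (fun x => (`|v x| `^ q) `^ b).
  rewrite powR_abs; apply: Lv; apply: le_trans b2 _; rewrite ler_peMl ?(ltW b0)// ltW//.
have LG' : L1 mu (fun x => (`|v x| `^ q) `^ b') by rewrite powR_abs; apply: Lv; case/andP: qb.
have [C C0 P] := riesz_pairing N0 al0 alN (lexx 1) (ltW b1) s1 abs sN b'1 s'1 abs' s'N mG (fun x => powR_ge0 _ _) LG LG'.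
exists C => // F t mF F0 t0 LF IF.
have eF : (fun x => F x `^ 1) = F by apply/funext => x; rewrite powRr1.
by have [] // := P F t mF F0 t0 LF IF; rewrite ?eF// powRr1// ltW.
Qed.

Lemma expR_le_quad (x : R) : x <= 2^-1 -> expR x <= 1 + x + 2 * x ^+ 2.
Proof.
move=> x2; have h := expR_ge1Dx (- x); rewrite expRN in h.
have e0 := expR_gt0 x.
rewrite -(ler_pM2r e0) mulVf ?gt_eqF// in h.
have p1 : 0 < 1 - x by lra.
rewrite -(ler_pM2l p1); apply: le_trans h _; nra.
Qed.

Lemma second_difference_arith (ea na nb a2 D a : R) : ea <= 1 + a + 2 * a2 -> na <= 1 - a + 2 * a2 -> nb <= ea ->
  a2 <= D -> na + nb - 2 <= 4 * D.
Proof. by move=> *; lra. Qed.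

Lemma energy_arith (D X Y Z b w : R) : D <= b + w -> X + Y <= Z -> b <= Y -> D + X <= w + Z.
Proof. by move=> *; lra. Qed.

Lemma half_absorb (X Y : R) : X <= X / 2 + Y / 2 -> X <= Y.
Proof. by move=> *; lra. Qed.

(** The exponents satisfy a + b >= 0 by convexity of the sum norm, so the kinks of the weight push
    the second difference down. The rest is the quadratic upper bound for exp at a and -a. *)
Lemma bar_second_difference d x y : 0 <= d -> d * nrm1 y <= 2^-1 ->
  bar d (x + y) + bar d (x - y) - 2 * bar d x <= 4 * (d * nrm1 y) ^+ 2 * bar d x.
Proof.
move=> d0 dy; pose a := d * (nrm1 (x + y) - nrm1 x); pose b := d * (nrm1 (x - y) - nrm1 x).
have e (w : E) : bar d w = bar d x * expR (- (d * (nrm1 w - nrm1 x))).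
  by rewrite /bar -expRD; congr expR; ring.
rewrite (e (x + y)) (e (x - y)) -/a -/b -[X in _ - 2 * X]mulr1.
rewrite (_ : _ - _ = (expR (- a) + expR (- b) - 2) * bar d x); last by ring.
apply: ler_wpM2r; first exact: bar_ge0.
have ab : 0 <= a + b.
  rewrite /a /b -mulrDr mulr_ge0//; have := nrm1D (x + y) (x - y); rewrite addrACA subrr addr0.
  have -> : nrm1 (x + x) = 2 * nrm1 x.
    rewrite /nrm1 mulr_sumr; apply: eq_bigr => i _.
    have -> : (x + x) ord0 i = 2 * x ord0 i by rewrite mxE; ring.
    by rewrite (normrM 2) ger0_norm.
  by move: (nrm1 (x + y)) (nrm1 (x - y)) (nrm1 x) => *; lra.
have ha : a <= d * nrm1 y by apply: ler_wpM2l => //; rewrite lerBlDl; exact: nrm1D.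
have hna : - a <= d * nrm1 y.
  rewrite /a -mulrN; apply: ler_wpM2l => //; rewrite opprB lerBlDl.
  by have := nrm1D (x + y) (- y); rewrite addrK nrm1N.
have eb : expR (- b) <= expR a by rewrite ler_expR; lra.
have q1 := @expR_le_quad a (le_trans ha dy); have q2 := @expR_le_quad (- a) (le_trans hna dy).
have sq : a ^+ 2 <= (d * nrm1 y) ^+ 2.
  by rewrite -sqr_normr; apply: lerXn2r; rewrite ?nnegrE ?mulr_ge0 ?nrm1_ge0// ler_norml ha andbT lerNl.
rewrite sqrrN in q2; exact: (second_difference_arith q1 q2 eb sq).
Qed.

(** The weak form of Laplacian(bar) <= 4 N d^2 bar: one difference quotient is moved from z' onto
    the other, which produces the second differences of the weight along the axes. *)
Lemma dir_bar d (z' : E -> R) : 0 < d <= 2^-1 -> H1 z' -> (forall x, 0 <= z' x) ->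
  - dir (bar d) z' <= 4 * N%:R * d ^+ 2 * \int[mu]_x (bar d x * z' x).
Proof.
move=> /andP[d0 d1] hz z0; have hb := H1_bar N0 d0; have Lb := H1_L2 hb; have Lz := H1_L2 hz.
have Lbz := L2_mul Lb Lz.
have dn : (fun n => - dirn n (bar d) z') @ \oo --> - dir (bar d) z' by exact: cvgN (dirn_cvg hb hz).
suff le n : - dirn n (bar d) z' <= 4 * N%:R * d ^+ 2 * \int[mu]_x (bar d x * z' x).
  by apply: (cvgn_le_lim le dn); exact: cvg_cst.
rewrite /dirn -sumrN.
have -> : 4 * N%:R * d ^+ 2 * \int[mu]_x (bar d x * z' x) = \sum_(i < N) (4 * d ^+ 2 * \int[mu]_x (bar d x * z' x)).
  by rewrite sumr_const card_ord -mulr_natl; move: (\int[mu]_x _) => I; ring.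
apply: ler_sum => i _; have /andP[t0 t1] := tn_itv (R := R) n; set t := tn n in t0 t1 *.
have Ldb := L2_dq i t Lb.
under eq_Rintegral do rewrite mulrC.
rewrite (dq_adjoint i t Lz Ldb) opprK -(intZ _ Lbz).
apply: int_le; [exact: L2_mul Lz (L2_dq i (- t) Ldb)|exact: L1Z|move=> x].
rewrite (_ : 4 * d ^+ 2 * _ = z' x * (4 * d ^+ 2 * bar d x)); last by ring.
apply: ler_wpM2l => //.
have := @bar_second_difference d x (t *: unitv i) (ltW d0); rewrite nrm1_unitv (gtr0_norm t0).
have dt : d * t <= 2^-1 by apply: le_trans d1; rewrite ler_piMr// ltW.
move=> /(_ dt); rewrite /dq scaleNr subrK.
set a := bar d (x + _); set b := bar d (x - _); set e := bar d x => h.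
have -> : (- t)^-1 * (t^-1 * (e - b) - t^-1 * (a - e)) = (a + b - 2 * e) / t ^+ 2.
  by field; rewrite gt_eqF.
rewrite ler_pdivrMr ?exprn_gt0//; apply: le_trans h _; apply: le_of_eq; ring.
Qed.

(** At w^2 = t^(-2/(m-2)) the two terms on the right are equal; below this value the second one
    suffices, above it the first. *)
Lemma square_young (w t m : R) : 0 <= w -> 2 < m -> 0 < t -> w ^+ 2 <= t * w `^ m + t `^ (- (2 / (m - 2))).
Proof.
move=> w0 m2 t0; have m20 : 0 < m - 2 by lra.
have [h|h] := leP (w ^+ 2) (t `^ (- (2 / (m - 2)))).
  by apply: ler_wpDl => //; rewrite mulr_ge0 ?powR_ge0// ltW.
apply: ler_wpDr; first exact: powR_ge0.
have wp : 0 < w.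
  rewrite lt_def w0 andbT; apply: contraTneq h => ->; by rewrite expr0n -leNgt powR_ge0.
have e1 : w `^ m = w ^+ 2 * w `^ (m - 2).
  by rewrite -powR_mulrn// -powR_pos_add// addrC subrK.
rewrite e1 mulrCA ler_peMr ?sqr_ge0//.
have : (t `^ (- (2 / (m - 2)))) `^ ((m - 2) / 2) <= (w ^+ 2) `^ ((m - 2) / 2).
  by apply: ge0_ler_powR; rewrite ?nnegrE ?powR_ge0 ?sqr_ge0 ?divr_ge0 ?(ltW m20)// ltW.
rewrite -powR_mulrn// -!powRrM.
have -> : - (2 / (m - 2)) * ((m - 2) / 2) = -1 by field; rewrite gt_eqF.
have -> : 2%:R * ((m - 2) / 2) = m - 2 by field.
rewrite powR_inv1 ?(ltW t0)// => g; have := ler_wpM2l (ltW t0) g.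
by rewrite mulfV ?gt_eqF.
Qed.

Lemma trunc_H1 (k : R) u : 0 < k -> H1 u -> H1 (fun x => Num.max (u x - k) 0).
Proof.
move=> k0 hu; apply: (H1_lipschitz (F := fun s => Num.max (s - k) 0)) => //.
- by rewrite max_r// sub0r oppr_le0 ltW.
- by move=> a b; case: (leP (a - k) 0); case: (leP (b - k) 0) => *; rewrite ler_norml; have := ler_norm (a - b); have := ler_norm (b - a); rewrite distrC => *; apply/andP; split; lra.
- by apply: measurable_maxr => //; apply: measurable_funB => //; exact: (H1_L2 hu).1.
Qed.

(** * De Giorgi iteration against the barrier *)

Section level_sets.
Variables (A : E -> R) (m0 M0 c p q : R) (u v : E -> R).
Hypotheses (pA : pot A m0 M0) (c0 : 0 < c) (p1 : 1 < p) (hq : (N%:R + al) / N%:R < q).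
Hypotheses (hu : H1 u) (hv : H1 v) (u0 : forall x, 0 <= u x) (el : el_eq al A c p q u v).
Hypotheses (Lu : forall r, 2 <= r -> L1 mu (fun x => `|u x| `^ r)) (Lv : forall r, 2 <= r -> L1 mu (fun x => `|v x| `^ r)).
Variable (d : R).
Hypotheses (d0 : 0 < d <= 2^-1) (dm : 4 * N%:R * d ^+ 2 <= m0).

(** De Giorgi's truncation above the level M bar + k. For M >= 0 the constant k > 0 confines it to
    {u > k}, where u^(p-1) <= u^p / k. *)
Definition barrier_excess (M k : R) : E -> R := fun x => Num.max (u x - M * bar d x - k) 0.
Local Notation zz := barrier_excess.

Let hb : H1 (bar d : E -> R). Proof. by case/andP: d0 => d1 _; exact: H1_bar. Qed.

Let hw M : H1 (fun x => - M * bar d x + u x). Proof. exact: H1_lin. Qed.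

Let zzE M k : zz M k = fun x => Num.max ((- M * bar d x + u x) - k) 0.
Proof. by apply/funext => x; rewrite /zz; congr (Num.max (_ - _) _); ring. Qed.

Lemma excess_H1 M k : 0 < k -> H1 (zz M k).
Proof. by move=> k0; rewrite zzE; exact: trunc_H1. Qed.

Lemma excess_ge0 M k x : 0 <= zz M k x.
Proof. by rewrite /zz le_max lexx orbT. Qed.

Let spu x : sp p (u x) = u x `^ (p - 1).
Proof.
rewrite /sp; have [->|un] := eqVneq (u x) 0; first by rewrite sgr0 mul0r powR0// subr_eq0 gt_eqF.
by rewrite ger0_norm// gtr0_sg ?mul1r// lt_def un u0.
Qed.

Lemma excess_L1 M k : 0 < k -> 0 <= M -> L1 mu (fun x => sp p (u x) * zz M k x).
Proof.
move=> k0 M1; have hz := excess_H1 M k0.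
have L2p : L2 mu (fun x => `|u x| `^ p).
  split; first exact: measurable_abs_powR (H1_L2 hu).1.
  rewrite (_ : (fun x => _) = fun x => `|u x| `^ (p * 2)); first by apply: Lu; rewrite ler_peMl// ltW.
  by apply/funext => x; rewrite powRrM powR_mulrn// powR_ge0.
apply: (L1_le _ _ (L1Z k^-1 (L2_mul L2p (H1_L2 hz)))).
  by apply: measurable_funM; [exact: measurable_sp (H1_L2 hu).1|exact: (H1_L2 hz).1].
move=> x; rewrite spu ger0_norm; last by rewrite mulr_ge0 ?powR_ge0 ?excess_ge0.
have [h|h] := leP (u x) k.
  have -> : zz M k x = 0.
    rewrite /zz max_r//; have := bar_ge0 d x => b0; have : 0 <= M * bar d x by exact: mulr_ge0.
    by move: (M * bar d x) => t t0; lra.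
  by rewrite !mulr0.
rewrite mulrA; apply: ler_wpM2r; first exact: excess_ge0.
have ux : 0 < u x by exact: lt_trans h.
have ep : u x `^ p = u x * u x `^ (p - 1) by rewrite -{2}(powRr1 (ltW ux)) -powR_pos_add// addrC subrK.
rewrite ger0_norm// ler_pdivlMl// ep.
by apply: ler_wpM2r; [exact: powR_ge0|exact: ltW].
Qed.

(** As 4 N d^2 <= m0, the barrier is a supersolution of the linear operator, and its gradient term
    is absorbed by the potential term m0 M bar. The constant is therefore independent of M and k.
    The right-hand side of the equation enters through the bounded potential. *)
Lemma excess_energy : exists2 C : R, 0 < C & forall M k, 0 <= M -> 0 < k ->
  hn (zz M k) <= C * \int[mu]_x (sp p (u x) * zz M k x).
Proof.
have [C C0 P] := riesz_bounded hq hv Lv.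
have [m00 _ _] := pA; have m1 : 0 < Num.min 1 m0 by rewrite lt_min ltr01.
have cC : 0 < c * (C + 1) by rewrite mulr_gt0// ltr_wpDl.
exists ((Num.min 1 m0)^-1 * (c * (C + 1))) => [|M k M1 k0]; first by rewrite mulr_gt0// invr_gt0.
have hz := excess_H1 M k0; have LF := excess_L1 k0 M1; have z0 := excess_ge0 M k.
have F0 x : 0 <= sp p (u x) * zz M k x by rewrite spu mulr_ge0 ?powR_ge0.
have IF0 : 0 <= \int[mu]_x (sp p (u x) * zz M k x) by exact: int_ge0.
rewrite -mulrA -ler_pdivrMl ?invr_gt0// invrK.
have q0 : qb A u (zz M k) <= c * (C + 1) * \int[mu]_x (sp p (u x) * zz M k x).
  rewrite (el hz) -mulrA ler_pM2l//.
  apply/ler_addgt0Pr => e e0; pose t := \int[mu]_x (sp p (u x) * zz M k x) + e / (C + 1).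
  have C1 : 0 < C + 1 by rewrite ltr_wpDl.
  have ec : 0 < e / (C + 1) by rewrite divr_gt0.
  have t0 : 0 < t by rewrite ltr_wpDl.
  have It : \int[mu]_x (sp p (u x) * zz M k x) <= t by rewrite lerDl ltW.
  have := P (fun x => sp p (u x) * zz M k x) t (L1_meas LF) F0 t0 LF It => h.
  apply: le_trans h _; apply: (@le_trans _ _ ((C + 1) * t)); first by rewrite ler_pM2r// lerDl.
  by rewrite /t mulrDr lerD2l mulrC divfK// gt_eqF.
apply: le_trans q0.
have Lz := H1_L2 hz; have Lb := H1_L2 hb; have LU := H1_L2 hu.
have dz : dir (zz M k) (zz M k) <= dir (fun x => - M * bar d x + u x) (zz M k).
  apply: (dir_le hz hz (hw M) hz) => x y; rewrite zzE.
  move: (- M * bar d x + u x) (- M * bar d y + u y) => s t.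
  by case: (leP (s - k) 0); case: (leP (t - k) 0) => *; nra.
rewrite (dir_linl (- M) hb hu hz) in dz.
have db := dir_bar d0 hz z0.
have Lbz := L2_mul Lb Lz; have Lz2 := Lz.2; have LAz := pot_L1 pA LU Lz.
have I2 : m0 * \int[mu]_x zz M k x ^+ 2 + M * (m0 * \int[mu]_x (bar d x * zz M k x)) <= \int[mu]_x (A x * (u x * zz M k x)).
  rewrite mulrA -(intZ m0 Lz2) -(intZ (M * m0) Lbz) -(intD (L1Z m0 Lz2) (L1Z (M * m0) Lbz)).
  apply: int_le => // [|x]; first exact: L1D (L1Z m0 Lz2) (L1Z (M * m0) Lbz).
  have [_ _ /(_ x)/andP[mA _]] := pA; have zx := z0 x.
  have h : zz M k x * (zz M k x + M * bar d x) <= zz M k x * u x.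
    rewrite /zz; case: (leP (u x - M * bar d x - k) 0) => h; first by rewrite !mul0r.
    by rewrite (ler_pM2l h) addrAC subrK gerBl ltW.
  apply: (@le_trans _ _ (m0 * (zz M k x * (zz M k x + M * bar d x)))).
    by apply: le_of_eq; ring.
  rewrite [u x * _]mulrC; apply: ler_pM => //; first exact: ltW.
  by rewrite mulr_ge0// addr_ge0// mulr_ge0 ?bar_ge0.
have Ib0 : 0 <= \int[mu]_x (bar d x * zz M k x) by apply: int_ge0 => x; rewrite mulr_ge0 ?bar_ge0.
have Iz0 : 0 <= \int[mu]_x zz M k x ^+ 2 by apply: int_ge0 => x; exact: sqr_ge0.
have db2 : - M * dir (bar d) (zz M k) <= M * (m0 * \int[mu]_x (bar d x * zz M k x)).
  rewrite mulNr -mulrN; apply: ler_wpM2l => //; apply: le_trans db _; exact: ler_wpM2r.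
have D0 := dir_ge0 (zz M k).
apply: (@le_trans _ _ (dir (zz M k) (zz M k) + m0 * \int[mu]_x zz M k x ^+ 2)).
  rewrite /hn mulrDr; apply: lerD; first by rewrite ler_piMl// ge_min lexx.
  by apply: ler_wpM2r => //; rewrite ge_min lexx orbT.
exact: energy_arith dz I2 db2.
Qed.

Let NR4 : 2 < N%:R + 4 + 2 / (p - 1).
Proof.
have h : 0 < 2 / (p - 1) by rewrite divr_gt0// subr_gt0.
by move: (2 / (p - 1)) h NR => *; lra.
Qed.

(** With m = N + 4 + 2/(p-1) this is 4/N - 2/m: the factor s^(2/N) of Faber-Krahn enters squared,
    and Hoelder with the L^m norm of u^(p-1) loses s^(2/m). It is positive since m > N/2, and (p-1)
    m >= 2 makes that norm finite. *)
Definition decay_gain : R := 2 * (2 / N%:R) - 2 / (N%:R + 4 + 2 / (p - 1)).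

Lemma decay_gain_gt0 : 0 < decay_gain.
Proof.
have h := NR4; have m3 : 0 < N%:R + 4 + 2 / (p - 1) by exact: lt_trans h.
rewrite /decay_gain subr_gt0 mulrA ltr_pdivrMr// mulrAC ltr_pdivlMr//.
have g : 0 < 2 / (p - 1) by rewrite divr_gt0// subr_gt0.
by move: (2 / (p - 1)) g NR => *; lra.
Qed.

(** Faber-Krahn and [excess_energy] bound X, the integral of z^2, by T times that of u^(p-1) z with
    T of order s^(2/N). Young's inequality with weight eta = 1/(2T) absorbs X/2; the rest is T^2
    times the integral of u^(2(p-1)) over a set of measure at most s. *)
Lemma excess_decay : exists2 C : R, 0 < C & forall M k s, 0 <= M -> 0 < k -> 0 < s ->
  (mu [set x | (M * bar d x + k < u x)%R] <= s%:E)%E ->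
  \int[mu]_x zz M k x ^+ 2 <= C * s `^ (1 + decay_gain).
Proof.
have [C0 C00 en] := excess_energy.
pose tau : R := 2 / N%:R; have tN : 0 <= tau <= 2 / N%:R by rewrite lexx divr_ge0.
have [C1 C10 fk] := faber_krahn N0 tN.
pose m := N%:R + 4 + 2 / (p - 1); have m2 : 2 < m := NR4.
have m20 : 0 < m - 2 by rewrite subr_gt0.
have mp : 0 < m by exact: lt_trans m2.
have p10 : 0 < p - 1 by rewrite subr_gt0.
have Lm : L1 mu (fun x => (u x `^ (p - 1)) `^ m).
  rewrite (_ : (fun x => _) = fun x => `|u x| `^ ((p - 1) * m)).
    apply: Lu; rewrite /m mulrDr mulrCA divff ?gt_eqF// mulr1 lerDr mulr_ge0 ?(ltW p10)//.
  by apply/funext => x; rewrite powRrM ger0_norm.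
pose W := \int[mu]_x ((u x `^ (p - 1)) `^ m).
have W0 : 0 <= W by apply: int_ge0 => x; exact: powR_ge0.
exists ((C1 * C0) ^+ 2 * (W + 1)) => [|M k s M1 k0 s0 mS].
  by rewrite mulr_gt0 ?exprn_gt0 ?mulr_gt0// ltr_wpDl.
have hz := excess_H1 M k0; have z0 := excess_ge0 M k; have LF := excess_L1 k0 M1.
pose SS : set E := [set x | M * bar d x + k < u x].
have mSS : measurable SS.
  rewrite -[SS]setTI; apply: measurable_fun_ltr => //; last exact: (H1_L2 hu).1.
  by apply: measurable_funD => //; apply: measurable_funM => //; exact: measurable_bar.
have zS x : zz M k x != 0 -> SS x.
  rewrite /zz /SS/=; case: (leP (u x - M * bar d x - k) 0) => [_|h _]; first by rewrite eqxx.
  by rewrite -subr_gt0 opprD addrA.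
have mz : (mu [set x | (zz M k x != 0)%R] <= s%:E)%E.
  have mZ : measurable [set x | (zz M k x != 0)%R].
    rewrite (_ : [set x | _] = ~` (zz M k @^-1` [set 0])); last by apply/seteqP; split => x /= /eqP.
    by apply: measurableC; rewrite -[X in measurable X]setTI; exact: (H1_L2 hz).1.
  by apply: le_trans mS; apply: le_measure; rewrite ?inE// => x /= /zS.
set X := \int[mu]_x zz M k x ^+ 2.
have X0 : 0 <= X by apply: int_ge0 => x; exact: sqr_ge0.
have FK := fk _ _ hz s0 mz; rewrite -/(hn (zz M k)) -/X in FK.
pose T := C1 * s `^ tau * C0; have T0 : 0 < T by rewrite !mulr_gt0// powR_gt0.
have XT : X <= T * \int[mu]_x (sp p (u x) * zz M k x).
  apply: le_trans FK _; rewrite /T -[leRHS]mulrA; apply: ler_wpM2l; last exact: en.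
  by rewrite mulr_ge0 ?powR_ge0// ltW.
(* This weight makes the constant term of [square_young], integrated over a set of measure s, equal
   to th itself, so both terms have the same order. *)
pose th := s `^ (1 - 2 / m); have th0 : 0 < th by rewrite powR_gt0.
pose eta := (2 * T)^-1; have eta0 : 0 < eta by rewrite invr_gt0 mulr_gt0.
have LS : L1 mu (fun x => \1_SS x : R).
  by apply: L1_indic => //; apply: le_lt_trans mS _; exact: ltry.
have IS : \int[mu]_x (\1_SS x : R) <= s by rewrite -lee_fin EFin_int// integral_indic// setIT.
have pw x : sp p (u x) * zz M k x <= eta * zz M k x ^+ 2
    + (4 * eta)^-1 * (th * (u x `^ (p - 1)) `^ m + th `^ (- (2 / (m - 2))) * \1_SS x).
  have e40 : 0 < (4 * eta)^-1 by rewrite invr_gt0 mulr_gt0.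
  have [zx|zx] := eqVneq (zz M k x) 0.
    rewrite zx mulr0 expr0n mulr0 add0r; apply: mulr_ge0; first exact: ltW.
    by apply: addr_ge0; apply: mulr_ge0 => //; rewrite ?powR_ge0// ltW.
  rewrite indicE mem_set; last exact: zS.
  rewrite mulr1 spu; have h := square_young (powR_ge0 (u x) (p - 1)) m2 th0.
  apply: (@le_trans _ _ (eta * zz M k x ^+ 2 + (4 * eta)^-1 * (u x `^ (p - 1)) ^+ 2)).
    rewrite -subr_ge0 (_ : _ - _ = (4 * eta)^-1 * (u x `^ (p - 1) - 2 * eta * zz M k x) ^+ 2).
      by rewrite mulr_ge0 ?sqr_ge0// ltW.
    by field; rewrite gt_eqF.
  by rewrite lerD2l ler_pM2l.
have LW := L1D (L1Z th Lm) (L1Z (th `^ (- (2 / (m - 2)))) LS).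
have Lz2 := (H1_L2 hz).2.
have IF := int_le LF (L1D (L1Z eta Lz2) (L1Z (4 * eta)^-1 LW)) pw.
rewrite (intD (L1Z eta Lz2) (L1Z _ LW)) (intZ eta Lz2) (intZ _ LW) (intD (L1Z th Lm) (L1Z _ LS)) (intZ th Lm) (intZ _ LS) -/W -/X in IF.
have e1 : th `^ (- (2 / (m - 2))) = s `^ (- (2 / m)).
  rewrite /th -powRrM; congr (_ `^ _); field; by rewrite !gt_eqF.
have e2 : s `^ (- (2 / m)) * s = th.
  by rewrite -{2}(powRr1 (ltW s0)) -powR_pos_add// addrC.
have IF2 : \int[mu]_x (sp p (u x) * zz M k x) <= eta * X + (4 * eta)^-1 * (th * (W + 1)).
  apply: le_trans IF _; rewrite lerD2l ler_pM2l ?invr_gt0 ?mulr_gt0// mulrDr mulr1 lerD2l e1 -[leRHS]e2.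
  by apply: ler_wpM2l => //; exact: powR_ge0.
have XX : X <= T ^+ 2 * (th * (W + 1)).
  have h : X <= T * (eta * X + (4 * eta)^-1 * (th * (W + 1))) by apply: le_trans XT _; rewrite ler_pM2l.
  have h' : T * (eta * X + (4 * eta)^-1 * (th * (W + 1))) = X / 2 + T ^+ 2 * (th * (W + 1)) / 2.
    by rewrite /eta; field; rewrite gt_eqF.
  by rewrite h' in h; exact: half_absorb h.
apply: le_trans XX _; apply: le_of_eq.
have -> : 1 + decay_gain = tau + tau + (1 - 2 / m) by rewrite /decay_gain /tau -/m; ring.
by rewrite (powR_pos_add (tau + tau) (1 - 2 / m) s0) (powR_pos_add tau tau s0) -/th /T; ring.
Qed.

Let mS M k : measurable [set x | (M * bar d x + k < u x)%R].
Proof.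
rewrite -[X in measurable X]setTI; apply: measurable_fun_ltr => //; last exact: (H1_L2 hu).1.
by apply: measurable_funD => //; apply: measurable_funM => //; exact: measurable_bar.
Qed.

(** The weight is positive everywhere, so u restricted to {u > n bar + k} tends to 0 pointwise;
    dominated convergence and Chebyshev at height k make these sets small. *)
Lemma level_start k s : 0 < k -> 0 < s -> exists2 M : R, 0 <= M &
  (mu [set x | (M * bar d x + k < u x)%R] <= s%:E)%E.
Proof.
move=> k0 s0; have LU := H1_L2 hu.
pose SS (n : nat) : set E := [set x | n%:R * bar d x + k < u x].
pose f (n : nat) x := \1_(SS n) x * u x.
have mf (n : nat) : meas (f n) by apply: measurable_funM; [exact: measurable_indic (mS _ _)|exact: LU.1].
have fu (n : nat) x : `|f n x| <= `|u x|.
  by rewrite /f indicE; case: (x \in _); rewrite ?mul1r ?mul0r ?normr0.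
have fc x : f n x ^+ 2 @[n --> \oo] --> (0 : R).
  apply/cvgn_leP => e e0; exists (Num.truncn (u x / bar d x)).+1 => n nx.
  rewrite /f indicE memNset ?mul0r ?expr0n ?subr0 ?normr0 ?(ltW e0)//= /SS/= => h.
  have : u x < n%:R * bar d x.
    rewrite -ltr_pdivrMr ?bar_gt0//; apply: lt_le_trans (truncnS_gt _) _.
    by rewrite ler_nat.
  have h2 : n%:R * bar d x < u x by apply: lt_trans h; rewrite ltrDl.
  by move=> h3; have := lt_trans h3 h2; rewrite ltxx.
have Lf (n : nat) : L2 mu (f n) by apply: L2_le (L2_abs LU).
have [] := @dct _ _ _ mu (fun n x => f n x ^+ 2) (fun=> 0) (fun x => u x ^+ 2).
- by move=> n; exact: measurable_funX (mf n).
- exact: fc.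
- exact: measurable_cst.
- exact: LU.2.
- by move=> n x; rewrite ger0_norm ?sqr_ge0// -sqr_normr -[leRHS]sqr_normr; apply: lerXn2r; rewrite ?nnegrE.
move=> _; rewrite int_0 => /cvgn_leP/(_ (s * k ^+ 2)) []; first by rewrite mulr_gt0// exprn_gt0.
move=> n /(_ n (leqnn n)); rewrite subr0 => /(le_trans (ler_norm _)) h.
exists n%:R => //; apply: le_trans (@chebyshev_sqr _ _ _ mu (f n) k _ (SS n) k0 (mS _ _) _ (Lf n) h) _.
  move=> x xS; rewrite /f indicE mem_set// mul1r; apply: le_trans (ler_norm _).
  by apply: ltW; apply: le_lt_trans xS; rewrite lerDr mulr_ge0 ?bar_ge0.
by rewrite lee_fin mulfK// gt_eqF// exprn_gt0.
Qed.

(** De Giorgi's iteration over the levels k (2 - 2^-j), with measures at most s th^j. Chebyshev over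
    a gap k 2^-(j+1) costs 4^(j+1)/k^2, and th^g = 1/4, s^g = th k^2/(4C) make the recursion close
    exactly. *)
Lemma level_vanish k : 0 < k -> exists2 M : R, 0 <= M & mu [set x | (M * bar d x + 2 * k < u x)%R] = 0%E.
Proof.
move=> k0; have [C C0 dec] := excess_decay; have g0 := decay_gain_gt0.
set g := decay_gain in dec g0.
pose th : R := 4^-1 `^ g^-1.
have th0 : 0 < th by rewrite powR_gt0// invr_gt0.
have th1 : th < 1 by apply: powR_base_lt1; rewrite ?invr_gt0// invf_lt1// ltr1n.
have thg : th `^ g = 4^-1 by rewrite /th -powRrM mulVf ?powRr1 ?gt_eqF// invr_ge0.
pose s : R := (th * k ^+ 2 / (4 * C)) `^ g^-1.
have b0 : 0 < th * k ^+ 2 / (4 * C) by rewrite divr_gt0 ?mulr_gt0// exprn_gt0.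
have s0 : 0 < s by rewrite powR_gt0.
have sg : s `^ g = th * k ^+ 2 / (4 * C) by rewrite /s -powRrM mulVf ?powRr1 ?gt_eqF// ltW.
have [M M1 start] := level_start k0 s0; exists M => //.
pose kk (j : nat) := k * (2 - tn j).
have tS (j : nat) : tn j = 2 * tn (R := R) j.+1 by rewrite /tn exprS mulrA divff ?mul1r.
have kkp (j : nat) : 0 < kk j.
  rewrite mulr_gt0// subr_gt0; have /andP[_ h] := tn_itv (R := R) j; apply: le_lt_trans h _.
  by rewrite ltr1n.
have it (j : nat) : (mu [set x | (M * bar d x + kk j < u x)%R] <= (s * th ^+ j)%:E)%E.
  elim: j => [|j IH].
    by rewrite /kk /tn !expr0 mulr1 (_ : 2 - 1 = 1) ?mulr1//; ring.
  have sj : 0 < s * th ^+ j by rewrite mulr_gt0// exprn_gt0.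
  have IX := dec M (kk j) _ M1 (kkp j) sj IH.
  have ct : 0 < k * tn j.+1 by rewrite mulr_gt0// tn_gt0.
  apply: le_trans (@chebyshev_sqr _ _ _ mu (zz M (kk j)) (k * tn j.+1) _ _ ct (mS _ _) _ (H1_L2 (excess_H1 M (kkp j))) IX) _.
    move=> x /= h; apply: le_trans (ler_norm _); apply: le_trans (_ : _ <= u x - M * bar d x - kk j) _; last by rewrite /zz le_max lexx.
    rewrite lerBrDr lerBrDr; apply: ltW; apply: le_lt_trans h.
    apply: le_of_eq; rewrite /kk (tS j); ring.
  rewrite lee_fin; apply: le_of_eq.
  rewrite powR_pos_add// powRr1 ?(ltW sj)// powRM ?(ltW s0) ?exprn_ge0 ?(ltW th0)// sg.
  have -> : (th ^+ j) `^ g = 4^-1 ^+ j.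
    by rewrite -powR_mulrn ?(ltW th0)// -powRrM mulrC powRrM thg powR_mulrn// invr_ge0.
  have -> : (k * tn j.+1) ^+ 2 = k ^+ 2 * (4^-1 ^+ j * 4^-1).
    by rewrite exprMn /tn -exprM mulnC exprM (_ : 2^-1 ^+ 2 = 4^-1 :> R) ?exprSr//; field.
  rewrite [th ^+ j.+1]exprSr; have : 4^-1 ^+ j != 0 :> R by rewrite expf_neq0// invr_eq0.
  move: (4^-1 ^+ j) (th ^+ j) => a b a0; field.
  by rewrite a0 !gt_eqF.
apply/eqP; rewrite -measure_le0; apply/lee_addgt0Pr => e e0; rewrite add0e.
have th1' : `|th| < 1 by rewrite gtr0_norm.
have /cvgn_leP/(_ (e / s)) [|j /(_ j (leqnn j))] := cvg_expr th1'; first by rewrite divr_gt0.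
rewrite subr0 ger0_norm ?exprn_ge0 ?(ltW th0)// ler_pdivlMr// mulrC => h.
apply: (@le_trans _ _ (s * th ^+ j)%:E); last by rewrite lee_fin.
apply: le_trans (it j); apply: le_measure; rewrite ?inE//= => x /=; apply: le_lt_trans; rewrite lerD2l.
by rewrite /kk [leRHS]mulrC (ler_pM2l k0) gerBl; exact: ltW (tn_gt0 j).
Qed.

End level_sets.

Theorem decay (A : E -> R) m0 M0 c p q u v : pot A m0 M0 -> 0 < c -> 1 < p -> (N%:R + al) / N%:R < q ->
  H1 u -> H1 v -> (forall x, 0 <= u x) -> el_eq al A c p q u v ->
  (forall r, 2 <= r -> L1 mu (fun x => `|u x| `^ r)) -> (forall r, 2 <= r -> L1 mu (fun x => `|v x| `^ r)) ->
  exists2 d : R, 0 < d & forall k, 0 < k -> exists2 M : R, 0 <= M & {ae mu, forall x, u x <= M * bar d x + k}.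
Proof.
move=> pA c0 p1 hq hu hv u0 el Lu Lv; have [m00 _ _] := pA.
(* d <= 1/2 is the range of the second-difference bound, and d^2 <= d <= m0/(4N) makes the barrier a
   supersolution. *)
pose d := Num.min 2^-1 (m0 / (4 * N%:R)).
have d0 : 0 < d <= 2^-1 by rewrite lt_min invr_gt0 ltr0n divr_gt0 ?mulr_gt0//= ge_min lexx.
have /andP[dp d2] := d0.
have dm : 4 * N%:R * d ^+ 2 <= m0.
  have h : d <= m0 / (4 * N%:R) by rewrite ge_min lexx orbT.
  rewrite mulrC -ler_pdivlMr ?mulr_gt0//; apply: le_trans h; rewrite expr2 ler_piMl ?(ltW dp)//.
  by apply: le_trans d2 _; rewrite invf_le1// ler1n.
exists d => // k k0; have kE : 2 * (k / 2) = k by rewrite mulrCA divff ?mulr1.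
have k2 : 0 < k / 2 by rewrite divr_gt0.
have [M M1 h] := level_vanish pA c0 p1 hq hu hv u0 el Lu Lv d0 dm k2.
exists M => //; exists [set x | (M * bar d x + 2 * (k / 2) < u x)%R]; split => //.
  rewrite -[X in measurable X]setTI; apply: measurable_fun_ltr => //; last exact: (H1_L2 hu).1.
  by apply: measurable_funD => //; apply: measurable_funM => //; exact: measurable_bar.
by move=> x /= /negP; rewrite -ltNge kE.
Qed.

End regularity.

(** * Positivity *)

Section fraction_inequalities.
Context {R : realType}.
Implicit Types (a b s t e : R).

(* For P = a + e, Q = b + e and D = t P - s Q, the first product is
   (t - s)^2 - D^2 / (P Q). *)
Lemma picone_fraction a b s t e : 0 <= a -> 0 <= b -> 0 < e ->
  (b - a) * (t ^+ 2 / (b + e) - s ^+ 2 / (a + e)) + 2^-1 * ((t * (b / (b + e)) - s * (a / (a + e))) ^+ 2)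
    <= 2 * (t - s) ^+ 2.
Proof.
move=> a0 b0 e0; have P0 : 0 < a + e by exact: ltr_wpDl.
have Q0 : 0 < b + e by exact: ltr_wpDl.
pose P := a + e; pose Q := b + e; pose D := t * P - s * Q.
have PQ : 0 < P * Q by exact: mulr_gt0.
have e1 : (b - a) * (t ^+ 2 / (b + e) - s ^+ 2 / (a + e)) = (t - s) ^+ 2 - D ^+ 2 / (P * Q).
  by rewrite /D /P /Q; field; rewrite !gt_eqF.
have e2 : t * (b / (b + e)) - s * (a / (a + e)) = (t - s) - e * D / (P * Q).
  by rewrite /D /P /Q; field; rewrite !gt_eqF.
have e3 : (e * D / (P * Q)) ^+ 2 <= D ^+ 2 / (P * Q).
  rewrite (_ : (e * D / (P * Q)) ^+ 2 = (e ^+ 2 / (P * Q)) * (D ^+ 2 / (P * Q))); last by field; rewrite !gt_eqF.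
  apply: ler_piMl; first by rewrite divr_ge0 ?sqr_ge0 ?(ltW PQ).
  by rewrite ler_pdivrMr// mul1r expr2; apply: ler_pM; rewrite ?(ltW e0)// /P /Q lerDr.
rewrite e1 e2; move: (D ^+ 2 / (P * Q)) (e * D / (P * Q)) (t - s) e3 => y z x h.
have := sqr_ge0 (x + z); nra.
Qed.

Lemma fraction_lipschitz1 a b s t e : 0 <= a -> 0 <= b -> 0 < e -> 0 <= s <= 1 -> 0 <= t <= 1 ->
  `|t ^+ 2 / (b + e) - s ^+ 2 / (a + e)| <= (2 / e + e^-1 ^+ 2) * (`|b - a| + `|t - s|).
Proof.
move=> a0 b0 e0 /andP[s0 s1] /andP[t0 t1]; have P0 : 0 < a + e by exact: ltr_wpDl.
have Q0 : 0 < b + e by exact: ltr_wpDl.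
have ie : 0 <= e^-1 by rewrite invr_ge0 ltW.
have iQ : (b + e)^-1 <= e^-1 by rewrite lef_pV2 ?posrE// lerDr.
have iP : (a + e)^-1 <= e^-1 by rewrite lef_pV2 ?posrE// lerDr.
have -> : t ^+ 2 / (b + e) - s ^+ 2 / (a + e) = (b + e)^-1 * ((t + s) * (t - s)) - s ^+ 2 * ((a + e)^-1 * (b + e)^-1 * (b - a)).
  by field; rewrite !gt_eqF.
have h1 : `|(b + e)^-1 * ((t + s) * (t - s))| <= 2 / e * `|t - s|.
  rewrite (normrM (_^-1)) (normrM (t + s)) [`|(b + e)^-1|]ger0_norm ?invr_ge0 ?(ltW Q0)// ger0_norm ?addr_ge0//.
  rewrite mulrA; apply: ler_wpM2r => //; rewrite [leRHS]mulrC; apply: ler_pM; rewrite ?addr_ge0 ?invr_ge0 ?(ltW Q0)//.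
  by lra.
have h2 : `|s ^+ 2 * ((a + e)^-1 * (b + e)^-1 * (b - a))| <= e^-1 ^+ 2 * `|b - a|.
  rewrite (normrM (s ^+ 2)) (ger0_norm (sqr_ge0 s)) (normrM (_ * _)) [`|(a + e)^-1 * _|]ger0_norm; last by rewrite mulr_ge0 ?invr_ge0 ?ltW.
  rewrite mulrA; apply: ler_wpM2r => //; rewrite -[leRHS]mul1r; apply: ler_pM; rewrite ?sqr_ge0//.
  - by rewrite mulr_ge0 ?invr_ge0 ?ltW.
  - exact: exprn_ile1.
  - by rewrite expr2; apply: ler_pM => //; rewrite invr_ge0 ltW.
apply: le_trans (ler_normB _ _) _; apply: le_trans (lerD h1 h2) _.
have := normr_ge0 (b - a); have := normr_ge0 (t - s); have : 0 <= 2 / e by exact: mulr_ge0.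
have := sqr_ge0 e^-1; move: (2 / e) (e^-1 ^+ 2) `|b - a| `|t - s|; clear; move=> *; nra.
Qed.

Lemma fraction_lipschitz2 a b s t e : 0 <= a -> 0 <= b -> 0 < e -> 0 <= s <= 1 -> 0 <= t <= 1 ->
  `|t * (b / (b + e)) - s * (a / (a + e))| <= (1 + e^-1) * (`|b - a| + `|t - s|).
Proof.
move=> a0 b0 e0 /andP[s0 s1] /andP[t0 t1]; have P0 : 0 < a + e by exact: ltr_wpDl.
have Q0 : 0 < b + e by exact: ltr_wpDl.
have ie : 0 <= e^-1 by rewrite invr_ge0 ltW.
have -> : t * (b / (b + e)) - s * (a / (a + e)) = (b / (b + e)) * (t - s) + (s * (e / (a + e)) * (b + e)^-1) * (b - a).
  by field; rewrite !gt_eqF.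
have h0 : 0 <= b / (b + e) by rewrite divr_ge0// ltW.
have h1 : `|(b / (b + e)) * (t - s)| <= `|t - s|.
  rewrite (normrM (_ / _)) (ger0_norm h0); apply: ler_piMl => //.
  by rewrite ler_pdivrMr// mul1r lerDl ltW.
have h2' : 0 <= s * (e / (a + e)) by exact: mulr_ge0 s0 (divr_ge0 (ltW e0) (ltW P0)).
have h2'' : 0 <= (b + e)^-1 by rewrite invr_ge0 ltW.
have h2 : `|(s * (e / (a + e)) * (b + e)^-1) * (b - a)| <= e^-1 * `|b - a|.
  rewrite (normrM (_ * _)) (ger0_norm (mulr_ge0 h2' h2'')); apply: ler_wpM2r => //.
  rewrite -[leRHS]mul1r; apply: ler_pM => //; last by rewrite lef_pV2 ?posrE// lerDr.
  by apply: mulr_ile1 => //; [exact: divr_ge0 (ltW e0) (ltW P0)|rewrite ler_pdivrMr// mul1r lerDr].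
apply: le_trans (ler_normD _ _) _; apply: le_trans (lerD h1 h2) _.
have := normr_ge0 (b - a); have := normr_ge0 (t - s); move: (e^-1) `|b - a| `|t - s| ie; clear; move=> *; nra.
Qed.

Lemma ratio_arith (d1 d2 d3 I J : R) : I <= J -> 0 <= d1 + I -> d1 + 2^-1 * d2 <= 2 * d3 -> d2 <= 4 * d3 + 2 * J.
Proof. by move=> *; lra. Qed.

Lemma expR_quarter t : 0 < t -> t <= 1 -> expR (4^-1 * t + 4^-1 * t) <= 2.
Proof.
move=> t0 t1; have h : 4^-1 * t + 4^-1 * t <= 2^-1 by lra.
by apply: le_trans (expR_le_quad h) _; nra.
Qed.

(** For values 0 and 1 one has (z - x)^2 <= (z - y)^2 + (y - x)^2, without the usual factor 2. This
    keeps the doubling constant at 3, below the 4 of a quadratic bound. *)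
Lemma jump_arith (a b x y z : R) : 0 <= a -> 0 <= b -> a <= 2 * b -> x = 0 \/ x = 1 -> y = 0 \/ y = 1 -> z = 0 \/ z = 1 ->
  a * (z - x) ^+ 2 <= 2 * (b * (z - y) ^+ 2) + a * (y - x) ^+ 2.
Proof. by move=> a0 b0 ab [->|->] [->|->] [->|->]; lra. Qed.

Lemma jump_arith2 (a b x y : R) : x = 0 \/ x = 1 -> y = 0 \/ y = 1 ->
  (a * (y - x)) ^+ 2 <= 2 * (y * b - x * a) ^+ 2 + 2 * (b - a) ^+ 2.
Proof.
have := sqr_ge0 (b + b - a); have := sqr_ge0 (b - a); have := sqr_ge0 a.
by move=> ? ? ? [->|->] [->|->]; nra.
Qed.

End fraction_inequalities.

Section positivity.
Context {R : realType} {N : nat}.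
Local Notation E := 'rV[R]_N.
Local Notation mu := (@lebesgue_rV R N).
Implicit Types (u v f g h F G : E -> R) (x y : E) (s t c m M e : R).
Hypothesis N0 : (0 < N)%N.

Lemma dq_sqr_le i u t : H1 u -> 0 < t -> \int[mu]_x dq i t u x ^+ 2 <= dir u u.
Proof.
move=> hu t0; apply: le_trans (n2_wd_le i u); rewrite -sqr_n2.
by apply: lerXn2r; rewrite ?nnegrE ?n2_ge0//; exact: dq_wd_le.
Qed.

Lemma H1_dominated f g u v c : meas f -> L2 mu g -> (forall x, `|f x| <= g x) -> 0 <= c ->
  H1 u -> H1 v -> (forall x y, `|f y - f x| <= c * (`|u y - u x| + `|v y - v x|)) -> H1 f.
Proof.
move=> mf Lg fg c0 hu hv fL; have Lf : L2 mu f := L2_le mf fg Lg.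
apply: H1_intro => // i; exists (Num.sqrt (2 * c ^+ 2 * (dir u u + dir v v))) => n.
have /andP[t0 _] := tn_itv (R := R) n; set t := tn n in t0 *.
have Ldf := L2_dq i t Lf; have Ldu := L2_dq i t (H1_L2 hu); have Ldv := L2_dq i t (H1_L2 hv).
rewrite /n2; apply: ler_wsqrtr.
apply: (@le_trans _ _ (2 * c ^+ 2 * (\int[mu]_x dq i t u x ^+ 2 + \int[mu]_x dq i t v x ^+ 2))); last first.
  apply: ler_wpM2l; first by rewrite mulr_ge0 ?sqr_ge0.
  by apply: lerD; exact: dq_sqr_le.
rewrite -(intD Ldu.2 Ldv.2) -(intZ _ (L1D Ldu.2 Ldv.2)); apply: int_le; [exact: Ldf.2|exact: L1Z (L1D Ldu.2 Ldv.2)|move=> x].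
rewrite /dq !exprMn; have := fL x (x + t *: unitv i).
set a := f _ - f x; set b := u _ - u x; set e := v _ - v x => h.
have h2 : a ^+ 2 <= (c * (`|b| + `|e|)) ^+ 2.
  by rewrite -sqr_normr; apply: lerXn2r; rewrite ?nnegrE// mulr_ge0// addr_ge0.
have h3 : (c * (`|b| + `|e|)) ^+ 2 <= 2 * c ^+ 2 * (b ^+ 2 + e ^+ 2).
  rewrite exprMn [2 * _]mulrC -[leRHS]mulrA; apply: ler_wpM2l; first exact: sqr_ge0.
  by rewrite -(sqr_normr b) -(sqr_normr e); move: `|b| `|e| => y z; have := sqr_ge0 (y - z); nra.
rewrite -mulrDr [leRHS]mulrCA; apply: ler_wpM2l; first exact: sqr_ge0.
exact: le_trans h2 h3.
Qed.

Lemma dir_le3 u f g v : H1 u -> H1 f -> H1 g -> H1 v ->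
  (forall x y, (u y - u x) * (f y - f x) + 2^-1 * (g y - g x) ^+ 2 <= 2 * (v y - v x) ^+ 2) ->
  dir u f + 2^-1 * dir g g <= 2 * dir v v.
Proof.
move=> hu hf hg hv h.
have c1 : (fun n => dirn n u f + 2^-1 * dirn n g g) @ \oo --> dir u f + 2^-1 * dir g g.
  by apply: cvgD; [exact: dirn_cvg|apply: cvgM; [exact: cvg_cst|exact: dirn_cvg]].
have c2 : (fun n => 2 * dirn n v v) @ \oo --> 2 * dir v v.
  by apply: cvgM; [exact: cvg_cst|exact: dirn_cvg].
apply: cvgn_le_lim c1 c2 => n.
have Lu := H1_L2 hu; have Lf := H1_L2 hf; have Lg := H1_L2 hg; have Lv := H1_L2 hv.
rewrite /dirn !mulr_sumr -big_split/=; apply: ler_sum => i _.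
have l1 := L2_mul (L2_dq i (tn n) Lu) (L2_dq i (tn n) Lf).
have l2 := L2_mul (L2_dq i (tn n) Lg) (L2_dq i (tn n) Lg).
have l3 := L2_mul (L2_dq i (tn n) Lv) (L2_dq i (tn n) Lv).
rewrite -(intZ 2^-1 l2) -(intD l1 (L1Z _ l2)) -(intZ 2 l3).
apply: int_le; [exact: L1D l1 (L1Z _ l2)|exact: L1Z l3|move=> x].
have := h x (x + tn n *: unitv i); rewrite /dq; set t := (tn n)^-1; set y : E := x + _ => hxy.
rewrite [leLHS](_ : _ = t ^+ 2 * ((u y - u x) * (f y - f x) + 2^-1 * (g y - g x) ^+ 2)); last ring.
rewrite [leRHS](_ : _ = t ^+ 2 * (2 * (v y - v x) ^+ 2)); last ring.
by rewrite ler_wpM2l// sqr_ge0.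
Qed.

Variables (A : E -> R) (m M : R) (u : E -> R).
Hypotheses (pA : pot A m M) (hu : H1 u) (u0 : forall x, 0 <= u x).
Hypothesis sup : forall h, H1 h -> (forall x, 0 <= h x) -> 0 <= qb A u h.

Local Notation be := (bar 4^-1 : E -> R).
Let d4 : 0 < 4^-1 :> R. Proof. by rewrite invr_gt0. Qed.
Let hb : H1 be. Proof. exact: H1_bar. Qed.
Let Lb := H1_L2 hb.
Let b01 x : 0 <= be x <= 1. Proof. by rewrite bar_ge0 bar_le1 ?ltW. Qed.
Let mu_ : meas u := (H1_L2 hu).1.

(** Picone's test function for a supersolution u, with a cutoff that makes it square-integrable; e >
    0 keeps the denominator away from 0. The companion [ratio e] tends to the cutoff times the
    indicator of {u > 0} as e tends to 0. *)
Let test e : E -> R := fun x => be x ^+ 2 / (u x + e).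
Let ratio e : E -> R := fun x => be x * (u x / (u x + e)).

Let ue e x : 0 < e -> 0 < u x + e. Proof. by move=> e0; exact: ltr_wpDl. Qed.

Let minv e : 0 < e -> meas (fun x => (u x + e)^-1).
Proof.
move=> e0; rewrite (_ : (fun x => _) = fun x => (u x + e) `^ (-1)); last first.
  by apply/funext => x; rewrite powR_inv1 ?ltW ?ue.
apply: measurable_powR_comp; exact: measurable_funD.
Qed.

Let H1_test e : 0 < e -> H1 (test e).
Proof.
move=> e0; apply: (@H1_dominated _ (fun x => e^-1 * be x) u be (2 / e + e^-1 ^+ 2)) => //.
- by apply: measurable_funM; [exact: measurable_funX Lb.1|exact: minv].
- exact: L2Z.
- move=> x; have /andP[b0 b1] := b01 x; have up := ue x e0.
  rewrite /test ger0_norm; last by rewrite divr_ge0 ?sqr_ge0 ?ltW.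
  rewrite mulrC; apply: ler_pM; rewrite ?sqr_ge0 ?invr_ge0 ?(ltW up)//.
    by rewrite lef_pV2 ?posrE// lerDr.
  by rewrite expr2 ler_piMl.
- by rewrite addr_ge0 ?sqr_ge0// divr_ge0// ltW.
- by move=> x y; apply: fraction_lipschitz1.
Qed.

Let ratio_le e x : 0 < e -> 0 <= ratio e x <= be x.
Proof.
move=> e0; have /andP[b0 b1] := b01 x; have up := ue x e0.
rewrite /ratio mulr_ge0 ?divr_ge0 ?(ltW up)//=; apply: ler_piMr => //.
by rewrite ler_pdivrMr// mul1r lerDl ltW.
Qed.

Let H1_ratio e : 0 < e -> H1 (ratio e).
Proof.
move=> e0; apply: (@H1_dominated _ be u be (1 + e^-1)) => //.
- by apply: measurable_funM; [exact: Lb.1|apply: measurable_funM => //; exact: minv].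
- by move=> x; have /andP[h1 h2] := ratio_le x e0; rewrite ger0_norm.
- by rewrite addr_ge0// invr_ge0 ltW.
- by move=> x y; apply: fraction_lipschitz2.
Qed.

Let LB : R := 4 * dir be be + 2 * (M * \int[mu]_x be x ^+ 2).

(** The supersolution property with [test e] and [picone_fraction] combine to a bound free of e,
    because u / (u + e) <= 1 in the potential term. *)
Let ratio_dir e : 0 < e -> dir (ratio e) (ratio e) <= LB.
Proof.
move=> e0; have ht := H1_test e0; have hr := H1_ratio e0; have [m0 _ AM] := pA.
have d3 := @dir_le3 u (test e) (ratio e) be hu ht hr hb (fun x y => @picone_fraction _ (u x) (u y) (be x) (be y) e (u0 x) (u0 y) e0).
have t0 x : 0 <= test e x by rewrite divr_ge0 ?sqr_ge0// ltW// ue.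
have s0 := sup ht t0.
have LAt := pot_L1 pA (H1_L2 hu) (H1_L2 ht).
have I : \int[mu]_x (A x * (u x * test e x)) <= M * \int[mu]_x be x ^+ 2.
  rewrite -(intZ M Lb.2); apply: int_le; [exact: LAt|exact: L1Z Lb.2|move=> x].
  have /andP[A1 A2] := AM x; apply: ler_pM => //; [exact: le_trans (ltW m0) A1|exact: mulr_ge0|].
  rewrite /test mulrCA; apply: ler_piMr; first exact: sqr_ge0.
  by rewrite ler_pdivrMr ?ue// mul1r lerDl ltW.
exact: ratio_arith I s0 d3.
Qed.

Let P : set E := [set x | 0 < u x].
Let mP : measurable P.
Proof. by rewrite -[X in measurable X]setTI; exact: measurable_fun_ltr. Qed.

Let chi : E -> R := \1_P.
Let mchi : meas chi. Proof. exact: measurable_indic. Qed.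

Let chi01 x : chi x = 0 \/ chi x = 1.
Proof. by rewrite /chi indicE; case: (x \in P); [right|left]. Qed.

Let ratio_cvg x : ratio (tn n) x @[n --> \oo] --> chi x * be x.
Proof.
rewrite /ratio /chi indicE; have [|/negP] := boolP (x \in P); last first.
  rewrite inE /P/= => /negP; rewrite -leNgt => ux.
  have -> : u x = 0 by apply/le_anti; rewrite ux u0.
  by rewrite mul0r; under eq_fun do rewrite mul0r mulr0; exact: cvg_cst.
rewrite inE /P/= => ux.
have -> : true%:R * be x = be x * (u x / (u x + 0)) by rewrite addr0 divff ?gt_eqF// mulr1 mul1r.
apply: cvgM; first exact: cvg_cst.
apply: cvgM; first exact: cvg_cst.
apply: cvgV; first by rewrite addr0 gt_eqF.
by apply: cvgD; [exact: cvg_cst|exact: tn_cvg].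
Qed.

Let jump i t x := be x * (chi (x + t *: unitv i) - chi x).

Let L2_jump i t : L2 mu (jump i t).
Proof.
apply: L2_le Lb => [|x].
  by apply: measurable_funM; [exact: Lb.1|apply: measurable_funB => //; exact: measurable_comp_shift].
have /andP[b0 _] := b01 x; rewrite /jump (normrM (be x)) (ger0_norm b0); apply: ler_piMr => //.
by case: (chi01 x) => ->; case: (chi01 (x + t *: unitv i)) => ->; rewrite ?subrr ?subr0 ?sub0r ?normrN ?normr0 ?normr1.
Qed.

(** Fatou's lemma carries the energy bound of the ratios to the difference quotients of the cutoff
    times the indicator; the product is then separated at the cost of a difference quotient of the
    cutoff. *)
Let jump_quadratic i t : 0 < t -> \int[mu]_x jump i t x ^+ 2 <= (2 * LB + 2 * dir be be) * t ^+ 2.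
Proof.
move=> t0; pose cb x := chi x * be x.
have mcb : meas cb by apply: measurable_funM => //; exact: Lb.1.
have Lcb : L2 mu cb.
  apply: L2_le Lb => // x; have /andP[b0 _] := b01 x; rewrite /cb (normrM (chi x)) (ger0_norm b0).
  by case: (chi01 x) => ->; rewrite ?normr0 ?normr1 ?mul0r ?mul1r.
have [||||||Lf If] := @L1_fatou _ _ _ mu (fun n x => dq i t (ratio (tn n)) x ^+ 2) (fun x => dq i t cb x ^+ 2) LB.
- by move=> n; exact: (L2_dq i t (H1_L2 (H1_ratio (tn_gt0 n)))).2.
- exact: L1_meas (L2_dq i t Lcb).2.
- by move=> n x; exact: sqr_ge0.
- by move=> n; apply: le_trans (dq_sqr_le i (H1_ratio (tn_gt0 n)) t0) (ratio_dir (tn_gt0 n)).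
- by move=> x; exact: sqr_ge0.
- apply: aeW => x; have h : dq i t (ratio (tn n)) x @[n --> \oo] --> dq i t cb x.
    by rewrite /dq; apply: cvgM; [exact: cvg_cst|apply: cvgB; exact: ratio_cvg].
  by rewrite expr2; under eq_cvg do rewrite expr2; exact: (cvgM h h).
have Ldb := L2_dq i t Lb; have dbl := dq_sqr_le i hb t0.
have t20 : 0 <= 2 * t ^+ 2 by rewrite mulr_ge0 ?sqr_ge0.
apply: (@le_trans _ _ (2 * t ^+ 2 * (\int[mu]_x dq i t cb x ^+ 2 + \int[mu]_x dq i t be x ^+ 2))); last first.
  rewrite (_ : (_ + _) * t ^+ 2 = 2 * t ^+ 2 * (LB + dir be be)); last by ring.
  by apply: ler_wpM2l => //; apply: lerD.
rewrite -(intD Lf Ldb.2) -(intZ _ (L1D Lf Ldb.2)); apply: int_le; [exact: (L2_jump i t).2|exact: L1Z (L1D Lf Ldb.2)|move=> x].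
rewrite /jump /dq /cb; set x' := x + t *: unitv i.
have -> : 2 * t ^+ 2 * ((t^-1 * (chi x' * be x' - chi x * be x)) ^+ 2 + (t^-1 * (be x' - be x)) ^+ 2) =
    2 * (chi x' * be x' - chi x * be x) ^+ 2 + 2 * (be x' - be x) ^+ 2 by field; rewrite gt_eqF.
exact: (jump_arith2 _ _ (chi01 x) (chi01 x')).
Qed.

(* The jump of an indicator is of second order in the step, so many small steps
   show that it is zero. *)
Let jump_double i t : 0 < t <= 1 -> \int[mu]_x jump i (t + t) x ^+ 2 <= 3 * \int[mu]_x jump i t x ^+ 2.
Proof.
move=> /andP[t0 t1]; have LJ := (L2_jump i t).2; have LJs := L1_shift (t *: unitv i) LJ.
have -> : 3 * \int[mu]_x jump i t x ^+ 2 = 2 * \int[mu]_x jump i t (x + t *: unitv i) ^+ 2 + \int[mu]_x jump i t x ^+ 2.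
  by rewrite (int_shift (t *: unitv i) LJ); ring.
rewrite -(intZ 2 LJs) -(intD (L1Z 2 LJs) LJ); apply: int_le; [exact: (L2_jump i (t + t)).2|exact: L1D (L1Z 2 LJs) LJ|move=> x].
rewrite /jump scalerDl addrA; set x' := x + t *: unitv i; set x'' := x' + t *: unitv i.
have bb : be x ^+ 2 <= 2 * be x' ^+ 2.
  have h := @bar_harnack _ _ 4^-1 x' (- (t *: unitv i)) (ltW d4).
  rewrite /x' addrK nrm1N nrm1_unitv gtr0_norm// -/x' in h.
  have /andP[b0 _] := b01 x; have /andP[b0' _] := b01 x'.
  apply: (@le_trans _ _ ((expR (4^-1 * t) * be x') ^+ 2)).
    by apply: lerXn2r; rewrite ?nnegrE ?mulr_ge0 ?expR_ge0.
  rewrite exprMn; apply: ler_wpM2r; first exact: sqr_ge0.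
  rewrite expr2 -expRD; exact: expR_quarter.
rewrite !exprMn; move: (sqr_ge0 (be x)) (sqr_ge0 (be x')) bb; move: (be x ^+ 2) (be x' ^+ 2) => a b a0 b0 ab.
exact: (jump_arith a0 b0 ab (chi01 x) (chi01 x') (chi01 x'')).
Qed.

Let inv y := {ae mu, forall x, chi (x + y) = chi x}.

Let inv_small i t : 0 < t <= 1 -> inv (t *: unitv i).
Proof.
(* Doubling gives J(s) <= 3 J(s/2), and halving s divides a quadratic bound by 4, so each round
   multiplies the constant by 3/4. *)
move=> t01; have bound k : forall s, 0 < s <= 1 -> \int[mu]_x jump i s x ^+ 2 <= (3 / 4) ^+ k * ((2 * LB + 2 * dir be be) * s ^+ 2).
  elim: k => [|k IH] s /andP[s0 s1]; first by rewrite expr0 mul1r; exact: jump_quadratic.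
  have h0 : 0 < s / 2 by rewrite divr_gt0.
  have h1 : 0 < s / 2 <= 1 by rewrite h0 ler_pdivrMr// mul1r; apply: le_trans s1 _; rewrite ler1n.
  have := jump_double i h1; rewrite -splitr => /le_trans; apply.
  apply: le_trans (ler_wpM2l _ (IH _ h1)) _ => //.
  apply: le_of_eq; rewrite [(3 / 4) ^+ k.+1]exprSr; move: ((3 / 4) ^+ k) (2 * LB + _) => a b; by field.
have z : \int[mu]_x jump i t x ^+ 2 <= 0.
  set C := (2 * LB + 2 * dir be be) * t ^+ 2 in bound *.
  have c : (3 / 4 : R) ^+ k * C @[k --> \oo] --> 0.
    rewrite -[X in _ --> X](mul0r C); apply: cvgM; last exact: cvg_cst.
    by apply: cvg_expr; rewrite ger0_norm ?divr_ge0// ltr_pdivrMr// mul1r ltr_nat.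
  by apply: (cvgn_le_lim (fun k => bound k t t01) (cvg_cst _) c).
apply: filterS (int_sqr_eq0 (L2_jump i t) z) => x /eqP; rewrite mulf_eq0 gt_eqF ?bar_gt0//= subr_eq0.
by move/eqP.
Qed.

Let invD y y' : inv y -> inv y' -> inv (y + y').
Proof.
move=> h h'; apply: filterS2 (ae_shift y' h) h' => x <- <-.
by rewrite -addrA [y' + y]addrC.
Qed.

Let inv0 : inv 0. Proof. by apply: aeW => x; rewrite addr0. Qed.

Let invN y : inv y -> inv (- y).
Proof. by move=> h; apply: filterS (ae_shift (- y) h) => x; rewrite addrNK. Qed.

Let inv_mulrn y (n : nat) : inv y -> inv (y *+ n).
Proof.
move=> h; elim: n => [|n IH]; first by rewrite mulr0n; exact: inv0.
by rewrite mulrS; exact: invD.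
Qed.

Let inv_axis i t : inv (t *: unitv i).
Proof.
have pos s : 0 < s -> inv (s *: unitv i).
  move=> s0; pose n := (Num.truncn s).+1; have n0 : 0 < n%:R :> R by rewrite ltr0n.
  have -> : s *: unitv i = ((s / n%:R) *: unitv i) *+ n.
    by rewrite -scaler_nat scalerA mulrCA divff ?mulr1// gt_eqF.
  apply: inv_mulrn; apply: inv_small; rewrite divr_gt0//= ler_pdivrMr// mul1r ltW//.
  exact: truncnS_gt.
have [t0|t0|->] := ltgtP t 0; [|exact: pos|by rewrite scale0r; exact: inv0].
by rewrite -[t]opprK scaleNr; apply: invN; apply: pos; rewrite oppr_gt0.
Qed.

Let inv_all y : inv y.
Proof.
rewrite [y]row_sum_delta; elim/big_ind: _ => [|y1 y2|i _]; [exact: inv0|exact: invD|exact: inv_axis].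
Qed.

Theorem positivity : mu [set x | 0 < u x] != 0%E -> {ae mu, forall x, 0 < u x}.
Proof.
(* Integrated over x first, (1 - chi(x)) chi(x + y) gives 0 by translation invariance; integrated
   over y first, it gives (1 - chi(x)) times the nonzero measure of {u > 0}. Hence chi = 1 a.e. *)
move=> P0; pose f (xy : E * E) := ((1 - chi xy.1) * chi (xy.1 + xy.2))%:E.
have c1 x : 0 <= 1 - chi x by case: (chi01 x) => ->; rewrite ?subr0 ?subrr.
have c0 x : 0 <= chi x by case: (chi01 x) => ->.
have mf : meas f.
  apply/measurable_EFinP; apply: measurable_funM.
    by apply: measurable_funB => //; apply: (@measurableT_comp _ _ _ _ _ _ chi _ _ mchi).
  by apply: (@measurableT_comp _ _ _ _ _ _ chi _ _ mchi); exact: measurable_addr2.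
have f0 xy : (0 <= f xy)%E by rewrite lee_fin mulr_ge0.
have F := @fubini_tonelli _ _ _ _ _ mu mu f mf f0.
have mfy y : meas (fun x => f (x, y)).
  apply/measurable_EFinP; apply: measurable_funM; first exact: measurable_funB.
  exact: measurable_comp_shift.
have z : (\int[mu]_x \int[mu]_y f (x, y) = 0)%E.
  rewrite F; apply: integral0_eq => y _.
  have h : ae_eq mu setT (fun x => f (x, y)) (cst 0%E).
    apply: filterS (inv_all y) => x h _; rewrite /f/= h.
    by case: (chi01 x) => ->; rewrite ?mulr0 ?subrr ?mul0r.
  apply: (@etrans _ _ (\int[mu]_x (cst 0%E x))%E); last exact: integral0.
  by apply: ae_eq_integral; [exact: measurableT|exact: mfy|exact: measurable_cst|exact: h].
have mchiE : meas (fun y => (chi y)%:E) by exact/measurable_EFinP.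
have G x : (\int[mu]_y f (x, y) = (1 - chi x)%:E * mu P)%E.
  have e : (\int[mu]_y (chi (y + x))%:E = mu P)%E.
    by rewrite (ge0_integral_shift x mchiE) ?integral_indic ?setIT// => y; rewrite lee_fin.
  have mx : meas (fun y => (chi (y + x))%:E) by apply/measurable_EFinP; exact: measurable_comp_shift.
  have ce y : setT y -> (0 <= (chi (y + x))%:E)%E by rewrite lee_fin.
  have Z := @ge0_integralZl_EFin _ _ _ mu setT measurableT (fun y => (chi (y + x))%:E) ce mx (1 - chi x) (c1 x).
  rewrite -e; apply: etrans Z; apply: eq_integral => y _.
  by rewrite /f/= [x + y]addrC EFinM.
have mG : meas (fun x => (1 - chi x)%:E * mu P)%E.
  apply: emeasurable_funM; last exact: measurable_cst.
  by apply/measurable_EFinP; exact: measurable_funB.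
have : (\int[mu]_x `|(1 - chi x)%:E * mu P| = 0)%E.
  have n0 x : (0 <= (1 - chi x)%:E * mu P)%E by rewrite mule_ge0 ?lee_fin ?measure_ge0.
  by apply: etrans z; apply: eq_integral => x _; exact: (etrans (gee0_abs (n0 x)) (esym (G x))).
move=> /(ae_eq_integral_abs mu measurableT mG); apply: filterS => x /(_ I)/eqP; rewrite mule_eq0 (negbTE P0) orbF eqe.
by rewrite /chi indicE; case: (boolP (x \in P)) => [|_]; [rewrite inE|rewrite subr0 oner_eq0].
Qed.

End positivity.

Local Transparent dir Rintegral.

(** * Representatives that are positive and decay everywhere *)

Section representatives.
Context {R : realType} {N : nat}.
Local Notation E := 'rV[R]_N.
Local Notation mu := (@lebesgue_rV R N).
Local Notation pm := (mu \x mu)%E.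
Implicit Types (u h a : E -> R) (x : E) (d e k m M : R).

Lemma qa_ae a m M u u' : pot a m M -> H1 u -> H1 u' -> {ae mu, forall x, u x = u' x} ->
  (forall i, {ae mu, forall x, wd i u x = wd i u' x}) -> qa a u = qa a u'.
Proof.
move=> [_ ma _] hu hu' uu ww; have L := H1_L2 hu; have L' := H1_L2 hu'.
have e1 : dir u u = dir u' u'.
  apply: eq_bigr => i _; have Li := wd_L2 i hu; have Li' := wd_L2 i hu'.
  apply: ae_eq_int; [exact: measurable_funM Li.1 Li.1|exact: measurable_funM Li'.1 Li'.1|].
  by apply: filterS (ww i) => x ->.
have e2 : \int[mu]_x (a x * u x ^+ 2) = \int[mu]_x (a x * u' x ^+ 2).
  apply: ae_eq_int; [exact: measurable_funM ma (L1_meas L.2)|exact: measurable_funM ma (L1_meas L'.2)|].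
  by apply: filterS uu => x ->.
by rewrite /qa e1 e2.
Qed.

Lemma bar_infty d e : 0 < d -> 0 < e -> exists r : R, forall x, r < enorm x -> bar d x <= e.
Proof.
move=> d0 e0; exists (d * e)^-1 => x rx.
rewrite /bar expRN -[leRHS]invrK lef_pV2 ?posrE ?expR_gt0 ?invr_gt0//.
apply: (@le_trans _ _ (d * nrm1 x)); last by apply: le_trans (expR_ge1Dx _); rewrite lerDr.
apply: (@le_trans _ _ (d * enorm x)); last by apply: ler_wpM2l; [exact: ltW|exact: enorm_nrm1].
by move/ltW: rx; rewrite -(ler_pM2l d0) invfM mulrA divff ?mul1r// gt_eqF.
Qed.

(** Positivity and decay are wanted at every point, while they are known a.e. One null set covers
    the exceptions for all the levels k = 2^-n, and there u is replaced by the weight, which is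
    positive and decays. *)
Lemma representative d u : (0 < N)%N -> 0 < d -> H1 u -> {ae mu, forall x, 0 < u x} ->
  (forall k, 0 < k -> exists2 M : R, 0 <= M & {ae mu, forall x, u x <= M * bar d x + k}) ->
  exists u' : E -> R, [/\ H1 u', forall x, 0 < u' x, u' x @[x --> infty_nbhs] --> 0,
    {ae mu, forall x, u x = u' x} & forall i, {ae mu, forall x, wd i u x = wd i u' x}].
Proof.
move=> N0 d0 hu up dec.
have /choice[MM MMP] : forall n : nat, exists M : R, 0 <= M /\ {ae mu, forall x, u x <= M * bar d x + tn n}.
  by move=> n; have [M M0 h] := dec _ (tn_gt0 n); exists M.
have : {ae mu, forall x, 0 < u x /\ forall n : nat, u x <= MM n * bar d x + tn n}.
  have h2 : {ae mu, forall x, forall n : nat, u x <= MM n * bar d x + tn n}.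
    by apply/ae_foralln => n; exact: (MMP n).2.
  exact: filterS2 up h2.
move=> [Z [mZ Z0 ZP]].
have good x : ~ Z x -> 0 < u x /\ forall n : nat, u x <= MM n * bar d x + tn n.
  by move=> nZ; apply: contrapT => h; apply: nZ; exact: ZP.
pose u' x := \1_Z x * bar d x + (1 - \1_Z x) * u x.
have uZ x : Z x -> u' x = bar d x by move=> zx; rewrite /u' indicE mem_set// subrr mul0r mul1r addr0.
have unZ x : ~ Z x -> u' x = u x by move=> zx; rewrite /u' indicE memNset// mul0r subr0 mul1r add0r.
have ae : {ae mu, forall x, u x = u' x}.
  by exists Z; split => // x /= h; apply: contrapT => nZ; apply: h; rewrite unZ.
have mu' : meas u'.
  have mI : meas (\1_Z : E -> R) by exact: measurable_indic.
  apply: measurable_funD; first by apply: measurable_funM => //; exact: measurable_bar.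
  by apply: measurable_funM; [exact: measurable_funB|exact: (H1_L2 hu).1].
have [hu' ww] := H1_ae mu' ae hu.
have bound x n : u' x <= Num.max 1 (MM n) * bar d x + tn n.
  have b0 := bar_gt0 d x; have [zx|nz] := pselect (Z x).
    rewrite uZ//; apply: ler_wpDr; first exact: ltW (tn_gt0 n).
    by rewrite ler_peMl ?(ltW b0)// le_max lexx.
  rewrite unZ//; have [_ h] := good x nz; apply: le_trans (h n) _.
  by rewrite lerD2r; apply: ler_wpM2r; [exact: ltW|rewrite le_max lexx orbT].
have pos x : 0 < u' x.
  by have [zx|nz] := pselect (Z x); [rewrite uZ//; exact: bar_gt0|rewrite unZ//; have [] := good x nz].
exists u'; split => //.
apply/cvgrPdist_le => e e0; have e2 : 0 < e / 2 by rewrite divr_gt0.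
have /cvgn_leP/(_ _ e2)[n /(_ n (leqnn n)) nP] := @tn_cvg R.
rewrite subr0 ger0_norm ?(ltW (tn_gt0 n))// in nP.
have M0 : 0 < Num.max 1 (MM n) by rewrite lt_max ltr01.
have [r rP] := bar_infty d0 (divr_gt0 e2 M0).
exists r => x rx; rewrite sub0r normrN ger0_norm ?(ltW (pos x))//.
apply: le_trans (bound x n) _; rewrite [leRHS]splitr; apply: lerD => //.
by rewrite mulrC -ler_pdivlMr//; exact: rP.
Qed.

Lemma ae_positive_neq0 u : meas u -> (forall x, 0 <= u x) -> ~ {ae mu, forall x, u x = 0} ->
  mu [set x | 0 < u x] != 0%E.
Proof.
move=> mu' u0 h; apply/negP => /eqP z; apply: h.
exists [set x | 0 < u x]; split => //; first by rewrite -[X in measurable X]setTI; exact: measurable_fun_ltr.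
by move=> x /= /eqP un; rewrite lt_def un u0.
Qed.

End representatives.

Local Opaque dir Rintegral.

(** Multiplied out by N - 2, the upper bound takes one form for all N; for N <= 2 the left side is
    nonpositive. *)
Lemma critical_lt (R : realType) (N : nat) (al p : R) : (0 < N)%N -> 0 < al -> 0 < p ->
  (p%:E < critical_exponent N al)%E -> p * (N%:R - 2) < N%:R + al.
Proof.
move=> N0 al0 p0; have NR : 0 < N%:R :> R by rewrite ltr0n.
rewrite /critical_exponent; case: leqP => [N2 _|N2].
  apply: (@le_lt_trans _ _ 0); last exact: addr_gt0.
  by rewrite pmulr_rle0// subr_le0 ler_nat.
by rewrite lte_fin ltr_pdivlMr// subr_gt0 ltr_nat.
Qed.

Theorem theorem1p1 (R : realType) (N : nat) (alpha p q : R)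
    (A : 'rV[R]_N -> R) (A0 Ainf B : R)
    (hN : (1 <= N)%N)
    (halpha : 0 < alpha < N%:R)
    (hp : (N%:R + alpha) / N%:R < p) (hp' : (p%:E < critical_exponent N alpha)%E)
    (hq : (N%:R + alpha) / N%:R < q) (hq' : (q%:E < critical_exponent N alpha)%E)
    (hpq : p <> q)
    (hAcont : continuous A)
    (hA0 : 0 < A0) (hAA0 : forall x, A0 <= A x)
    (hAinf : A x @[x --> infty_nbhs] --> Ainf)
    (hAAinf : forall x, A x <= Ainf)
    (hB : 0 < B) :
  exists u v : 'rV[R]_N -> R,
    positive_ground_state_solution alpha A (cst B) p q u v.
Proof.
case/andP: halpha => al0 alN; have NR : 0 < N%:R :> R by rewrite ltr0n.
have gt1 (r : R) : (N%:R + alpha) / N%:R < r -> 1 < r.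
  by apply: lt_trans; rewrite ltr_pdivlMr// mul1r ltrDl.
have p1 := gt1 _ hp; have q1 := gt1 _ hq.
have p0 : 0 < p by exact: lt_trans p1. have q0 : 0 < q by exact: lt_trans q1.
have hpN := critical_lt hN al0 p0 hp'; have hqN := critical_lt hN al0 q0 hq'.
have [a1 [s1 [a2 [s2 [Y1 Y2 s1N s2N]]]]] := exponents hN al0 alN hp hpN hq hqN.
pose S := @Setting R N alpha p q a1 s1 a2 s2 hN al0 alN hp hpN hq hqN Y1 Y2 s1N s2N.
have pA : pot A A0 Ainf by exact: pot_A.
have pB : pot (cst B : 'rV[R]_N -> R) B B by exact: pot_B.
have [u [v [hu hv uv0 Qe De]]] := ground_state_pair S hAcont hA0 hAA0 hAinf hAAinf hB.
have u0 x : 0 <= u x by have [] := uv0 x.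
have v0 x : 0 <= v x by have [] := uv0 x.
have qm : 0 < qmin S A B by apply: (qmin_gt0 S hAcont hA0 hAA0 hAAinf hB).
have pq0 : 0 < p + q by exact: addr_gt0.
have c1 : 0 < 2 * p / (p + q) by rewrite divr_gt0// mulr_gt0.
have c2 : 0 < 2 * q / (p + q) by rewrite divr_gt0// mulr_gt0.
have el1 : el_eq alpha A (2 * p / (p + q)) p q u v.
  by move=> h hh; exact: (euler_lagrange1 hAcont hA0 hAA0 hAAinf hB hu hv Qe De hh).
(* The second equation in the form of the first: exchanging the variables of the even kernel makes
   every regularity result apply to both components. *)
have el2 : el_eq alpha (cst B) (2 * q / (p + q)) q p v u.
  move=> h hh; rewrite (euler_lagrange2 hAcont hA0 hAA0 hAAinf hB hu hv Qe De hh); congr (_ * _).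
  have [L _] := pk_sp2 S hu hv hh.
  have [_ e] := L1_pm_swap L; apply: etrans (esym e) _.
  by apply: eq_Rintegral => z _; rewrite [LHS](pk_swap S).
have Lr := bootstrap hN al0 alN pA pB c1 c2 p1 q1 hp hq hpN hqN hu hv u0 v0 el1 el2.
have Lu r : 2 <= r -> L1 (@lebesgue_rV R N) (fun x => `|u x| `^ r) by move=> /Lr[].
have Lv r : 2 <= r -> L1 (@lebesgue_rV R N) (fun x => `|v x| `^ r) by move=> /Lr[].
have [d d0 du] := decay hN al0 alN pA c1 p1 hq hu hv u0 el1 Lu Lv.
have [d' d'0 dv] := decay hN al0 alN pB c2 q1 hp hv hu v0 el2 Lv Lu.
have sp0 (r s : R) : 0 <= s -> 0 <= sp r s.
  by move=> s0; rewrite /sp mulr_ge0 ?powR_ge0// sgr_ge0.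
have sup (a f g h : 'rV[R]_N -> R) (c r s : R) : 0 < c -> el_eq alpha a c r s f g -> (forall x, 0 <= f x) -> H1 h -> (forall x, 0 <= h x) -> 0 <= qb a f h.
  move=> c0 el f0 hh h0; rewrite (el _ hh) mulr_ge0 ?(ltW c0)//; apply: int_ge0 => z.
  by apply: (pk_ge0 (even_riesz S)) => x; [rewrite mulr_ge0// sp0|exact: powR_ge0].
(* A null component would give D(u, v) = 0, against D(u, v) = qmin/2 > 0. *)
have nzu : ~ {ae @lebesgue_rV R N, forall x, u x = 0}.
  move=> z; have := DDZ S 0 1 hu hv; rewrite normr0 powR0 ?gt_eqF// !mul0r.
  have <- : DD S u v = DD S (fun x => 0 * u x) (fun x => 1 * v x).
    apply: (@DD_ae _ _ S u v (fun x => 0 * u x) (fun x => 1 * v x) hu hv (H1Z 0 hu) (H1Z 1 hv)).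
      by apply: filterS z => x ->; rewrite mul0r.
    by apply: aeW => x; rewrite mul1r.
  by rewrite De => /eqP; rewrite mulf_eq0 invr_eq0 pnatr_eq0 orbF gt_eqF.
have nzv : ~ {ae @lebesgue_rV R N, forall x, v x = 0}.
  move=> z; have := DDZ S 1 0 hu hv; rewrite normr0 [_ `^ q]powR0 ?gt_eqF// mulr0 mul0r.
  have <- : DD S u v = DD S (fun x => 1 * u x) (fun x => 0 * v x).
    apply: (@DD_ae _ _ S u v (fun x => 1 * u x) (fun x => 0 * v x) hu hv (H1Z 1 hu) (H1Z 0 hv)).
      by apply: aeW => x; rewrite mul1r.
    by apply: filterS z => x ->; rewrite mul0r.
  by rewrite De => /eqP; rewrite mulf_eq0 invr_eq0 pnatr_eq0 orbF gt_eqF.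
have up := positivity hN pA hu u0 (fun h hh h0 => sup A u v h _ _ _ c1 el1 u0 hh h0) (ae_positive_neq0 (H1_L2 hu).1 u0 nzu).
have vp := positivity hN pB hv v0 (fun h hh h0 => sup (cst B) v u h _ _ _ c2 el2 v0 hh h0) (ae_positive_neq0 (H1_L2 hv).1 v0 nzv).
have [u' [hu' u'0 u'c uu wu]] := representative hN d0 hu up du.
have [v' [hv' v'0 v'c vv wv]] := representative hN d'0 hv vp dv.
(* Changing representatives leaves Q and D as they are, so criticality and the level are obtained
   for the positive, decaying pair itself. *)
have Qe' : QQ B A u' v' = qmin S A B.
  by rewrite -Qe /QQ (qa_ae pA hu hu' uu wu) (qa_ae pB hv hv' vv wv).
have De' : DD S u' v' = qmin S A B / 2 by rewrite -De; apply: esym; exact: (@DD_ae _ _ S u v u' v' hu hv hu' hv' uu vv).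
have [crit nz lev] := ground_state_of hAcont hA0 hAA0 hAAinf hB hu' hv' Qe' De'.
by exists u', v'.
Qed.
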